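(* Let $K$ be a number field and $f(x)\in K[x]$ such that all finite critical points of $f(x)$ are defined over $K$. Then for any positive integer $m$, the density of the set of primes $\mathfrak p$ of $K$ for which $f$ has a finite attracting periodic point in $\overline{K_{\mathfrak p}}$ is bounded above by $\operatorname{FPP}\left(\operatorname{Gal}(K((f'\circ f^m)^{-1}(0))/K)\right)$, the proportion of elements of this Galois group whose action on the roots of $f'\circ f^m(x)$ has a fixed point.
   Context: Primes of $K$ are nonzero primes of its ring of integers; $K_{\mathfrak p}$ is the completion at $\mathfrak p$ with algebraic closure $\overline{K_{\mathfrak p}}$ and extended absolute value $|\cdot|_{\mathfrak p}$. A point $P\in\overline{K_{\mathfrak p}}$ with $f^n(P)=P$ and $f^k(P)\neq P$ for $0<k<n$ is attracting if $|(f^n)'(P)|_{\mathfrak p}<1$. $K((f'\circ f^m)^{-1}(0))$ is the splitting field of $f'(f^m(x))$ over $K$. For a finite group $G$ acting on a set $X$, $\operatorname{FPP}(G)=|\{g\in G: g(x)=x\text{ for some }x\in X\}|/|G|$. Density means natural density of sets of primes (read as upper natural density if the limit does not exist). *)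

(* Defs.v *)
From HB Require Import structures.
From mathcomp Require Import all_boot all_order all_fingroup all_algebra all_field.
From mathcomp Require Import finmap.
From mathcomp Require Import boolp classical_sets cardinality reals ereal.
From mathcomp Require Import topology normedtype sequences.

Set Implicit Arguments.
Unset Strict Implicit.
Unset Printing Implicit Defensive.

Import Order.TTheory GRing.Theory Num.Theory.

Local Open Scope classical_set_scope.
Local Open Scope ring_scope.

Section PrimesOfNumberField.
Variable K : fieldExtType rat.

Definition ring_of_integers : set K :=
  [set x | integralOver (intr : int -> K) x].

Definition is_ideal (I : set K) : Prop :=
  [/\ I `<=` ring_of_integers, I 0,
      forall x y, I x -> I y -> I (x + y)
    & forall a x, ring_of_integers a -> I x -> I (a * x)].

Definition nonzero_prime (p : set K) : Prop :=
  [/\ is_ideal p, exists2 x, p x & x != 0, ~ p 1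
    & forall x y, ring_of_integers x -> ring_of_integers y ->
        p (x * y) -> p x \/ p y].

Definition coset_mod (p : set K) (x : K) : set K :=
  [set y | ring_of_integers y /\ p (y - x)].

(* The absolute norm, i.e. the number of elements of the residue ring. *)
Definition ideal_norm (p : set K) : nat :=
  #|` fset_set [set coset_mod p x | x in ring_of_integers]|.

Definition ideal_mul (I J : set K) : set K :=
  [set x | exists n, exists a b : 'I_n -> K,
     [/\ forall i, I (a i), forall i, J (b i) & x = \sum_(i < n) a i * b i]].

Definition ideal_exp (p : set K) (n : nat) : set K :=
  iter n (ideal_mul p) ring_of_integers.

Definition has_ord (p : set K) (a : K) (n : nat) : Prop :=
  ideal_exp p n a /\ ~ ideal_exp p n.+1 a.

(* The p-adic valuation of a nonzero x, through any way of writing x as a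
   fraction of algebraic integers. *)
Definition padic_ord (p : set K) (x : K) : int :=
  xget 0 [set k | exists a b : K, exists i j : nat,
    [/\ x = a / b, b != 0, has_ord p a i, has_ord p b j & k = i%:Z - j%:Z]].

Definition padic_abs (R : realType) (p : set K) (x : K) : R :=
  if x == 0 then 0 else (ideal_norm p)%:R ^ (- padic_ord p x).

Definition prime_count (S : set (set K)) (n : nat) : nat :=
  #|` fset_set [set p | [/\ nonzero_prime p, S p & (ideal_norm p <= n)%N]]|.

(* The upper natural density; it is the natural density when that exists. *)
Definition upper_density (R : realType) (S : set (set K)) : \bar R :=
  limn_esup (fun n : nat =>
    ((prime_count S n)%:R / (prime_count setT n)%:R : R)%:E).

End PrimesOfNumberField.

Record nonarchimedean_absval (R : realType) (F : fieldType) (a : F -> R) : Prop :=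
  NonarchimedeanAbsval {
    absval_ge0 : forall x, 0 <= a x;
    absval_eq0 : forall x, (a x == 0) = (x == 0);
    absvalM : forall x y, a (x * y) = a x * a y;
    absvalD : forall x y, a (x + y) <= Num.max (a x) (a y) }.

Definition absval_cauchy (R : realType) (F : fieldType) (a : F -> R) (u : nat -> F) :=
  forall e : R, 0 < e ->
    exists N, forall i j, (N <= i)%N -> (N <= j)%N -> a (u i - u j) < e.

Definition absval_cvg (R : realType) (F : fieldType) (a : F -> R) (u : nat -> F) (l : F) :=
  forall e : R, 0 < e -> exists N, forall i, (N <= i)%N -> a (u i - l) < e.

(* A completion K_p of K for the p-adic absolute value, together with an
   algebraic closure of K_p and an extension of the absolute value to it.
   All of this is determined by K and p up to isometric K-isomorphism. *)
Record padic_closure (R : realType) (K : fieldExtType rat) (p : set K) :=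
  PadicClosure {
    pc_completion : fieldType;
    pc_inj : {rmorphism K -> pc_completion};
    pc_abs : pc_completion -> R;
    pc_absP : nonarchimedean_absval pc_abs;
    pc_abs_inj : forall x, pc_abs (pc_inj x) = padic_abs R p x;
    pc_dense : forall (y : pc_completion) (e : R), 0 < e ->
      exists x : K, pc_abs (y - pc_inj x) < e;
    pc_complete : forall u : nat -> pc_completion,
      absval_cauchy pc_abs u -> exists l, absval_cvg pc_abs u l;
    pc_closure :> closedFieldType;
    pc_closure_inj : {rmorphism pc_completion -> pc_closure};
    pc_algebraic : forall z : pc_closure, algebraicOver pc_closure_inj z;
    pc_closure_abs : pc_closure -> R;
    pc_closure_absP : nonarchimedean_absval pc_closure_abs;
    pc_closure_abs_inj : forall y,
      pc_closure_abs (pc_closure_inj y) = pc_abs y }.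

Definition pc_poly (R : realType) (K : fieldExtType rat) (p : set K)
    (C : padic_closure R p) (g : {poly K}) : {poly C} :=
  map_poly (pc_closure_inj C \o pc_inj C) g.

Definition iter_poly (K : fieldType) (f : {poly K}) (n : nat) : {poly K} :=
  iter n (fun g => f \Po g) 'X.

Definition attracting_periodic (R : realType) (K : fieldExtType rat) (p : set K)
    (C : padic_closure R p) (f : {poly K}) (P : C) : Prop :=
  exists n : nat,
    [/\ (0 < n)%N,
        (pc_poly C (iter_poly f n)).[P] = P,
        forall k, (0 < k < n)%N -> (pc_poly C (iter_poly f k)).[P] <> P
      & pc_closure_abs (pc_poly C (deriv (iter_poly f n))).[P] < 1].

(* Every critical point of f in an algebraic closure of K lies in K; such a
   point generates a finite extension of K. When f is constant every point is
   critical, so the condition fails. *)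
Definition critical_points_rational (K : fieldType) (f : {poly K}) : Prop :=
  forall (L : fieldExtType K) (c : L),
    root (map_poly (in_alg L) (deriv f)) c -> exists a : K, c = a%:A.

Definition FPP (R : realType) (gT : finGroupType) (G : {set gT})
    (X : Type) (to : gT -> X -> X) (S : set X) : R :=
  #|[set g in G | `[< exists2 x, S x & to g x = x >]]%SET|%:R / #|G|%:R.

(* Main.v *)
(** Discard finitely many primes [p] of [K], so that [f] has [p]-integral
    coefficients, [f'] has unit leading coefficient and [p]-integral roots, and
    the roots of [F = f' o f^m] are integral and distinct modulo the primes
    above [p]. If [z] is attracting of period [n], the chain rule gives a point
    [w] of its cycle with [|f'(w)| < 1], so [w] is congruent to a critical point
    [c] in [K]; then [f^(nm)(c) = w = c] modulo [p], and [x = f^(nm-m)(c)] in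
    [K] satisfies [F(x) = f'(c) = 0] modulo [p]. For a prime [P] of [L] above
    [p], some root [r] of [F] is congruent to [x], hence to its image under the
    Frobenius element of [P]; as the roots are distinct modulo [P], Frobenius
    fixes [r].

    It remains to bound the density of primes whose Frobenius elements lie in a
    set [A] closed under conjugation and under change of generator of a cyclic
    subgroup. This follows from the prime ideal theorem for the fixed fields of
    all cyclic subgroups, by inclusion-exclusion (Frobenius).

    The prime ideal theorem comes from Selberg's elementary method, which needs
    only unique factorization of ideals and the estimate [rho Y + O(Y^s)],
    [s < 1], for the number of ideals of norm at most [Y]. The estimate is
    obtained in each ideal class by comparing a sum over a lattice with a
    Riemann sum; a Lipschitz weight that adds up to [1] over the generators of
    each principal ideal replaces a fundamental domain for the units. *)

Require Import Defs.
From HB Require Import structures.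
From mathcomp Require Import all_boot all_order all_fingroup all_algebra all_field.
From mathcomp Require Import finmap.
From mathcomp Require Import boolp classical_sets functions cardinality reals ereal.
From mathcomp Require Import topology normedtype sequences exp.
From mathcomp Require Import ring lra zify.

Set Implicit Arguments.
Unset Strict Implicit.
Unset Printing Implicit Defensive.

Import Order.TTheory GRing.Theory Num.Theory.

Local Open Scope ring_scope.

(** * Summation and logarithms *)

Section Summation.
Variable R : realType.
Implicit Types (u v w : nat -> R) (N n m : nat).

(** Whether an element fixes a root depends only on the cyclic subgroup that it generates; this is
    why Frobenius' theorem suffices and no characters enter. For a good prime, Frobenius lies in a
    subgroup [H] exactly when the prime below it in the fixed field of [H] has the same residue
    field as the prime of [K]. Otherwise its norm is at least the square of the norm below, so such
    primes are negligible. Primes of the splitting field are weighted by the order of their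
    Frobenius element, which is the order of the decomposition group, so that every fibre over a
    good prime of [K] has total weight [|G|].

    The analytic part deals with finite sums only: functions are cut off at [N], the Euler product
    becomes a composition of dilation operators, and the inverse of that composition stands for the
    Moebius function. The indicator function of a norm ball is not Lipschitz, so a lattice sum
    cannot count ideals directly; the ideals are first counted with weights that vanish at the
    boundary, and undoing the weights costs half of the power saving. *)

Definition psum u N : R := \sum_(1 <= n < N.+1) u n.

Lemma psum0 u : psum u 0 = 0.
Proof. by rewrite /psum big_geq. Qed.

Lemma psumS u N : psum u N.+1 = psum u N + u N.+1.
Proof. by rewrite /psum big_nat_recr. Qed.

Lemma eq_psum u v N : (forall n, (0 < n <= N)%N -> u n = v n) -> psum u N = psum v N.
Proof. by move=> h; apply: eq_big_nat => n hn; apply: h; lia. Qed.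

Lemma ler_psum u v N : (forall n, (0 < n <= N)%N -> u n <= v n) -> psum u N <= psum v N.
Proof.
elim: N => [|N IH] h; first by rewrite !psum0.
rewrite !psumS lerD ?h//; last lia.
by apply: IH => n hn; apply: h; lia.
Qed.

Lemma psum_ge0 u N : (forall n, 0 <= u n) -> 0 <= psum u N.
Proof. by move=> h; apply: sumr_ge0 => i _. Qed.

Lemma psumD u v N : psum (fun n => u n + v n) N = psum u N + psum v N.
Proof. exact: big_split. Qed.

Lemma psumN u N : psum (fun n => - u n) N = - psum u N.
Proof. exact: sumrN. Qed.

Lemma psumB u v N : psum (fun n => u n - v n) N = psum u N - psum v N.
Proof. by rewrite psumD psumN. Qed.

Lemma psumZ (c : R) u N : psum (fun n => c * u n) N = c * psum u N.
Proof. by rewrite /psum mulr_sumr. Qed.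

Lemma psumZr (c : R) u N : psum (fun n => u n * c) N = psum u N * c.
Proof. by rewrite /psum mulr_suml. Qed.

Lemma psum_const (c : R) N : psum (fun=> c) N = N%:R * c.
Proof.
elim: N => [|N IH]; first by rewrite psum0 mul0r.
by rewrite psumS IH -natr1 mulrDl mul1r.
Qed.

Lemma ler_norm_psum u v N : (forall n, (0 < n <= N)%N -> `|u n| <= v n) ->
  `|psum u N| <= psum v N.
Proof.
move=> h; apply: le_trans (ler_norm_sum _ _ _) _.
exact: (@ler_psum (fun n => `|u n|)).
Qed.

Lemma le_psum u N M : (forall n, 0 <= u n) -> (N <= M)%N -> psum u N <= psum u M.
Proof.
move=> h /subnK <-; elim: (M - N)%N => [|k IH] //.
by rewrite addSn psumS (le_trans IH)// lerDl.
Qed.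

Lemma psum_abel u v N : psum (fun n => u n * v n) N =
  psum u N * v N + psum (fun n => psum u n * (v n - v n.+1)) N.-1.
Proof.
elim: N => [|[|N] IH]; first by rewrite !psum0 mul0r addr0.
  by rewrite !psumS !psum0; ring.
by rewrite psumS IH /= !psumS; ring.
Qed.

Lemma psum_nat_abel v N :
  psum v N = N%:R * v N + psum (fun n => n%:R * (v n - v n.+1)) N.-1.
Proof.
have := psum_abel (fun=> 1) v N; rewrite psum_const mulr1.
under eq_psum => n _ do rewrite mul1r.
move=> ->; congr (_ + _); apply: eq_psum => n _.
by rewrite psum_const mulr1.
Qed.

Lemma psum_abel_le u v (C : R) N : (forall n, psum u n <= C * n%:R) ->
  (forall n, 0 <= v n) -> (forall n, (0 < n < N)%N -> v n.+1 <= v n) ->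
  psum (fun n => u n * v n) N <= C * psum v N.
Proof.
move=> hu v0 vd; rewrite psum_abel [in leRHS]psum_nat_abel mulrDr mulrA.
apply: lerD; first exact: ler_wpM2r.
rewrite -psumZ; apply: ler_psum => n hn; rewrite mulrA ler_wpM2r// subr_ge0.
by apply: vd; lia.
Qed.

Lemma psum_abel_norm u v (C : R) N : (forall n, `|psum u n| <= C * n%:R) ->
  `|psum (fun n => u n * v n) N| <=
    C * (N%:R * `|v N| + psum (fun n => n%:R * `|v n - v n.+1|) N.-1).
Proof.
move=> hu; rewrite psum_abel (le_trans (ler_normD _ _))// mulrDr.
apply: lerD; first by rewrite normrM mulrA ler_wpM2r.
rewrite -psumZ; apply: ler_norm_psum => n hn.
by rewrite normrM mulrA ler_wpM2r.
Qed.

(** Both sides run over the pairs with [n * m <= N]; extending the inner sums by zeros up to [N]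
    makes this visible. *)
Lemma psum_hyper (f : nat -> nat -> R) N :
  psum (fun n => psum (f n) (N %/ n)) N =
  psum (fun m => psum (f^~ m) (N %/ m)) N.
Proof.
have E (g : nat -> nat -> R) : psum (fun n => psum (g n) (N %/ n)) N =
    psum (fun n => psum (fun m => if (n * m <= N)%N then g n m else 0) N) N.
  apply: eq_psum => n /andP[n0 nN]; rewrite /psum.
  rewrite (@big_cat_nat _ _ _ (N %/ n).+1 1 N.+1)//=; last by rewrite ltnS leq_div.
  rewrite [X in _ = _ + X]big_nat_cond [X in _ = _ + X]big1 ?addr0; last first.
    move=> m /andP[/andP[h _] _]; case: ifP => // h'; move: h.
    by rewrite ltnNge leq_divRL// mulnC h'.
  apply: eq_big_nat => m /andP[_]; rewrite ltnS leq_divRL// mulnC => -> //.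
rewrite E E /psum exchange_big; apply: eq_big_nat => m _.
by apply: eq_big_nat => n _; rewrite mulnC.
Qed.

Lemma psum_div u w N :
  psum (fun n => u n * psum w (N %/ n)) N =
  psum (fun n => w n * psum u (N %/ n)) N.
Proof.
under eq_psum => n _ do rewrite -psumZ.
rewrite psum_hyper; apply: eq_psum => n _.
by rewrite -psumZ; apply: eq_psum => m _; rewrite mulrC.
Qed.

Definition dconv u v k : R := \sum_(1 <= n < k.+1 | (n %| k)%N) u n * v (k %/ n)%N.

Lemma psum_dconv u v w N : psum (fun k => dconv u v k * w k) N =
  psum (fun n => psum (fun m => u n * v m * w (n * m)%N) (N %/ n)) N.
Proof.
have E1 : psum (fun k => dconv u v k * w k) N =
    psum (fun k => psum (fun n => if (n %| k)%N then u n * v (k %/ n)%N * w k else 0) N) N.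
  apply: eq_psum => k /andP[k0 kN]; rewrite /dconv mulr_suml /psum.
  rewrite -big_mkcond/= (@big_cat_nat _ _ _ k.+1 1 N.+1)//=.
  rewrite [X in _ = _ + X]big_nat_cond [X in _ = _ + X]big1 ?addr0//.
  by move=> n /andP[/andP[h _] /dvdn_leq]; lia.
rewrite E1 /psum exchange_big; apply: eq_big_nat => n /andP[n0 nN].
(* From [N] to [N + 1] the quotient by [n] grows, by one, exactly when [n] divides [N + 1]. *)
elim: {E1}N nN => [|N IH] nN; first by rewrite div0n !big_geq.
rewrite big_nat_recr//= ltnS in nN *.
have [nN'|nN'] := ltnP N n.
  have -> : n = N.+1 by lia.
  rewrite divnn dvdnn /= big_nat1 big_nat_cond big1 ?add0r ?muln1//.
  move=> k /andP[/andP[k0 kN] _]; case: ifP => // /dvdn_leq; lia.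
rewrite IH//; case: ifP => hd.
  case/dvdnP: hd => q hq; rewrite hq mulnK//.
  have -> : (N %/ n = q.-1)%N.
    have q0: (0 < q)%N by case: q hq.
    have -> : N = (q.-1 * n + n.-1)%N by nia.
    by rewrite divnMDl// divn_small ?addn0//; lia.
  case: q hq => [|q] hq; first lia.
  by rewrite /= [RHS]big_nat_recr//= (mulnC n).
rewrite addr0; have -> // : (N.+1 %/ n = N %/ n)%N.
rewrite -addn1 divnD//.
have n1 : (1 < n)%N by case: (n) n0 hd => [//|[|//]] _; rewrite dvd1n.
rewrite (@divn_small 1)// addn0.
have -> : (n <= N %% n + 1 %% n)%N = false; last by rewrite addn0.
apply/negbTE/negP => h.
have h2 := ltn_pmod N n0; rewrite (@modn_small 1)// in h.
move/negP: hd; apply; rewrite /dvdn -addn1 -modnDml.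
have -> : (N %% n + 1 = n)%N by lia.
by rewrite modnn.
Qed.

(* The limit is squeezed between the nondecreasing [u - v] and the
   nonincreasing [u + v], so [v] need not tend to 0. *)
Lemma ex_limit_of_steps u v : (forall n, 0 <= v n) ->
  (forall n, `|u n.+1 - u n| <= v n - v n.+1) ->
  exists l : R, forall n, `|u n - l| <= v n.
Proof.
move=> v0 h.
have hm n k : u n - v n <= u (n + k)%N - v (n + k)%N.
  elim: k => [|k IH]; first by rewrite addn0.
  by rewrite (le_trans IH)// addnS; have := h (n + k)%N; rewrite ler_norml; lra.
have hp n k : u (n + k)%N + v (n + k)%N <= u n + v n.
  elim: k => [|k IH]; first by rewrite addn0.
  by rewrite (le_trans _ IH)// addnS; have := h (n + k)%N; rewrite ler_norml; lra.
have hnm n m : u n - v n <= u m + v m.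
  have := hm n m; have := hp m n; have := v0 (n + m)%N; rewrite (addnC m n); lra.
pose X : set R := [set x | exists n, x = u n - v n]%classic.
have hX : has_sup X.
  split; first by exists (u 0%N - v 0%N); exists 0%N.
  by exists (u 0%N + v 0%N) => x [n ->].
exists (sup X) => n; rewrite ler_norml; apply/andP; split.
  have : sup X <= u n + v n by apply: ge_sup => [|x [m ->]//]; exact: hX.1.
  lra.
have : u n - v n <= sup X by apply: ub_le_sup; [exact: hX.2|exists n].
lra.
Qed.

End Summation.

Section PowersAndLogs.
Variable R : realType.
Implicit Types (N n m : nat) (x y s : R).

Lemma ln_step_bounds n : (0 < n)%N ->
  n.+1%:R^-1 <= ln n.+1%:R - ln (n%:R : R) <= n%:R^-1.
Proof.
move=> n0; have n0' : 0 < n%:R :> R by rewrite ltr0n.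
have n1' : 0 < n.+1%:R :> R by rewrite ltr0n.
rewrite -ln_div ?posrE//; apply/andP; split.
  have : ln (n%:R / n.+1%:R : R) <= - n.+1%:R^-1.
    have -> : n%:R / n.+1%:R = 1 + - n.+1%:R^-1 :> R.
      by rewrite -natr1; field; rewrite natr1 pnatr_eq0.
    apply: le_ln1Dx; rewrite ltrN2 invf_lt1// ltr1n; lia.
  rewrite [in X in _ -> X]ln_div ?posrE// ln_div ?posrE//.
  by move: (n.+1%:R^-1) => z; lra.
have -> : n.+1%:R / n%:R = 1 + n%:R^-1 :> R.
  by rewrite -natr1; field; rewrite pnatr_eq0; lia.
by apply: le_ln1Dx; rewrite (lt_trans (ltrN10 _))// invr_gt0.
Qed.

Lemma ln_nat_ge0 n : 0 <= ln (n%:R : R).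
Proof. by case: n => [|n]; [rewrite ln0|rewrite ln_ge0// ler1n]. Qed.

Lemma ler_ln_nat n m : (0 < n)%N -> (n <= m)%N -> ln (n%:R : R) <= ln m%:R.
Proof. by move=> n0 nm; rewrite ler_ln ?posrE ?ltr0n ?ler_nat//; lia. Qed.

Lemma ln_le_powR s x : 0 < s -> 1 <= x -> ln x <= s^-1 * x `^ s.
Proof.
move=> s0 x1; rewrite -[leLHS](mulKf (lt0r_neq0 s0)) ler_pM2l ?invr_gt0//.
by rewrite -ln_powR ltW// ln_sublinear// powR_gt0//; lra.
Qed.

Lemma powR_exp x s : 0 < x -> x `^ s = expR (s * ln x).
Proof. by move=> x0; rewrite /powR gt_eqF. Qed.

Lemma one_sub_expN x : 0 <= x <= 1 -> x / 2 <= 1 - expR (- x).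
Proof.
move=> /andP[x0 x1]; rewrite expRN.
have h := expR_ge1Dx x; have e0 := expR_gt0 x.
have : (expR x)^-1 <= (1 + x)^-1 by rewrite lef_pV2 ?posrE//; lra.
suff : (1 + x)^-1 <= 1 - x / 2 by lra.
by rewrite -[leLHS]mul1r ler_pdivrMr; nra.
Qed.

(** A discrete derivative: it bounds [n ^ (s - 1)] by a telescoping difference, which is how
    [sum_powR] is summed. The step of the logarithm is at least [1 / n], so one step back multiplies
    [n ^ s] by at most [exp (- s / n)]. *)
Lemma powR_step s n : 0 < s <= 1 -> (0 < n)%N ->
  s / 2 * (n%:R `^ s / n%:R) <= n%:R `^ s - n.-1%:R `^ s :> R.
Proof.
move=> /andP[s0 s1]; case: n => [//|[|n]] _.
  by rewrite powR1 powR0 ?gt_eqF//; lra.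
have n0 : 0 < n.+1%:R :> R by rewrite ltr0n.
have n1 : 0 < n.+2%:R :> R by rewrite ltr0n.
set t := s / n.+2%:R.
have ht : 0 <= t <= 1.
  rewrite /t divr_ge0//=; try exact: ltW.
  by rewrite ler_pdivrMr// mul1r (le_trans s1)// ler1n.
have := one_sub_expN ht => h1.
have : n.+1%:R `^ s <= n.+2%:R `^ s * expR (- t).
  rewrite !powR_exp// -expRD ler_expR.
  have /andP[+ _] := @ln_step_bounds n.+1 isT => h.
  have : s * n.+2%:R^-1 <= s * (ln n.+2%:R - ln n.+1%:R) by rewrite ler_pM2l.
  by rewrite -/t; lra.
have p0 : 0 < n.+2%:R `^ s :> R by exact: powR_gt0.
have -> : s / 2 * (n.+2%:R `^ s / n.+2%:R) = n.+2%:R `^ s * (t / 2) by rewrite /t; ring.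
by move=> h2; rewrite [_.-1]/=; nra.
Qed.

Lemma sum_powR s N : 0 < s <= 1 ->
  psum (fun n => n%:R `^ s / n%:R) N <= 2 / s * N%:R `^ s.
Proof.
move=> hs; have /andP[s0 s1] := hs.
elim: N => [|N IH]; first by rewrite psum0 mulr_ge0 ?powR_ge0// divr_ge0// ltW.
rewrite psumS; have := @powR_step s N.+1 hs isT; rewrite [_.-1]/= => h.
have {}h := ler_wpM2l (ltW (divr_gt0 (ltr0Sn R 1) s0)) h.
have E : 2 / s * (s / 2) = 1 by field; rewrite gt_eqF.
rewrite [leLHS]mulrA E mul1r in h.
by move: h; move: (N.+1%:R `^ s / _) => z; lra.
Qed.

(** The companion for the tails of [n ^ (s - 2)]: multiples of [n ^ (s - 1)] can serve as the
    majorant in [ex_limit_of_steps]. *)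
Lemma powRB1_step s n : 0 < s < 1 -> (0 < n)%N ->
  (1 - s) / 4 * (n%:R `^ s / n%:R ^+ 2) <=
  n%:R `^ s / n%:R - n.+1%:R `^ s / n.+1%:R :> R.
Proof.
move=> /andP[s0 s1] n0'.
have n0 : 0 < n%:R :> R by rewrite ltr0n.
have n1 : 0 < n.+1%:R :> R by rewrite ltr0n.
have E m : (0 < m)%N -> m%:R `^ s / m%:R = expR (- (1 - s) * ln m%:R) :> R.
  move=> m0; have m0' : 0 < m%:R :> R by rewrite ltr0n.
  rewrite powR_exp// -[X in _ / X](@lnK _ m%:R) ?posrE// -expRN -expRD.
  by congr expR; rewrite ?lnK ?posrE//; ring.
(* The step of the logarithm is at least [1 / (n + 1)], hence at least [1 / (2 n)]. *)
set t := (1 - s) / (2 * n%:R).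
have ht : 0 <= t <= 1.
  apply/andP; split; first by apply: divr_ge0; [lra|apply: mulr_ge0; lra].
  rewrite /t ler_pdivrMr ?mulr_gt0// mul1r.
  have : 1 <= n%:R :> R by rewrite ler1n.
  lra.
have := one_sub_expN ht => h1.
have : n.+1%:R `^ s / n.+1%:R <= n%:R `^ s / n%:R * expR (- t).
  rewrite !E// -expRD ler_expR.
  have /andP[+ _] := ln_step_bounds n0' => h.
  have h2 : (2 * n%:R)^-1 <= n.+1%:R^-1 :> R.
    rewrite lef_pV2 ?posrE ?mulr_gt0//; rewrite -natr1.
    have : 1 <= n%:R :> R by rewrite ler1n.
    lra.
  have : (1 - s) * (2 * n%:R)^-1 <= (1 - s) * (ln n.+1%:R - ln n%:R).
    rewrite ler_pM2l; last lra.
    exact: le_trans h.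
  by rewrite /t; lra.
have p0 : 0 < n%:R `^ s / n%:R :> R by rewrite divr_gt0// powR_gt0.
have -> : (1 - s) / 4 * (n%:R `^ s / n%:R ^+ 2) = n%:R `^ s / n%:R * (t / 2).
  by rewrite /t; field; rewrite gt_eqF.
move: (_ / n%:R) (_ / n.+1%:R) p0 => p q p0 h2.
by have := ler_wpM2l (ltW p0) h1; lra.
Qed.

Lemma powR_nat_ge1 s n : 0 <= s -> (0 < n)%N -> 1 <= n%:R `^ s :> R.
Proof.
move=> s0 n0; have n1 : 1 <= n%:R :> R by rewrite ler1n.
by rewrite -[leLHS](powRr0 n%:R) ler_powR.
Qed.

Lemma ler_powR_nat s n m : 0 <= s -> (n <= m)%N -> n%:R `^ s <= m%:R `^ s :> R.
Proof. by move=> s0 nm; rewrite ge0_ler_powR// ?nnegrE ?ler_nat. Qed.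

Lemma powR_nat_le s t n : s <= t -> (0 < n)%N -> n%:R `^ s <= n%:R `^ t :> R.
Proof. by move=> st n0; rewrite ler_powR// ler1n. Qed.

(** A logarithm is absorbed at the price of half the distance from [s] to 1, so the exponent stays
    below 1 however often this is done. *)
Lemma ln_mul_powR s x : 0 < s < 1 -> 1 <= x ->
  x `^ s * ln x <= 2 / (1 - s) * x `^ ((1 + s) / 2).
Proof.
move=> /andP[s0 s1] x1; have h0 : 0 < (1 - s) / 2 by lra.
have h := ln_le_powR h0 x1.
have -> : (1 + s) / 2 = s + (1 - s) / 2 by field.
rewrite powRD; last by rewrite (gt_eqF (_ : 0 < _))//; lra.
rewrite invf_div in h.
by rewrite mulrCA ler_wpM2l// powR_ge0.
Qed.

End PowersAndLogs.

(** * Selberg's formula *)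

(* [B] plays the role of summation against the Moebius function of the ideals. *)
Section Selberg.
Variables (R : realType) (a La : nat -> R) (B : nat -> (nat -> R) -> R).
Variables (rho C0 s : R).
Hypothesis a_ge0 : forall n, 0 <= a n.
Hypothesis La_ge0 : forall n, 0 <= La n.
(** The logarithmic derivative of the zeta function, [a ln = La * a] as Dirichlet convolutions,
    tested against an arbitrary [w]. *)
Hypothesis a_ln : forall N w, psum (fun k => a k * ln k%:R * w k) N =
  psum (fun n => psum (fun m => La n * a m * w (n * m)%N) (N %/ n)) N.
Hypothesis B_add : forall N u v, B N (fun n => u n + v n) = B N u + B N v.
Hypothesis B_le : forall N w, `|B N w| <= psum (fun n => a n * `|w n|) N.
Hypothesis B_inv : forall N w, (0 < N)%N ->
  B N (fun d => psum (fun m => a m * w (d * m)%N) (N %/ d)) = w 1%N.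
Hypothesis rho_gt0 : 0 < rho.
Hypothesis s01 : 0 < s < 1.
Hypothesis A_est : forall n, `|psum a n - rho * n%:R| <= C0 * n%:R `^ s.

Let E n := psum a n - rho * n%:R.
Let psi := psum La.

Lemma s1_bounds : s < (1 + s) / 2 /\ 0 < (1 + s) / 2 < 1.
Proof. by case/andP: s01 => h1 h2; split; lra. Qed.

Lemma C0_ge0 : 0 <= C0.
Proof. by have := A_est 1; rewrite powR1 mulr1; apply: le_trans. Qed.

Lemma A_le n : psum a n <= (rho + C0) * n%:R.
Proof.
have := A_est n; rewrite ler_norml => /andP[_ h].
have : C0 * n%:R `^ s <= C0 * n%:R.
  rewrite ler_wpM2l ?C0_ge0//; case: n {h} => [|n].
    by rewrite powR0// gt_eqF//; case/andP: s01.
  by apply: ler1_powR; [rewrite ler1n|case/andP: s01 => _ /ltW].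
lra.
Qed.

Lemma inv_le_pow n : (0 < n)%N -> n%:R^-1 <= n%:R `^ s / n%:R :> R.
Proof.
move=> n0; rewrite ler_peMl ?invr_ge0// powR_nat_ge1//.
by case/andP: s01 => /ltW.
Qed.

Lemma A_div_est : exists K, forall N d, (0 < d <= N)%N ->
  `|psum a (N %/ d) - rho * (N%:R / d%:R)| <= K * (N%:R / d%:R) `^ s.
Proof.
exists (C0 + rho) => N d /andP[d0 dN].
have d0' : 0 < d%:R :> R by rewrite ltr0n.
set y := N%:R / d%:R; set M := (N %/ d)%N.
have M1 : (0 < M)%N by rewrite divn_gt0.
have hM : M%:R <= y by rewrite /y ler_pdivlMr// -natrM ler_nat leq_trunc_div.
have hM' : y <= M%:R + 1.
  by rewrite /y ler_pdivrMr// natr1 -natrM ler_nat ltnW// ltn_ceil.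
have hp : M%:R `^ s <= y `^ s.
  rewrite ge0_ler_powR ?nnegrE//; first by case/andP: s01 => /ltW.
  exact: le_trans hM.
have := A_est M; have p1 := powR_nat_ge1 (ltW (andP s01).1) M1.
have := ler_wpM2l C0_ge0 hp; move: C0_ge0 => c0.
rewrite !ler_norml; have := ler_wpM2l (ltW rho_gt0) hM; have := ler_wpM2l (ltW rho_gt0) hM'.
have : rho * 1 <= rho * y `^ s by rewrite ler_wpM2l ?(ltW rho_gt0)//; lra.
move: (y `^ s) (M%:R `^ s) => p q; nra.
Qed.

Definition sum_aln M := psum (fun n => a n * ln n%:R) M.
Definition sum_ainv M := psum (fun n => a n / n%:R) M.

Lemma sum_aln_est : exists K, forall M, (0 < M)%N ->
  `|sum_aln M - rho * (M%:R * ln M%:R - M%:R)| <= K * M%:R `^ ((1 + s) / 2).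
Proof.
have /andP[s0 s1] := s01; have [ss /andP[s10 s11]] := s1_bounds.
exists (C0 * (2 / (1 - s)) + rho * (1 + 2 / s) + C0 * (2 / s)) => M M0.
have M1 : 1 <= M%:R :> R by rewrite ler1n.
rewrite /sum_aln psum_abel.
have hp : M%:R `^ s <= M%:R `^ ((1 + s) / 2) :> R by apply: powR_nat_le; rewrite ?ltW.
have hp1 : 1 <= M%:R `^ s :> R by apply: powR_nat_ge1; rewrite ?ltW.
pose l n : R := ln n.+1%:R - ln n%:R.
have hP : psum (fun n => n%:R `^ s / n%:R) M.-1 <= 2 / s * M%:R `^ s :> R.
  apply: le_trans (sum_powR _ _) _; first by rewrite s0 ltW.
  by rewrite ler_wpM2l ?ler_powR_nat ?leq_pred// ?ltW// divr_gt0.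
have E1 : psum (fun n => psum a n * (ln n%:R - ln n.+1%:R)) M.-1 =
   - (rho * psum (fun n => n%:R * l n) M.-1) - psum (fun n => E n * l n) M.-1.
  rewrite -psumZ -psumN -psumB; apply: eq_psum => n _.
  by rewrite /E /l; ring.
have b1 : `|psum (fun n => E n * l n) M.-1| <= C0 * (2 / s * M%:R `^ s).
  apply: le_trans (_ : C0 * psum (fun n => n%:R `^ s / n%:R) M.-1 <= _); last first.
    by rewrite ler_wpM2l// C0_ge0.
  rewrite -psumZ; apply: ler_norm_psum => n /andP[n0 _].
  have /andP[l1 l2] := ln_step_bounds R n0.
  have l0 : 0 <= l n by rewrite (le_trans _ l1)// invr_ge0.
  rewrite normrM mulrA (ger0_norm l0) ler_pM//; exact: A_est.
have b2 : `|psum (fun n => n%:R * l n) M.-1 - M%:R| <= (1 + 2 / s) * M%:R `^ s.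
  have -> : psum (fun n => n%:R * l n) M.-1 - M%:R =
            psum (fun n => n%:R * l n - 1) M.-1 - 1.
    rewrite psumB psum_const mulr1; case: M M0 {M1 hp hp1 hP E1 b1} => // M _.
    by rewrite -natr1 /=; ring.
  apply: le_trans (ler_normB _ _) _; rewrite normr1 addrC mulrDl mul1r.
  apply: lerD => //; apply: le_trans hP; apply: ler_norm_psum => n /andP[n0 _].
  have n0' : 0 < n%:R :> R by rewrite ltr0n.
  have /andP[l1 l2] := ln_step_bounds R n0.
  apply: le_trans (inv_le_pow n0).
  have h1 : n%:R * l n <= 1 by rewrite mulrC -ler_pdivlMr// mul1r.
  rewrite ler_norml; apply/andP; split; last first.
    by rewrite (le_trans (_ : _ <= 0)) ?invr_ge0//; lra.
  have h2 : n%:R * n.+1%:R^-1 <= n%:R * l n by rewrite ler_pM2l.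
  have h3 : n%:R * n.+1%:R^-1 = 1 - n.+1%:R^-1 :> R.
    by rewrite -natr1; field; rewrite natr1 pnatr_eq0.
  have h4 : n.+1%:R^-1 <= n%:R^-1 :> R by rewrite lef_pV2 ?posrE ?ltr0n// ler_nat.
  by move: h2 h3 h4; move: (n.+1%:R^-1) => z; lra.
have b3 : `|E M * ln M%:R| <= C0 * (2 / (1 - s) * M%:R `^ ((1 + s) / 2)).
  have := ln_mul_powR s01 M1 => h.
  apply: le_trans (ler_wpM2l C0_ge0 h).
  by rewrite normrM mulrA (ger0_norm (ln_nat_ge0 _ _)) ler_wpM2r ?ln_nat_ge0// A_est.
rewrite E1.
have -> : psum a M * ln M%:R = rho * (M%:R * ln M%:R) + E M * ln M%:R.
  by rewrite /E; ring.
have C00 := C0_ge0.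
have s2 : 0 <= 2 / s by rewrite divr_ge0// ltW.
have b1' : C0 * (2 / s * M%:R `^ s) <= C0 * (2 / s * M%:R `^ ((1 + s) / 2)).
  by rewrite !ler_wpM2l.
have b2' : `|rho * (psum (fun n => n%:R * l n) M.-1 - M%:R)| <=
    rho * ((1 + 2 / s) * M%:R `^ ((1 + s) / 2)).
  rewrite normrM gtr0_norm// ler_pM2l//; apply: le_trans b2 _.
  by apply: ler_wpM2l => //; lra.
move: b1 b1' b2' b3.
move: (psum (fun n => E n * l n) M.-1) (psum (fun n => n%:R * l n) M.-1) => X Y.
move: (E M * _) => Z; move: (M%:R `^ s) (M%:R `^ ((1 + s) / 2)) => p q.
by rewrite !ler_norml; move: (2 / s) (2 / (1 - s)) => S1 S2; lra.
Qed.

Lemma sum_ainv_est : exists K g, forall M, (0 < M)%N ->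
  `|sum_ainv M - rho * ln M%:R - g| <= K * (M%:R `^ s / M%:R).
Proof.
have /andP[s0 s1] := s01.
pose D := (C0 + rho) * (4 / (1 - s)).
have D0 : 0 <= D by rewrite mulr_ge0 ?addr_ge0 ?C0_ge0 ?ltW// divr_gt0//; lra.
pose v n : R := D * (n.+1%:R `^ s / n.+1%:R).
(* Subtracting [psum a M / M] leaves [E] in the increments of [U] only through [E n / (n (n + 1))];
   it shifts the limit by [rho], which is restored at the end. *)
pose U M := sum_ainv M - psum a M / M%:R - rho * ln M%:R.
pose u n := U n.+1.
have [] := @ex_limit_of_steps _ u v.
- by move=> n; rewrite mulr_ge0// divr_ge0// powR_ge0.
- move=> n; rewrite -mulrBr.
  have := @powRB1_step R s n.+1 s01 isT => h.
  have {}h := ler_wpM2l D0 h.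
  apply: le_trans h; rewrite mulrA.
  have -> : D * ((1 - s) / 4) = C0 + rho by rewrite /D; field; lra.
  have -> : u n.+1 - u n = E n.+1 / (n.+1%:R * n.+2%:R) +
      rho * (n.+2%:R^-1 - (ln n.+2%:R - ln n.+1%:R)).
    rewrite /u /U /sum_ainv /E (psumS _ n.+1) (psumS a n.+1).
    have : n.+1%:R != 0 :> R by rewrite pnatr_eq0.
    have : n.+2%:R != 0 :> R by rewrite pnatr_eq0.
    rewrite -(natr1 n.+1); move: (n.+1%:R) => x hx hx'; field.
    by rewrite hx' hx.
  have n1 : 0 < n.+1%:R :> R by rewrite ltr0n.
  have n2 : 0 < n.+2%:R :> R by rewrite ltr0n.
  have p1 : 1 <= n.+1%:R `^ s :> R by apply: powR_nat_ge1 => //; exact: ltW.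
  have n12 : n.+1%:R <= n.+2%:R :> R by rewrite ler_nat.
  apply: le_trans (ler_normD _ _) _; rewrite [leRHS]mulrDl; apply: lerD.
    rewrite normrM (ger0_norm (x := _^-1)) ?invr_ge0 ?mulr_ge0//.
    have i0 : 0 <= (n.+1%:R * n.+2%:R)^-1 :> R by apply: ltW; rewrite invr_gt0 mulr_gt0.
    rewrite mulrA; apply: ler_pM => //; first exact: A_est.
    by rewrite expr2 lef_pV2 ?posrE ?mulr_gt0// ler_pM2l.
  rewrite normrM gtr0_norm// ler_pM2l//.
  have /andP[l1 l2] := @ln_step_bounds R n.+1 isT.
  have h1 : n.+1%:R^-1 - n.+2%:R^-1 <= (n.+1%:R ^+ 2)^-1 :> R.
    have -> : n.+1%:R^-1 - n.+2%:R^-1 = (n.+1%:R * n.+2%:R)^-1 :> R.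
      have : n.+1%:R != 0 :> R by rewrite pnatr_eq0.
      have : n.+2%:R != 0 :> R by rewrite pnatr_eq0.
      rewrite -(natr1 n.+1); move: (n.+1%:R) => x hx hx'; field.
      by rewrite hx' hx.
    by rewrite expr2 lef_pV2 ?posrE ?mulr_gt0// ler_pM2l.
  have h2 : (n.+1%:R ^+ 2)^-1 <= n.+1%:R `^ s / n.+1%:R ^+ 2 :> R.
    by rewrite ler_peMl// invr_ge0 exprn_ge0// ltW.
  move: l1 l2 h1 h2; move: (n.+1%:R^-1) (n.+2%:R^-1) (n.+1%:R `^ s / n.+1%:R ^+ 2) ((n.+1%:R ^+ 2)^-1) => x y z t.
  by rewrite ler_norml; lra.
move=> l hl; exists (D + C0), (l + rho) => M M0.
have := hl M.-1; rewrite /u /v prednK//.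
have M0' : 0 < M%:R :> R by rewrite ltr0n.
have h2 : `|psum a M / M%:R - rho| <= C0 * (M%:R `^ s / M%:R).
  have -> : psum a M / M%:R - rho = E M / M%:R by rewrite /E; field; rewrite gt_eqF.
  by rewrite normrM mulrA (ger0_norm (x := _^-1)) ?invr_ge0 ?(ltW M0')// ler_pM2r ?invr_gt0// A_est.
rewrite /U; move: h2; move: (psum a M / M%:R) (M%:R `^ s / M%:R) => x y.
by rewrite !ler_norml; lra.
Qed.

(** The error [psi x - x] at [x = N / n], shifted by a constant that [G_est] tunes. *)
Definition Fc c N n := psi (N %/ n) - N%:R / n%:R + c.

Lemma floor_bounds N d : (0 < d)%N ->
  (N %/ d)%:R <= N%:R / d%:R :> R /\ N%:R / d%:R <= (N %/ d)%:R + 1 :> R.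
Proof.
move=> d0; have d0' : 0 < d%:R :> R by rewrite ltr0n.
split; first by rewrite ler_pdivlMr// -natrM ler_nat leq_trunc_div.
by rewrite ler_pdivrMr// natr1 -natrM ler_nat ltnW// ltn_ceil.
Qed.

Lemma a_psi M : psum (fun m => a m * psi (M %/ m)) M = sum_aln M.
Proof.
have := a_ln M (fun=> 1); rewrite /psi psum_div /sum_aln.
under eq_psum => k _ do rewrite mulr1.
move=> ->; apply: eq_psum => n _; rewrite -psumZ.
by apply: eq_psum => m _; rewrite mulr1.
Qed.

(** With [y = N / d] and [M] its integer part, the terms in [M ln M] cancel, and [c = 1 + g / rho]
    is the value for which the linear terms [- rho], [- g] and [c rho] cancel too. What is left has
    a power saving. *)
Lemma G_est : exists K c, forall N d, (0 < d <= N)%N ->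
  `|psum (fun m => a m * Fc c N (d * m)) (N %/ d)| <= K * (N%:R / d%:R) `^ ((1 + s) / 2).
Proof.
have [K1 h1] := sum_aln_est; have [K2 [g h2]] := sum_ainv_est.
have /andP[s0 s1] := s01; have [ss /andP[s10 s11]] := s1_bounds.
pose c := 1 + g / rho.
exists (K1 + rho * (2 / (1 - s)) + `|g| + 2 * K2 + `|c| * C0), c => N d /andP[d0 dN].
have d0' : 0 < d%:R :> R by rewrite ltr0n.
have [] := floor_bounds N d0; set y := N%:R / d%:R; set M := (N %/ d)%N => hM hM'.
have M0 : (0 < M)%N by rewrite divn_gt0.
have M1 : 1 <= M%:R :> R by rewrite ler1n.
have -> : psum (fun m => a m * Fc c N (d * m)) M =
    sum_aln M - y * sum_ainv M + c * psum a M.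
  rewrite -a_psi /sum_ainv -!psumZ -psumB -psumD; apply: eq_psum => m /andP[m0 _].
  rewrite /Fc divnMA -/M natrM /y; field.
  by rewrite !pnatr_eq0 -!lt0n d0 m0.
have {}h1 := h1 M M0; have {}h2 := h2 M M0.
have p0 : 0 < M%:R `^ s :> R by apply: powR_gt0; lra.
have p1 : 1 <= M%:R `^ s :> R by apply: powR_nat_ge1 => //; exact: ltW.
have pp : M%:R `^ s <= M%:R `^ ((1 + s) / 2) :> R by apply: powR_nat_le => //; exact: ltW.
have ppy : M%:R `^ ((1 + s) / 2) <= y `^ ((1 + s) / 2) :> R.
  rewrite ge0_ler_powR ?nnegrE//; [exact: ltW|exact: le_trans hM].
have hl : ln M%:R <= 2 / (1 - s) * M%:R `^ ((1 + s) / 2).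
  apply: le_trans (ln_mul_powR s01 M1).
  by rewrite ler_peMl// ln_nat_ge0.
have K10 : 0 <= K1.
  have := le_trans (normr_ge0 _) h1; rewrite pmulr_lge0//; lra.
have q0 : 0 < M%:R `^ s / M%:R :> R by rewrite divr_gt0//; lra.
have K20 : 0 <= K2 by have := le_trans (normr_ge0 _) h2; rewrite pmulr_lge0.
have h2' : `|y * (sum_ainv M - rho * ln M%:R - g)| <= 2 * K2 * M%:R `^ s.
  rewrite normrM ger0_norm; last lra.
  have hy : y <= 2 * M%:R by lra.
  apply: le_trans (_ : (2 * M%:R) * (K2 * (M%:R `^ s / M%:R)) <= _).
    by rewrite ler_pM//; lra.
  have E1 (x p : R) : x != 0 -> 2 * x * (K2 * (p / x)) = 2 * K2 * p.
    by move=> hx; field.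
  by rewrite E1// pnatr_eq0 -lt0n.
have h3 : `|c * (psum a M - rho * M%:R)| <= `|c| * (C0 * M%:R `^ s).
  by rewrite normrM ler_wpM2l// A_est.
have hc : c * rho = rho + g by rewrite /c; field; rewrite gt_eqF.
have -> : sum_aln M - y * sum_ainv M + c * psum a M =
  (sum_aln M - rho * (M%:R * ln M%:R - M%:R))
  - y * (sum_ainv M - rho * ln M%:R - g) + c * (psum a M - rho * M%:R)
  - (y - M%:R) * (rho * ln M%:R) - (y - M%:R) * g.
  have -> : g = c * rho - rho by lra.
  ring.
have h4 : `|(y - M%:R) * (rho * ln M%:R)| <= rho * (2 / (1 - s)) * M%:R `^ ((1 + s) / 2).
  have l0 := ln_nat_ge0 R M.
  rewrite ger0_norm; last by rewrite mulr_ge0 ?subr_ge0// mulr_ge0// ltW.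
  rewrite -[leRHS]mul1r -mulrA.
  by apply: ler_pM; [lra|rewrite mulr_ge0// ltW|lra|rewrite ler_pM2l].
have h5 : `|(y - M%:R) * g| <= `|g| * M%:R `^ s.
  rewrite normrM mulrC ler_wpM2l// ger0_norm; lra.
have C00 := C0_ge0; have g0 := normr_ge0 g; have c0 := normr_ge0 c.
have hq : 0 <= y `^ ((1 + s) / 2) - M%:R `^ s by lra.
have s20 : 0 <= rho * (2 / (1 - s)) by rewrite mulr_ge0 ?(ltW rho_gt0)// divr_ge0// subr_ge0 ltW.
apply: le_trans (ler_normB _ _) _; apply: le_trans (lerD (ler_normB _ _) (lexx _)) _.
apply: le_trans (lerD (lerD (ler_normD _ _) (lexx _)) (lexx _)) _.
apply: le_trans (lerD (lerD (lerD (ler_normB _ _) (lexx _)) (lexx _)) (lexx _)) _.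
move: h1 h2' h3 h4 h5 pp ppy hq; move: (`|_ - rho * (_ - _)|) (`|y * _|) (`|c * _|) (`|_ * (rho * _)|) (`|_ * g|).
move: (y `^ _) (M%:R `^ s) (M%:R `^ _) => Y P Q e1 e2 e3 e4 e5 h1' h2' h3 h4 h5 PQ QY hq.
have := ler_wpM2l K10 QY; have := ler_wpM2l s20 QY; have := mulr_ge0 g0 hq.
have := mulr_ge0 K20 hq; have := mulr_ge0 (mulr_ge0 c0 C00) hq.
lra.
Qed.

Lemma B_ext N u v : (forall n, (0 < n <= N)%N -> u n = v n) -> B N u = B N v.
Proof.
move=> h; have -> : u = (fun n => v n + (u n - v n)).
  by apply: functional_extensionality_dep => n; ring.
rewrite B_add; have := B_le N (fun n => u n - v n).
rewrite (@eq_psum _ _ (fun=> 0)) ?psum_const ?mulr0 ?normr_le0; last first.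
  by move=> n hn; rewrite h// subrr normr0 mulr0.
by move=> /eqP ->; rewrite addr0.
Qed.

Lemma psum_powR_le (u : nat -> R) (C r : R) N : 0 < r < 1 -> 0 <= C -> (forall n, psum u n <= C * n%:R) ->
  psum (fun n => u n * (N%:R / n%:R) `^ r) N <= C * (2 / (1 - r)) * N%:R.
Proof.
move=> /andP[r0 r1] C_ge0 hu.
case: N => [|N]; first by rewrite psum0 mulr0.
have N0 : 0 < N.+1%:R :> R by rewrite ltr0n.
apply: le_trans (psum_abel_le hu _ _) _; [by move=> n; exact: powR_ge0| |].
  move=> n /andP[n0 _]; rewrite ge0_ler_powR ?nnegrE ?divr_ge0//; first exact: ltW.
  by rewrite ler_pM2l// lef_pV2 ?posrE ?ltr0n// ler_nat.
rewrite -mulrA ler_wpM2l//.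
rewrite (@eq_psum _ _ (fun n => N.+1%:R `^ r * (n%:R `^ (1 - r) / n%:R))); last first.
  move=> n /andP[n0 _]; have n0' : 0 < n%:R :> R by rewrite ltr0n.
  rewrite powRM ?invr_ge0//.
  congr (_ * _); rewrite powRB ?(gt_eqF n0') ?implybT// powRr1 ?ltW//.
  have -> : n%:R^-1 `^ r = (n%:R `^ r)^-1.
    by rewrite -powR_inv1 ?ltW// -powRrM mulN1r powRN.
  by field; rewrite ?gt_eqF ?powR_gt0.
rewrite psumZ; apply: le_trans (ler_wpM2l (powR_ge0 _ _) (sum_powR _ _)) _; first lra.
rewrite mulrCA ler_wpM2l ?divr_ge0//; first lra.
rewrite -powRD; last by rewrite (gt_eqF N0) implybT.
have -> : r + (1 - r) = 1 by ring.
by rewrite powRr1.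
Qed.

(** Applying [B] to the sums of [G_est] returns [Fc c N 1], that is [psi N - N + c]; the saving in
    [G_est] makes the sum of absolute values linear in [N]. *)
Lemma chebyshev_bound : exists K, 0 <= K /\ forall N, psi N <= K * N%:R.
Proof.
have [K [c hG]] := G_est; have [ss hs1] := s1_bounds.
exists (`|K| * ((rho + C0) * (2 / (1 - (1 + s) / 2))) + 1 + `|c|); split.
  have : 0 <= 2 / (1 - (1 + s) / 2) by rewrite divr_ge0//; lra.
  have : 0 <= rho + C0 by rewrite addr_ge0 ?C0_ge0// ltW.
  by move=> h1 h2; rewrite -addrA addr_ge0 ?addr_ge0// mulr_ge0// mulr_ge0.
case=> [|N]; first by rewrite /psi psum0 mulr0.
have := B_inv (Fc c N.+1) (ltn0Sn N) => hB.
have := B_le N.+1 (fun d => psum (fun m => a m * Fc c N.+1 (d * m)) (N.+1 %/ d)).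
rewrite hB => h.
have h' : psum (fun n => a n *
   `|psum (fun m => a m * Fc c N.+1 (n * m)) (N.+1 %/ n)|) N.+1 <=
   `|K| * ((rho + C0) * (2 / (1 - (1 + s) / 2)) * N.+1%:R).
  apply: le_trans (_ : psum (fun n => `|K| * (a n * (N.+1%:R / n%:R) `^ ((1 + s) / 2))) N.+1 <= _).
    apply: ler_psum => n hn; rewrite mulrCA ler_wpM2l//.
    apply: le_trans (hG _ _ hn) _; apply: ler_wpM2r; [exact: powR_ge0|exact: ler_norm].
  rewrite psumZ ler_wpM2l// psum_powR_le//; last exact: A_le.
  by rewrite addr_ge0 ?C0_ge0// ltW.
have {h h'} := le_trans h h'; rewrite /Fc divn1 divr1 ler_norml => /andP[_ h].
have c1 : - c <= `|c| * N.+1%:R.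
  rewrite (le_trans (_ : _ <= `|c|)) ?ler_peMr ?ler1n//.
  by rewrite -normrN ler_norm.
by move: (2 / (1 - _)) h => q h; lra.
Qed.

(** The identity of Tatuzawa and Iseki: inserting the factor [ln (N / d)] before applying [B]
    produces the term with [ln N] and, through [a_ln], the sum against [La]. The power saving of
    [G_est] absorbs the inserted logarithm. *)
Lemma selberg_raw : exists K c, forall N, (0 < N)%N ->
  `|Fc c N 1 * ln N%:R + psum (fun n => La n * Fc c N n) N| <= K * N%:R.
Proof.
have [K [c hG]] := G_est; have [ss hs1] := s1_bounds.
pose s2 := (1 + (1 + s) / 2) / 2.
exists (`|K| * (2 / (1 - (1 + s) / 2)) * ((rho + C0) * (2 / (1 - s2)))), c => N N0.
have N0' : 0 < N%:R :> R by rewrite ltr0n.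
pose G d := psum (fun m => a m * Fc c N (d * m)) (N %/ d).
(* [ln (N / d)] is split as [ln (N / (d m)) + ln m]: the first part is inverted by [B] directly, the
   second after [a_ln]. *)
have E1 : B N (fun d => ln (N%:R / d%:R) * G d) =
    Fc c N 1 * ln N%:R + psum (fun n => La n * Fc c N n) N.
  pose w k := ln (N%:R / k%:R) * Fc c N k.
  pose w' k := psum (fun l => La l * Fc c N (k * l)) (N %/ k).
  have -> : Fc c N 1 * ln N%:R = w 1%N by rewrite /w divr1 mulrC.
  have -> : psum (fun n => La n * Fc c N n) N = w' 1%N.
    by rewrite /w' divn1; apply: eq_psum => n _; rewrite mul1n.
  rewrite -(B_inv w N0) -(B_inv w' N0) -B_add; apply: B_ext => d /andP[d0 dN].
  have -> : psum (fun m => a m * w' (d * m)%N) (N %/ d) =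
      psum (fun m => a m * ln m%:R * Fc c N (d * m)) (N %/ d).
    rewrite (a_ln _ (fun k => Fc c N (d * k))) psum_hyper.
    apply: eq_psum => m _; rewrite /w' -psumZ divnMA; apply: eq_psum => l _.
    by rewrite -mulnA (mulnC m); ring.
  rewrite -psumD -psumZ; apply: eq_psum => m /andP[m0 _].
  have d0' : 0 < d%:R :> R by rewrite ltr0n.
  have m0' : 0 < m%:R :> R by rewrite ltr0n.
  rewrite /w !ln_div ?posrE ?ltr0n ?muln_gt0 ?d0// natrM lnM ?posrE//; ring.
rewrite -E1; apply: le_trans (B_le _ _) _.
apply: le_trans (_ : psum (fun n => `|K| * (2 / (1 - (1 + s) / 2)) *
   (a n * (N%:R / n%:R) `^ s2)) N <= _); last first.
  rewrite psumZ -[leRHS]mulrA; apply: ler_wpM2l.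
    by rewrite mulr_ge0// divr_ge0//; lra.
  apply: psum_powR_le; [rewrite /s2; lra|by rewrite addr_ge0 ?C0_ge0// ltW|exact: A_le].
apply: ler_psum => n hn; rewrite mulrCA ler_wpM2l//.
have /andP[n0 nN] := hn; have n0' : 0 < n%:R :> R by rewrite ltr0n.
have y1 : 1 <= N%:R / n%:R :> R by rewrite ler_pdivlMr// mul1r ler_nat.
rewrite normrM ger0_norm ?ln_ge0//.
have hl := ln_mul_powR hs1 y1.
rewrite -mulrA; apply: le_trans (ler_wpM2l (normr_ge0 K) hl).
rewrite mulrC mulrA ler_wpM2r ?ln_ge0//.
apply: le_trans (hG _ _ hn) _; apply: ler_wpM2r; [exact: powR_ge0|exact: ler_norm].
Qed.

(** The sum of [La n * psum a (N / n)] is exactly [sum_aln N]. Replacing [psum a (N / n)] by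
    [rho N / n] costs a linear error by Chebyshev's bound; then divide by [rho N]. *)
Lemma mertens : exists K, forall N, (0 < N)%N ->
  `|psum (fun n => La n / n%:R) N - ln N%:R| <= K.
Proof.
have [K0 [K00 hcheb]] := chebyshev_bound; have [K1 hA] := A_div_est.
have [K2 hT] := sum_aln_est; have [ss /andP[s10 s11]] := s1_bounds.
exists ((`|K1| * (K0 * (2 / (1 - s))) + `|K2|) / rho + 1) => N N0.
have N0' : 0 < N%:R :> R by rewrite ltr0n.
have h1 : psum (fun n => La n * psum a (N %/ n)) N = sum_aln N.
  by rewrite psum_div; exact: a_psi.
have h2 : `|psum (fun n => La n * psum a (N %/ n)) N -
    rho * N%:R * psum (fun n => La n / n%:R) N| <= `|K1| * (K0 * (2 / (1 - s)) * N%:R).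
  rewrite -psumZ -psumB.
  apply: le_trans (_ : psum (fun n => `|K1| * (La n * (N%:R / n%:R) `^ s)) N <= _).
    apply: ler_norm_psum => n hn.
    have -> : La n * psum a (N %/ n) - rho * N%:R * (La n / n%:R) =
       La n * (psum a (N %/ n) - rho * (N%:R / n%:R)) by ring.
    rewrite normrM (ger0_norm (La_ge0 n)) [leRHS]mulrCA ler_wpM2l//.
    apply: le_trans (hA _ _ hn) _; apply: ler_wpM2r; [exact: powR_ge0|exact: ler_norm].
  by rewrite psumZ ler_wpM2l// psum_powR_le.
have h3 := hT N N0.
have h4 : N%:R `^ ((1 + s) / 2) <= N%:R :> R.
  by apply: ler1_powR; [rewrite ler1n|exact: ltW].
have h5 : K2 * N%:R `^ ((1 + s) / 2) <= `|K2| * N%:R.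
  apply: le_trans (ler_wpM2l (normr_ge0 K2) h4).
  by rewrite ler_wpM2r ?powR_ge0// ler_norm.
rewrite h1 in h2; set L := psum _ N in h2 *.
have h6 : `|rho * N%:R * (L - ln N%:R)| <=
   (`|K1| * (K0 * (2 / (1 - s))) + `|K2| + rho) * N%:R.
  move: (normr_ge0 K1) (normr_ge0 K2) h2 h3.
  have := mulr_gt0 rho_gt0 N0'.
  rewrite !ler_norml; nra.
rewrite normrM gtr0_norm ?mulr_gt0// mulrC in h6.
rewrite -ler_pdivlMr ?mulr_gt0// in h6; apply: le_trans h6 _.
rewrite le_eqVlt; apply/orP; left; apply/eqP; field.
by rewrite !gt_eqF//; lra.
Qed.

(** Dropping [c] and rounding [N / n] down change each term by a bounded multiple of [La n], which
    Chebyshev's bound sums to a linear error. *)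
Lemma selberg1 : exists K, forall N,
  `|(psi N - N%:R) * ln N%:R + psum (fun n => La n * (psi (N %/ n) - (N %/ n)%:R)) N|
     <= K * N%:R.
Proof.
have [K [c h]] := selberg_raw; have [K0 [K00 hcheb]] := chebyshev_bound.
exists (K + `|c| + (1 + `|c|) * K0) => -[|N].
  by rewrite psum0 ln0// !mulr0 addr0 normr0.
have {}h := h N.+1 isT; move: h; set M := N.+1.
have h2 : `|psum (fun n => La n * Fc c M n) M -
    psum (fun n => La n * (psi (M %/ n) - (M %/ n)%:R)) M| <= (1 + `|c|) * (K0 * M%:R).
  rewrite -psumB; apply: le_trans (_ : psum (fun n => La n * (1 + `|c|)) M <= _).
    apply: ler_norm_psum => n /andP[n0 _]; have [f1 f2] := floor_bounds M n0.
    rewrite -mulrBr normrM ger0_norm// ler_wpM2l// /Fc.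
    have := ler_norm c; have := ler_norm (- c); rewrite normrN ler_norml.
    by move: (M%:R / n%:R) f1 f2 => y; lra.
  rewrite psumZr mulrC ler_wpM2l ?addr_ge0//; exact: hcheb.
have -> : Fc c M 1 = psi M - M%:R + c by rewrite /Fc divn1 divr1.
have h3 : `|c * ln M%:R| <= `|c| * M%:R.
  rewrite normrM ler_wpM2l// ger0_norm ?ln_nat_ge0//.
  by rewrite ltW// ln_sublinear// ltr0n.
move: h2 h3; rewrite !ler_norml; move: (psum _ M) (psum _ M) (ln M%:R) => X Y l; nra.
Qed.

(** The part of [selberg_raw] that is linear in [N / n] is evaluated by [mertens]; this supplies the
    second copy of [N ln N]. *)
Lemma selberg2 : exists K, forall N,
  `|psi N * ln N%:R + psum (fun n => La n * psi (N %/ n)) N - 2 * (N%:R * ln N%:R)|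
     <= K * N%:R.
Proof.
have [K [c h]] := selberg_raw; have [K0 [K00 hcheb]] := chebyshev_bound.
have [K1 hm] := mertens.
exists (K + `|c| + `|c| * K0 + K1) => -[|N].
  by rewrite psum0 ln0// !mulr0 addr0 subrr normr0.
have {}h := h N.+1 isT; have {}hm := hm N.+1 isT; move: h hm; set M := N.+1.
have -> : psum (fun n => La n * Fc c M n) M = psum (fun n => La n * psi (M %/ n)) M
    - M%:R * psum (fun n => La n / n%:R) M + c * psi M.
  by rewrite -!psumZ -psumB -psumD; apply: eq_psum => n _; rewrite /Fc; ring.
have -> : Fc c M 1 = psi M - M%:R + c by rewrite /Fc divn1 divr1.
have h3 : `|c * ln M%:R| <= `|c| * M%:R.
  rewrite normrM ler_wpM2l// ger0_norm ?ln_nat_ge0//.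
  by rewrite ltW// ln_sublinear// ltr0n.
have h4 : `|c * psi M| <= `|c| * (K0 * M%:R).
  rewrite normrM ler_wpM2l// ger0_norm//; exact: psum_ge0.
have M0 : 0 < M%:R :> R by rewrite ltr0n.
move=> h hm.
have h5 : `|M%:R * (psum (fun n => La n / n%:R) M - ln M%:R)| <= M%:R * K1.
  by rewrite normrM gtr0_norm// ler_pM2l.
move: h h3 h4 h5 {hm}; rewrite !ler_norml.
move: (psum _ M) (psum _ M) (ln M%:R) (psi M) => X Y l p; lra.
Qed.

End Selberg.

(** * The prime number theorem from the formula *)

Section Harmonic.
Variable R : realType.

Lemma ln_large (c : R) : exists n0 : nat, (0 < n0)%N /\ forall n, (n0 <= n)%N -> c <= ln n%:R.
Proof.
exists (Num.truncn (expR c)).+1; split=> // n hn.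
rewrite -(expRK c) ler_ln ?posrE ?expR_gt0 ?ltr0n ?(leq_trans _ hn)//.
apply: le_trans (_ : (Num.truncn (expR c)).+1%:R <= _); last by rewrite ler_nat.
by rewrite ltW// truncnS_gt// real1.
Qed.

Lemma harmonic_le N : (0 < N)%N -> psum (fun n => n%:R^-1) N <= 1 + ln N%:R :> R.
Proof.
elim: N => // -[|N] IH _; first by rewrite psumS psum0 ln1 invr1 add0r addr0.
rewrite psumS; have := IH isT; have /andP[+ _] := @ln_step_bounds R N.+1 isT.
by move: (N.+2%:R^-1) => z; lra.
Qed.

Lemma harmonic_ge N : ln N.+1%:R <= psum (fun n => n%:R^-1) N :> R.
Proof.
elim: N => [|N IH]; first by rewrite psum0 ln1.
rewrite psumS; have /andP[_ +] := @ln_step_bounds R N.+1 isT.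
by move: (N.+1%:R^-1) IH => z; lra.
Qed.

Lemma sum_ln_div_le N : (0 < N)%N ->
  psum (fun n => ln n%:R / n%:R) N <= ln N%:R ^+ 2 / 2 + 1 + ln N%:R :> R.
Proof.
move=> N0; apply: le_trans (_ : ln N%:R ^+ 2 / 2 + psum (fun n => n%:R^-1) N <= _); last first.
  by have := harmonic_le N0; lra.
elim: N N0 => // -[|N] IH _.
  by rewrite !psumS !psum0 ln1; lra.
rewrite (psumS _ N.+1) [in leRHS](psumS _ N.+1).
have /andP[h1 h2] := @ln_step_bounds R N.+1 isT.
have l0 := ln_nat_ge0 R N.+1.
have z0 : 0 <= N.+2%:R^-1 :> R by rewrite invr_ge0.
have h3 : N.+1%:R^-1 <= 1 :> R by rewrite invf_le1 ?ler1n ?ltr0n.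
have := IH isT; move: (psum _ _) (psum _ _) (N.+2%:R^-1) (N.+1%:R^-1) h1 h2 z0 h3 => X Y z z'.
move: (ln N.+1%:R) (ln N.+2%:R) l0 => l l' l0 h1 h2 z0 h3 IH'.
have : 0 <= (l' - l - z) * (l' + l) by rewrite mulr_ge0//; lra.
have : 0 <= z * (1 - (l' - l)) by rewrite mulr_ge0//; lra.
lra.
Qed.

Lemma sum_ln_est N : `|psum (fun n => ln n%:R) N - N%:R * ln N%:R| <= N%:R :> R.
Proof.
rewrite psum_nat_abel addrC addKr.
apply: le_trans (_ : psum (fun=> 1) N.-1 <= _); last first.
  by rewrite psum_const mulr1 ler_nat leq_pred.
apply: ler_norm_psum => n /andP[n0 _]; have n0' : 0 < n%:R :> R by rewrite ltr0n.
have /andP[l1 l2] := ln_step_bounds R n0.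
have l0 : 0 <= n.+1%:R^-1 :> R by rewrite invr_ge0.
rewrite normrM gtr0_norm// mulrC -ler_pdivlMr// mul1r distrC ger0_norm//.
exact: le_trans l1.
Qed.

End Harmonic.

Section Endgame.
Variables (R : realType) (La : nat -> R) (K : R).
Let psi := psum La.
Let r n : R := psi n - n%:R.
Hypothesis La_ge0 : forall n, 0 <= La n.
Hypothesis K_ge1 : 1 <= K.
Hypothesis cheb : forall N, psi N <= K * N%:R.
Hypothesis mert : forall N, (0 < N)%N -> `|psum (fun n => La n / n%:R) N - ln N%:R| <= K.
Hypothesis sel1 : forall N,
  `|r N * ln N%:R + psum (fun n => La n * r (N %/ n)) N| <= K * N%:R.
Hypothesis sel2 : forall N,
  `|psi N * ln N%:R + psum (fun n => La n * psi (N %/ n)) N - 2 * (N%:R * ln N%:R)|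
     <= K * N%:R.

Lemma psi_ge0 n : 0 <= psi n.
Proof. exact: psum_ge0. Qed.

Lemma r_le n : `|r n| <= (K + 1) * n%:R.
Proof.
have := cheb n; have := psi_ge0 n; have : 0 <= n%:R :> R by [].
have : 0 <= (K - 1) * n%:R by rewrite mulr_ge0//; move: K_ge1; lra.
by rewrite /r ler_norml; lra.
Qed.

Lemma ln_floor N n : (0 < n <= N)%N ->
  0 <= ln N%:R - ln n%:R - ln (N %/ n)%:R :> R /\
  ln N%:R - ln n%:R - ln (N %/ n)%:R <= (N %/ n)%:R^-1 :> R.
Proof.
move=> /andP[n0 nN]; set M := (N %/ n)%N.
have M0 : (0 < M)%N by rewrite divn_gt0.
have h1 : ln (M * n)%:R <= ln N%:R :> R by apply: ler_ln_nat; rewrite ?muln_gt0 ?M0// leq_trunc_div.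
have h2 : ln N%:R <= ln (M.+1 * n)%:R :> R.
  by apply: ler_ln_nat; [exact: leq_trans nN|rewrite ltnW// ltn_ceil].
rewrite !natrM !lnM ?posrE ?ltr0n// in h1 h2.
have /andP[_] := ln_step_bounds R M0.
by move: (M%:R^-1) => z; lra.
Qed.

(** Selberg's function of second order. On average it behaves like [2 ln k], with a linear error in
    its partial sums. *)
Definition la2 k := La k * ln k%:R + dconv La La k.

Lemma la2_est : exists K2 : R, 0 <= K2 /\ forall N, `|psum la2 N - 2 * (N%:R * ln N%:R)| <= K2 * N%:R.
Proof.
exists (2 * K); split=> [|N]; first by move: K_ge1; lra.
have E1 : psum la2 N = psi N * ln N%:R + psum (fun n => psi n * (ln n%:R - ln n.+1%:R)) N.-1
     + psum (fun n => La n * psi (N %/ n)) N.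
  rewrite /la2 psumD psum_abel; congr (_ + _).
  have := psum_dconv La La (fun=> 1) N.
  under eq_psum => n _ do rewrite mulr1.
  move=> ->; apply: eq_psum => n _; rewrite -psumZ.
  by apply: eq_psum => m _; rewrite mulr1.
have h : `|psum (fun n => psi n * (ln n%:R - ln n.+1%:R)) N.-1| <= K * N%:R.
  apply: le_trans (_ : psum (fun=> K) N.-1 <= _); last first.
    by rewrite psum_const mulrC ler_wpM2l ?ler_nat ?leq_pred//; move: K_ge1; lra.
  apply: ler_norm_psum => n /andP[n0 _]; have n0' : 0 < n%:R :> R by rewrite ltr0n.
  have /andP[l1 l2] := ln_step_bounds R n0.
  have l0 : 0 <= n.+1%:R^-1 :> R by rewrite invr_ge0.
  rewrite normrM ger0_norm ?psi_ge0// distrC ger0_norm; last exact: le_trans l1.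
  apply: le_trans (_ : (K * n%:R) * n%:R^-1 <= _).
    by apply: ler_pM => //; [exact: psi_ge0|exact: le_trans l1].
  by rewrite mulfK ?gt_eqF.
by move: (sel2 N) h; rewrite E1 !ler_norml; move: (psum _ _) (psum _ _) => X Y; lra.
Qed.

(** [sel1] at [N], multiplied by [ln N], is combined with [sel1] at each [N / n], weighted by
    [La n]. Since [ln N] is nearly [ln n + ln (N / n)], the sums with [ln (N / n)] cancel, and
    [S3 - S2] is left; its absolute value is at most the sum against [la2]. *)
Lemma iterated_selberg : exists K3 : R, forall N, (0 < N)%N ->
  `|r N| * ln N%:R ^+ 2 <= psum (fun n => la2 n * `|r (N %/ n)|) N + K3 * (N%:R * (1 + ln N%:R)).
Proof.
have K0 : 0 <= K by move: K_ge1; lra.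
exists (K + K * (1 + K) + (K + 1) * K) => N N0.
have N0' : 0 < N%:R :> R by rewrite ltr0n.
have lN := ln_nat_ge0 R N.
pose S1 := psum (fun n => La n * r (N %/ n)) N.
pose S2 := psum (fun n => La n * ln n%:R * r (N %/ n)) N.
pose S3 := psum (fun n => psum (fun m => La n * La m * r (N %/ (n * m))) (N %/ n)) N.
have h1 : `|(r N * ln N%:R + S1) * ln N%:R| <= K * N%:R * ln N%:R.
  by rewrite normrM (ger0_norm lN) ler_wpM2r// sel1.
have h2 : `|psum (fun n => La n * (r (N %/ n) * ln (N %/ n)%:R)) N + S3| <=
     K * (N%:R * (ln N%:R + K)).
  rewrite -psumD.
  apply: le_trans (_ : psum (fun n => K * N%:R * (La n / n%:R)) N <= _); last first.
    rewrite psumZ mulrA ler_wpM2l ?mulr_ge0//.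
    by have := mert N0; rewrite ler_norml; lra.
  apply: ler_norm_psum => n /andP[n0 nN].
  have -> : psum (fun m => La n * La m * r (N %/ (n * m))) (N %/ n) =
     La n * psum (fun m => La m * r (N %/ n %/ m)) (N %/ n).
    by rewrite -psumZ; apply: eq_psum => m _; rewrite divnMA mulrA.
  rewrite -mulrDr normrM ger0_norm//.
  have -> : K * N%:R * (La n / n%:R) = La n * (K * (N%:R / n%:R)) by ring.
  rewrite ler_wpM2l//; apply: le_trans (sel1 _) _; rewrite ler_wpM2l//.
  by rewrite ler_pdivlMr ?ltr0n// -natrM ler_nat leq_trunc_div.
have h3 : `|S1 * ln N%:R - S2 - psum (fun n => La n * (r (N %/ n) * ln (N %/ n)%:R)) N| <=
    (K + 1) * (K * N%:R).
  have -> : S1 * ln N%:R - S2 - psum (fun n => La n * (r (N %/ n) * ln (N %/ n)%:R)) N =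
    psum (fun n => La n * (r (N %/ n) * (ln N%:R - ln n%:R - ln (N %/ n)%:R))) N.
    rewrite /S1 /S2 -psumZr -!psumB; apply: eq_psum => n _; ring.
  apply: le_trans (_ : psum (fun n => (K + 1) * La n) N <= _); last first.
    by rewrite psumZ ler_wpM2l ?cheb//; lra.
  apply: ler_norm_psum => n hn; have /andP[n0 nN] := hn.
  have M0 : 0 < (N %/ n)%:R :> R by rewrite ltr0n divn_gt0.
  have [l1 l2] := ln_floor hn.
  rewrite normrM ger0_norm// mulrC ler_wpM2r// normrM (ger0_norm l1).
  apply: le_trans (_ : ((K + 1) * (N %/ n)%:R) * (N %/ n)%:R^-1 <= _).
    by apply: ler_pM => //; exact: r_le.
  by rewrite mulfK ?gt_eqF.
have h4 : `|S3 - S2| <= psum (fun n => la2 n * `|r (N %/ n)|) N.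
  have -> : psum (fun n => la2 n * `|r (N %/ n)|) N =
     psum (fun n => La n * ln n%:R * `|r (N %/ n)|) N +
     psum (fun n => psum (fun m => La n * La m * `|r (N %/ (n * m))|) (N %/ n)) N.
    by rewrite -(psum_dconv La La (fun k => `|r (N %/ k)|)) -psumD; apply: eq_psum => n _; rewrite /la2; ring.
  rewrite [leRHS]addrC; apply: le_trans (ler_normB _ _) _; apply: lerD.
    apply: ler_norm_psum => n _; apply: ler_norm_psum => m _.
    by rewrite !normrM !(ger0_norm (La_ge0 _)).
  by apply: ler_norm_psum => n _; rewrite !normrM (ger0_norm (La_ge0 _)) (ger0_norm (ln_nat_ge0 _ _)).
have h5 : `|r N * ln N%:R ^+ 2 - (S3 - S2)| <=
   (K + K * (1 + K) + (K + 1) * K) * (N%:R * (1 + ln N%:R)).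
  have : 0 <= K * N%:R by rewrite mulr_ge0// ltW.
  have : 0 <= K * K * (N%:R * ln N%:R) by rewrite !mulr_ge0// ltW.
  have : 0 <= K * (N%:R * ln N%:R) by rewrite !mulr_ge0// ltW.
  move: h1 h2 h3; rewrite !ler_norml expr2.
  move: (psum (fun n => La n * (r (N %/ n) * ln (N %/ n)%:R)) N) => X.
  by move: S1 S2 S3 (r N) (ln N%:R) {h4 lN} => s1 s2 s3 rN l; lra.
rewrite -[ln N%:R ^+ 2]ger0_norm ?sqr_ge0// -normrM.
by move: h4 h5; rewrite !ler_norml; lra.
Qed.

(** Partial summation replaces [la2] by its average. This needs the total variation of [|r (N / n)|]
    in [n]. *)
Lemma selberg_ln : exists K4 : R, 0 <= K4 /\ forall N, (0 < N)%N ->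
  `|r N| * ln N%:R ^+ 2 <=
  2 * psum (fun n => ln n%:R * `|r (N %/ n)|) N + K4 * (N%:R * (1 + ln N%:R)).
Proof.
have K0 : 0 <= K by move: K_ge1; lra.
have [K2 [K20 h2]] := la2_est; have [K3 h3] := iterated_selberg.
exists (`|K3| + (K2 + 2) * (K + 1)); split; first by rewrite addr_ge0// mulr_ge0//; lra.
move=> N N0; apply: le_trans (h3 N N0) _.
have N0' : 0 < N%:R :> R by rewrite ltr0n.
have lN := ln_nat_ge0 R N.
pose v n := `|r (N %/ n)|.
have hE n : `|psum (fun k => la2 k - 2 * ln k%:R) n| <= (K2 + 2) * n%:R.
  rewrite psumB psumZ; have := h2 n; have := sum_ln_est R n.
  by rewrite !ler_norml; lra.
have := psum_abel_norm v N hE => hab.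
(* The variation of [|r|] is at most that of the monotone function [psi x + x], so it telescopes. *)
pose g n : R := psi (N %/ n) + (N %/ n)%:R.
have gv n m : (0 < n <= m)%N -> `|v n - v m| <= g n - g m.
  move=> /andP[n0 nm]; apply: le_trans (ler_dist_dist _ _) _.
  have hd : (N %/ m <= N %/ n)%N by apply: leq_div2l.
  have : psi (N %/ m) <= psi (N %/ n) by apply: le_psum.
  have : (N %/ m)%:R <= (N %/ n)%:R :> R by rewrite ler_nat.
  by rewrite /g /r ler_norml; lra.
have hg : N%:R * `|v N| + psum (fun n => n%:R * `|v n - v n.+1|) N.-1 <= psum g N.
  rewrite [leRHS]psum_nat_abel; apply: lerD.
    rewrite ler_pM2l// /v normr_id /g /r.
    have := psi_ge0 (N %/ N); have : 0 <= (N %/ N)%:R :> R by [].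
    by rewrite ler_norml; lra.
  by apply: ler_psum => n /andP[n0 _]; rewrite ler_wpM2l// gv// n0/=.
have hg2 : psum g N <= (K + 1) * (N%:R * (1 + ln N%:R)).
  apply: le_trans (_ : psum (fun n => (K + 1) * (N%:R * n%:R^-1)) N <= _); last first.
    by rewrite psumZ psumZ ler_wpM2l//; [lra|rewrite ler_pM2l// harmonic_le].
  apply: ler_psum => n /andP[n0 _].
  apply: le_trans (_ : (K + 1) * (N %/ n)%:R <= _).
    by have := cheb (N %/ n); rewrite /g; lra.
  rewrite ler_wpM2l; [by []|lra|].
  by rewrite ler_pdivlMr ?ltr0n// -natrM ler_nat leq_trunc_div.
have hab2 : `|psum (fun n => (la2 n - 2 * ln n%:R) * v n) N| <=
    (K2 + 2) * ((K + 1) * (N%:R * (1 + ln N%:R))).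
  apply: le_trans hab _; rewrite ler_wpM2l; [by []|lra|].
  exact: le_trans hg hg2.
have E : psum (fun n => (la2 n - 2 * ln n%:R) * v n) N =
  psum (fun n => la2 n * v n) N - 2 * psum (fun n => ln n%:R * v n) N.
  by rewrite -psumZ -psumB; apply: eq_psum => n _; ring.
have hK3 : K3 * (N%:R * (1 + ln N%:R)) <= `|K3| * (N%:R * (1 + ln N%:R)).
  by rewrite ler_wpM2r ?ler_norm// mulr_ge0//; lra.
move: hab2 hK3; rewrite E ler_norml -/(v _); move: (psum _ N) (psum _ N) => X Y.
by move: (N%:R * _) => Z; lra.
Qed.

(** A discrete form of the integral of [r (t) / t ^ 2]; Mertens' estimate keeps it bounded. *)
Definition avg_r N := psum (fun n => r n * (n%:R^-1 - n.+1%:R^-1)) N.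

Lemma avg_r_bound : exists Kb : R, 0 < Kb /\ forall N, `|avg_r N| <= Kb.
Proof.
have K0 : 0 <= K by move: K_ge1; lra.
exists (2 * K + 2); split=> [|N]; first lra.
have := psum_abel La (fun n => n%:R^-1) N.+1.
have := psum_nat_abel (fun n => n%:R^-1 : R) N.+1; rewrite /= -/psi.
rewrite mulfV ?pnatr_eq0// => e1 e2.
have -> : avg_r N = psum (fun n => psi n * (n%:R^-1 - n.+1%:R^-1)) N -
   psum (fun n => n%:R * (n%:R^-1 - n.+1%:R^-1)) N.
  by rewrite -psumB; apply: eq_psum => n _; rewrite /r mulrBl.
have m := @mert N.+1 isT; have h1 := harmonic_ge R N; have h2 := @harmonic_le R N.+1 isT.
have h3 : 0 <= psi N.+1 * N.+1%:R^-1 <= K.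
  rewrite mulr_ge0 ?psi_ge0 ?invr_ge0//= ler_pdivrMr ?ltr0n//; exact: cheb.
have h4 : ln N.+1%:R <= psum (fun n => n%:R^-1) N.+1 :> R.
  by rewrite psumS (le_trans h1)// lerDl invr_ge0.
move: e1 e2 m h2 h3 h4 => /=; rewrite !ler_norml.
move: (psum (fun n => n%:R * _) N) (psum (fun n => psi n * _) N) => X Y.
move: (psum _ N.+1) (psum _ N.+1) (psi N.+1 / _) (ln _) => Z W T l.
lra.
Qed.

(** Otherwise [|r z| > e z] on the whole interval. As [La >= 0], [r] drops by at most 1 at a step,
    so it cannot pass from positive to negative without being small: it changes sign at most once.
    On each of the two stretches [avg_r] is monotone and moves by [e] times a harmonic sum, too much
    for a bounded function. *)
Lemma small_value (e : R) : 0 < e -> exists D y0, (2 <= D)%N /\ forall y, (y0 <= y)%N ->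
  exists2 z, (y < z <= D * y)%N & `|r z| <= e * z%:R.
Proof.
move=> e0; have [Kb [Kb0 hKb]] := avg_r_bound.
pose H N : R := psum (fun n => n.+1%:R^-1) N.
(* Two monotone stretches move [avg_r] by at most [4 Kb] altogether, so [5 Kb] is a contradiction;
   the harmonic sum over the interval is at least [ln D - ln 2 - 1]. *)
have [D [D0 hD]] := ln_large (5 * Kb / e + 1 + ln 2%:R : R).
pose D' := maxn D 2; pose y0 := (Num.truncn (e^-1)).+1.
exists D', y0; split; first by rewrite leq_maxr.
move=> y hy; apply: contrapT => hno.
have {}hno z : (y < z <= D' * y)%N -> e * z%:R < `|r z|.
  by move=> hz; rewrite ltNge; apply/negP => h; apply: hno; exists z.
have y0y : (0 < y)%N by exact: leq_trans hy.
have ey : 1 <= e * y%:R.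
  rewrite -ler_pdivrMl// mulr1; apply: le_trans (_ : y0%:R <= _); last by rewrite ler_nat.
  by rewrite ltW// truncnS_gt// real1.
have step z : (0 < z)%N -> z.+1%:R^-1 * (z%:R)^-1 = z%:R^-1 - z.+1%:R^-1 :> R.
  move=> z0; have : z%:R != 0 :> R by rewrite pnatr_eq0 -lt0n.
  have : z.+1%:R != 0 :> R by rewrite pnatr_eq0.
  rewrite -(natr1 z); move: (z%:R : R) => x hx hx'; field.
  by rewrite hx' hx.
have hs z : (0 < z)%N -> 0 < z%:R^-1 - z.+1%:R^-1 :> R.
  by move=> z0; rewrite -step// mulr_gt0// invr_gt0 ltr0n.
have hs2 z : (0 < z)%N -> e * z%:R * (z%:R^-1 - z.+1%:R^-1) = e * z.+1%:R^-1.
  move=> z0; rewrite -step//; have : z%:R != 0 :> R by rewrite pnatr_eq0 -lt0n.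
  by move: (z.+1%:R^-1) (z%:R : R) => x1 x hx; field.
(* Either [avg_r] has been falling since [y], or it fell until some [j] and has been rising since
   then, with [r] now positive. *)
have inv k : (y + k <= D' * y)%N ->
    (avg_r y - avg_r (y + k)%N >= e * (H (y + k)%N - H y)) \/
    (0 < r (y + k)%N /\ exists2 j, avg_r y - avg_r j >= e * (H j - H y) &
       avg_r (y + k)%N - avg_r j >= e * (H (y + k)%N - H j)).
  elim: k => [|k IH] hk; first by left; rewrite addn0 !subrr mulr0.
  have {}IH := IH (ltac:(lia)).
  rewrite addnS in hk *; set z := (y + k)%N in hk IH *.
  have zy : (y <= z)%N by rewrite leq_addr.
  have z1 := hno z.+1 (introT andP (conj (leq_ltn_trans zy (ltnSn z)) hk)).
  have hz0 := hs z.+1 isT; have hz2 := hs2 z.+1 isT.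
  have HS : H z.+1 = H z + z.+2%:R^-1 by rewrite /H psumS.
  have AS : avg_r z.+1 = avg_r z + r z.+1 * (z.+1%:R^-1 - z.+2%:R^-1) by rewrite /avg_r psumS.
  have pos : 0 < r z.+1 -> e * z.+2%:R^-1 <= r z.+1 * (z.+1%:R^-1 - z.+2%:R^-1).
    by move=> rz; rewrite -hz2 ler_pM2r//; rewrite gtr0_norm// in z1; exact: ltW.
  have neg : r z.+1 <= 0 -> r z.+1 * (z.+1%:R^-1 - z.+2%:R^-1) <= - (e * z.+2%:R^-1).
    move=> rz; rewrite -hz2 -mulNr ler_pM2r//.
    by rewrite ler0_norm// in z1; lra.
  rewrite HS AS; move: (z.+2%:R^-1) (_ - z.+2%:R^-1) pos neg {hz0 hz2 HS AS} => x t pos neg.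
  case: IH => [IH|[rz [j j1 j2]]].
    have [rz|rz] := ltP 0 (r z.+1); last by left; have := neg rz; lra.
    right; split=> //; exists z => //; have := pos rz; lra.
  right; have rz1 : 0 < r z.+1.
    rewrite ltNge; apply/negP => rz1; rewrite ler0_norm// in z1.
    have : r z.+1 = r z + La z.+1 - 1 by rewrite /r /psi psumS -natr1; ring.
    have := La_ge0 z.+1; rewrite -natr1 in z1.
    have : e * y%:R <= e * z%:R by rewrite ler_pM2l// ler_nat.
    by lra.
  by split=> //; exists j => //; have := pos rz1; lra.
have yD : (y <= D' * y)%N by rewrite leq_pmull// leq_max orbC.
have := inv (D' * y - y)%N; rewrite subnKC// => /(_ (leqnn _)).
have hH : ln D'%:R - ln 2%:R <= H (D' * y)%N - H y + 1.
  have HE N : H N = psum (fun n => n%:R^-1) N.+1 - 1.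
    elim: N => [|N IH]; first by rewrite /H psumS !psum0 invr1; ring.
    by rewrite /H psumS -/(H N) IH (psumS _ N.+1); ring.
  rewrite !HE; have h1 := harmonic_ge R (D' * y).+1; have h2 := @harmonic_le R y.+1 isT.
  have h3 : ln D'%:R + ln y%:R <= ln (D' * y).+2%:R :> R.
    rewrite -lnM ?posrE ?ltr0n ?leq_max ?orbT// -natrM ler_ln_nat//; last lia.
    by rewrite muln_gt0 y0y leq_max orbT.
  have h4 : ln y.+1%:R <= ln 2%:R + ln y%:R :> R.
    by rewrite -lnM ?posrE ?ltr0n// -natrM ler_ln_nat//; lia.
  by move: (psum _ _) (psum _ _) h1 h2 => X Y; lra.
have hDD : 5 * Kb / e + 1 + ln 2%:R <= ln D'%:R :> R.
  by apply: le_trans (hD _ (leqnn _)) _; rewrite ler_ln_nat// leq_maxl.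
have {hH hDD}hH : 5 * Kb <= e * (H (D' * y)%N - H y).
  rewrite -ler_pdivrMl// mulrC; lra.
have := hKb (D' * y)%N; have := hKb y; rewrite !ler_norml => b1 b2.
case=> [h|[_ [j h1 h2]]]; first lra.
by have := hKb j; rewrite ler_norml; lra.
Qed.

Lemma la2_ge n : La n * ln n%:R <= la2 n.
Proof. by rewrite lerDl sumr_ge0// => k _; rewrite mulr_ge0. Qed.

(** Since [La ln <= la2], the estimate for [la2] lets [psi] grow between [z] and [m] at most by
    [2 (m - z)] plus a small multiple of [z]. A small value of [r] therefore stays small on a whole
    interval of fixed ratio. *)
Lemma near_small (al : R) : 0 < al <= 1 -> exists y0, (0 < y0)%N /\ forall z m,
  (y0 <= z)%N -> `|r z| <= al / 8 * z%:R -> (z <= m)%N -> m%:R <= (1 + al / 32) * z%:R ->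
  `|r m| <= al / 2 * m%:R.
Proof.
move=> /andP[a0 a1]; have [K2 [K20 h2]] := la2_est.
have [y0 [y00 hy0]] := ln_large (32 * (4 + 3 * K2) / al + 1 : R).
exists y0; split=> // z m hz rz zm mz.
have z0 : (0 < z)%N by exact: leq_trans hz.
have z0' : 0 < z%:R :> R by rewrite ltr0n.
have zm' : z%:R <= m%:R :> R by rewrite ler_nat.
have lz := hy0 z hz; have m0' : 0 < m%:R :> R by lra.
have q0 : 0 <= 32 * (4 + 3 * K2) / al by rewrite divr_ge0//; lra.
have A : ln z%:R * (psi m - psi z) <= psum la2 m - psum la2 z.
  rewrite -(subnKC zm); elim: (m - z)%N => [|k IH]; first by rewrite addn0 !subrr mulr0.
  rewrite addnS /psi !psumS -/psi.
  have : ln z%:R <= ln (z + k).+1%:R :> R by apply: ler_ln_nat => //; exact: leqW (leq_addr _ _).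
  move=> hl; have := ler_wpM2l (La_ge0 (z + k).+1) hl; have := la2_ge (z + k).+1.
  by move: IH; rewrite /psi; lra.
have lmz : ln m%:R - ln z%:R <= (m%:R - z%:R) / z%:R :> R.
  rewrite -ln_div ?posrE//.
  have -> : m%:R / z%:R = 1 + (m%:R - z%:R) / z%:R :> R by field; rewrite gt_eqF.
  apply: le_ln1Dx; apply: (lt_le_trans (ltrN10 R)); rewrite divr_ge0//; lra.
have lzm : 0 <= ln m%:R - ln z%:R :> R by rewrite subr_ge0 ler_ln_nat.
have := h2 m; have := h2 z; rewrite !ler_norml.
rewrite ler_pdivlMr// in lmz.
move: (ln m%:R) (ln z%:R) lz lmz lzm A => lm l lz lmz lzm A B1 B2.
set d := m%:R - z%:R in lmz.
have d0 : 0 <= d by rewrite /d; lra.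
have dz : d <= al / 32 * z%:R by rewrite /d; lra.
have dz1 : d <= z%:R by have : al / 32 * z%:R <= 1 * z%:R by [rewrite ler_pM2r//; lra]; lra.
have hd : d * (lm - l) <= d.
  rewrite -[leRHS]mulr1 ler_wpM2l//.
  by rewrite -(ler_pM2r z0') mul1r; lra.
have hK : (4 + 3 * K2) * z%:R <= al / 32 * z%:R * l.
  have : 32 * (4 + 3 * K2) / al <= l by lra.
  rewrite ler_pdivrMr// => h.
  have := ler_wpM2r (ltW z0') h; lra.
have hm : m%:R = z%:R + d by rewrite /d; ring.
have l0 : 0 < l by lra.
have D : l * (psi m - psi z) <= l * (2 * d + al / 32 * z%:R).
  have : K2 * d <= K2 * z%:R by rewrite ler_wpM2l.
  move: A B1 B2; rewrite hm; move: (psum la2 _) (psum la2 _) => X Y; lra.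
rewrite ler_pM2l// in D.
have pm : psi z <= psi m by apply: le_psum.
move: rz; rewrite /r !ler_norml; rewrite hm.
have := mulr_ge0 (ltW a0) (ltW z0'); have := mulr_ge0 (ltW a0) d0.
lra.
Qed.

Definition good (al : R) N n := `|r (N %/ n)| <= al / 2 * (N%:R / n%:R).

(** Take [y = N / E ^ (i + 1)] and a small value at some [z] in [(y, D y]]. The [n] with [N / n]
    between [z] and [(1 + al / 32) z] are good, lie in the block, and carry a harmonic mass that
    does not depend on [i]. *)
Lemma good_block (al : R) : 0 < al <= 1 -> exists E Y, (2 <= E)%N /\ (0 < Y)%N /\
  forall N i, (E ^ i.+1 * Y <= N)%N ->
  psum (fun n => if good al N n then n%:R^-1 else 0) (E ^ i) + al / 128 <=
  psum (fun n => if good al N n then n%:R^-1 else 0) (E ^ i.+1).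
Proof.
move=> hal; have /andP[a0 a1] := hal.
have [y1 [y10 hy1]] := near_small hal.
have [D [y2 [D2 hy2]]] := @small_value (al / 8) ltac:(lra).
(* The summand [2 D] keeps the good interval above [E ^ i]; the other makes [N / z] at least
   [4 / ka], so that rounding its ends costs less than half of its length. *)
pose E := (2 * D + (Num.truncn (128 * D%:R / al)).+1)%N.
exists E, (maxn y1 y2); split.
  by rewrite /E (leq_trans D2)// (leq_trans (@leq_pmull D 2 isT))// leq_addr.
split; first by rewrite leq_max y10.
move=> N i hN; set Gs := psum _.
pose y := (N %/ E ^ i.+1)%N.
have E0 : (0 < E)%N by rewrite /E addn_gt0 orbT.
have Ei0 k : (0 < E ^ k)%N by rewrite expn_gt0 E0.
have hy : (maxn y1 y2 <= y)%N by rewrite leq_divRL// mulnC.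
have y0 : (0 < y)%N by rewrite (leq_trans _ hy)// leq_max y10.
have [z /andP[yz zD] rz] := hy2 y (leq_trans (leq_maxr _ _) hy).
have z1 : (y1 <= z)%N by rewrite (leq_trans _ (ltnW yz))// (leq_trans _ hy)// leq_maxl.
have z0 : (0 < z)%N by exact: leq_ltn_trans yz.
have z0' : 0 < z%:R :> R by rewrite ltr0n.
pose ka := al / 32.
pose x1 : R := N%:R / ((1 + ka) * z%:R); pose x2 : R := N%:R / z%:R.
have ka0 : 0 < ka by rewrite /ka; lra.
have ka1 : ka <= 1 by rewrite /ka; lra.
have kz0 : 0 < (1 + ka) * z%:R by rewrite mulr_gt0//; lra.
pose t := Num.truncn x1; pose q := (N %/ z)%N.
have x10 : 0 <= x1 by rewrite divr_ge0// ltW.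
have /andP[t1 t2] := truncn_itv x10; rewrite -/t in t1 t2.
have NE : (y * E ^ i.+1 <= N)%N by rewrite leq_trunc_div.
have zE : (z * E ^ i.+1 <= D * N)%N.
  apply: leq_trans (_ : (D * y) * E ^ i.+1 <= _)%N; first by rewrite leq_mul2r zD orbT.
  by rewrite -mulnA leq_mul2l NE orbT.
have zEr : z%:R * (E ^ i.+1)%:R <= D%:R * N%:R :> R by rewrite -!natrM ler_nat.
have D0 : 0 < D%:R :> R by rewrite ltr0n (leq_trans _ D2).
have x2E : (E ^ i.+1)%:R / D%:R <= x2.
  by rewrite /x2 ler_pdivlMr// mulrAC ler_pdivrMr// mulrC (mulrC N%:R).
have tE : (E ^ i <= t)%N.
  rewrite truncn_ge_nat//.
  rewrite /x1 ler_pdivlMr//; apply: le_trans (_ : (E ^ i)%:R * (2 * z%:R) <= _).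
    by rewrite ler_wpM2l// ler_pM2r//; lra.
  rewrite -!natrM ler_nat.
  have h2D : (2 * D <= E)%N by rewrite /E leq_addr.
  rewrite -(@leq_pmul2l D); last by rewrite (leq_trans _ D2).
  apply: leq_trans zE; rewrite expnS.
  have -> : (D * (E ^ i * (2 * z)) = z * (2 * D * E ^ i))%N by ring.
  by rewrite leq_mul2l leq_mul2r h2D !orbT.
have qE : (q <= E ^ i.+1)%N.
  rewrite -ltnS ltn_divLR//; apply: leq_trans (ltn_ceil N (Ei0 i.+1)) _.
  rewrite -/y mulnC; apply: leq_trans (_ : E ^ i.+1 * z <= _)%N; first by rewrite leq_mul2l yz orbT.
  by rewrite leq_mul2r leqnSn orbT.
have x2big : 4 / ka <= x2.
  apply: le_trans x2E; rewrite ler_pdivlMr//.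
  apply: le_trans (_ : E%:R <= _); last by rewrite ler_nat expnS leq_pmulr.
  have -> : 4 / ka * D%:R = 128 * D%:R / al by rewrite /ka; field; rewrite gt_eqF.
  apply: le_trans (_ : (Num.truncn (128 * D%:R / al)).+1%:R <= _); last by rewrite ler_nat leq_addl.
  by rewrite ltW// truncnS_gt// real1.
have x20 : 0 < x2 by rewrite (lt_le_trans _ x2big)// divr_gt0.
have [q1 q2] : q%:R <= x2 /\ x2 <= q%:R + 1.
  split; first by rewrite /x2 ler_pdivlMr// -natrM ler_nat leq_trunc_div.
  by rewrite /x2 ler_pdivrMr// natr1 -natrM ler_nat ltnW// ltn_ceil.
have x12 : x2 - x1 = x2 * (ka / (1 + ka)).
  by rewrite /x1 /x2; field; rewrite !gt_eqF//; lra.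
have kk : ka / 2 <= ka / (1 + ka) by rewrite ler_pM2l// lef_pV2 ?posrE; lra.
have x12' : x2 * (ka / 4) + 1 <= x2 - x1.
  have : x2 * (ka / 2) <= x2 - x1 by rewrite x12 ler_pM2l.
  have : 1 <= x2 * (ka / 4).
    have := ler_wpM2r (ltW ka0) x2big; rewrite mulfVK ?gt_eqF//; lra.
  lra.
have tq : (t <= q)%N.
  rewrite -ltnS -(ltr_nat R) -natr1.
  have : 0 < x2 * (ka / 4) by rewrite mulr_gt0//; lra.
  lra.
have goodn n : (t < n <= q)%N -> good al N n.
  move=> /andP[tn nq].
  have n0 : (0 < n)%N by exact: leq_ltn_trans tn.
  have n0' : 0 < n%:R :> R by rewrite ltr0n.
  have fl : (N %/ n)%:R <= N%:R / n%:R :> R by rewrite ler_pdivlMr// -natrM ler_nat leq_trunc_div.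
  rewrite /good; apply: le_trans (_ : al / 2 * (N %/ n)%:R <= _); last by rewrite ler_pM2l//; lra.
  apply: (hy1 z) => //.
    rewrite leq_divRL// mulnC -leq_divRL//.
  apply: le_trans fl _; rewrite ler_pdivrMr// mulrC -ler_pdivrMr// -/x1.
  by apply: ltW; apply: lt_le_trans t2 _; rewrite ler_nat.
have Gs_le a b : (a <= b)%N -> Gs a <= Gs b.
  by apply: le_psum => n; case: ifP => // _; rewrite invr_ge0.
have q0 : 0 < q%:R :> R.
  have : 0 < x2 * (ka / 4) by rewrite mulr_gt0//; lra.
  lra.
have inc k : (t + k <= q)%N -> Gs t + k%:R / q%:R <= Gs (t + k)%N.
  elim: k => [|k IH] hk; first by rewrite addn0 mul0r addr0.
  rewrite addnS in hk *; rewrite /Gs psumS -/Gs goodn; last by rewrite ltnS leq_addr.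
  rewrite -natr1 mulrDl mul1r addrA; apply: lerD; first by apply: IH; exact: ltnW.
  by rewrite lef_pV2 ?posrE// ler_nat.
have := inc (q - t)%N; rewrite subnKC// => /(_ (leqnn _)) hinc.
apply: le_trans (Gs_le _ _ qE); apply: le_trans hinc; apply: lerD; first exact: Gs_le.
rewrite ler_pdivlMr// natrB//.
have : q%:R * (ka / 4) <= x2 * (ka / 4) by rewrite ler_pM2r//; lra.
rewrite /ka in x12' *; lra.
Qed.

(** In the block of index [i] the weight [ln n] is at least [i ln E], so the blocks add up to a
    multiple of the square of their number, that is of [ln N ^ 2]. *)
Lemma good_sum (al : R) : 0 < al <= 1 -> exists (c : R) (n0 : nat), 0 < c /\ (0 < n0)%N /\
  forall N, (n0 <= N)%N ->
  c * ln N%:R ^+ 2 <= psum (fun n => if good al N n then ln n%:R / n%:R else 0 : R) N.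
Proof.
move=> hal; have /andP[a0 a1] := hal; have [E [Y [E2 [Y0 hE]]]] := good_block hal.
pose L := ln E%:R : R.
have L0 : 0 < L by rewrite /L ln_gt0// ltr1n.
have [n0 [n00 hn0]] := ln_large (2 * (2 * L + ln Y%:R)).
exists (al / 128 / 8 / L), (maxn n0 Y); split.
  by rewrite divr_gt0//; lra.
split; first by rewrite leq_max n00.
move=> N hN; have N0 : (0 < N)%N by rewrite (leq_trans n00)// (leq_trans _ hN)// leq_maxl.
have {hn0}hl := hn0 N (leq_trans (leq_maxl _ _) hN).
have YN : (Y <= N)%N by exact: leq_trans (leq_maxr _ _) hN.
set W := psum _.
have step I : (E ^ I * Y <= N)%N -> al / 128 * L * (I%:R * (I%:R - 1) / 2) <= W (E ^ I)%N.
  elim: I => [|I IH] hI.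
    rewrite mul0r mul0r mulr0; apply: psum_ge0 => n; case: ifP => // _.
    by rewrite divr_ge0// ln_nat_ge0.
  have EI : (E ^ I <= E ^ I.+1)%N by rewrite leq_exp2l.
  have {}IH : al / 128 * L * (I%:R * (I%:R - 1) / 2) <= W (E ^ I)%N.
    by apply: IH; apply: leq_trans hI; rewrite leq_mul2r EI orbT.
  have hb := hE N I hI.
  pose Gs := psum (fun n => if good al N n then n%:R^-1 else 0 : R).
  have inc k : W (E ^ I)%N + I%:R * L * (Gs (E ^ I + k)%N - Gs (E ^ I)%N) <= W (E ^ I + k)%N.
    elim: k => [|k IH2]; first by rewrite addn0 subrr mulr0 addr0.
    rewrite addnS /W /Gs !psumS -/W -/Gs; set n := (E ^ I + k)%N in IH2 *.
    have hln : I%:R * L <= ln n.+1%:R :> R.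
      rewrite /L mulr_natl -lnXn ?ltr0n// 1?ltnW// -natrX.
      by apply: ler_ln_nat; [rewrite expn_gt0 ltnW|exact: leqW (leq_addr _ _)].
    case: ifP => _; last by lra.
    have z0 : 0 <= n.+1%:R^-1 :> R by rewrite invr_ge0.
    have := ler_wpM2r z0 hln; move: (n.+1%:R^-1) => z; move: IH2; lra.
  have := inc (E ^ I.+1 - E ^ I)%N; rewrite subnKC//.
  have IL : 0 <= I%:R * L by rewrite mulr_ge0// ltW.
  have : I%:R * L * (al / 128) <= I%:R * L * (Gs (E ^ I.+1)%N - Gs (E ^ I)%N).
    by rewrite ler_wpM2l// /Gs; lra.
  rewrite -(natr1 I) => h1 h2; move: IH h1 h2; lra.
pose I := trunc_log E (N %/ Y).
have NY : (0 < N %/ Y)%N by rewrite divn_gt0.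
have /andP[I1 I2] := trunc_log_bounds E2 NY; rewrite -/I in I1 I2.
have hI : (E ^ I * Y <= N)%N by rewrite -leq_divRL.
have := step I hI.
have EN : (E ^ I <= N)%N by exact: leq_trans (leq_pmulr _ Y0) hI.
have WN : W (E ^ I)%N <= W N.
  by apply: le_psum => // n; case: ifP => // _; rewrite divr_ge0// ln_nat_ge0.
move=> h; apply: le_trans WN; apply: le_trans h.
have hlN : ln N%:R <= (I%:R + 1) * L + ln Y%:R.
  rewrite natr1 /L mulr_natl -lnXn ?ltr0n// 1?ltnW// -natrX -lnM ?posrE ?ltr0n ?expn_gt0 ?(ltnW E2)//.
  by rewrite -natrM ler_ln_nat// ltnW// -ltn_divLR.
move: (I%:R : R) (ln N%:R) (ln Y%:R) (ln_nat_ge0 R N) (ln_nat_ge0 R Y) hl hlN {step W hE} => i l y l0 y0 hl hlN.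
set p := i * L.
have p1 : l / 2 <= p by rewrite /p; lra.
have p2 : l / 2 <= p - L by rewrite /p; lra.
have -> : al / 128 * L * (i * (i - 1) / 2) = al / 128 / 8 / L * (4 * (p * (p - L))).
  by rewrite /p; field; rewrite gt_eqF.
rewrite ler_pM2l; last by rewrite divr_gt0//; lra.
have : l / 2 * (l / 2) <= p * (p - L) by apply: ler_pM => //; lra.
by rewrite expr2; lra.
Qed.

(** In [selberg_ln] the bound [x] reproduces itself. For good [n] it can be replaced by [al / 2], a
    gain of at least [al / 2] as [al <= x], and by [good_sum] these [n] carry a fixed proportion of
    the sum. The gain does not depend on [x], so finitely many rounds suffice. *)
Lemma improve (al : R) : 0 < al <= 1 -> exists2 th : R, 0 < th & forall x : R, al <= x ->
  (exists n0, forall n, (n0 <= n)%N -> `|r n| <= x * n%:R) ->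
  exists n0, forall n, (n0 <= n)%N -> `|r n| <= (x - th) * n%:R.
Proof.
move=> hal; have /andP[a0 a1] := hal; have [c [m0 [c0 [m00 hc]]]] := good_sum hal.
have [K4 [K40 h4]] := selberg_ln.
(* The total gain is [al * c]; half of it pays for the terms of order [N ln N]. *)
exists (al * c / 2); first by rewrite divr_gt0// mulr_gt0.
move=> x ax [n0 hn0].
have K0 : 0 <= K by move: K_ge1; lra.
pose C := 2 * x + 2 * (K + 1) * n0%:R + K4.
have C0 : 0 <= C.
  have : 0 <= (K + 1) * n0%:R by rewrite mulr_ge0//; lra.
  by rewrite /C; lra.
have [n1 [n10 hn1]] := ln_large (2 * C / (al * c / 2) + 1 : R).
exists (maxn m0 n1) => N hN.
have N0 : (0 < N)%N by rewrite (leq_trans m00)// (leq_trans _ hN)// leq_maxl.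
have N0' : 0 < N%:R :> R by rewrite ltr0n.
have {}hn1 := hn1 N (leq_trans (leq_maxr _ _) hN).
have {}hc := hc N (leq_trans (leq_maxl _ _) hN).
have {}h4 := h4 N N0.
have lN := ln_nat_ge0 R N.
have hsum : psum (fun n => ln n%:R * `|r (N %/ n)|) N <=
  psum (fun n => x * N%:R * (ln n%:R / n%:R) + (K + 1) * n0%:R * ln N%:R
    - al / 2 * N%:R * (if good al N n then ln n%:R / n%:R else 0)) N.
  apply: ler_psum => n /andP[n0' nN].
  have ln0 := ln_nat_ge0 R n.
  have n0'' : 0 < n%:R :> R by rewrite ltr0n.
  have q0 : 0 <= ln n%:R / n%:R :> R by rewrite divr_ge0.
  have lnN : ln n%:R <= ln N%:R :> R by apply: ler_ln_nat.
  have e0 : 0 <= (K + 1) * n0%:R by rewrite mulr_ge0//; lra.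
  have e1 : 0 <= (K + 1) * n0%:R * ln N%:R by rewrite mulr_ge0.
  have fl : (N %/ n)%:R <= N%:R / n%:R :> R by rewrite ler_pdivlMr// -natrM ler_nat leq_trunc_div.
  case: ifP => [hg|_].
    have hxa : 0 <= (x - al) * (N%:R * (ln n%:R / n%:R)).
      by apply: mulr_ge0; [lra|rewrite mulr_ge0].
    have := ler_wpM2l ln0 hg; rewrite /good; lra.
  rewrite mulr0 subr0.
  have [h|h] := leqP n0 (N %/ n).
    have := hn0 _ h => h'.
    have : x * (N %/ n)%:R <= x * (N%:R / n%:R) by rewrite ler_wpM2l//; lra.
    move=> h''; have := ler_wpM2l ln0 (le_trans h' h''); lra.
  have h1 : `|r (N %/ n)| <= (K + 1) * n0%:R.
    apply: le_trans (r_le _) _; rewrite ler_wpM2l; [by []|lra|].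
    by rewrite ler_nat ltnW.
  have : ln n%:R * `|r (N %/ n)| <= ln N%:R * ((K + 1) * n0%:R) by apply: ler_pM.
  have : 0 <= x * N%:R * (ln n%:R / n%:R) by rewrite mulr_ge0// mulr_ge0//; lra.
  lra.
rewrite psumB psumD !psumZ psum_const in hsum.
have hld := sum_ln_div_le R N0.
have hx0 : 0 <= x * N%:R by rewrite mulr_ge0//; lra.
have hld' := ler_wpM2l hx0 hld.
have ha0 : 0 <= al / 2 * N%:R by rewrite mulr_ge0//; lra.
have hc' := ler_wpM2l ha0 hc.
have q0 : 0 <= 2 * C / (al * c / 2) by rewrite divr_ge0//; [lra|rewrite divr_ge0// mulr_ge0// ltW].
have l1 : 1 <= ln N%:R :> R by lra.
have hC : C * (1 + ln N%:R) <= al * c / 2 * ln N%:R ^+ 2.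
  have : 2 * C / (al * c / 2) <= ln N%:R by lra.
  rewrite ler_pdivrMr ?divr_gt0 ?mulr_gt0// => h.
  have := ler_wpM2r lN h; have : C * 1 <= C * ln N%:R by rewrite ler_wpM2l.
  by rewrite expr2; lra.
have hCN := ler_wpM2r (ltW N0') hC.
have l2 : 0 < ln N%:R ^+ 2 :> R by rewrite exprn_gt0//; lra.
rewrite -(ler_pM2r l2).
have nn : 0 <= (K + 1) * n0%:R * N%:R.
  by rewrite !mulr_ge0//; lra.
move: hsum hld' hc' h4 hCN; rewrite /C.
move: (psum _ N) (psum _ N) (psum _ N) (ln N%:R ^+ 2) => X Y Z L2.
move: (ln N%:R) (`|r N|) => l rr; lra.
Qed.

Theorem pnt_endgame (e : R) : 0 < e ->
  exists n0, forall n, (n0 <= n)%N -> `|psi n - n%:R| <= e * n%:R.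
Proof.
move=> e0; pose al := Num.min e 1.
have al0 : 0 < al by rewrite lt_min e0 ltr01.
have hal : 0 < al <= 1 by rewrite al0 ge_min lexx orbT.
have ale : al <= e by rewrite ge_min lexx.
pose P x := exists n0, forall n, (n0 <= n)%N -> `|r n| <= x * n%:R.
have Pm x y : x <= y -> P x -> P y.
  move=> xy [n0 h]; exists n0 => n hn; apply: le_trans (h n hn) _.
  by rewrite ler_wpM2r.
have [th th0 himp] := improve hal.
have H k : P e \/ P (K + 1 - k%:R * th).
  elim: k => [|k [IH|IH]]; [by right; exists 0%N => n _; rewrite mul0r subr0; exact: r_le|by left|].
  have [h|h] := leP al (K + 1 - k%:R * th); last by left; apply: Pm IH; lra.
  right; have := himp _ h IH; rewrite -natr1.
  by rewrite mulrDl mul1r opprD addrA.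
have [//|] := H (Num.truncn ((K + 1) / th)).+1.
apply: Pm; have : (K + 1) / th <= (Num.truncn ((K + 1) / th)).+1%:R.
  by rewrite ltW// truncnS_gt// real1.
by rewrite ler_pdivrMr//; lra.
Qed.

End Endgame.

(** * Euler products *)

Section EulerOperators.
Variables (R : realType) (K : nat).
Implicit Types (w : nat -> R) (S : seq nat) (q n d : nat).

(* Operators attached to the (truncated) Euler product over [S] and its inverse. *)
Fixpoint opA S w n : R :=
  if S is q :: S' then \sum_(k < K) opA S' (fun m => w (q ^ k * m)%N) n else w n.

Fixpoint opB S w n : R :=
  if S is q :: S' then opB S' w n - opB S' (fun m => w (q * m)%N) n else w n.

Definition supp N w := forall n, (n == 0)%N || (N < n)%N -> w n = 0.

Lemma supp_dil N w d : supp N w -> supp N (fun m => w (d * m)%N).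
Proof.
move=> h n hn; apply: h; case: d => [|d]; first by rewrite mul0n.
by case/orP: hn => [/eqP->|hn]; [rewrite muln0|apply/orP; right; nia].
Qed.

Lemma eq_opA S w v n : w =1 v -> opA S w n = opA S v n.
Proof.
elim: S w v => [|q S IH] w v h //=.
by apply: eq_bigr => k _; apply: IH => m; rewrite h.
Qed.

Lemma eq_opB S w v n : w =1 v -> opB S w n = opB S v n.
Proof.
elim: S w v => [|q S IH] w v h //=.
by congr (_ - _); apply: IH => m; rewrite h.
Qed.

Lemma opA0 S n : opA S (fun=> 0) n = 0.
Proof. by elim: S => //= q S IH; rewrite big1. Qed.

Lemma opAD S w v n : opA S (fun m => w m + v m) n = opA S w n + opA S v n.
Proof.
elim: S w v => [|q S IH] w v //=.
by rewrite -big_split; apply: eq_bigr => k _; rewrite IH.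
Qed.

Lemma opAZ S c w n : opA S (fun m => c * w m) n = c * opA S w n.
Proof.
elim: S w => [|q S IH] w //=.
by rewrite mulr_sumr; apply: eq_bigr => k _; rewrite IH.
Qed.

Lemma opBD S w v n : opB S (fun m => w m + v m) n = opB S w n + opB S v n.
Proof.
elim: S w v => [|q S IH] w v //=.
by rewrite !IH; ring.
Qed.

Lemma opBN S w n : opB S (fun m => - w m) n = - opB S w n.
Proof. by elim: S w => [|q S IH] w //=; rewrite !IH; ring. Qed.

Lemma opA_dil S w d n : opA S (fun m => w (d * m)%N) n = opA S w (d * n)%N.
Proof.
elim: S w => [|q S IH] w //=; apply: eq_bigr => k _.
by rewrite -(IH (fun m => w (q ^ k * m)%N)); apply: eq_opA => m; rewrite mulnCA.
Qed.

Lemma opA_ge0 S w n : (forall m, 0 <= w m) -> 0 <= opA S w n.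
Proof.
elim: S w => [|q S IH] w h //=.
by apply: sumr_ge0 => k _; apply: IH.
Qed.

Lemma opB_le S w n : (1 < K)%N -> `|opB S w n| <= opA S (fun m => `|w m|) n.
Proof.
move=> K1; elim: S w => [|q S IH] w //=.
apply: le_trans (ler_normB _ _) _.
have K0 : (0 < K)%N by exact: ltnW.
rewrite (bigD1 (Ordinal K0))//= (bigD1 (Ordinal K1))//= addrA expn0 expn1.
rewrite -[leLHS]addr0; apply: lerD; last by apply: sumr_ge0 => k _; apply: opA_ge0.
apply: lerD; last exact: IH.
by apply: le_trans (IH _) _; rewrite le_eqVlt; apply/orP; left; apply/eqP; apply: eq_opA => m; rewrite mul1n.
Qed.

(** If [T] is dilation by [q], the factor at [q] is [1 - T] applied to a truncated geometric series
    in [T]. The sum telescopes, and its top term vanishes because [q ^ K > N]. *)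
Lemma opB_opA S w N : (0 < K)%N -> all (leq 2) S -> (N < 2 ^ K)%N -> supp N w -> opB S (opA S w) 1 = w 1%N.
Proof.
move=> K0 + NK; elim: S w => [|q S IH] w //= /andP[q2 hS] hw.
rewrite -opBN -opBD -[RHS](IH w)//; apply: eq_opB => n.
have E k : opA S (fun m => w (q ^ k.+1 * m)%N) n = opA S (fun m => w (q ^ k * m)%N) (q * n)%N.
  by rewrite -opA_dil; apply: eq_opA => m; rewrite expnSr mulnA.
under [X in _ - X]eq_bigr => k _ do rewrite -E.
pose F k := opA S (fun m => w (q ^ k * m)%N) n.
rewrite -[LHS]opprB -sumrB -(big_mkord xpredT (fun k => F k.+1 - F k)) telescope_sumr// opprB.
have -> : F K = 0.
  rewrite -(opA0 S n); apply: eq_opA => m; apply: hw; case: m => [|m]; first by rewrite muln0.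
  apply/orP; right; apply: leq_trans NK _; apply: leq_trans (leq_pmulr _ _) => //.
  by rewrite leq_exp2r.
by rewrite subr0; apply: eq_opA => m; rewrite expn0 mul1n.
Qed.

(** The logarithmic derivative of the Euler product: [ln (q ^ j * m)] is [j ln q + ln m], and the
    sum of [j F j] equals the sum over [k >= 1] of the tails of [F] from [k] on. *)
Lemma opA_ln S w N : (0 < K)%N -> all (leq 2) S -> (N < 2 ^ K)%N -> supp N w ->
  opA S (fun n => ln n%:R * w n) 1 =
  \sum_(q <- S) \sum_(1 <= k < K) ln q%:R * opA S (fun m => w (q ^ k * m)%N) 1.
Proof.
move=> K0 + NK; elim: S w => [|q S IH] w /= => [_ hw|/andP[q2 hS] hw].
  by rewrite big_nil ln1 mul0r.
rewrite big_cons.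
have q0 : (0 < q)%N by exact: ltnW.
pose F j := opA S (fun m => w (q ^ j * m)%N) 1.
have F0 j : (K <= j)%N -> F j = 0.
  move=> hj; rewrite /F -[RHS](opA0 S 1); apply: eq_opA => m; apply: hw.
  case: m => [|m]; first by rewrite muln0.
  apply/orP; right; apply: leq_trans NK _; apply: leq_trans (leq_pmulr _ _) => //.
  by apply: leq_trans (_ : 2 ^ j <= _)%N; [rewrite leq_exp2l|rewrite leq_exp2r// (leq_trans K0)].
have E j : opA S (fun m => ln (q ^ j * m)%:R * w (q ^ j * m)%N) 1 =
    j%:R * ln q%:R * F j + \sum_(q' <- S) \sum_(1 <= k < K)
      ln q'%:R * opA S (fun m => w (q ^ j * (q' ^ k * m))%N) 1.
  rewrite -(IH (fun m => w (q ^ j * m)%N))//; last exact: supp_dil.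
  rewrite /F -opAZ -opAD; apply: eq_opA => -[|m]; first by rewrite muln0 hw// !mulr0 addr0.
  rewrite natrM lnM ?posrE ?ltr0n ?expn_gt0 ?q0//.
  by rewrite natrX lnXn ?ltr0n// -mulr_natl; ring.
under eq_bigr => j _ do rewrite E.
rewrite big_split /=; congr (_ + _); last first.
  rewrite exchange_big /=; apply: eq_bigr => q' _; rewrite exchange_big /=.
  apply: eq_bigr => k _; rewrite mulr_sumr; apply: eq_bigr => j _.
  by congr (_ * _); apply: eq_opA => m; congr w; ring.
have H2 k : \sum_(i < K) opA S (fun m => w (q ^ k * (q ^ i * m))%N) 1 = \sum_(k <= j < K) F j.
  rewrite -(big_mkord xpredT (fun i => opA S (fun m => w (q ^ k * (q ^ i * m))%N) 1)).
  have [hk|hk] := leqP k K; last first.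
    rewrite [RHS]big_geq ?(ltnW hk)// big_nat big1// => i _.
    rewrite -(F0 (k + i)%N) ?(leq_trans (ltnW hk)) ?leq_addr//.
    by apply: eq_opA => m; rewrite mulnA expnD.
  rewrite (@big_cat_nat _ _ _ (K - k))//= ?leq_subr//.
  rewrite [X in _ + X]big_nat [X in _ + X]big1 ?addr0; last first.
    move=> i /andP[hi _]; rewrite -(F0 (k + i)%N); last by rewrite -leq_subLR.
    by apply: eq_opA => m; rewrite mulnA expnD.
  rewrite -[in RHS](add0n k) -[in X in \sum_(_ <= _ < X) _](subnK hk) big_addn addnK.
  by apply: eq_bigr => i _; apply: eq_opA => m; rewrite addnC expnD mulnA.
under [RHS]eq_bigr => k _ do rewrite H2.
rewrite -mulr_sumr.
have -> : \sum_(i < K) i%:R * ln q%:R * F i = ln q%:R * \sum_(0 <= i < K) i%:R * F i.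
  rewrite mulr_sumr big_mkord; apply: eq_bigr => i _; ring.
congr (_ * _); elim: (K) => [|k IHk]; first by rewrite !big_geq.
rewrite big_nat_recr//= IHk; case: k {IHk} => [|k]; first by rewrite !big_geq// mul0r add0r.
rewrite [RHS]big_nat_recr//= [X in _ = _ + X]big_nat1.
rewrite [in RHS](eq_big_nat _ _ (F2 := fun i => \sum_(i <= j < k.+1) F j + F k.+1)); last first.
  by move=> i /andP[i1 i2]; rewrite big_nat_recr//= ltnW.
rewrite big_split /= sumr_const_nat subn1 /= -addrA; congr (_ + _).
by rewrite -natr1 mulrDl mul1r mulr_natl.
Qed.

End EulerOperators.

(** * From the Euler product to the function theta *)

Section PrimeCounting.
Variables (R : realType) (a c : nat -> nat) (rho C0 s : R).
Definition norm_list N := flatten [seq nseq (c q) q | q <- iota 2 N.-1].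
Hypothesis c_le_a : forall q, (c q <= a q)%N.
Hypothesis euler : forall N w, supp N w ->
  psum (fun n => (a n)%:R * w n) N = opA N.+1 (norm_list N) w 1 :> R.
Hypothesis rho_gt0 : 0 < rho.
Hypothesis s01 : 0 < s < 1.
Hypothesis A_est : forall n, `|psum (fun k => (a k)%:R) n - rho * n%:R| <= C0 * n%:R `^ s.

(** The von Mangoldt function of the ideals, grouped by norm. Here [q] runs over the norms of
    primes, which may be proper powers, so that several [q] can contribute to one [n]. *)
Definition Lam n : R := \sum_(2 <= q < n.+1) \sum_(1 <= k < n.+1 | (q ^ k == n)%N) (c q)%:R * ln q%:R.

Definition trunc_fun N (w : nat -> R) n := if (0 < n <= N)%N then w n else 0.

Lemma trunc_supp N w : supp N (trunc_fun N w).
Proof. by move=> n; rewrite /trunc_fun; case: ifP => //; case/andP=> n0 nN /orP[]; lia. Qed.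

Definition invB N (w : nat -> R) := opB (norm_list N) (trunc_fun N w) 1.

Lemma norm_list_ge2 N : all (leq 2) (norm_list N).
Proof.
apply/allP => x /flatten_mapP[q]; rewrite mem_iota => /andP[q2 _].
by rewrite mem_nseq => /andP[_ /eqP->].
Qed.

Lemma sum_norm_list N (F : nat -> R) :
  \sum_(q <- norm_list N) F q = \sum_(2 <= q < N.+1) (c q)%:R * F q.
Proof.
rewrite /norm_list big_flatten big_map /index_iota subSS.
have -> : (N - 1 = N.-1)%N by rewrite subn1.
apply: eq_bigr => q _; rewrite big_nseq.
elim: (c q) => [|n IH]; first by rewrite mul0r.
by rewrite iterS IH -natr1 mulrDl mul1r addrC.
Qed.

Lemma Lam_ge0 n : 0 <= Lam n.
Proof.
apply: sumr_ge0 => q _; apply: sumr_ge0 => k _; by rewrite mulr_ge0// ln_nat_ge0.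
Qed.

Lemma ltn_expS2 N : (N < 2 ^ N.+1)%N.
Proof. by apply: leq_trans (ltn_expl N (ltnSn 1)) _; rewrite leq_exp2l. Qed.

Lemma invB_add N u v : invB N (fun n => u n + v n) = invB N u + invB N v.
Proof.
rewrite /invB -opBD; apply: eq_opB => n; rewrite /trunc_fun.
by case: ifP; rewrite ?addr0.
Qed.

Lemma invB_le N w : `|invB N w| <= psum (fun n => (a n)%:R * `|w n|) N.
Proof.
case: N => [|N]; first by rewrite psum0 /invB /= /trunc_fun /= normr0.
apply: le_trans (opB_le (norm_list N.+1) _ _ (isT : (1 < N.+2)%N)) _.
rewrite -euler; last by move=> n hn; rewrite trunc_supp// normr0.
by apply: ler_psum => n hn; rewrite /trunc_fun hn.
Qed.

Lemma invB_inv N w : (0 < N)%N ->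
  invB N (fun d => psum (fun m => (a m)%:R * w (d * m)%N) (N %/ d)) = w 1%N.
Proof.
move=> N0; have hs := @trunc_supp N w.
have := opB_opA (ltn0Sn N) (norm_list_ge2 N) (ltn_expS2 N) hs.
rewrite {2}/trunc_fun /= N0 => <-; apply: eq_opB => d; rewrite /trunc_fun.
have := opA_dil N.+1 (norm_list N) (trunc_fun N w) d 1; rewrite muln1 => <-.
rewrite -euler; last exact: supp_dil.
case: ifP => hd; last first.
  rewrite -(@eq_psum _ (fun=> 0)) ?psum_const ?mulr0// => n /andP[n0 _].
  rewrite /trunc_fun; case: ifP => [h|_]; last by rewrite mulr0.
  by move: hd h; case: d => [|d]; rewrite ?mul0n//=; nia.
case/andP: hd => d0 dN.
rewrite /psum (@big_cat_nat _ _ _ (N %/ d).+1 1 N.+1)//=; last by rewrite ltnS leq_div.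
rewrite [X in _ = _ + X]big_nat [X in _ = _ + X]big1 ?addr0; last first.
  move=> m /andP[hm _]; rewrite /trunc_fun; case: ifP => [/andP[_ h]|_]; last by rewrite mulr0.
  by move: hm; rewrite ltnNge leq_divRL// mulnC h.
apply: eq_big_nat => m /andP[m0]; rewrite ltnS leq_divRL// mulnC => hm.
by rewrite /trunc_fun muln_gt0 d0 m0 hm.
Qed.

Lemma Lam_ext N n : (0 < n <= N)%N -> Lam n =
   \sum_(2 <= q < N.+1) \sum_(1 <= k < N.+1) (if (q ^ k == n)%N then (c q)%:R * ln q%:R else 0).
Proof.
move=> /andP[n0 nN]; rewrite /Lam.
have hcut q : (2 <= q)%N -> \sum_(1 <= k < N.+1) (if (q ^ k == n)%N then (c q)%:R * ln q%:R else 0) =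
   \sum_(1 <= k < n.+1 | (q ^ k == n)%N) (c q)%:R * ln q%:R :> R.
  move=> q2; rewrite (@big_cat_nat _ _ _ n.+1 1 N.+1)//=.
  rewrite [X in _ + X]big_nat [X in _ + X]big1 ?addr0; last first.
    move=> k /andP[hk _]; case: eqP => // e; have := ltn_expl k q2; lia.
  by rewrite [RHS]big_mkcond.
have [n1|n1] := leqP n 1.
  have -> : n = 1%N by lia.
  rewrite [LHS]big_geq// big_nat big1// => q /andP[q2 _]; rewrite big_nat big1// => k /andP[k1 _].
  by case: eqP => // e; have := ltn_expl k q2; lia.
rewrite [RHS](@big_cat_nat _ _ _ n.+1 2 N.+1)//=.
rewrite [X in _ = _ + X]big_nat [X in _ = _ + X]big1 ?addr0; last first.
  move=> q /andP[hq _]; rewrite big_nat big1// => k /andP[k1 _]; case: eqP => // e.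
  have : (q ^ 1 <= q ^ k)%N by rewrite leq_exp2l; lia.
  rewrite expn1; lia.
by apply: eq_big_nat => q /andP[q2 _]; rewrite hcut.
Qed.

Lemma a_ln_Lam N w : psum (fun k => (a k)%:R * ln k%:R * w k) N =
  psum (fun n => psum (fun m => Lam n * (a m)%:R * w (n * m)%N) (N %/ n)) N.
Proof.
pose w' := trunc_fun N w; have hw' : supp N w' by exact: trunc_supp.
have -> : psum (fun k => (a k)%:R * ln k%:R * w k) N =
    psum (fun k => (a k)%:R * (ln k%:R * w' k)) N.
  by apply: eq_psum => k hk; rewrite /w' /trunc_fun hk mulrA.
rewrite euler; last by move=> n hn; rewrite hw'// mulr0.
rewrite (opA_ln (ltn0Sn N) (norm_list_ge2 N) (ltn_expS2 N) hw') sum_norm_list.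
pose G n := psum (fun m => (a m)%:R * w (n * m)%N) (N %/ n).
have HG n : (0 < n <= N)%N -> opA N.+1 (norm_list N) (fun m => w' (n * m)%N) 1 = G n.
  move=> /andP[n0 nN]; rewrite -euler; last exact: supp_dil.
  rewrite /G /psum (@big_cat_nat _ _ _ (N %/ n).+1 1 N.+1)//=; last by rewrite ltnS leq_div.
  rewrite [X in _ + X]big_nat [X in _ + X]big1 ?addr0; last first.
    move=> m /andP[hm _]; rewrite /w' /trunc_fun; case: ifP => [/andP[_ h]|_]; last by rewrite mulr0.
    by move: hm; rewrite ltnNge leq_divRL// mulnC h.
  apply: eq_big_nat => m /andP[m0]; rewrite ltnS leq_divRL// mulnC => hm.
  by rewrite /w' /trunc_fun muln_gt0 n0 m0 hm.
have HG0 n : (N < n)%N -> opA N.+1 (norm_list N) (fun m => w' (n * m)%N) 1 = 0.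
  move=> hn; rewrite -[RHS](opA0 R N.+1 (norm_list N) 1); apply: eq_opA => -[|m].
    by rewrite muln0 hw'.
  by apply: hw'; apply/orP; right; nia.
have -> : psum (fun n => psum (fun m => Lam n * (a m)%:R * w (n * m)%N) (N %/ n)) N =
    psum (fun n => Lam n * G n) N.
  by apply: eq_psum => n _; rewrite /G -psumZ; apply: eq_psum => m _; rewrite mulrA.
have E n : (0 < n <= N)%N -> Lam n * G n =
   \sum_(2 <= q < N.+1) \sum_(1 <= k < N.+1) (if (q ^ k == n)%N then (c q)%:R * ln q%:R * G n else 0).
  move=> hn; rewrite (Lam_ext hn) mulr_suml; apply: eq_bigr => q _.
  by rewrite mulr_suml; apply: eq_bigr => k _; case: ifP; rewrite ?mul0r.
rewrite (@eq_psum _ _ _ _ E) /psum [RHS]exchange_big /=.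
apply: eq_big_nat => q /andP[q2 _]; rewrite mulr_sumr [RHS]exchange_big /=.
apply: eq_big_nat => k /andP[k1 _].
have [hk|hk] := leqP (q ^ k) N; last first.
  rewrite HG0// !mulr0 big_nat big1// => n /andP[_ hn]; case: eqP => // e; lia.
have qk0 : (0 < q ^ k)%N by rewrite expn_gt0; lia.
rewrite HG ?qk0// (bigD1_seq (q ^ k)%N) ?iota_uniq//=; last by rewrite mem_index_iota ltnS qk0.
by rewrite eqxx big1 ?addr0 ?mulrA// => n; rewrite eq_sym => /negbTE ->.
Qed.

Lemma Lam_pnt (e : R) : 0 < e ->
  exists n0, forall n, (n0 <= n)%N -> `|psum Lam n - n%:R| <= e * n%:R.
Proof.
have a0 n : 0 <= (a n)%:R :> R by [].
have [K1 [K10 h1]] := chebyshev_bound a0 a_ln_Lam invB_le invB_inv rho_gt0 s01 A_est.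
have [K2 h2] := mertens a0 Lam_ge0 a_ln_Lam invB_le invB_inv rho_gt0 s01 A_est.
have [K3 h3] := selberg1 a0 Lam_ge0 a_ln_Lam invB_add invB_le invB_inv rho_gt0 s01 A_est.
have [K4 h4] := selberg2 a0 Lam_ge0 a_ln_Lam invB_add invB_le invB_inv rho_gt0 s01 A_est.
pose K := 1 + K1 + `|K2| + `|K3| + `|K4|.
have n2 := normr_ge0 K2; have n3 := normr_ge0 K3; have n4 := normr_ge0 K4.
have le x N : x <= K -> x * N%:R <= K * N%:R by move=> h; apply: ler_wpM2r.
apply: (@pnt_endgame R Lam K Lam_ge0).
- by rewrite /K; lra.
- by move=> N; apply: le_trans (h1 N) _; apply: le; rewrite /K; lra.
- by move=> N N0; apply: le_trans (h2 N N0) _; have := ler_norm K2; rewrite /K; lra.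
- by move=> N; apply: le_trans (h3 N) _; apply: le; have := ler_norm K3; rewrite /K; lra.
- by move=> N; apply: le_trans (h4 N) _; apply: le; have := ler_norm K4; rewrite /K; lra.
Qed.

Definition theta N : R := psum (fun q => (c q)%:R * ln q%:R) N.

Lemma psum_Lam N : psum Lam N =
  \sum_(2 <= q < N.+1) \sum_(1 <= k < N.+1) (if (q ^ k <= N)%N then (c q)%:R * ln q%:R else 0).
Proof.
rewrite (@eq_psum _ _ _ _ (@Lam_ext N)) /psum exchange_big /=.
apply: eq_big_nat => q /andP[q2 _]; rewrite exchange_big /=.
apply: eq_big_nat => k /andP[k1 _].
have qk0 : (0 < q ^ k)%N by rewrite expn_gt0; lia.
case: ifP => hk; last first.
  rewrite big_nat big1// => n /andP[_ hn]; case: eqP => // e; lia.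
rewrite (bigD1_seq (q ^ k)%N) ?iota_uniq//=; last by rewrite mem_index_iota ltnS qk0.
by rewrite eqxx big1 ?addr0// => n; rewrite eq_sym => /negbTE ->.
Qed.

Lemma thetaE N : theta N = \sum_(2 <= q < N.+1) (c q)%:R * ln q%:R.
Proof.
rewrite /theta /psum; case: N => [|N]; first by rewrite !big_geq.
by rewrite big_ltn// ln1 mulr0 add0r.
Qed.

(** Powers with [k >= 2] occur only for [q] up to the square root of [N], and all powers of one such
    [q] together contribute at most [c q * ln N]. *)
Lemma Lam_theta N : theta N <= psum Lam N /\
  psum Lam N <= theta N + ln N%:R * psum (fun q => (c q)%:R) (Num.truncn (Num.sqrt N%:R : R)).
Proof.
case: N => [|N]; first by rewrite /theta !psum0 ln0// mul0r addr0.
set M := N.+1; rewrite thetaE psum_Lam.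
have h1 q : (2 <= q)%N -> (q <= M)%N -> (c q)%:R * ln q%:R <=
   \sum_(1 <= k < M.+1) (if (q ^ k <= M)%N then (c q)%:R * ln q%:R else 0) :> R.
  move=> q2 qM; rewrite big_ltn// expn1 qM lerDl; apply: sumr_ge0 => k _.
  by case: ifP => // _; rewrite mulr_ge0// ln_nat_ge0.
split.
  rewrite big_nat [leRHS]big_nat; apply: ler_sum => q /andP[q2 qM]; exact: h1.
have h2 q : (2 <= q)%N -> (q <= M)%N ->
   \sum_(1 <= k < M.+1) (if (q ^ k <= M)%N then (c q)%:R * ln q%:R else 0) <=
   (c q)%:R * ln q%:R + (if (q ^ 2 <= M)%N then ln M%:R * (c q)%:R else 0) :> R.
  move=> q2 qM; case: ifP => hq2; last first.
    rewrite big_ltn// expn1 qM lerD2l big_nat big1// => k /andP[k2 _].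
    case: ifP => // hk; have : (q ^ 2 <= q ^ k)%N by rewrite leq_exp2l.
    by move=> h; move: hq2; rewrite (leq_trans h hk).
  set T := trunc_log q M.
  have TM : (T <= M)%N by apply: leq_trans (trunc_logP q2 (isT : (0 < M)%N)); exact: ltnW (ltn_expl _ q2).
  have -> : \sum_(1 <= k < M.+1) (if (q ^ k <= M)%N then (c q)%:R * ln q%:R else 0) = T%:R * ((c q)%:R * ln q%:R) :> R.
    rewrite (@big_cat_nat _ _ _ T.+1 1 M.+1)//=.
    rewrite [X in _ + X]big_nat [X in _ + X]big1 ?addr0; last first.
      move=> k /andP[hk _]; case: ifP => // h; move: hk.
      by rewrite ltnNge trunc_log_max.
    rewrite -(psum_const ((c q)%:R * ln q%:R) T) /psum; apply: eq_big_nat => k /andP[_ hk]; case: ifP => //.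
    move/negP => hn; case: hn; apply: leq_trans (trunc_logP q2 (isT : (0 < M)%N)).
    by rewrite leq_exp2l.
  have hT : T%:R * ln q%:R <= ln M%:R :> R.
    rewrite mulr_natl -lnXn ?ltr0n 1?ltnW// -natrX ler_ln_nat//; first by rewrite expn_gt0 ltnW.
    exact: trunc_logP.
  have := ler_wpM2l (ler0n R (c q)) hT; have := ln_nat_ge0 R q.
  have := mulr_ge0 (ler0n R (c q)) (ln_nat_ge0 R q); lra.
set Q := Num.truncn _.
have QQ q : (q ^ 2 <= M)%N -> (q <= Q)%N.
  move=> h; rewrite truncn_ge_nat ?sqrtr_ge0//.
  by rewrite -[leLHS]ger0_norm// -sqrtr_sqr ler_wsqrtr// -natrX ler_nat.
apply: le_trans (_ : _ <= \sum_(2 <= q < M.+1) ((c q)%:R * ln q%:R +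
    (if (q ^ 2 <= M)%N then ln M%:R * (c q)%:R else 0))) _.
  by rewrite big_nat [leRHS]big_nat; apply: ler_sum => q /andP[q2 qM]; exact: h2.
rewrite big_split /= lerD2l -psumZ.
have lM := ln_nat_ge0 R M.
apply: le_trans (_ : _ <= psum (fun q => if (q ^ 2 <= M)%N then ln M%:R * (c q)%:R else 0) M) _.
  rewrite /psum [X in _ <= X](@big_ltn _ _ _ 1 M.+1)//; apply: ler_wpDl => //.
  by rewrite mulr_ge0.
have [hQM|hQM] := leqP M Q.
  apply: le_trans (le_psum (M := Q) _ hQM) _; first by move=> q; case: ifP => // _; rewrite mulr_ge0.
  by apply: ler_psum => q _; case: ifP => // _; rewrite mulr_ge0.
rewrite /psum (@big_cat_nat _ _ _ Q.+1 1 M.+1)//=; last exact: ltnW.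
rewrite [X in _ + X]big_nat [X in _ + X]big1 ?addr0; last first.
  move=> k /andP[hk _]; case: ifP => // h; have := QQ _ h; lia.
by apply: ler_sum => q _; case: ifP => // _; rewrite mulr_ge0.
Qed.

Lemma prime_sum_le n : psum (fun q => (c q)%:R) n <= (rho + C0) * n%:R.
Proof.
apply: le_trans (A_le s01 A_est n); apply: ler_psum => q _.
by rewrite ler_nat.
Qed.

End PrimeCounting.

(** * From theta to the logarithmic integral *)

Section LogIntegral.
Variable R : realType.

Lemma sqrt_ln_small (C e : R) : 0 < e -> exists n0 : nat, forall n, (n0 <= n)%N ->
  C * (Num.sqrt n%:R * ln n%:R) <= e * n%:R.
Proof.
move=> e0; pose t0 := 4 * `|C| / e.
exists (Num.truncn (t0 ^+ 4)).+1 => n hn.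
have n0 : (0 < n)%N by exact: leq_trans hn.
have n0' : 0 < n%:R :> R by rewrite ltr0n.
pose t : R := n%:R `^ 4^-1.
have t4 : t ^+ 4 = n%:R.
  have E : 4^-1 * 4%:R = 1 :> R by lra.
  by rewrite /t -powR_mulrn ?powR_ge0// -powRrM E powRr1.
have t0' : 0 < t by rewrite powR_gt0.
have hs : Num.sqrt n%:R = t ^+ 2.
  by rewrite -t4 (_ : t ^+ 4 = (t ^+ 2) ^+ 2) ?sqrtr_sqr ?ger0_norm ?sqr_ge0// -exprM.
have hl : ln n%:R <= 4 * t.
  have := @ln_le_powR R 4^-1 n%:R ltac:(lra); rewrite ler1n invrK; exact.
have tt : t0 <= t.
  rewrite -(@ler_pXn2r _ 4)// ?nnegrE ?(ltW t0')//; last by rewrite /t0 divr_ge0// ?mulr_ge0// ltW.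
  rewrite t4 ltW// (lt_le_trans (truncnS_gt _))// ?ler_nat//.
have CC : C <= `|C| by exact: ler_norm.
have p0 : 0 <= Num.sqrt n%:R * ln n%:R :> R by rewrite mulr_ge0 ?sqrtr_ge0// ln_nat_ge0.
apply: le_trans (ler_wpM2r p0 CC) _.
apply: le_trans (_ : `|C| * (t ^+ 2 * (4 * t)) <= _).
  by rewrite ler_wpM2l// hs ler_wpM2l// sqr_ge0.
rewrite -t4; move: tt; rewrite /t0 ler_pdivrMr// => tt.
have := ler_wpM2r (exprn_ge0 3 (ltW t0')) tt.
have -> : e * t ^+ 4 = t * e * t ^+ 3 by ring.
have -> : `|C| * (t ^+ 2 * (4 * t)) = 4 * `|C| * t ^+ 3 by ring.
by [].
Qed.

(* The term n = 1 is 0^-1 = 0. *)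
Definition Li (N : nat) : R := psum (fun n => (ln n%:R)^-1) N.

Lemma Li_ge N : (0 < N)%N -> (N%:R - 1) / ln N%:R <= Li N.
Proof.
case: N => // N _; rewrite /Li; elim: N => [|N IH]; first by rewrite subrr mul0r psumS psum0 ln1 invr0 addr0.
rewrite psumS; apply: le_trans (lerD IH (lexx _)).
have l2 : 0 < ln N.+2%:R :> R by rewrite ln_gt0// ltr1n.
have -> : N.+2%:R - 1 = N.+1%:R :> R by rewrite -natr1; ring.
case: N {IH} l2 => [|N] l2; first by rewrite subrr mul0r add0r mul1r.
have l1 : 0 < ln N.+2%:R :> R by rewrite ln_gt0// ltr1n.
rewrite -[X in X / _](subrK 1) mulrDl mul1r lerD2r ler_wpM2l ?subr_ge0 ?ler1n//.
by rewrite lef_pV2 ?posrE// ler_ln_nat.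
Qed.

Lemma Li_ge0 N : 0 <= Li N.
Proof. by apply: psum_ge0 => n; rewrite invr_ge0 ln_nat_ge0. Qed.

Lemma sqrt_Li_small (C e : R) : 0 < e -> exists n0 : nat, forall n, (n0 <= n)%N ->
  C * Num.sqrt n%:R <= e * Li n.
Proof.
move=> e0; have [n0 h] := @sqrt_ln_small (2 * C) e e0; exists (maxn n0 2) => n hn.
have n2 : (2 <= n)%N by exact: leq_trans (leq_maxr _ _) hn.
have n2' : 2 <= n%:R :> R by rewrite ler_nat.
have l0 : 0 < ln n%:R :> R by rewrite ln_gt0//; lra.
apply: le_trans (_ : e * ((n%:R - 1) / ln n%:R) <= _); last first.
  by rewrite ler_pM2l// Li_ge// ltnW.
rewrite mulrA ler_pdivlMr//; have := h n (leq_trans (leq_maxl _ _) hn).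
have : e * n%:R <= 2 * (e * (n%:R - 1)) by rewrite mulrCA ler_pM2l//; lra.
lra.
Qed.

Lemma cst_Li_small (C e : R) : 0 < e -> exists n0 : nat, forall n, (n0 <= n)%N -> C <= e * Li n.
Proof.
move=> e0; have [n0 h] := @sqrt_Li_small `|C| e e0; exists n0.+1 => n hn.
apply: le_trans (h n (ltnW hn)); apply: le_trans (ler_norm C) _.
by rewrite ler_peMr// -[leLHS]sqrtr1 ler_wsqrtr// ler1n (leq_ltn_trans _ hn).
Qed.

(** Partial summation of [c n ln n - 1] against [1 / ln n], compared with [Li] as a sum over
    integers, so that no integral is estimated. *)
Lemma count_Li (c : nat -> R) : (forall n, 0 <= c n) -> c 1%N = 0 ->
  (forall e : R, 0 < e -> exists n0, forall n, (n0 <= n)%N ->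
     `|psum (fun q => c q * ln q%:R) n - n%:R| <= e * n%:R) ->
  forall e : R, 0 < e -> exists n0, forall n, (n0 <= n)%N -> `|psum c n - Li n| <= e * Li n.
Proof.
move=> c0 c1 h e e0; have [n0 hn0] := h (e / 4) ltac:(lra).
pose u n := c n * ln n%:R - (if (1 < n)%N then 1 else 0).
(* The maximum with 2 keeps [v] monotone and finite at 1, where [ln] vanishes. *)
pose v (n : nat) : R := (ln (maxn n 2)%:R)^-1.
(* A constant that covers all [n < n0], so that the bound [hU] holds without restriction. *)
pose D := psum (fun q => c q * ln q%:R) n0 + n0%:R + 1.
have th0 n : 0 <= psum (fun q => c q * ln q%:R) n by apply: psum_ge0 => q; rewrite mulr_ge0// ln_nat_ge0.
have D0 : 0 <= D by rewrite /D !addr_ge0.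
have hU n : `|psum u n| <= e / 4 * n%:R + D.
  have -> : psum u n = psum (fun q => c q * ln q%:R) n - n.-1%:R.
    rewrite /u psumB; congr (_ - _); elim: n => [|n IH]; first by rewrite psum0.
    rewrite psumS IH /=; case: n {IH} => [|n] /=; first by rewrite addr0.
    by rewrite natr1.
  have [hp1 hp2] : n%:R - 1 <= n.-1%:R :> R /\ n.-1%:R <= n%:R :> R.
    by case: n => [|n] /=; [split; lra|rewrite -natr1; split; lra].
  have [hn|hn] := leqP n0 n.
    by have := hn0 n hn; have := th0 n0; have : 0 <= n0%:R :> R by []; rewrite /D !ler_norml; lra.
  have m1 : psum (fun q => c q * ln q%:R) n <= psum (fun q => c q * ln q%:R) n0.
    by apply: le_psum (ltnW hn) => q; rewrite mulr_ge0// ln_nat_ge0.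
  have m2 : n%:R <= n0%:R :> R by rewrite ler_nat ltnW.
  have : 0 <= e / 4 * n%:R by rewrite mulr_ge0//; lra.
  have : 0 <= n.-1%:R :> R by [].
  by have := th0 n; rewrite /D !ler_norml; lra.
have v_ge0 n : 0 <= v n by rewrite /v invr_ge0 ln_nat_ge0.
have vd n : v n.+1 <= v n.
  have hm : (maxn n 2 <= maxn n.+1 2)%N by lia.
  have lp k : ln (maxn k 2)%:R \is @Num.pos R by rewrite posrE ln_gt0// ltr1n leq_max orbT.
  by rewrite /v lef_pV2//; apply: ler_ln_nat => //; rewrite leq_max orbT.
have uv N : psum c N - Li N = psum (fun n => u n * v n) N.
  rewrite /Li -psumB; apply: eq_psum => -[//|[|n]] _.
    by rewrite /u /= ln1 c1 invr0; ring.
  rewrite /u /v /= (maxn_idPl _)//; field.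
  by rewrite gt_eqF// ln_gt0// ltr1n.
have hN N : `|psum c N - Li N| <= e / 4 * (Li N + v 1%N) + D * v 1%N.
  rewrite uv psum_abel.
  have hv : psum v N <= Li N + v 1%N.
    case: N => [|N]; first by rewrite /Li !psum0 add0r.
    have E (f : nat -> R) : psum f N.+1 = f 1%N + \sum_(2 <= n < N.+2) f n by rewrite /psum big_ltn.
    rewrite /Li !E ln1 invr0 add0r addrC lerD2r.
    by rewrite le_eqVlt; apply/orP; left; apply/eqP; apply: eq_big_nat => n /andP[n2 _]; rewrite /v (maxn_idPl _).
  have hD : D * v N + psum (fun n => D * (v n - v n.+1)) N.-1 <= D * v 1%N.
    rewrite psumZ -mulrDr ler_wpM2l//; case: N {hv} => [|N].
      by rewrite psum0 addr0 /v.
    by elim: N => [|N IH]; [rewrite psum0 addr0|rewrite /= psumS /= in IH *; lra].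
  apply: le_trans (ler_normD _ _) _.
  apply: le_trans (_ : _ <= (e / 4 * N%:R + D) * v N +
     psum (fun n => (e / 4 * n%:R + D) * (v n - v n.+1)) N.-1) _.
    apply: lerD; first by rewrite normrM (ger0_norm (v_ge0 _)) ler_wpM2r.
    apply: ler_norm_psum => n _; rewrite normrM (@ger0_norm _ (_ - _)) ?subr_ge0//.
    by rewrite ler_wpM2r ?subr_ge0.
  have -> : psum (fun n => (e / 4 * n%:R + D) * (v n - v n.+1)) N.-1 =
     e / 4 * psum (fun n => n%:R * (v n - v n.+1)) N.-1 + psum (fun n => D * (v n - v n.+1)) N.-1.
    by rewrite -psumZ -psumD; apply: eq_psum => n _; ring.
  have := psum_nat_abel v N => E; have e4 : 0 <= e / 4 by lra.
  have := ler_wpM2l e4 hv; rewrite E; move: hD; move: (psum _ _) (psum _ _) => X Y; lra.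
have [n1 h1] := @cst_Li_small (e / 4 * v 1%N + D * v 1%N) (e / 2) ltac:(lra).
exists n1 => n hn; apply: le_trans (hN n) _; have := h1 n hn; have := Li_ge0 n.
have := mulr_ge0 (ltW e0) (Li_ge0 n); lra.
Qed.

End LogIntegral.

(** * Riemann sums *)

Section RiemannSums.
Variables (R : realType) (d M : nat) (Phi : ('I_d -> rat) -> R) (K : R).
Hypothesis K_ge0 : 0 <= K.
Hypothesis Phi_lip : forall (v v' : 'I_d -> rat) (e : rat),
  (forall i, 0 <= v i <= M%:R) -> (forall i, 0 <= v' i <= M%:R) ->
  (forall i, `|v i - v' i| <= e) -> `|Phi v - Phi v'| <= K * ratr e.

Definition grid t (f : {ffun 'I_d -> 'I_(M * t)}) (i : 'I_d) : rat := (f i)%:R / t%:R.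

Definition riemann t : R := \sum_(f : {ffun 'I_d -> 'I_(M * t)}) Phi (grid f).

Lemma grid_in t (f : {ffun 'I_d -> 'I_(M * t)}) i : 0 <= grid f i <= M%:R.
Proof.
have t0 : (0 < t)%N.
  by have := leq_ltn_trans (leq0n _) (ltn_ord (f i)); rewrite muln_gt0 => /andP[].
rewrite /grid divr_ge0//= ler_pdivrMr ?ltr0n// -natrM ler_nat ltnW//.
Qed.

Lemma block_subproof k t (a : 'I_(M * t)) (b : 'I_k) : (a * k + b < M * (k * t))%N.
Proof.
apply: (@leq_trans (a.+1 * k)); first by rewrite mulSn addnC ltn_add2r.
by rewrite mulnCA mulnC leq_mul2l ltn_ord orbT.
Qed.

Definition block k t (p : {ffun 'I_d -> 'I_(M * t)} * {ffun 'I_d -> 'I_k}) :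
  {ffun 'I_d -> 'I_(M * (k * t))} := [ffun i => Ordinal (block_subproof (p.1 i) (p.2 i))].

Lemma riemann_block k t : (0 < k)%N -> riemann (k * t) =
  \sum_(f : {ffun 'I_d -> 'I_(M * t)}) \sum_(g : {ffun 'I_d -> 'I_k}) Phi (grid (block (f, g))).
Proof.
move=> k0; rewrite /riemann pair_big /= (reindex (@block k t)); first by apply: eq_bigr => -[].
have h1 (a : 'I_(M * (k * t))) : (a %/ k < M * t)%N.
  rewrite ltn_divLR//; have -> : (M * t * k = M * (k * t))%N by rewrite -mulnA (mulnC t).
  exact: ltn_ord.
have h2 (a : 'I_(M * (k * t))) : (a %% k < k)%N by rewrite ltn_mod.
exists (fun f : {ffun 'I_d -> 'I_(M * (k * t))} => ([ffun i => Ordinal (h1 (f i))], [ffun i => Ordinal (h2 (f i))])).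
  move=> [f g] _; congr (_, _); apply/ffunP => i; rewrite !ffunE; apply/val_inj; rewrite /= ?ffunE /=.
    by rewrite divnMDl// divn_small// addn0.
  by rewrite modnMDl modn_small.
by move=> f _; apply/ffunP => i; rewrite !ffunE; apply/val_inj; rewrite /= ?ffunE /= -divn_eq.
Qed.

Lemma grid_block k t f (g : {ffun 'I_d -> 'I_k}) i : (0 < k)%N -> (0 < t)%N ->
  `|grid (block (f, g)) i - @grid t f i| <= t%:R^-1.
Proof.
move=> k0 t0; rewrite /grid ffunE /=.
have k0' : k%:R != 0 :> rat by rewrite pnatr_eq0 -lt0n.
have t0' : t%:R != 0 :> rat by rewrite pnatr_eq0 -lt0n.
have -> : (f i * k + g i)%:R / (k * t)%:R - (f i)%:R / t%:R = (g i)%:R / (k%:R * t%:R) :> rat.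
  by rewrite natrD !natrM; field; rewrite k0' t0'.
rewrite ger0_norm ?divr_ge0 ?mulr_ge0// invfM mulrA ler_piMl ?invr_ge0//.
by rewrite ler_pdivrMr ?ltr0n// mul1r ler_nat ltnW.
Qed.

Lemma Phi_block k t f (g : {ffun 'I_d -> 'I_k}) : (0 < k)%N -> (0 < t)%N ->
  `|Phi (grid (block (f, g))) - Phi (@grid t f)| <= K / t%:R.
Proof.
move=> k0 t0; have := @Phi_lip (grid (block (f, g))) (@grid t f) t%:R^-1.
rewrite fmorphV /= ratr_nat; apply=> i; [exact: grid_in|exact: grid_in|exact: grid_block].
Qed.

Lemma riemann_refine k t : (0 < k)%N -> (0 < t)%N ->
  `|riemann (k * t) - k%:R ^+ d * riemann t| <= k%:R ^+ d * ((M * t)%:R ^+ d * (K / t%:R)).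
Proof.
move=> k0 t0; rewrite riemann_block// /riemann mulr_sumr -sumrB.
apply: le_trans (ler_norm_sum _ _ _) _.
have e m : (m ^ d)%N = #|{ffun 'I_d -> 'I_m}| by rewrite card_ffun !card_ord.
rewrite mulrCA -(natrX _ (M * t)) (e (M * t)%N) mulr_natl -sumr_const; apply: ler_sum => f _.
rewrite -natrX (e k) !mulr_natl -!sumr_const -sumrB.
by apply: le_trans (ler_norm_sum _ _ _) _; apply: ler_sum => g _; exact: Phi_block.
Qed.

Let s t := riemann t / t%:R ^+ d.
Let C := M%:R ^+ d * K.

Lemma riemann_scale k t : (0 < k)%N -> (0 < t)%N -> `|s (k * t) - s t| <= C / t%:R.
Proof.
move=> k0 t0; have h := riemann_refine k0 t0.
have k0' : 0 < k%:R ^+ d :> R by rewrite exprn_gt0 ?ltr0n.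
have t0' : 0 < t%:R ^+ d :> R by rewrite exprn_gt0 ?ltr0n.
rewrite /s natrM exprMn.
have -> : riemann (k * t) / (k%:R ^+ d * t%:R ^+ d) - riemann t / t%:R ^+ d =
  (riemann (k * t) - k%:R ^+ d * riemann t) / (k%:R ^+ d * t%:R ^+ d).
  by field; rewrite !gt_eqF.
have p0 := mulr_gt0 k0' t0'; rewrite normrM [X in _ * X]gtr0_norm ?invr_gt0//.
rewrite ler_pdivrMr ?mulr_gt0//; apply: le_trans h _.
by rewrite natrM exprMn /C le_eqVlt; apply/orP; left; apply/eqP; ring.
Qed.

(** Refining a grid by a factor [k] changes the normalised sum by at most [C / t]. The sums along
    powers of 2 thus converge, and any [t] is compared with [2 ^ n] through their common refinement.
    The second clause bounds the limit below by one cell alone; positivity of the ideal density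
    comes from it. *)
Lemma riemann_limit : exists2 c : R, (forall t, (0 < t)%N -> `|riemann t - c * t%:R ^+ d| <= C * t%:R ^+ d / t%:R) &
  (forall t f, (forall v, 0 <= Phi v) -> (0 < t)%N ->
     (Phi (@grid t f) - K / t%:R) / t%:R ^+ d <= c).
Proof.
have C0 : 0 <= C by rewrite /C mulr_ge0// exprn_ge0.
have p2 n : 0 < (2 ^ n)%:R :> R by rewrite ltr0n expn_gt0.
have [n|n|c hc] := @ex_limit_of_steps R (fun n => s (2 ^ n)) (fun n => 2 * C / (2 ^ n)%:R).
- by apply: divr_ge0 => //; apply: mulr_ge0.
- rewrite expnS; apply: le_trans (riemann_scale _ _) _; rewrite ?expn_gt0//.
  rewrite natrM invfM; have := p2 n; move: ((2 ^ n)%:R^-1) => z _; lra.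
have lim t : (0 < t)%N -> `|s t - c| <= C / t%:R.
  move=> t0; apply/ler_addgt0Pr => e e0.
  have [n hn] : exists n, 3 * C / (2 ^ n)%:R <= e.
    exists (Num.truncn (3 * C / e)); rewrite ler_pdivrMr// -ler_pdivrMl// [e^-1 * _]mulrC.
    apply: le_trans (ltW (truncnS_gt _)) _; rewrite ler_nat; exact: ltn_expl.
  have h1 := @riemann_scale (2 ^ n) t (ltac:(by rewrite expn_gt0)) t0.
  have h2 := @riemann_scale t (2 ^ n) t0 (ltac:(by rewrite expn_gt0)).
  have h3 := hc n; rewrite mulnC in h2; move: h1 h2 h3 hn.
  rewrite (mulrC 3) (mulrC 2) -!mulrA (mulrC 3) (mulrC 2) !mulrA.
  move: (C / (2 ^ n)%:R) (C / t%:R) => a b; rewrite !ler_norml => /andP[? ?] /andP[? ?] /andP[? ?] ?.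
  by apply/andP; split; lra.
exists c => [t t0|t f Phi0 t0].
  have t0' : 0 < t%:R ^+ d :> R by rewrite exprn_gt0 ?ltr0n.
  have := lim t t0; rewrite /s -(ler_pM2r t0') -[in X in _ * X <= _](gtr0_norm t0') -normrM mulrBl divfK ?gt_eqF//.
  by rewrite mulrAC.
apply/ler_addgt0Pr => e e0.
pose k := (Num.truncn (C / e)).+1.
have kt : C / (k * t)%:R <= e.
  rewrite ler_pdivrMr ?ltr0n ?muln_gt0 ?t0// -ler_pdivrMl// [e^-1 * _]mulrC.
  by apply: le_trans (ltW (truncnS_gt _)) _; rewrite ler_nat leq_pmulr.
have h := lim (k * t)%N (ltac:(by rewrite muln_gt0 t0)).
suff : (Phi (grid f) - K / t%:R) / t%:R ^+ d <= s (k * t).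
  by move: h kt; rewrite ler_norml => /andP[? ?]; lra.
have k0' : 0 < k%:R ^+ d :> R by rewrite exprn_gt0 ?ltr0n.
have t0' : 0 < t%:R ^+ d :> R by rewrite exprn_gt0 ?ltr0n.
rewrite /s natrM exprMn invfM mulrA ler_pM2r ?invr_gt0// ler_pdivlMr//.
rewrite riemann_block// (bigD1 f)//= -[leLHS]addr0 lerD//; last first.
  by apply: sumr_ge0 => f' _; apply: sumr_ge0.
have e1 m : (m ^ d)%N = #|{ffun 'I_d -> 'I_m}| by rewrite card_ffun !card_ord.
rewrite -natrX mulrC (e1 k) mulr_natl -sumr_const; apply: ler_sum => g _.
by have := @Phi_block k t f g isT t0; rewrite ler_norml => /andP[? ?]; lra.
Qed.

End RiemannSums.

(** * Removing the smooth weights *)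

Definition unsmooth_exp (R : realType) (d : nat) : R := 1 - (2 * d)%:R^-1.

Lemma unsmooth_exp_bounds (R : realType) d : (0 < d)%N -> 0 < unsmooth_exp R d < 1.
Proof.
move=> d0; have : 0 < (2 * d)%:R^-1 :> R by rewrite invr_gt0 ltr0n; lia.
have : (2 * d)%:R^-1 <= 2^-1 :> R by rewrite lef_pV2 ?posrE ?ltr0n ?ler_nat; lia.
by rewrite /unsmooth_exp; move: ((2 * d)%:R^-1) => x; lra.
Qed.

(* The weights [n * (N - n)] make the lattice sum Lipschitz; they are removed by
   differencing [Q] and then by partial summation. *)
Section Unsmoothing.
Variables (R : realType) (d : nat) (b : nat -> R) (c C : R).
Hypothesis d_gt0 : (0 < d)%N.
Hypothesis b_ge0 : forall n, 0 <= b n.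
Hypothesis c_ge0 : 0 <= c.
Hypothesis C_ge0 : 0 <= C.

Let B1 N := psum (fun n => n%:R * b n) N.
Let Q N := psum (fun n => n%:R * b n * (N%:R - n%:R)) N.

Hypothesis Q_est : forall t, (0 < t)%N ->
  `|Q (t ^ d) - c * t%:R ^+ (3 * d)| <= C * t%:R ^+ (3 * d).-1.

Lemma exp_split : (3 * d).-1 = (2 * d + d.-1)%N.
Proof. by move: d_gt0; clear; lia. Qed.

Lemma Q_est0 t : `|Q (t ^ d) - c * t%:R ^+ (3 * d)| <= C * t%:R ^+ (3 * d).-1.
Proof.
case: t => [|t]; last exact: Q_est.
rewrite exp0n// /Q psum0 !expr0n; have -> : (3 * d == 0)%N = false by lia.
by rewrite mulr0 subr0 normr0 mulr_ge0// ler0n.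
Qed.

Lemma QS N : Q N.+1 = Q N + B1 N.
Proof.
rewrite /Q psumS subrr mulr0 addr0 /B1 -psumD; apply: eq_psum => n _.
by rewrite -natr1; ring.
Qed.

Lemma B1_homo N N' : (N <= N')%N -> B1 N <= B1 N'.
Proof. by apply: le_psum => n; rewrite mulr_ge0. Qed.

(** [Q] is a summatory function of the monotone [B1], so a difference quotient of [Q] squeezes
    [B1]. *)
Lemma Q_diff N N' : (N <= N')%N ->
  (N'%:R - N%:R) * B1 N <= Q N' - Q N /\ Q N' - Q N <= (N'%:R - N%:R) * B1 N'.
Proof.
move=> /subnKC <-; elim: (N' - N)%N => [|k [IH1 IH2]]; first by rewrite addn0 !subrr !mul0r.
have h1 := @B1_homo N (N + k) (leq_addr _ _).
have h2 := @B1_homo (N + k) (N + k).+1 (leqnSn _).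
rewrite addnS QS -natr1; move: IH1 IH2; rewrite natrD.
have h3 : 0 <= (k%:R : R) by [].
split; nra.
Qed.

Lemma exp1D_le m (z : R) : 0 <= z <= 2 -> (1 + z) ^+ m <= 1 + m%:R * 3 ^+ m * z.
Proof.
move=> /andP[z0 z2]; elim: m => [|m IH]; first by rewrite expr0 !mul0r addr0.
rewrite exprS -natr1 [3 ^+ m.+1]exprS.
have h : 1 <= 3 ^+ m :> R by rewrite exprn_ege1//; lra.
have h2 : 0 <= m%:R * 3 ^+ m * z :> R by rewrite !mulr_ge0// ltW// exprn_gt0.
apply: le_trans (ler_wpM2l _ IH) _; first lra.
have h3 : m%:R * 3 ^+ m * z * z <= m%:R * 3 ^+ m * z * 2 by rewrite ler_wpM2l.
have h4 : z <= 3 ^+ m * z by rewrite ler_peMl.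
have h5 : 0 <= 3 ^+ m * z by rewrite mulr_ge0//; lra.
move: h2 h3 h4 h5; rewrite -!mulrA; set m' := m%:R : R; set T := 3 ^+ m : R.
by nra.
Qed.

Lemma exp1B_ge m (z : R) : 0 <= z <= 1 -> 1 - m%:R * z <= (1 - z) ^+ m.
Proof.
move=> /andP[z0 z1]; elim: m => [|m IH]; first by rewrite mul0r subr0.
rewrite exprS -natr1; apply: le_trans (ler_wpM2l _ IH); last lra.
have : 0 <= m%:R * z * z by rewrite !mulr_ge0.
by nra.
Qed.

Lemma cube_gap (x y : R) : 0 <= x -> x <= y ->
  (y - x) * (3 * x ^+ 2) <= y ^+ 3 - x ^+ 3 /\ y ^+ 3 - x ^+ 3 <= (y - x) * (3 * y ^+ 2).
Proof.
move=> x0 xy; have -> : y ^+ 3 - x ^+ 3 = (y - x) * (y ^+ 2 + x * y + x ^+ 2) by ring.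
by split; rewrite ler_wpM2l ?subr_ge0//; nra.
Qed.

Lemma exp_gap (a r : nat) : (a + r)%:R ^+ d.-1 * r%:R <= ((a + r) ^ d)%:R - (a ^ d)%:R :> R.
Proof.
rewrite -{2 3}(prednK d_gt0) /=; set e := d.-1.
rewrite lerBrDr -natrX -natrM -natrD ler_nat !expnSr mulnDr addnC leq_add2r leq_mul2r.
by case: (e) => [|k]; rewrite ?orbT// leq_exp2r// leq_addr orbT.
Qed.

Lemma ex_root m Y : (0 < m)%N -> exists t, (t ^ m <= Y < t.+1 ^ m)%N.
Proof.
move=> m0; elim: Y => [|Y [t /andP[h1 h2]]]; first by exists 0%N; rewrite exp0n// exp1n.
have [h|h] := ltnP Y.+1 (t.+1 ^ m); first by exists t; rewrite h andbT leqW.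
by exists t.+1; rewrite h /=; apply: leq_ltn_trans h2 _; rewrite ltn_exp2r.
Qed.

(** The difference quotient of [Q] between the [d]-th powers of [t + 1] and [t + 1 + r]. The gap is
    at least about [t ^ (d - 1) * r], so the error of [Q] contributes a relative [1 / r]; moving the
    argument contributes [r / t]. The condition [r ^ 2 <= t] makes the second at most the first. *)
Lemma B1_upper Y t r : (0 < r)%N -> (r ^ 2 <= t)%N -> (t ^ d <= Y < t.+1 ^ d)%N ->
  B1 Y <= 3 * c * Y%:R ^+ 2 +
   (6 * c * (2 * d)%:R * 3 ^+ (2 * d) + 2 * C * 3 ^+ (3 * d).-1) * Y%:R ^+ 2 / r%:R.
Proof.
move=> r0 rt /andP[tY Yt].
set z := r%:R^-1 : R; set T := t%:R : R; set rho := r%:R : R.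
have rho1 : 1 <= rho by rewrite ler1n.
have zr : rho * z = 1 by rewrite mulfV// pnatr_eq0 -lt0n.
have z0 : 0 < z by rewrite invr_gt0 ltr0n.
have rT : rho ^+ 2 <= T by rewrite /T -natrX ler_nat.
have T1 : 1 <= T by nra.
have rTz : rho <= T * z.
  by have : rho ^+ 2 * z <= T * z by [rewrite ler_wpM2r// ltW]; rewrite expr2 -mulrA zr mulr1.
have z1 : z <= 1 by rewrite -zr ler_peMl// ltW.
set N0 := (t.+1 ^ d)%N; set N1 := ((t.+1 + r) ^ d)%N.
have N01 : (N0 <= N1)%N by rewrite leq_exp2r// leq_addr.
have gap := exp_gap t.+1 r; rewrite -/N0 -/N1 in gap.
set g := N1%:R - N0%:R in gap.
have ta : T <= (t.+1 + r)%:R by rewrite ler_nat addSn -addnS leq_addr.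
have tb : (t.+1 + r)%:R <= T * (1 + 2 * z).
  by rewrite natrD -natr1 -/T -/rho; nra.
have tb0 : (t.+1)%:R <= T * (1 + 2 * z).
  by apply: le_trans tb; rewrite ler_nat leq_addr.
have g0 : T ^+ d.-1 * rho <= g.
  by apply: le_trans gap; rewrite ler_wpM2r// lerXn2r// nnegrE.
have Te : 0 < T ^+ d.-1 by rewrite exprn_gt0//; lra.
have gpos : 0 < g by nra.
have [h1 _] := Q_diff N01; rewrite -/g in h1.
have hB : B1 Y <= B1 N0 by apply: B1_homo; exact: ltnW.
have q1 := Q_est0 (t.+1 + r); have q0 := Q_est0 t.+1.
rewrite -/N0 in q0; rewrite -/N1 in q1.
have e3 m : m%:R ^+ (3 * d) = (m ^ d)%:R ^+ 3 :> R by rewrite natrX -exprM mulnC.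
rewrite !e3 in q1 q0.
set D := (3 * d).-1; set T3 := T ^+ (2 * d).
have pw (x : R) : 0 <= x -> x <= T * (1 + 2 * z) -> x ^+ D <= 3 ^+ D * (T3 * (g * z)).
  move=> x0 xT; apply: (@le_trans _ _ ((3 * T) ^+ D)).
    by rewrite lerXn2r ?nnegrE//; [nra|apply: le_trans xT _; nra].
  rewrite exprMn ler_wpM2l ?exprn_ge0//.
  rewrite {1}/D exp_split.
  rewrite exprD ler_wpM2l ?exprn_ge0//.
  by rewrite -(mulr1 (T ^+ d.-1)) -zr mulrA ler_wpM2r// ltW.
have p1 := pw _ (ler0n _ _) tb; have p0 := pw _ (ler0n _ _) tb0.
have cg : N1%:R ^+ 3 - N0%:R ^+ 3 <= g * (3 * N1%:R ^+ 2) :> R.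
  have n01 : N0%:R <= N1%:R :> R by rewrite ler_nat.
  have n0 : 0 <= N0%:R :> R by [].
  by have [_] := cube_gap n0 n01.
have main : g * B1 Y <= g * (3 * c * N1%:R ^+ 2 + 2 * C * 3 ^+ D * (T3 * z)).
  apply: le_trans (ler_wpM2l (ltW gpos) hB) _; apply: le_trans h1 _.
  have a1 : Q N1 - Q N0 <= c * (N1%:R ^+ 3 - N0%:R ^+ 3) + C * (t.+1 + r)%:R ^+ D + C * t.+1%:R ^+ D.
    by move: q1 q0; rewrite -/D !ler_norml => /andP[? ?] /andP[? ?]; lra.
  apply: le_trans a1 _.
  have a2 := ler_wpM2l c_ge0 cg; have a3 := ler_wpM2l C_ge0 p1; have a4 := ler_wpM2l C_ge0 p0.
  apply: le_trans (lerD (lerD a2 a3) a4) _.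
  by rewrite le_eqVlt; apply/orP; left; apply/eqP; ring.
rewrite ler_pM2l// in main.
have N1e : N1%:R ^+ 2 <= T3 * (1 + (2 * d)%:R * 3 ^+ (2 * d) * (2 * z)) :> R.
  rewrite natrX -exprM mulnC; apply: (@le_trans _ _ ((T * (1 + 2 * z)) ^+ (2 * d))).
    by rewrite lerXn2r ?nnegrE//; nra.
  rewrite exprMn ler_wpM2l ?exprn_ge0//.
  by apply: exp1D_le; lra.
have T3Y : T3 <= Y%:R ^+ 2.
  by rewrite /T3 [(2 * d)%N]mulnC exprM /T -natrX lerXn2r ?nnegrE// ler_nat.
have b1 : 3 * c * N1%:R ^+ 2 <= 3 * c * (Y%:R ^+ 2 * (1 + (2 * d)%:R * 3 ^+ (2 * d) * (2 * z))).
  rewrite ler_wpM2l ?mulr_ge0//; apply: le_trans N1e _; rewrite ler_wpM2r//.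
  by rewrite addr_ge0// !mulr_ge0 ?exprn_ge0// ltW.
have b2 : 2 * C * 3 ^+ D * (T3 * z) <= 2 * C * 3 ^+ D * (Y%:R ^+ 2 * z).
  by rewrite ler_wpM2l ?mulr_ge0 ?exprn_ge0// ler_wpM2r// ltW.
apply: le_trans main _; apply: le_trans (lerD b1 b2) _.
by rewrite le_eqVlt; apply/orP; left; apply/eqP; ring.
Qed.

Lemma B1_lower Y t r : (0 < r)%N -> (r ^ 2 <= t)%N -> (t ^ d <= Y < t.+1 ^ d)%N ->
  3 * c * Y%:R ^+ 2 -
   (6 * c * (2 * d)%:R * 2 ^+ (2 * d) + 2 * C) * Y%:R ^+ 2 / r%:R <= B1 Y.
Proof.
move=> r0 rt /andP[tY Yt].
set z := r%:R^-1 : R; set T := t%:R : R; set rho := r%:R : R.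
have rho1 : 1 <= rho by rewrite ler1n.
have zr : rho * z = 1 by rewrite mulfV// pnatr_eq0 -lt0n.
have z0 : 0 < z by rewrite invr_gt0 ltr0n.
have rT : rho ^+ 2 <= T by rewrite /T -natrX ler_nat.
have T1 : 1 <= T by nra.
have rTz : rho <= T * z.
  by have : rho ^+ 2 * z <= T * z by [rewrite ler_wpM2r// ltW]; rewrite expr2 -mulrA zr mulr1.
have z1 : z <= 1 by rewrite -zr ler_peMl// ltW.
have rlt : (r <= t)%N by apply: leq_trans rt; rewrite -{1}(expn1 r) leq_pexp2l.
set N0 := ((t - r) ^ d)%N; set N1 := (t ^ d)%N.
have N01 : (N0 <= N1)%N by rewrite leq_exp2r// leq_subr.
have gap := exp_gap (t - r) r; rewrite subnK// -/N0 -/N1 in gap.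
set g := N1%:R - N0%:R in gap; rewrite -/T -/rho in gap.
have Te : 0 < T ^+ d.-1 by rewrite exprn_gt0//; lra.
have gpos : 0 < g by nra.
have [_ h1] := Q_diff N01; rewrite -/g in h1.
have hB : B1 N1 <= B1 Y by apply: B1_homo.
have q1 := Q_est0 t; have q0 := Q_est0 (t - r).
rewrite -/N0 in q0; rewrite -/N1 in q1.
have e3 m : m%:R ^+ (3 * d) = (m ^ d)%:R ^+ 3 :> R by rewrite natrX -exprM mulnC.
rewrite !e3 in q1 q0.
set D := (3 * d).-1; set T3 := T ^+ (2 * d).
have pw : T ^+ D <= T3 * (g * z).
  rewrite {1}/D exp_split.
  rewrite exprD ler_wpM2l ?exprn_ge0//.
  by rewrite -(mulr1 (T ^+ d.-1)) -zr mulrA ler_wpM2r// ltW.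
have p0 : (t - r)%:R ^+ D <= T ^+ D by rewrite lerXn2r ?nnegrE// ler_nat leq_subr.
have cg : g * (3 * N0%:R ^+ 2) <= N1%:R ^+ 3 - N0%:R ^+ 3 :> R.
  have n01 : N0%:R <= N1%:R :> R by rewrite ler_nat.
  have n0 : 0 <= N0%:R :> R by [].
  by have [] := cube_gap n0 n01.
have main : g * (3 * c * N0%:R ^+ 2 - 2 * C * (T3 * z)) <= g * B1 Y.
  apply: le_trans (ler_wpM2l (ltW gpos) hB); apply: le_trans h1.
  have a1 : c * (N1%:R ^+ 3 - N0%:R ^+ 3) - C * T ^+ D - C * (t - r)%:R ^+ D <= Q N1 - Q N0.
    by move: q1 q0; rewrite -/D -/T !ler_norml => /andP[? ?] /andP[? ?]; lra.
  apply: le_trans a1.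
  have a2 := ler_wpM2l c_ge0 cg; have a3 := ler_wpM2l C_ge0 pw.
  have a4 := ler_wpM2l C_ge0 (le_trans p0 pw).
  apply: le_trans (lerB (lerB a2 a3) a4).
  by rewrite le_eqVlt; apply/orP; left; apply/eqP; ring.
rewrite ler_pM2l// in main.
have T3Y : T3 <= Y%:R ^+ 2.
  by rewrite /T3 [(2 * d)%N]mulnC exprM /T -natrX lerXn2r ?nnegrE// ler_nat.
have N0e : Y%:R ^+ 2 - (2 * d)%:R * (2 * z) * (2 ^+ (2 * d) * Y%:R ^+ 2) <= N0%:R ^+ 2 :> R.
  rewrite [N0%:R]natrX -exprM [(d * 2)%N]mulnC natrB// -/T -/rho.
  pose w := (rho + 1) / (T + 1).
  have wE : T - rho = (T + 1) * (1 - w) by rewrite /w; field; lra.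
  have w0 : 0 <= w by rewrite divr_ge0//; lra.
  have w2 : w <= 2 * z.
    rewrite /w ler_pdivrMr; last lra.
    by apply: (@le_trans _ _ (2 * rho)); [lra|nra].
  have w1 : w <= 1 by rewrite /w ler_pdivrMr; [nra|lra].
  rewrite wE exprMn; apply: le_trans (ler_wpM2l _ (exp1B_ge (2 * d) _)); rewrite ?w0 ?w1//; last first.
    by rewrite exprn_ge0//; lra.
  have u1 : Y%:R ^+ 2 <= (T + 1) ^+ (2 * d).
    by rewrite [(2 * d)%N]mulnC exprM /T natr1 -[t.+1%:R ^+ d]natrX lerXn2r ?nnegrE// ler_nat ltnW.
  have u2 : (T + 1) ^+ (2 * d) <= 2 ^+ (2 * d) * Y%:R ^+ 2.
    apply: (@le_trans _ _ ((2 * T) ^+ (2 * d))); first by rewrite lerXn2r ?nnegrE//; lra.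
    by rewrite exprMn ler_wpM2l// exprn_ge0.
  rewrite mulrBr mulr1 lerB// mulrC.
  by apply: ler_pM => //; [rewrite mulr_ge0|rewrite exprn_ge0//; lra|rewrite ler_wpM2l].
have b1 : 3 * c * (Y%:R ^+ 2 - (2 * d)%:R * (2 * z) * (2 ^+ (2 * d) * Y%:R ^+ 2)) <= 3 * c * N0%:R ^+ 2.
  by rewrite ler_wpM2l ?mulr_ge0.
have b2 : 2 * C * (T3 * z) <= 2 * C * (Y%:R ^+ 2 * z).
  by rewrite ler_wpM2l ?mulr_ge0// ler_wpM2r// ltW.
apply: le_trans main; apply: le_trans (lerB b1 b2).
by rewrite le_eqVlt; apply/orP; left; apply/eqP; ring.
Qed.

Let s := unsmooth_exp R d.

(** Taking [r] close to the square root of [t], and [t] close to the [d]-th root of [Y], gives the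
    relative error [Y ^ (- 1 / (2 d))]; this is the origin of [unsmooth_exp]. *)
Lemma B1_est : exists2 C' : R, 0 <= C' & forall Y, (0 < Y)%N ->
  `|B1 Y - 3 * c * Y%:R ^+ 2| <= C' * (Y%:R * Y%:R `^ s).
Proof.
set K1 := 6 * c * (2 * d)%:R * 3 ^+ (2 * d) + 2 * C * 3 ^+ (3 * d).-1.
set K2 := 6 * c * (2 * d)%:R * 2 ^+ (2 * d) + 2 * C.
have K10 : 0 <= K1 by rewrite addr_ge0// !mulr_ge0// exprn_ge0.
have K20 : 0 <= K2 by rewrite addr_ge0// !mulr_ge0// exprn_ge0.
exists (2 * (K1 + K2)) => [|Y Y0]; first lra.
have [t /andP[h1 h2]] := @ex_root d Y d_gt0.
have t0 : (0 < t)%N by move: h2; case: (t) => //; rewrite exp1n; lia.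
have [r /andP[h3 h4]] := @ex_root 2 t isT.
have r0 : (0 < r)%N by move: h4; case: (r) => //; rewrite exp1n; lia.
have ht : (t ^ d <= Y < t.+1 ^ d)%N by rewrite h1.
have := B1_upper r0 h3 ht; have := B1_lower r0 h3 ht; rewrite -/K1 -/K2 => l u.
have zs : Y%:R ^+ 2 / r%:R <= 2 * (Y%:R * Y%:R `^ s).
  have Y2 : (Y < (2 * r) ^ (2 * d))%N.
    apply: leq_trans h2 _; rewrite expnM leq_exp2r//.
    by apply: leq_trans h4 _; rewrite leq_exp2r//; lia.
  have Yp : 0 < Y%:R :> R by rewrite ltr0n.
  have e2 : Y%:R `^ (2 * d)%:R^-1 <= 2 * r%:R :> R.
    have -> : 2 * r%:R = ((2 * r)%:R ^+ (2 * d)) `^ (2 * d)%:R^-1 :> R.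
      rewrite -powR_mulrn// -powRrM mulfV ?powRr1 ?natrM ?mulr_ge0//.
      by rewrite -natrM pnatr_eq0; lia.
    rewrite ge0_ler_powR ?nnegrE ?invr_ge0 ?exprn_ge0//.
    by rewrite -natrX ler_nat ltnW.
  have e1 : Y%:R `^ s * Y%:R `^ (2 * d)%:R^-1 = Y%:R :> R.
    rewrite -powRD; last by apply/implyP => _; rewrite gt_eqF.
    by rewrite /s /unsmooth_exp subrK powRr1.
  rewrite ler_pdivrMr ?ltr0n// expr2 -{2}e1 mulrCA -mulrA -mulrA mulrCA.
  rewrite [leRHS](_ : _ = Y%:R * (Y%:R `^ s * (2 * r%:R))); last by ring.
  by rewrite ler_pM2l// ler_wpM2l// powR_ge0.
have Z0 : 0 <= Y%:R ^+ 2 / r%:R :> R by rewrite divr_ge0// exprn_ge0.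
rewrite -[K2 * _ / _]mulrA in l; rewrite -[K1 * _ / _]mulrA in u.
move: zs Z0 l u; set Z := Y%:R ^+ 2 / r%:R; set W := Y%:R * _ => zs Z0 l u.
have W0 : 0 <= W by rewrite mulr_ge0 ?powR_ge0.
have p1 := ler_wpM2l K10 zs; have p2 := ler_wpM2l K20 zs.
have p3 := mulr_ge0 K10 W0; have p4 := mulr_ge0 K20 W0.
by rewrite ler_norml; apply/andP; split; lra.
Qed.

Lemma unsmooth : exists2 C' : R, 0 <= C' & forall Y,
  `|psum b Y - 6 * c * Y%:R| <= C' * Y%:R `^ s.
Proof.
have [C1 C10 hC1] := B1_est; have /andP[s0 s1] : 0 < s < 1 := unsmooth_exp_bounds R d_gt0.
exists (C1 + C1 * (2 / s) + 3 * c * (2 / s)) => [|Y].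
  by rewrite !addr_ge0 ?mulr_ge0 ?divr_ge0 ?invr_ge0// ltW.
case: Y => [|Y]; first by rewrite psum0 mulr0 subr0 normr0 mulr_ge0 ?powR_ge0// !addr_ge0 ?mulr_ge0 ?divr_ge0 ?invr_ge0// ltW.
(* [n + n - 1] is the increment of [n ^ 2], so the partial sums of [u] are the error term of
   [B1_est]; after division by [n] it leaves [6 c] and a harmonic term. *)
pose u n : R := n%:R * b n - 3 * c * (n%:R + n%:R - 1).
have pu n : psum u n = B1 n - 3 * c * n%:R ^+ 2.
  rewrite /u psumB psumZ; congr (_ - _ * _).
  by elim: n => [|n IH]; rewrite ?psum0 ?expr0n// psumS IH -natr1; ring.
have E : psum b Y.+1 - 6 * c * Y.+1%:R = psum (fun n => u n * n%:R^-1) Y.+1 - 3 * c * psum (fun n => n%:R^-1) Y.+1.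
  have -> : 6 * c * Y.+1%:R = psum (fun=> 6 * c) Y.+1 by rewrite psum_const mulrC.
  rewrite -psumZ -psumB -psumB; apply: eq_psum => n /andP[n0 _].
  by rewrite /u; field; rewrite pnatr_eq0 -lt0n.
have hn n : (0 < n)%N -> n%:R^-1 <= n%:R `^ s / n%:R :> R.
  by move=> n0; rewrite ler_peMl ?invr_ge0// powR_nat_ge1// ltW.
have h1 : `|3 * c * psum (fun n => n%:R^-1) Y.+1| <= 3 * c * (2 / s) * Y.+1%:R `^ s.
  have i0 : 0 <= psum (fun n => n%:R^-1) Y.+1 :> R by apply: psum_ge0 => n; rewrite invr_ge0.
  rewrite ger0_norm ?mulr_ge0//.
  rewrite -[leRHS]mulrA ler_wpM2l ?mulr_ge0//; apply: le_trans (sum_powR _ _); last by rewrite s0 ltW.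
  by apply: ler_psum => n /andP[n0 _]; exact: hn.
have h2 : `|psum (fun n => u n * n%:R^-1) Y.+1| <= (C1 + C1 * (2 / s)) * Y.+1%:R `^ s.
  rewrite psum_abel; apply: le_trans (ler_normD _ _) _; rewrite mulrDl; apply: lerD.
    rewrite pu normrM [X in _ * X]ger0_norm ?invr_ge0// ler_pdivrMr ?ltr0n//.
    by rewrite -[leRHS]mulrA [X in C1 * X]mulrC hC1.
  have : psum (fun n => C1 * (n%:R `^ s / n%:R)) Y.+1.-1 <= C1 * (2 / s) * Y.+1%:R `^ s.
    rewrite psumZ -mulrA ler_wpM2l//; apply: le_trans (sum_powR _ _) _; first by rewrite s0 ltW.
    by apply: ler_wpM2l; [rewrite divr_ge0// ltW|apply: ler_powR_nat => //; exact: ltW].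
  apply: le_trans; apply: ler_norm_psum => n /andP[n0 _].
  have np : 0 < n%:R :> R by rewrite ltr0n.
  have -> : n%:R^-1 - n.+1%:R^-1 = (n%:R * n.+1%:R)^-1 :> R.
    by rewrite -natr1; field; rewrite !gt_eqF//; lra.
  rewrite pu normrM [X in _ * X]ger0_norm ?invr_ge0 ?mulr_ge0// ler_pdivrMr ?mulr_gt0//.
  apply: le_trans (hC1 _ n0) _; rewrite -mulrA ler_wpM2l//.
  have -> : n%:R `^ s / n%:R * (n%:R * n.+1%:R) = n.+1%:R * n%:R `^ s :> R by field; rewrite gt_eqF.
  by rewrite ler_wpM2r ?powR_ge0// ler_nat.
rewrite E; apply: le_trans (ler_normB _ _) _.
by apply: le_trans (lerD h2 h1) _; rewrite -mulrDl.
Qed.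

End Unsmoothing.

Import VectorInternalTheory.

Local Open Scope classical_set_scope.

(** * Ideals as lattices *)

Lemma det_replace_row (T : comNzRingType) n (E : 'M[T]_n) i :
  (forall k j, k != i -> E k j = (k == j)%:R) -> \det E = E i i.
Proof.
move=> h; rewrite (expand_det_row E i).
have hc j : cofactor E i j = (1%:M : 'M[T]_n) j i.
  have -> : cofactor E i j = cofactor 1%:M i j.
    rewrite /cofactor; congr (_ * \det _); apply/matrixP => k l; rewrite !mxE.
    by rewrite h 1?eq_sym ?neq_lift.
  have := mul_mx_adj (1%:M : 'M[T]_n); rewrite mul1mx det1 => /matrixP/(_ j i).
  by rewrite !mxE.
rewrite (bigD1 i)//= hc !mxE eqxx mulr1 big1 ?addr0// => j ji.
by rewrite hc mxE (negbTE ji) mulr0.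
Qed.

Lemma rat_common_den m n (A : 'M[rat]_(m, n)) :
  exists2 D : nat, (0 < D)%N & D%:R *: A \is a mxOver Num.int.
Proof.
pose f (i : 'I_m) (j : 'I_n) : nat := `|denq (A i j)|%N.
exists (\prod_i \prod_j f i j)%N.
  by rewrite prodn_gt0// => i; rewrite prodn_gt0// => j; rewrite absz_gt0 denq_neq0.
apply/mxOverP => i j; rewrite mxE (bigD1 i)//= (bigD1 j)//= !natrM.
have -> : (f i j)%:R = (denq (A i j))%:~R :> rat by rewrite /f -[in RHS](gez0_abs (denq_ge0 _)).
set X := (\prod_(_ | _) _)%:R; set Y := (\prod_(_ | _) _)%:R.
have -> : (denq (A i j))%:~R * X * Y * A i j = X * Y * ((denq (A i j))%:~R * A i j) by ring.
rewrite rpredM//; first by rewrite rpredM ?natr_int.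
rewrite mulrC -{1}(divq_num_den (A i j)) mulfVK ?intr_int//.
by rewrite intr_eq0 denq_neq0.
Qed.

Lemma mxintB m n (A B : 'M[rat]_(m, n)) : A \is a mxOver Num.int ->
  B \is a mxOver Num.int -> A - B \is a mxOver Num.int.
Proof.
move=> /mxOverP hA /mxOverP hB; apply/mxOverP => i j; rewrite !mxE.
by rewrite rpredB ?hA ?hB.
Qed.

Section Lattices.
Variable F : fieldExtType rat.
Local Notation d := (dim F).
Local Notation O := (@ring_of_integers F).
Implicit Types (x y : F) (M : set F) (A B : 'M[rat]_d).

Definition cv (x : F) : 'rV[rat]_d := @v2r _ F x.
Definition vc (r : 'rV[rat]_d) : F := @r2v _ F r.

Lemma cvK : cancel cv vc. Proof. exact: v2rK. Qed.
Lemma vcK : cancel vc cv. Proof. exact: r2vK. Qed.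

Fact cv_is_linear : linear cv. Proof. exact: linearP. Qed.
Fact vc_is_linear : linear vc. Proof. exact: linearP. Qed.
HB.instance Definition _ := GRing.isLinear.Build rat F 'rV_d _ cv cv_is_linear.
HB.instance Definition _ := GRing.isLinear.Build rat 'rV_d F _ vc vc_is_linear.

Lemma d_gt0 : (0 < d)%N.
Proof. by rewrite -(dimvf F) adim_gt0. Qed.

Definition mulM x : 'M[rat]_d := lin1_mx (cv \o (fun z => z * x) \o vc).

Lemma mulME x y : cv (y * x) = cv y *m mulM x.
Proof.
have lin : linear (cv \o (fun z => z * x) \o vc : 'rV_d -> 'rV_d).
  by move=> c u w /=; rewrite linearP mulrDl -scalerAl linearP.
pose f := GRing.isLinear.Build _ _ _ _ _ lin.
pose g : {linear 'rV_d -> 'rV_d} := HB.pack (cv \o (fun z => z * x) \o vc) f.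
by rewrite /mulM -[cv \o _ \o _]/(g : _ -> _) mul_rV_lin1 /= cvK.
Qed.

Lemma mulM_eq x A : (forall y, cv (y * x) = cv y *m A) -> mulM x = A.
Proof.
move=> h; apply/row_matrixP => i; rewrite !rowE -[delta_mx 0 i]vcK.
by rewrite -mulME h.
Qed.

Lemma mulM_mul x y : mulM (x * y) = mulM x *m mulM y.
Proof. by apply: mulM_eq => z; rewrite mulrA !mulME mulmxA. Qed.

Lemma mulM_add x y : mulM (x + y) = mulM x + mulM y.
Proof. by apply: mulM_eq => z; rewrite mulrDr linearD /= !mulME mulmxDr. Qed.

Lemma mulM_alg (c : rat) : mulM (c%:A) = c%:M.
Proof. by apply: mulM_eq => z; rewrite -scalerAr mulr1 linearZ mul_mx_scalar. Qed.

Lemma mulM1 : mulM 1 = 1%:M.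
Proof. by rewrite -(mulM_alg 1) scale1r. Qed.

Lemma mulMZ (c : rat) x : mulM (c *: x) = c *: mulM x.
Proof. by rewrite -[c *: x]mulr_algl mulM_mul mulM_alg mul_scalar_mx. Qed.

Lemma mulM_unit x : x != 0 -> mulM x \in unitmx.
Proof.
by move=> x0; apply: (mulmx1_unit (B := mulM x^-1) _).1; rewrite -mulM_mul mulfV// mulM1.
Qed.

Definition Nm x : rat := \det (mulM x).
Definition Tr x : rat := \tr (mulM x).

Lemma NmM x y : Nm (x * y) = Nm x * Nm y.
Proof. by rewrite /Nm mulM_mul det_mulmx. Qed.

Lemma Nm1 : Nm 1 = 1. Proof. by rewrite /Nm mulM1 det1. Qed.

Lemma Nm_eq0 x : (Nm x == 0) = (x == 0).
Proof.
apply/idP/eqP => [|->]; last first.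
  rewrite -(scale0r 1) /Nm mulM_alg det_scalar expr0n.
  by have := d_gt0; rewrite lt0n => /negbTE ->.
apply: contraTeq => x0; have := mulM_unit x0; by rewrite unitmxE unitfE.
Qed.

Lemma NmZ (c : rat) x : Nm (c *: x) = c ^+ d * Nm x.
Proof. by rewrite /Nm mulMZ detZ. Qed.

Lemma TrD x y : Tr (x + y) = Tr x + Tr y.
Proof. by rewrite /Tr mulM_add mxtraceD. Qed.

Lemma TrZ (c : rat) x : Tr (c *: x) = c * Tr x.
Proof. by rewrite /Tr mulMZ mxtraceZ. Qed.

Definition crd B x : 'rV[rat]_d := cv x *m invmx B.
Definition Lat B : set F := [set x | crd B x \is a mxOver Num.int].

Lemma crdD B x y : crd B (x + y) = crd B x + crd B y.
Proof. by rewrite /crd linearD mulmxDl. Qed.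
Lemma crdN B x : crd B (- x) = - crd B x.
Proof. by rewrite /crd linearN mulNmx. Qed.
Lemma crdB B x y : crd B (x - y) = crd B x - crd B y.
Proof. by rewrite crdD crdN. Qed.
Lemma crdZ B c x : crd B (c *: x) = c *: crd B x.
Proof. by rewrite /crd linearZ scalemxAl. Qed.
Lemma crd_vc B (r : 'rV_d) : B \in unitmx -> crd B (vc (r *m B)) = r.
Proof. by move=> uB; rewrite /crd vcK mulmxK. Qed.
Lemma crdK B x : B \in unitmx -> vc (crd B x *m B) = x.
Proof. by move=> uB; rewrite /crd mulmxKV// cvK. Qed.

Definition is_subgroup M := M 0 /\ forall x y, M x -> M y -> M (x - y).

Lemma subgN M x : is_subgroup M -> M x -> M (- x).
Proof. by move=> [M0 MB] h; rewrite -sub0r; apply: MB. Qed.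

Lemma subgD M x y : is_subgroup M -> M x -> M y -> M (x + y).
Proof. by move=> hM hx hy; rewrite -[y]opprK; apply: hM.2 => //; apply: subgN. Qed.

Lemma subg_sum M (I : Type) (r : seq I) (P : pred I) (f : I -> F) : is_subgroup M ->
  (forall i, P i -> M (f i)) -> M (\sum_(i <- r | P i) f i).
Proof. by move=> hM h; apply: big_ind => //; [exact: hM.1|move=> x y; exact: subgD]. Qed.

Lemma subg_int M (c : rat) x : is_subgroup M -> c \is a Num.int -> M x -> M (c *: x).
Proof.
move=> hM /intrP[m ->] hx.
have hn (n : nat) : M (n%:~R *: x).
  elim: n => [|n IH]; first by rewrite scale0r; exact: hM.1.
  by rewrite -addn1 PoszD rmorphD scalerDl scale1r; apply: subgD.
case: m => [//|n]; rewrite NegzE rmorphN scaleNr; apply: subgN => //; exact: hn.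
Qed.

Lemma Lat_subgroup B : is_subgroup (Lat B).
Proof.
split=> [|x y hx hy]; rewrite /Lat /=.
  by rewrite /crd linear0 mul0mx mxOver0 ?rpred0.
by rewrite crdB mxintB.
Qed.

Lemma vc_sum (r : 'rV_d) B : vc (r *m B) = \sum_i r 0 i *: vc (row i B).
Proof.
rewrite mulmx_sum_row linear_sum; apply: eq_bigr => i _; by rewrite linearZ.
Qed.

(** Among the bases of the space with rows in [M], one of least determinant generates [M]: if an
    element of [M] had a fractional coordinate, replacing the corresponding row by the fractional
    part would multiply the determinant by a factor strictly between 0 and 1. *)
Lemma lattice_basis M B0 : is_subgroup M -> B0 \in unitmx -> M `<=` Lat B0 ->
  (forall x, exists2 n : nat, (0 < n)%N & M (n%:R *: x)) ->
  exists2 B, B \in unitmx & M = Lat B.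
Proof.
move=> hM uB0 hb hs.
pose rowsM A := forall i, M (vc (row i A)).
pose P k := exists A, [/\ A \in unitmx, rowsM A & `|\det (A *m invmx B0)| = k%:R].
have intA A : rowsM A -> A *m invmx B0 \is a mxOver Num.int.
  move=> hA; apply/mxOverP => i j; have /mxOverP/(_ 0 j) := hb _ (hA i).
  by rewrite /crd vcK -row_mul mxE.
have detA A : rowsM A -> exists k, `|\det (A *m invmx B0)| = k%:R.
  move=> /intA/mxOverP h; have : \det (A *m invmx B0) \is a Num.int.
    rewrite /determinant rpred_sum// => s _; rewrite rpredM ?rpred_sign//.
    by rewrite rpred_prod// => i _.
  by move=> /natr_norm_int/natrP.
have exP : exists k, `[< P k >].
  pose n i := projT1 (cid2 (hs (vc (delta_mx 0 i)))).
  pose A : 'M[rat]_d := diag_mx (\row_i (n i)%:R).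
  have hA : rowsM A.
    move=> i; rewrite /A row_diag_mx mxE linearZ /=.
    by rewrite /n; case: (cid2 _).
  have uA : A \in unitmx.
    rewrite unitmxE unitfE det_diag; apply/prodf_neq0 => i _; rewrite mxE pnatr_eq0 -lt0n.
    by rewrite /n; case: (cid2 _).
  by have [k hk] := detA A hA; exists k; apply/asboolP; exists A.
case: (ex_minnP exP) => k /asboolP[A [uA hA hk]] kmin.
exists A => //; apply/seteqP; split=> x /=; last first.
  move=> hx; rewrite -(crdK x uA) vc_sum; apply: subg_sum => // i _.
  by apply: subg_int => //; exact: (mxOverP hx).
move=> hx; apply: contrapT => hnx.
pose c := crd A x; pose fl : 'rV[rat]_d := \row_i (Num.floor (c 0 i))%:~R.
pose y := x - vc (fl *m A).
have hy : M y.
  apply: hM.2 => //; rewrite vc_sum; apply: subg_sum => // i _.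
  by apply: subg_int => //; rewrite mxE intr_int.
have cy : crd A y = c - fl by rewrite crdB crd_vc.
have [i ci] : exists i, c 0 i \isn't a Num.int.
  apply: contrapT => hno; apply: hnx; apply/mxOverP => j0 i; rewrite ord1.
  by apply: contrapT => hi; apply: hno; exists i; apply/negP.
have fi : 0 < (c - fl) 0 i < 1.
  have hfl := floor_itv (c 0 i).
  have -> : (c - fl) 0 i = c 0 i - (Num.floor (c 0 i))%:~R.
    by rewrite [LHS]mxE [(- fl) _ _]mxE [fl _ _]mxE.
  move: hfl; rewrite intrD => /andP[h1 h2].
  have h3 : (Num.floor (c 0 i))%:~R != c 0 i by apply: contra ci => /eqP <-; rewrite intr_int.
  have h4 : (Num.floor (c 0 i))%:~R < c 0 i by rewrite lt_neqAle h3.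
  by lra.
pose E : 'M[rat]_d := \matrix_(k, j) if k == i then (c - fl) 0 j else (k == j)%:R.
have detE : \det E = (c - fl) 0 i.
  rewrite (det_replace_row (i := i)); first by rewrite [LHS]mxE eqxx.
  by move=> k' j hk'; rewrite mxE (negbTE hk').
have hEA : rowsM (E *m A).
  move=> k'; rewrite row_mul; have [->|ki] := eqVneq k' i.
    have -> : row i E = c - fl by apply/rowP => j; rewrite [LHS]mxE [LHS]mxE eqxx.
    by rewrite -cy crdK.
  have -> : row k' E = delta_mx 0 k'.
    by apply/rowP => j; rewrite !mxE (negbTE ki) eqxx/= eq_sym.
  by rewrite -rowE.
have uE : E \in unitmx by rewrite unitmxE detE unitfE gt_eqF//; case/andP: fi.
have [k' hk'] := detA _ hEA.
have : (k <= k')%N by apply: kmin; apply/asboolP; exists (E *m A); split=> //; rewrite unitmx_mul uE.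
rewrite leqNgt => /negP; apply; rewrite -(ltr_nat rat) -hk -hk' -mulmxA det_mulmx normrM detE.
have /andP[f0 f1] := fi; rewrite (gtr0_norm f0) gtr_pMl// normr_gt0 -unitfE -unitmxE.
by rewrite unitmx_mul uA unitmx_inv.
Qed.

(** The rows of [B], read as field elements, form an eigenvector of an integer matrix with
    eigenvalue [x]; so [x] is a root of its characteristic polynomial, which is monic. *)
Lemma int_mx_integral x B : B \in unitmx ->
  B *m mulM x *m invmx B \is a mxOver Num.int -> O x.
Proof.
move=> uB; set A := _ *m invmx B => hA.
have hAB : A *m B = B *m mulM x by rewrite mulmxKV.
clearbody A.
pose A' : 'M[int]_d := \matrix_(i, j) Num.floor (A j i).
pose b : 'rV[F]_d := \row_i vc (row i B).
exists (char_poly A'); first exact: char_poly_monic.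
rewrite -/(map_poly _ _) (map_char_poly (intr : {rmorphism int -> F})) -eigenvalue_root_char.
apply/eigenvalueP; exists b.
  apply/rowP => i; rewrite mxE [RHS]mxE [b 0 i]mxE.
  have -> : x * vc (row i B) = vc (row i A *m B).
    have -> : row i A *m B = cv (vc (row i B) * x) by rewrite mulME vcK -!row_mul hAB.
    by rewrite cvK mulrC.
  rewrite vc_sum; apply: eq_bigr => j _; rewrite [b 0 j]mxE [map_mx _ _ _ _]mxE [A' _ _]mxE.
  rewrite [row i A 0 j]mxE mulrC.
  have /mxOverP/(_ i j) := hA; rewrite intrEfloor => /eqP{2}<-.
  by rewrite scaler_int mulrzl.
apply/eqP => b0; have i0 : 'I_d by exact: Ordinal d_gt0.
have /rowP/(_ i0) := b0; rewrite !mxE => /(congr1 cv); rewrite vcK linear0 => h.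
have := uB; rewrite -row_free_unit => /row_freeP[C] /(congr1 (row i0)).
rewrite row_mul h mul0mx => /rowP/(_ i0); rewrite !mxE eqxx => /eqP.
by rewrite eq_sym oner_eq0.
Qed.

Lemma stable_int_mx x M B : B \in unitmx -> M = Lat B ->
  (forall y, M y -> M (y * x)) -> B *m mulM x *m invmx B \is a mxOver Num.int.
Proof.
move=> uB hM hx; apply/mxOverP => i j.
have hi : M (vc (row i B)).
  rewrite hM /Lat /= rowE crd_vc//; apply/mxOverP => k l; rewrite mxE.
  by case: (_ && _); rewrite ?rpred1 ?rpred0.
have := hx _ hi; rewrite {1}hM /Lat /= => /mxOverP/(_ 0 j).
by rewrite /crd mulME vcK -!row_mul mxE.
Qed.

Lemma ex_integer_multiple x : exists2 n : nat, (0 < n)%N & O (n%:R *: x).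
Proof.
have [D D0 hD] := rat_common_den (mulM x); exists D => //.
by apply: (@int_mx_integral _ 1%:M); rewrite ?unitmx1// invmx1 mul1mx mulmx1 mulMZ.
Qed.

(** The coordinate lattice times the powers of [x] below the degree of a monic equation is a lattice
    stable under [x]. In a basis of it, multiplication by [x] has an integer matrix, and trace and
    determinant do not depend on the basis. *)
Lemma integral_Tr_Nm x : O x -> Tr x \is a Num.int /\ Nm x \is a Num.int.
Proof.
case=> p pm px.
pose k := (size p).-1.
pose M : set F := [set y | exists c : 'I_k -> 'rV[rat]_d,
   (forall i, c i \is a mxOver Num.int) /\ y = \sum_i vc (c i) * x ^+ i].
have hM : is_subgroup M.
  split=> [|_ _ [c [hc ->]] [c' [hc' ->]]].
    exists (fun=> 0); split=> [i|]; first by rewrite mxOver0 ?rpred0.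
    by rewrite big1// => i _; rewrite linear0 mul0r.
  exists (fun i => c i - c' i); split=> [i|]; first by rewrite mxintB.
  by rewrite -sumrB; apply: eq_bigr => i _; rewrite linearB mulrBl.
have szp : size p = k.+1 by rewrite prednK// size_poly_gt0 monic_neq0.
have k0 : (0 < k)%N.
  rewrite lt0n; apply/eqP => k0; move: px; rewrite -[p]coefK szp k0 poly_def big_ord1.
  rewrite alg_polyC; have -> : p`_0 = 1.
    by have /monicP := pm; rewrite lead_coefE szp k0.
  by rewrite rmorph1 rootE hornerE oner_eq0.
have xk : x ^+ k = - \sum_(i < k) (p`_i)%:~R * x ^+ i.
  move: px; rewrite rootE horner_coef (size_map_poly_id0 _) ?(monicP pm) ?oner_eq0// szp.
  rewrite big_ord_recr/= !coef_map /=.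
  have -> : p`_k = 1 by have /monicP := pm; rewrite lead_coefE szp.
  rewrite mul1r => h; apply/eqP; rewrite -addr_eq0 addrC.
  by under eq_bigr => i _ do rewrite -(coef_map (intr : {rmorphism int -> F})).
have hx y : M y -> M (y * x).
  case=> c [hc ->]; rewrite mulr_suml; apply: subg_sum => // i _.
  rewrite -mulrA -exprSr.
  have [hi|hi] := ltnP i.+1 k.
    exists (fun j => if j == Ordinal hi then c i else 0); split=> [j|].
      by case: ifP => // _; rewrite mxOver0 ?rpred0.
    rewrite (bigD1 (Ordinal hi))//= eqxx big1 ?addr0// => j /negbTE ->.
    by rewrite linear0 mul0r.
  have -> : i.+1 = k by apply/eqP; rewrite eqn_leq hi ltn_ord.
  rewrite xk mulrN mulr_sumr; apply: subgN => //.
  exists (fun j => (p`_j)%:~R *: c i); split=> [j|].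
    by apply: mxOverZ => //; exact: intr_int.
  apply: eq_bigr => j _; rewrite linearZ /= mulrA; congr (_ * _).
  by rewrite mulrC -scaler_int mulr_algl.
have [D D0 hD] : exists2 D : nat, (0 < D)%N & forall i : 'I_k, D%:R *: mulM (x ^+ i) \is a mxOver Num.int.
  pose f (i : 'I_k) := projT1 (cid2 (rat_common_den (mulM (x ^+ i)))).
  have f0 i : (0 < f i)%N by rewrite /f; case: (cid2 _).
  exists (\prod_i f i)%N; first by rewrite prodn_gt0.
  move=> i; rewrite (bigD1 i)//= mulnC natrM -scalerA; apply: mxOverZ; first exact: natr_int.
  by rewrite /f; case: (cid2 _).
have DQ : D%:R != 0 :> rat by rewrite pnatr_eq0 -lt0n.
have [|||B uB hB] := @lattice_basis M (D%:R^-1)%:M hM.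
- by rewrite unitmxE det_scalar unitfE expf_neq0// invr_eq0.
- move=> _ [c [hc ->]]; apply: subg_sum; first exact: Lat_subgroup.
  move=> i _; rewrite /Lat /= /crd mulME vcK invmx_scalar invrK mul_mx_scalar scalemxAr.
  by apply: mxOverM => //; exact: hD.
- move=> y; have [E E0 hE] := rat_common_den (cv y); exists E => //.
  exists (fun i => if i == Ordinal k0 then E%:R *: cv y else 0); split=> [i|].
    by case: ifP => // _; rewrite mxOver0 ?rpred0.
  rewrite (bigD1 (Ordinal k0))//= ?eqxx expr0 mulr1 linearZ /= cvK big1 ?addr0// => i /negbTE ->.
  by rewrite linear0 mul0r.
have hA := stable_int_mx uB hB hx.
have -> : Tr x = \tr (B *m mulM x *m invmx B).
  by rewrite mxtrace_mulC mulmxA mulVmx// mul1mx.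
have -> : Nm x = \det (B *m mulM x *m invmx B).
  by rewrite !det_mulmx mulrAC -det_mulmx mulmxV// det1 mul1r.
move/mxOverP: hA => hA; split; first by rewrite rpred_sum.
rewrite /determinant rpred_sum// => s _; rewrite rpredM ?rpred_sign//.
by rewrite rpred_prod// => i _.
Qed.

Lemma OD x y : O x -> O y -> O (x + y).
Proof. exact: (@integral_add _ _ (intr : {rmorphism int -> F})). Qed.
Lemma OM x y : O x -> O y -> O (x * y).
Proof. exact: (@integral_mul _ _ (intr : {rmorphism int -> F})). Qed.
Lemma OB x y : O x -> O y -> O (x - y).
Proof. exact: (@integral_sub _ _ (intr : {rmorphism int -> F})). Qed.
Lemma ON x : O x -> O (- x).
Proof. exact: (@integral_opp _ _ (intr : {rmorphism int -> F})). Qed.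
Lemma O0 : O 0.
Proof. exact: (@integral0 _ _ (intr : {rmorphism int -> F})). Qed.
Lemma O1 : O 1.
Proof. exact: (@integral1 _ _ (intr : {rmorphism int -> F})). Qed.
Lemma O_nat n : O n%:R.
Proof. exact: (@integral_nat _ _ (intr : {rmorphism int -> F})). Qed.
Lemma OX x n : O x -> O (x ^+ n).
Proof. by move=> h; elim: n => [|n IH]; [exact: O1|rewrite exprS; exact: OM]. Qed.

Lemma O_subgroup : is_subgroup (O).
Proof. by split; [exact: O0|exact: OB]. Qed.

(** The ring contains a lattice with basis [e] and, its elements having integral traces, is
    contained in the dual lattice for the trace form. The form is nondegenerate because [y] times
    its inverse has trace [d]. *)
Lemma O_lattice : exists2 B, B \in unitmx & O = Lat B.
Proof.
pose n i := projT1 (cid2 (ex_integer_multiple (vc (delta_mx 0 i)))).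
pose e i : F := (n i)%:R *: vc (delta_mx 0 i).
have n0 i : (0 < n i)%N by rewrite /n; case: (cid2 _).
have eO i : O (e i) by rewrite /e /n; case: (cid2 _).
pose A : 'M[rat]_d := diag_mx (\row_i (n i)%:R).
have eA i : vc (row i A) = e i by rewrite /A row_diag_mx mxE linearZ.
have uA : A \in unitmx.
  by rewrite unitmxE unitfE det_diag; apply/prodf_neq0 => i _; rewrite mxE pnatr_eq0 -lt0n.
pose G : 'M[rat]_d := \matrix_(i, j) Tr (e i * e j).
have TrG (r : 'rV_d) j : (r *m G) 0 j = Tr (vc (r *m A) * e j).
  rewrite vc_sum mulr_suml mxE.
  have -> (s : seq 'I_d) (f : 'I_d -> F) : Tr (\sum_(i <- s) f i) = \sum_(i <- s) Tr (f i).
    elim: s => [|i s IH]; last by rewrite !big_cons TrD IH.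
    by rewrite !big_nil -(scale0r 1) TrZ mul0r.
  by apply: eq_bigr => i _; rewrite eA -scalerAl TrZ mxE.
have uG : G \in unitmx.
  rewrite -row_free_unit -kermx_eq0; apply/eqP/row_matrixP => i; rewrite row0.
  set r := row i _; have hr : r *m G = 0.
    by apply/eqP; rewrite -sub_kermx row_sub.
  pose y := vc (r *m A).
  have Ty z : Tr (y * z) = 0.
    rewrite -(crdK z uA) vc_sum mulr_sumr.
    have -> (s : seq 'I_d) (f : 'I_d -> F) : Tr (\sum_(i <- s) f i) = \sum_(i <- s) Tr (f i).
      elim: s => [|i' s IH]; last by rewrite !big_cons TrD IH.
      by rewrite !big_nil -(scale0r 1) TrZ mul0r.
    by rewrite big1// => j _; rewrite eA -scalerAr TrZ -TrG hr [X in _ * X]mxE mulr0.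
  have [y0|y0] := eqVneq y 0.
    move: y0 => /(congr1 cv); rewrite vcK linear0 => h.
    by rewrite -(mulmxK uA r) h mul0mx.
  have := Ty y^-1; rewrite mulfV// /Tr mulM1 mxtrace1 => /eqP.
  by rewrite pnatr_eq0; have := d_gt0; rewrite lt0n => /negbTE ->.
apply: (@lattice_basis _ (invmx G *m A)).
- exact: O_subgroup.
- by rewrite unitmx_mul unitmx_inv uG.
- move=> x hx; rewrite /Lat /= /crd.
  have -> : invmx (invmx G *m A) = invmx A *m G.
    have uX : invmx G *m A \in unitmx by rewrite unitmx_mul unitmx_inv uG.
    have E1 : invmx G *m A *m (invmx A *m G) = 1%:M by rewrite mulmxA mulmxK// mulVmx.
    by rewrite -[RHS](mulKmx uX) E1 mulmx1.
  rewrite mulmxA; apply/mxOverP => i j; rewrite ord1 TrG mulmxKV// cvK.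
  exact: (integral_Tr_Nm (OM hx (eO j))).1.
- exact: ex_integer_multiple.
Qed.

End Lattices.

(** * Products of ideals *)

Section Ideals.
Variable F : fieldExtType rat.
Local Notation d := (dim F).
Local Notation O := (@ring_of_integers F).
Implicit Types (x y a b : F) (I J A B C P : set F).

Definition nzideal I := is_ideal I /\ exists2 x, I x & x != 0.
Definition scl a I : set F := [set a * x | x in I].

Lemma ideal_O I x : is_ideal I -> I x -> O x.
Proof. by case=> h _ _ _; apply: h. Qed.

Lemma idealM I a x : is_ideal I -> O a -> I x -> I (a * x).
Proof. by case=> _ _ _ h; apply: h. Qed.

Lemma idealMr I a x : is_ideal I -> O a -> I x -> I (x * a).
Proof. by move=> *; rewrite mulrC; apply: idealM. Qed.

Lemma ideal_subgroup I : is_ideal I -> is_subgroup I.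
Proof.
move=> hI; have [h1 h2 h3 h4] := hI; split=> // x y hx hy.
by apply: h3 => //; rewrite -mulN1r; apply: h4 => //; apply: ON; exact: O1.
Qed.

Lemma O_ideal : is_ideal O.
Proof. by split=> //; [exact: O0|exact: OD|exact: OM]. Qed.

Lemma O_nz : nzideal O.
Proof. by split; [exact: O_ideal|exists 1; [exact: O1|exact: oner_neq0]]. Qed.

Lemma ideal_eqO I : is_ideal I -> I 1 -> I = O.
Proof.
move=> hI h1; apply/seteqP; split=> x; first exact: ideal_O.
by move=> hx; rewrite -[x]mulr1; apply: idealM.
Qed.

Lemma in_idm I J x y : I x -> J y -> ideal_mul I J (x * y).
Proof.
by move=> hx hy; exists 1%N, (fun=> x), (fun=> y); split=> //; rewrite big_ord1.
Qed.

Lemma idm_min I J (X : set F) : is_subgroup X -> (forall x y, I x -> J y -> X (x * y)) ->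
  ideal_mul I J `<=` X.
Proof.
move=> hX h _ [n [a [b [ha hb ->]]]]; apply: subg_sum => // i _; exact: h.
Qed.

Lemma idm_ideal I J : is_ideal I -> is_ideal J -> is_ideal (ideal_mul I J).
Proof.
move=> hI hJ; split.
- apply: idm_min; first exact: O_subgroup.
  by move=> x y hx hy; apply: OM; [exact: ideal_O hx|exact: ideal_O hy].
- by exists 0%N, (fun=> 0), (fun=> 0); split=> [[]|[]|]//; rewrite big_ord0.
- move=> _ _ [n [a [b [ha hb ->]]]] [m [a' [b' [ha' hb' ->]]]].
  exists (n + m)%N, (fun i => match fintype.split i with inl i => a i | inr i => a' i end),
    (fun i => match fintype.split i with inl i => b i | inr i => b' i end); split.
  + by move=> i; case: (fintype.split i).
  + by move=> i; case: (fintype.split i).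
  + rewrite big_split_ord /=; congr (_ + _); apply: eq_bigr => i _.
      by rewrite (unsplitK (inl _ i)).
    by rewrite (unsplitK (inr _ i)).
- move=> c _ hc [n [a [b [ha hb ->]]]]; exists n, (fun i => c * a i), b; split=> //.
    by move=> i; apply: idealM.
  by rewrite mulr_sumr; apply: eq_bigr => i _; rewrite mulrA.
Qed.

Lemma idm_nz I J : nzideal I -> nzideal J -> nzideal (ideal_mul I J).
Proof.
move=> [hI [x hx x0]] [hJ [y hy y0]]; split; first exact: idm_ideal.
by exists (x * y); [exact: in_idm|rewrite mulf_neq0].
Qed.

Lemma idmS I J I' J' : is_ideal I' -> is_ideal J' -> I `<=` I' -> J `<=` J' ->
  ideal_mul I J `<=` ideal_mul I' J'.
Proof.
move=> hI hJ h h'; apply: idm_min; first exact/ideal_subgroup/idm_ideal.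
by move=> x y hx hy; apply: in_idm; [exact: h|exact: h'].
Qed.

Lemma idmC I J : is_ideal I -> is_ideal J -> ideal_mul I J = ideal_mul J I.
Proof.
move=> hI hJ; apply/seteqP; split; apply: idm_min => [|x y hx hy];
  try exact/ideal_subgroup/idm_ideal; rewrite mulrC; exact: in_idm.
Qed.

Lemma subgroup_scl_inv (X : set F) z : is_subgroup X -> is_subgroup [set x | X (x * z)].
Proof.
move=> hX; split=> [|x y hx hy] /=; first by rewrite mul0r; exact: hX.1.
by rewrite mulrBl; apply: hX.2.
Qed.

Lemma idmA I J A : is_ideal I -> is_ideal J -> is_ideal A ->
  ideal_mul I (ideal_mul J A) = ideal_mul (ideal_mul I J) A.
Proof.
move=> hI hJ hA; apply/seteqP; split.
  apply: idm_min; first by do 2?apply: ideal_subgroup; do 2?apply: idm_ideal.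
  move=> x y hx hy; move: y hy.
  have hs : is_subgroup [set y | ideal_mul (ideal_mul I J) A (y * x)].
    by apply: subgroup_scl_inv; apply: ideal_subgroup; do 2?apply: idm_ideal.
  move=> y hy; rewrite mulrC; apply: (idm_min hs) hy => y' z hy' hz /=.
  by rewrite mulrC mulrA; apply: in_idm => //; apply: in_idm.
apply: idm_min; first by do 2?apply: ideal_subgroup; do 2?apply: idm_ideal.
move=> x y hx hy.
have hs : is_subgroup [set x | ideal_mul I (ideal_mul J A) (x * y)].
  by apply: subgroup_scl_inv; apply: ideal_subgroup; do 2?apply: idm_ideal.
apply: (idm_min hs) hx => x' z hx' hz /=.
by rewrite -mulrA; apply: in_idm => //; apply: in_idm.
Qed.

Lemma idm1 I : is_ideal I -> ideal_mul I O = I.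
Proof.
move=> hI; apply/seteqP; split.
  apply: idm_min; first exact: ideal_subgroup.
  by move=> x y hx hy; apply: idealMr.
by move=> x hx; rewrite -[x]mulr1; apply: in_idm => //; exact: O1.
Qed.

Lemma idm1l I : is_ideal I -> ideal_mul O I = I.
Proof. by move=> hI; rewrite idmC ?idm1//; exact: O_ideal. Qed.

Lemma idm_subl I J : is_ideal I -> is_ideal J -> ideal_mul I J `<=` I.
Proof.
move=> hI hJ; apply: idm_min; first exact: ideal_subgroup.
by move=> x y hx hy; apply: idealMr => //; exact: ideal_O hy.
Qed.

Lemma idm_subr I J : is_ideal I -> is_ideal J -> ideal_mul I J `<=` J.
Proof. by move=> hI hJ; rewrite idmC//; exact: idm_subl. Qed.

Lemma scl_inj a : a != 0 -> injective (scl a).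
Proof.
move=> a0 I J h; apply/seteqP; split=> x hx.
  by have : scl a I (a * x) by [exists x]; rewrite h => -[y hy /(mulfI a0) <-].
by have : scl a J (a * x) by [exists x]; rewrite -h => -[y hy /(mulfI a0) <-].
Qed.

Lemma scl_scl a b I : scl a (scl b I) = scl (a * b) I.
Proof.
apply/seteqP; split=> x.
  by move=> [_ [y hy <-] <-]; exists y => //; rewrite mulrA.
by move=> [y hy <-]; exists (b * y); [exists y|rewrite mulrA].
Qed.

Lemma scl1 I : scl 1 I = I.
Proof.
apply/seteqP; split=> x; first by move=> [y hy <-]; rewrite mul1r.
by move=> hx; exists x => //; rewrite mul1r.
Qed.

Lemma scl_ideal a I : scl a I `<=` O -> is_ideal I -> is_ideal (scl a I).
Proof.
move=> h hI; have [_ i0 iD iM] := hI; split=> //.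
- by exists 0 => //; rewrite mulr0.
- by move=> _ _ [x hx <-] [y hy <-]; exists (x + y); [exact: iD|rewrite mulrDr].
- by move=> c _ hc [x hx <-]; exists (c * x); [exact: iM|rewrite mulrCA].
Qed.

Lemma scl_nz a I : a != 0 -> scl a I `<=` O -> nzideal I -> nzideal (scl a I).
Proof.
move=> a0 h [hI [x hx x0]]; split; first exact: scl_ideal.
by exists (a * x); [exists x|rewrite mulf_neq0].
Qed.

Lemma scl_idm a I J : ideal_mul (scl a I) J = scl a (ideal_mul I J).
Proof.
apply/seteqP; split=> x.
  move=> [n [u [v [hu hv ->]]]].
  have /choice[w hw] : forall i, exists w, I w /\ a * w = u i.
    by move=> i; case: (hu i) => y; exists y.
  exists (\sum_i w i * v i); first by exists n, w, v; split=> // i; case: (hw i).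
  by rewrite mulr_sumr; apply: eq_bigr => i _; rewrite mulrA (hw i).2.
move=> [_ [n [u [v [hu hv ->]]]] <-]; exists n, (fun i => a * u i), v; split=> //.
  by move=> i; exists (u i).
by rewrite mulr_sumr; apply: eq_bigr => i _; rewrite mulrA.
Qed.

Lemma scl_O_idm a I : is_ideal I -> ideal_mul (scl a O) I = scl a I.
Proof. by move=> hI; rewrite scl_idm idm1l. Qed.

Lemma nzideal_lattice I : nzideal I -> exists2 B : 'M[rat]_d, B \in unitmx & I = Lat B.
Proof.
move=> [hI [x hx x0]]; have [BO uBO hBO] := O_lattice F.
apply: (@lattice_basis _ _ BO) => //; first exact: ideal_subgroup.
  by rewrite -hBO => y; exact: ideal_O.
move=> y; have [n n0 hn] := ex_integer_multiple (y / x); exists n => //.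
have -> : n%:R *: y = n%:R *: (y / x) * x by rewrite -scalerAl mulfVK.
exact: idealM.
Qed.

Lemma stable_integral I x : nzideal I -> (forall y, I y -> I (y * x)) -> O x.
Proof.
move=> hI hx; have [B uB hB] := nzideal_lattice hI.
exact: int_mx_integral uB (stable_int_mx uB hB hx).
Qed.

(** Every permutation other than the identity moves some index and so picks up an off-diagonal
    entry, which lies in [C]. *)
Lemma det_cong1 n C (M : 'M[F]_n) : is_ideal C ->
  (forall i j, C (M i j - (i == j)%:R)) -> C (\det M - 1).
Proof.
move=> hC h; have hs := ideal_subgroup hC.
have MO i j : O (M i j).
  rewrite -[M i j](subrK ((i == j)%:R)); apply: OD; first exact: ideal_O (h _ _).
  exact: O_nat.
rewrite /determinant (bigD1 1%g)//= odd_perm1 expr0 mul1r addrAC; apply: subgD => //.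
  have -> : \prod_i M i ((1%g : 'S_n) i) - 1 = \prod_i M i i - 1.
    by congr (_ - _); apply: eq_bigr => i _; rewrite perm1.
  apply: (big_ind (fun z => C (z - 1) /\ O z) _ _ _).1.
  - by rewrite subrr; split; [exact: hs.1|exact: O1].
  - move=> u v [hu uO] [hv vO]; split; last exact: OM.
    have -> : u * v - 1 = u * (v - 1) + (u - 1) by ring.
    by apply: subgD => //; apply: idealM.
  - by move=> i _; split=> //; have := h i i; rewrite eqxx.
apply: subg_sum => // s s1; apply: idealM => //.
  by case: (odd_perm s); rewrite ?expr1 ?expr0; [apply: ON|]; exact: O1.
have [i si] : exists i, s i != i.
  apply: contrapT => hno; move/eqP: s1; apply; apply/permP => i; rewrite perm1.
  by apply: contrapT => /eqP hi; apply: hno; exists i.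
rewrite (bigD1 i)//=; apply: idealMr => //.
  by apply: big_ind => //; [exact: O1|exact: OM].
by have := h i (s i); rewrite eq_sym (negbTE si) subr0.
Qed.

Lemma idm_comb C (B : 'M[rat]_d) x : is_ideal C -> B \in unitmx -> ideal_mul C (Lat B) x ->
  exists2 b : 'I_d -> F, (forall j, C (b j)) & x = \sum_j b j * vc (row j B).
Proof.
move=> hC uB [n [u [v [hu hv ->]]]].
have hs := ideal_subgroup hC.
exists (fun j => \sum_i (crd B (v i) 0 j)%:A * u i).
  move=> j; apply: subg_sum => // i _; rewrite mulr_algl; apply: subg_int => //.
  exact: (mxOverP (hv i)).
under [RHS]eq_bigr => j _ do rewrite mulr_suml.
rewrite exchange_big /=; apply: eq_bigr => i _.
rewrite -{1}(crdK (v i) uB) vc_sum mulr_sumr; apply: eq_bigr => j _.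
by rewrite mulr_algl -scalerAl -scalerAr.
Qed.

(** The determinant trick of Nakayama: a basis of [A] is killed by a matrix congruent to 1 modulo
    [C], so its determinant is zero and also congruent to 1. *)
Lemma idm_id_O C A : is_ideal C -> nzideal A -> A `<=` ideal_mul C A -> C = O.
Proof.
move=> hC hA h; have [B uB hB] := nzideal_lattice hA.
have rB i : A (vc (row i B)).
  rewrite hB /Lat /= rowE crd_vc//; apply/mxOverP => k l; rewrite mxE.
  by case: (_ && _); rewrite ?rpred1 ?rpred0.
have /choice[b hb] : forall i, exists b : 'I_d -> F, (forall j, C (b j)) /\
    vc (row i B) = \sum_j b j * vc (row j B).
  move=> i; have := h _ (rB i); rewrite {1}hB => /(idm_comb hC uB)[b b1 b2]; by exists b.
pose M : 'M[F]_d := \matrix_(i, j) ((i == j)%:R - b i j).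
have detM : \det M = 0.
  apply/eqP; rewrite -det_tr; apply/det0P; exists (\row_i vc (row i B)).
    apply/eqP => b0; have i0 : 'I_d by exact: Ordinal (d_gt0 F).
    have /rowP/(_ i0) := b0; rewrite !mxE => /(congr1 (@cv F)); rewrite vcK linear0 => hh.
    have := uB; rewrite -row_free_unit => /row_freeP[D] /(congr1 (row i0)).
    rewrite row_mul hh mul0mx => /rowP/(_ i0); rewrite !mxE eqxx => /eqP.
    by rewrite eq_sym oner_eq0.
  apply/rowP => i; rewrite mxE [RHS]mxE.
  under eq_bigr => j _ do rewrite !mxE mulrBr [_ * b i j]mulrC.
  rewrite sumrB -(hb i).2 (bigD1 i)//= eqxx mulr1 big1 ?addr0 ?subrr// => j.
  by rewrite eq_sym => /negbTE ->; rewrite mulr0.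
apply: ideal_eqO => //; have := @det_cong1 d C M hC; rewrite detM sub0r => hh.
have : C (-1).
  apply: hh => i j; rewrite mxE addrAC subrr sub0r.
  by apply: subgN; [exact: ideal_subgroup|exact: (hb i).1].
by move/(subgN (ideal_subgroup hC)); rewrite opprK.
Qed.

Lemma idX_nz A k : nzideal A -> nzideal (ideal_exp A k).
Proof. by move=> hA; elim: k => [|k IH]; [exact: O_nz|exact: idm_nz]. Qed.

Lemma idX_add A i j : nzideal A ->
  ideal_exp A (i + j) = ideal_mul (ideal_exp A i) (ideal_exp A j).
Proof.
move=> hA; have h k := (idX_nz k hA).1; elim: i => [|i IH].
  by rewrite /= idm1l.
by rewrite addSn /ideal_exp /= -/(ideal_exp A (i + j)) IH idmA//; exact: hA.1.
Qed.

(** Division by [w] gives [A J = A] with [J = B / w]. The elements of [J] map [A] into itself, so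
    they are integral, and [idm_id_O] applies to [J]. *)
Lemma idm_scl_principal A B w : nzideal A -> is_ideal B -> w != 0 ->
  ideal_mul A B = scl w A -> B = scl w O.
Proof.
move=> hA hB w0 h.
have hsub : scl w^-1 B `<=` O.
  move=> _ [b hb <-]; apply: (stable_integral hA) => y hy.
  have : ideal_mul A B (y * b) by exact: in_idm.
  by rewrite h => -[z hz e]; rewrite mulrCA -e mulKf.
have hid := scl_ideal hsub hB.
have hO : scl w^-1 B = O.
  apply: (idm_id_O hid hA); rewrite scl_idm (idmC hB hA.1) h scl_scl mulVf// scl1//.
by rewrite -hO scl_scl mulfV// scl1.
Qed.

End Ideals.

Lemma det_le (T : realFieldType) n (M : 'M[T]_n) (e : T) :
  (forall i j, `|M i j| <= e) -> `|\det M| <= (n`!)%:R * e ^+ n.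
Proof.
move=> h; apply: le_trans (ler_norm_sum _ _ _) _.
apply: le_trans (_ : \sum_(s : 'S_n) e ^+ n <= _); last first.
  by rewrite sumr_const card_Sn mulr_natl.
apply: ler_sum => s _; rewrite normrM normr_sign mul1r normr_prod.
rewrite -[in leRHS](card_ord n) -prodr_const; apply: ler_prod => i _.
by rewrite normr_ge0 h.
Qed.

Lemma mxBE m n (A B : 'M[rat]_(m, n)) i j : (A - B) i j = A i j - B i j.
Proof. by rewrite !mxE. Qed.

Lemma finite_pigeonhole (T : Type) (X : set T) (f : nat -> T) :
  finite_set X -> (forall i, X (f i)) -> exists i j, (i < j)%N /\ f i = f j.
Proof.
move=> fX hf; apply: contrapT => hno.
have inj : injective f.
  move=> i j e; have [ij|ij|//] := ltngtP i j; exfalso; apply: hno.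
    by exists i, j.
  by exists j, i.
have : finite_set (f @^-1` X) by apply: finite_preimage => // i j _ _; exact: inj.
have -> : f @^-1` X = setT by apply/seteqP; split=> // i _; exact: hf.
exact: infinite_nat.
Qed.

(** * Finiteness of the class group and invertibility of ideals *)

Section ClassGroup.
Variable F : fieldExtType rat.
Local Notation d := (dim F).
Local Notation O := (@ring_of_integers F).
Implicit Types (x y a b : F) (I J A C P : set F) (B : 'M[rat]_d).

Lemma natF_eq0 n : ((n%:R : F) == 0) = (n == 0)%N.
Proof. by rewrite -(rmorph_nat (in_alg F)) fmorph_eq0 pnatr_eq0. Qed.

Definition bounded B (r : rat) x := forall i, `|crd B x 0 i| <= r.

Lemma mulM_sum (I : Type) (s : seq I) (f : I -> F) :
  mulM (\sum_(i <- s) f i) = \sum_(i <- s) mulM (f i).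
Proof.
elim: s => [|i s IH]; last by rewrite !big_cons mulM_add IH.
by rewrite !big_nil -(scale0r (1 : F)) mulMZ scale0r.
Qed.

Lemma mulM_bound B : B \in unitmx -> exists2 E : rat, 0 < E & forall x r,
  bounded B r x -> forall i j, `|mulM x i j| <= E * r.
Proof.
move=> uB; pose E := \sum_i \sum_k \sum_l `|mulM (vc (row i B)) k l| + 1.
have E0 : 0 <= \sum_i \sum_k \sum_l `|mulM (vc (row i B)) k l|.
  by apply: sumr_ge0 => i _; apply: sumr_ge0 => k _; apply: sumr_ge0.
exists E; first by rewrite /E; lra.
move=> x r hx k l; have r0 : 0 <= r.
  by apply: le_trans (hx (Ordinal (d_gt0 F))); exact: normr_ge0.
rewrite -(crdK x uB) vc_sum mulM_sum summxE.
apply: le_trans (ler_norm_sum _ _ _) _.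
apply: le_trans (_ : \sum_i (\sum_k \sum_l `|mulM (vc (row i B)) k l|) * r <= _); last first.
  by rewrite -mulr_suml ler_wpM2r// /E; lra.
apply: ler_sum => i _; rewrite mulMZ mxE normrM mulrC ler_pM//.
rewrite (bigD1 k)//= (bigD1 l)//= -addrA lerDl addr_ge0 ?sumr_ge0// => j _.
by rewrite sumr_ge0.
Qed.

Lemma Nm_bound B : B \in unitmx -> exists2 C : rat, 0 < C & forall x r,
  bounded B r x -> `|Nm x| <= C * r ^+ d.
Proof.
move=> uB; have [E E0 hE] := mulM_bound uB; exists ((d`!)%:R * E ^+ d).
  by rewrite mulr_gt0 ?exprn_gt0// ltr0n fact_gt0.
by move=> x r hx; rewrite -mulrA -exprMn; apply: det_le; exact: hE.
Qed.

Definition O_basis : 'M[rat]_d := projT1 (cid2 (O_lattice F)).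

Lemma O_basis_unit : O_basis \in unitmx.
Proof. by rewrite /O_basis; case: (cid2 _). Qed.

Lemma O_basisE : O = Lat O_basis.
Proof. by rewrite /O_basis; case: (cid2 _). Qed.

Definition pt m (f : {ffun 'I_d -> 'I_m}) : F := vc ((\row_i (f i)%:R) *m O_basis).

Lemma pt_O m (f : {ffun 'I_d -> 'I_m}) : O (pt f).
Proof.
rewrite O_basisE /Lat /= crd_vc ?O_basis_unit//.
by apply/mxOverP => i j; rewrite mxE natr_int.
Qed.

Lemma vc_O (r : 'rV[rat]_d) : r \is a mxOver Num.int -> O (vc (r *m O_basis)).
Proof. by move=> h; rewrite O_basisE /Lat /= crd_vc// O_basis_unit. Qed.

Lemma O_mod N x : (0 < N)%N -> O x ->
  exists f : {ffun 'I_d -> 'I_N}, exists2 y, O y & x = pt f + N%:R * y.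
Proof.
move=> N0; rewrite O_basisE => hx.
have hz i : {z : int | crd O_basis x 0 i = z%:~R}.
  by apply: cid; have /mxOverP/(_ 0 i)/intrP := hx.
pose z i := sval (hz i).
have N0' : (N%:Z != 0) by rewrite -lt0n in N0 *; case: (N) N0.
have zm i : (`|(z i %% N%:Z)%Z| < N)%N.
  have h1 := modz_ge0 (z i) N0'; have h2 := ltz_mod (z i) N0'.
  by rewrite -ltz_nat gez0_abs.
exists [ffun i => Ordinal (zm i)].
exists (vc ((\row_i ((z i %/ N%:Z)%Z)%:~R) *m O_basis)).
  by rewrite -O_basisE; apply: vc_O; apply/mxOverP => i j; rewrite mxE intr_int.
rewrite mulr_natl -scaler_nat -linearZ /= -linearD /= scalemxAl -mulmxDl.
rewrite -[LHS](crdK x O_basis_unit); congr (vc (_ *m _)); apply/rowP => i.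
rewrite [RHS]mxE [X in _ = X + _]mxE [X in _ = _ + X]mxE [X in _ = _ + _ * X]mxE ffunE /=.
rewrite (svalP (hz i)) -/(z i) {1}(divz_eq (z i) N%:Z) intrD addrC intrM mulrC.
congr (_ + _); rewrite -{1}(gez0_abs (modz_ge0 (z i) N0')).
by rewrite -pmulrn.
Qed.

Lemma finite_ideals_containing (N : nat) : (0 < N)%N ->
  finite_set [set I | is_ideal I /\ I (N%:R : F)].
Proof.
move=> N0.
pose g (S : {set {ffun 'I_d -> 'I_N}}) : set F :=
  [set x | exists2 f, f \in S & exists2 y, O y & x = pt f + N%:R * y].
apply: (@sub_finite_set _ _ (g @` setT)); last exact/finite_image/finite_finset.
move=> I [hI hN]; exists [set f | `[< I (pt f) >]]%SET => //.
apply/seteqP; split=> x.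
  move=> [f]; rewrite inE => /asboolP hf [y hy ->].
  by apply: (subgD (ideal_subgroup hI)) => //; apply: idealMr.
move=> hx; have [f [y hy e]] := O_mod N0 (ideal_O hI hx); exists f; last by exists y.
rewrite inE; apply/asboolP; have -> : pt f = x - N%:R * y by rewrite e addrK.
by apply: (ideal_subgroup hI).2 => //; apply: idealMr.
Qed.

(** Dirichlet's pigeonhole on the fractional parts of the multiples of [a / b]: the cube is cut into
    [m ^ d] cells, and a difference of two multiples in one cell has coordinates at most [1 / m],
    hence norm below 1 as [C < m]. *)
Lemma hurwitz : exists2 M : nat, (0 < M)%N & forall a b, O a -> O b -> b != 0 ->
  exists t w, [/\ (0 < t <= M)%N, O w & `|Nm (t%:R * a - w * b)| < `|Nm b|].
Proof.
have uB := O_basis_unit; have [C C0 hC] := Nm_bound uB.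
have [m m1 mC] : exists2 m : nat, (0 < m)%N & C < m%:R.
  by exists (Num.truncn C).+1 => //; exact: truncnS_gt.
have m0 : 0 < m%:R :> rat by rewrite ltr0n.
exists (m ^ d)%N; first by rewrite expn_gt0 m1.
move=> a b ha hb b0; pose g := a / b.
pose v (t : nat) := crd O_basis (t%:R *: g).
pose fl t : 'rV[rat]_d := \row_i (Num.floor (v t 0 i))%:~R.
pose fr t i := v t 0 i - fl t 0 i.
have frI t i : 0 <= fr t i /\ fr t i < 1.
  rewrite /fr [fl t 0 i]mxE; have /andP[] := floor_itv (v t 0 i); rewrite intrD; lra.
have tr t i : (Num.truncn (m%:R * fr t i) < m)%N.
  have [f0 f1] := frI t i.
  rewrite truncn_lt_nat ?mulr_ge0//.
  by rewrite gtr_pMr.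
pose cell (t : 'I_(m ^ d).+1) : {ffun 'I_d -> 'I_m} := [ffun i => Ordinal (tr t i)].
have [t [t' [tt' e]]] : exists t t' : 'I_(m ^ d).+1, (t < t')%N /\ cell t = cell t'.
  apply: contrapT => hno.
  have inj : injective cell.
    move=> t t' e; apply/val_inj; have [tt'|tt'|//] := ltngtP t t'; exfalso; apply: hno.
      by exists t, t'.
    by exists t', t.
  have := leq_card cell inj; rewrite card_ord card_ffun !card_ord; lia.
have close i : `|fr t' i - fr t i| <= m%:R^-1.
  have := congr1 (fun f : {ffun 'I_d -> 'I_m} => val (f i)) e; rewrite !ffunE /=.
  have [f0 f1] := frI t i; have [f0' f1'] := frI t' i.
  have /andP[] := truncn_itv (mulr_ge0 (ltW m0) f0).
  have /andP[] := truncn_itv (mulr_ge0 (ltW m0) f0').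
  move=> h1 h2 h3 h4 ee; rewrite ee -!natr1 in h3 h4 *.
  have : `|m%:R * (fr t' i - fr t i)| <= 1 by rewrite ler_norml; lra.
  by rewrite normrM gtr0_norm// mulrC -ler_pdivlMr// mul1r.
pose w := vc ((fl t' - fl t) *m O_basis).
exists (t' - t)%N, w; split.
- by rewrite subn_gt0 tt' (leq_trans (leq_subr _ _))// -ltnS.
- by apply: vc_O; apply: mxintB; apply/mxOverP => i j; rewrite mxE intr_int.
pose de := (t' - t)%:R *: g - w.
have -> : (t' - t)%:R * a - w * b = de * b.
  by rewrite /de /g mulrBl -scalerAl mulfVK// scaler_nat mulr_natl.
rewrite NmM normrM gtr_pMl ?normr_gt0 ?Nm_eq0//.
have hde : bounded O_basis m%:R^-1 de.
  move=> i; have -> : crd O_basis de 0 i = fr t' i - fr t i; last exact: close.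
  rewrite /de crdB crd_vc// natrB ?(ltnW tt')// scalerBl crdB -/(v t') -/(v t) /fr.
  by rewrite !mxBE; ring.
apply: le_lt_trans (hC _ _ hde) _; rewrite exprVn ltr_pdivrMr ?exprn_gt0// mul1r.
apply: lt_le_trans mC _; by rewrite -[leLHS]expr1 ler_weXn2l ?ler1n ?d_gt0.
Qed.

Lemma Nm_nat x : O x -> exists n : nat, `|Nm x| = n%:R.
Proof. by move=> /integral_Tr_Nm[_ /natr_norm_int/natrP]. Qed.

(** Let [b] have least norm among the nonzero elements of [A]. The remainder that [hurwitz] gives
    for an element [a] lies in [A] and has smaller norm, so it is zero; the multiplier [t] divides
    [M!]. *)
Lemma class_finite : exists2 N : nat, (0 < N)%N & forall A, nzideal A ->
  exists b, [/\ A b, b != 0 & scl N%:R A `<=` scl b O].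
Proof.
have [M M0 hM] := hurwitz; exists M`!; first exact: fact_gt0.
move=> A [hA [x hx x0]].
pose P k := exists2 b, A b & b != 0 /\ `|Nm b| = k%:R.
have exP : exists k, `[< P k >].
  by have [k hk] := Nm_nat (ideal_O hA hx); exists k; apply/asboolP; exists x.
case: (ex_minnP exP) => k /asboolP[b hb [b0 hk]] kmin; exists b; split=> //.
move=> _ [a ha <-]; have [t [w [/andP[t0 tM] wO hlt]]] := hM a b (ideal_O hA ha) (ideal_O hA hb) b0.
have hin : A (t%:R * a - w * b).
  by apply: (ideal_subgroup hA).2; apply: idealM => //; exact: O_nat.
have z0 : t%:R * a - w * b = 0.
  apply: contrapT => /eqP z0; have [k' hk'] := Nm_nat (ideal_O hA hin).
  have : (k <= k')%N by apply: kmin; apply/asboolP; exists (t%:R * a - w * b).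
  by rewrite leqNgt -(ltr_nat rat) -hk -hk' hlt.
have /dvdnP[q ->] : (t %| M`!)%N by apply: dvdn_fact; rewrite t0.
exists (q%:R * w); first by apply: OM => //; exact: O_nat.
by rewrite natrM -mulrA (subr0_eq z0); ring.
Qed.

(** By [class_finite] every power of [A] can be scaled to an ideal that contains the fixed integer
    [N]. There are finitely many such ideals, so two powers coincide up to a scalar, and
    [idm_scl_principal] cancels the smaller one. *)
Lemma idX_principal A : nzideal A ->
  exists k w, [/\ (0 < k)%N, w != 0 & ideal_exp A k = scl w O].
Proof.
move=> hA; have [N N0 hN] := class_finite.
have NF : (N%:R : F) != 0 by rewrite natF_eq0 -lt0n.
have /choice[b hb] : forall i, exists b, [/\ ideal_exp A i b, b != 0 & scl N%:R (ideal_exp A i) `<=` scl b O].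
  by move=> i; exact: hN (idX_nz i hA).
pose f i := scl (N%:R / b i) (ideal_exp A i).
have hf i : is_ideal (f i) /\ f i N%:R.
  have [b1 b2 b3] := hb i; split; last by exists (b i) => //; rewrite mulfVK.
  apply: scl_ideal; last exact: (idX_nz i hA).1.
  move=> _ [y hy <-]; have [z hz e] : scl (b i) O (N%:R * y) by apply: b3; exists y.
  by rewrite mulrAC -e mulrAC mulfV// mul1r.
have [i [j [ij e]]] := finite_pigeonhole (finite_ideals_containing N0) hf.
have [_ bi _] := hb i; have [_ bj _] := hb j.
exists (j - i)%N, ((N%:R / b i) / (N%:R / b j)); split.
- by rewrite subn_gt0.
- by rewrite !mulf_neq0 ?invr_eq0 ?mulf_neq0 ?invr_eq0.
apply: (@idm_scl_principal _ (ideal_exp A i)).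
- exact: idX_nz.
- exact: (idX_nz _ hA).1.
- by rewrite !mulf_neq0 ?invr_eq0 ?mulf_neq0 ?invr_eq0.
have nz : N%:R / b j != 0 by rewrite mulf_neq0 ?invr_eq0.
rewrite -idX_add// subnKC ?(ltnW ij)//; apply: (scl_inj nz).
by rewrite scl_scl -/(f j) -e /f [in RHS]mulrC divfK.
Qed.

Lemma ex_inverse_ideal A : nzideal A ->
  exists A' a, [/\ nzideal A', a != 0, O a & ideal_mul A A' = scl a O].
Proof.
move=> hA; have [k [w [k0 w0 e]]] := idX_principal hA.
exists (ideal_exp A k.-1), w; split=> //; first exact: idX_nz.
  have : scl w O w by exists 1; [exact: O1|rewrite mulr1].
  by rewrite -e; apply: ideal_O; exact: (idX_nz k hA).1.
by rewrite -e -[in RHS](prednK k0).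
Qed.

Lemma idm_subP A I J : nzideal A -> is_ideal I -> is_ideal J ->
  ideal_mul A I `<=` ideal_mul A J -> I `<=` J.
Proof.
move=> hA hI hJ h; have [A' [a [hA' a0 aO e]]] := ex_inverse_ideal hA.
have : ideal_mul A' (ideal_mul A I) `<=` ideal_mul A' (ideal_mul A J).
  by apply: idmS => //; [exact: hA'.1|apply: idm_ideal => //; exact: hA.1].
have [hA1 hA'1] := (hA.1, hA'.1).
rewrite !idmA// (idmC hA'1 hA1) e !scl_O_idm// => hh x hx.
have [y hy /(mulfI a0) <-] : scl a J (a * x) by apply: hh; exists x.
by [].
Qed.

Lemma idm_inj A I J : nzideal A -> is_ideal I -> is_ideal J ->
  ideal_mul A I = ideal_mul A J -> I = J.
Proof.
by move=> hA hI hJ h; apply/seteqP; split; apply: (idm_subP hA) => //; rewrite h.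
Qed.

Lemma idm_divides A I : nzideal A -> is_ideal I -> I `<=` A ->
  exists2 C, is_ideal C & I = ideal_mul A C.
Proof.
move=> hA hI h; have [A' [a [hA' a0 aO e]]] := ex_inverse_ideal hA.
have [hA1 hA'1] := (hA.1, hA'.1).
have hsub : scl a^-1 (ideal_mul A' I) `<=` O.
  move=> _ [y hy <-]; have : ideal_mul A' A y by apply: (idmS _ _ _ _ hy).
  by rewrite idmC// e => -[z hz <-]; rewrite mulKf.
have hC : is_ideal (scl a^-1 (ideal_mul A' I)) by apply: scl_ideal => //; exact: idm_ideal.
exists (scl a^-1 (ideal_mul A' I)) => //.
by rewrite idmC// scl_idm -idmA// (idmC hI hA1) idmA// (idmC hA'1 hA1) e scl_O_idm// scl_scl mulVf// scl1.
Qed.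

End ClassGroup.

Lemma subr_cong (V : zmodType) (a x y : V) : (x - a) - (y - a) = x - y.
Proof. by rewrite opprB addrA subrK. Qed.

(** * Norms and factorisation of ideals *)

Section Norms.
Variable F : fieldExtType rat.
Local Notation d := (dim F).
Local Notation O := (@ring_of_integers F).
Implicit Types (x y a b : F) (I J A C P Q : set F).

Definition reps I (T : Type) (r : T -> F) :=
  [/\ forall t, O (r t), forall x, O x -> exists t, I (x - r t) &
      forall t t', I (r t - r t') -> t = t'].

Lemma coset_eq I x y : is_ideal I -> O x -> O y ->
  (coset_mod I x = coset_mod I y) <-> I (x - y).
Proof.
move=> hI hx hy; have hs := ideal_subgroup hI; split=> [e|h].
  have : coset_mod I x x by split=> //; rewrite subrr; exact: hs.1.
  by rewrite e => -[].
apply/seteqP; split=> z [hz hzx]; split=> //.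
  by rewrite -(subrKA x); apply: subgD.
by rewrite -(subrKA y); apply: subgD => //; rewrite -opprB; apply: subgN.
Qed.

Lemma ideal_norm_reps I (T : finType) (r : T -> F) : is_ideal I -> reps I r ->
  ideal_norm I = #|T|.
Proof.
move=> hI [r1 r2 r3]; rewrite /ideal_norm.
have -> : [set coset_mod I x | x in O] = [set` [seq coset_mod I (r t) | t <- enum T]].
  apply/seteqP; split=> X /=.
    move=> [x hx <-]; have [t ht] := r2 x hx; apply/mapP; exists t; first by rewrite mem_enum.
    by apply/coset_eq.
  by move=> /mapP[t _ ->]; exists (r t).
set s := map _ _; have -> : [set` s] = [set` seq_fset tt s].
  by apply/seteqP; split=> X; rewrite /mkset seq_fsetE.
have us : uniq s.
  rewrite map_inj_uniq ?enum_uniq// => t t' /coset_eq; by move/(_ hI (r1 _) (r1 _))/r3.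
by rewrite set_fsetK size_seq_fset undup_id// size_map -cardE.
Qed.

Lemma ex_nat_in I : nzideal I -> exists2 n : nat, (0 < n)%N & I n%:R.
Proof.
move=> [hI [x hx x0]]; have [n n0 hn] := ex_integer_multiple x^-1; exists n => //.
by rewrite -[n%:R](mulfVK x0) mulr_natl -scaler_nat; apply: idealM.
Qed.

Lemma ex_reps I : nzideal I -> exists n (r : 'I_n -> F), reps I r.
Proof.
move=> hI; have [N N0 hN] := ex_nat_in hI; have [hI1 _] := hI.
have hs := ideal_subgroup hI1.
pose R := [rel f g : {ffun 'I_d -> 'I_N} | `[< I (pt f - pt g) >]].
have eqR : equivalence_rel R.
  move=> f g h; split=> /=; first by apply/asboolP; rewrite subrr; exact: hs.1.
  move=> /asboolP fg; apply/asboolP/asboolP => H.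
    rewrite -(subrKA (pt f)); apply: subgD => //; rewrite -opprB; exact: subgN.
  by rewrite -(subrKA (pt g)); apply: subgD.
pose c f := odflt f [pick g | R f g].
have Rc f : R f (c f).
  by rewrite /c; case: pickP => //= _; exact: (eqR f f f).1.
have cE f g : R f g -> c f = c g.
  move=> fg; have e : [pick h | R f h] = [pick h | R g h].
    by apply: eq_pick => h; have [_ /(_ fg) e] := eqR f g h; exact: e.
  rewrite /c e; case: pickP => //= hno.
  by have := (eqR g g g).1; rewrite /= hno.
pose T := [set f | c f == f]%SET.
exists #|T|, (fun i => pt (enum_val i)); split.
- by move=> t; exact: pt_O.
- move=> x hx; have [f [y hy e]] := O_mod N0 hx.
  have gT : c f \in T by rewrite inE -(cE _ _ (Rc f)).
  exists (enum_rank_in gT (c f)); rewrite enum_rankK_in//.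
  have -> : x - pt (c f) = (pt f - pt (c f)) + N%:R * y by rewrite e; ring.
  by apply: subgD => //; [exact/asboolP/Rc|apply: idealMr].
- move=> t t' h; apply: enum_val_inj.
  have := enum_valP t; have := enum_valP t'; rewrite !inE => /eqP <- /eqP <-.
  by apply: cE; apply/asboolP.
Qed.

Lemma ideal_norm_reps_ex I : nzideal I -> exists r : 'I_(ideal_norm I) -> F, reps I r.
Proof.
move=> hI; have [n [r hr]] := ex_reps hI.
by rewrite (ideal_norm_reps hI.1 hr) card_ord; exists r.
Qed.

Lemma ideal_norm_gt0 I : nzideal I -> (0 < ideal_norm I)%N.
Proof.
move=> hI; have [r [_ h _]] := ideal_norm_reps_ex hI.
by have [[k kn] _] := h 0 (O0 F); exact: leq_ltn_trans kn.
Qed.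

Lemma ideal_norm_O : ideal_norm O = 1%N.
Proof.
have : reps O (fun _ : 'I_1 => 0 : F).
  split=> [t|x hx|t t' _]; [exact: O0|exists ord0; rewrite subr0//|by rewrite !ord1].
by move/(ideal_norm_reps (O_ideal F)); rewrite card_ord.
Qed.

Lemma ideal_norm_eq1 I : nzideal I -> ideal_norm I = 1%N -> I = O.
Proof.
move=> hI; have [r [h1 h2 h3]] := ideal_norm_reps_ex hI; move: r h1 h2 h3 => + + + + e.
rewrite e => r h1 h2 h3; apply: ideal_eqO; first exact: hI.1.
have [t ht] := h2 1 (O1 F); have [t' ht'] := h2 0 (O0 F).
rewrite !ord1 in ht ht'; have hs := ideal_subgroup hI.1.
by have := hs.2 _ _ ht ht'; rewrite sub0r opprK subrK.
Qed.

Lemma norm_lt I J : nzideal I -> nzideal J -> I `<=` J -> I <> J ->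
  (ideal_norm J < ideal_norm I)%N.
Proof.
move=> hI hJ IJ nIJ.
have [r [r1 r2 r3]] := ideal_norm_reps_ex hI; have [r' [r1' r2' r3']] := ideal_norm_reps_ex hJ.
have /choice[f hf] : forall j, exists t, I (r' j - r t) by move=> j; exact: r2.
have hsI := ideal_subgroup hI.1; have hsJ := ideal_subgroup hJ.1.
have finj : injective f.
  move=> j j' e; apply: r3'; apply: IJ.
  by rewrite -(subr_cong (r (f j))) {2}e; apply: hsI.2.
have := leq_card f finj; rewrite !card_ord leq_eqVlt => /orP[/eqP e|//].
have [x hx nx] : exists2 x, J x & ~ I x.
  apply: contrapT => hno; apply: nIJ; apply/seteqP; split=> // x hx.
  by apply: contrapT => nx; apply: hno; exists x.
have [fi _ fK] : bijective f by apply: inj_card_bij => //; rewrite !card_ord e.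
have [t ht] := r2 x (ideal_O hJ.1 hx); have [s hs] := r2 0 (O0 F).
have ts : t <> s.
  move=> ts; apply: nx; rewrite ts in ht.
  by have := hsI.2 _ _ ht hs; rewrite sub0r opprK subrK.
exfalso; apply: ts; rewrite -(fK t) -(fK s); congr f; apply: r3'.
have h1 := hf (fi t); have h2 := hf (fi s); rewrite !fK in h1 h2.
have -> : r' (fi t) - r' (fi s) = (r' (fi t) - r t) - (r' (fi s) - r s) - (x - r t) + (0 - r s) + x.
  by ring.
apply: (subgD hsJ) => //; apply: IJ; apply: (subgD hsI) => //; apply: hsI.2 => //; exact: hsI.2.
Qed.

Lemma prime_nz P : nonzero_prime P -> nzideal P.
Proof. by case=> h1 h2 _ _; split. Qed.

Lemma prime_neqO P : nonzero_prime P -> P <> O.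
Proof. by move=> [_ _ h _] e; apply: h; rewrite e; exact: O1. Qed.

Lemma prime_norm_gt1 P : nonzero_prime P -> (1 < ideal_norm P)%N.
Proof.
move=> hP; have hn := prime_nz hP; have := ideal_norm_gt0 hn.
rewrite leq_eqVlt => /orP[/eqP e|//]; exfalso; apply: (prime_neqO hP).
by apply: ideal_norm_eq1 => //; rewrite -e.
Qed.

(** Two powers of [x] are congruent because there are finitely many residues; cancelling leaves a
    power of [x] congruent to 1. *)
Lemma prime_inv P x : nonzero_prime P -> O x -> ~ P x -> exists2 y, O y & P (x * y - 1).
Proof.
move=> hP hx nx; have hn := prime_nz hP; have [hid _ _ pP] := hP.
have [r [_ r2 _]] := ideal_norm_reps_ex hn.
have /choice[f hf] : forall k : nat, exists t, P (x ^+ k - r t).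
  by move=> k; apply: r2; exact: OX.
have [i [j [ij e]]] := finite_pigeonhole (@finite_finset _ setT) (fun i => I : setT (f i)).
have hs := ideal_subgroup hid.
have h : P (x ^+ i * (x ^+ (j - i) - 1)).
  rewrite mulrBr mulr1 -exprD subnKC ?(ltnW ij)//.
  by rewrite -(subr_cong (r (f j))) -{2}e; apply: hs.2.
have xi k : ~ P (x ^+ k).
  elim: k => [|k IH]; first by case: hP.
  by rewrite exprS => /pP[||//|//]//; exact: OX.
exists (x ^+ (j - i).-1); first exact: OX.
have -> : x * x ^+ (j - i).-1 = x ^+ (j - i) by rewrite -exprS prednK// subn_gt0.
have [//| |/xi//|//] := pP _ _ _ _ h; first exact: OX.
by apply: OB; [exact: OX|exact: O1].
Qed.

Lemma prime_max P I : nonzero_prime P -> is_ideal I -> P `<=` I -> I <> P -> I = O.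
Proof.
move=> hP hI PI nIP; have hs := ideal_subgroup hI.
have [x hx nx] : exists2 x, I x & ~ P x.
  apply: contrapT => hno; apply: nIP; apply/seteqP; split=> // x hx.
  by apply: contrapT => nx; apply: hno; exists x.
have [y hy hxy] := prime_inv hP (ideal_O hI hx) nx.
apply: ideal_eqO => //; have := hs.2 _ _ (idealMr hI hy hx) (PI _ hxy).
by rewrite opprB addrCA subrr addr0.
Qed.

Lemma ideal_sum_ideal I a : is_ideal I -> O a ->
  is_ideal [set x | exists2 y, O y & I (x - a * y)].
Proof.
move=> hI ha; have hs := ideal_subgroup hI; split.
- move=> x [y hy /(ideal_O hI) h]; rewrite -[x](subrK (a * y)); apply: OD => //; exact: OM.
- by exists 0; [exact: O0|rewrite mulr0 subr0; exact: hs.1].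
- move=> x x' [y hy h] [y' hy' h']; exists (y + y'); first exact: OD.
  have -> : x + x' - a * (y + y') = (x - a * y) + (x' - a * y') by ring.
  exact: subgD.
- move=> c x hc [y hy h]; exists (c * y); first exact: OM.
  have -> : c * x - a * (c * y) = c * (x - a * y) by ring.
  exact: idealM.
Qed.

Lemma max_prime Q : nzideal Q -> Q <> O ->
  (forall I, is_ideal I -> Q `<=` I -> I <> O -> I = Q) -> nonzero_prime Q.
Proof.
move=> [hQ hnz] nO hmax; split=> //; first by move=> h1; apply: nO; exact: ideal_eqO.
have hs := ideal_subgroup hQ.
move=> x y hx hy hxy; apply: contrapT => /not_orP[nx ny].
pose I := [set z | exists2 t, O t & Q (z - x * t)].
have hI : is_ideal I by exact: ideal_sum_ideal.
have QI : Q `<=` I by move=> z hz; exists 0; [exact: O0|rewrite mulr0 subr0].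
have xI : I x by exists 1; [exact: O1|rewrite mulr1 subrr; exact: hs.1].
have IO : I = O.
  by apply: contrapT => nIO; apply: nx; rewrite -(hmax I hI QI nIO).
have [t ht h] : I 1 by rewrite IO; exact: O1.
apply: ny; have -> : y = (1 - x * t) * y + t * (x * y) by ring.
by apply: (subgD hs); [apply: idealMr|apply: idealM].
Qed.

Lemma ex_prime_over I : nzideal I -> I <> O -> exists2 P, nonzero_prime P & I `<=` P.
Proof.
move=> hI nO.
pose S k := exists Q, [/\ nzideal Q, I `<=` Q, Q <> O & ideal_norm Q = k].
have exS : exists k, `[< S k >] by exists (ideal_norm I); apply/asboolP; exists I; split.
case: (ex_minnP exS) => k /asboolP[Q [hQ IQ QO nQ]] kmin.
exists Q => //; apply: max_prime => // J hJ QJ JO; apply: contrapT => nJQ.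
have hJ' : nzideal J by split=> //; have [_ [x /QJ]] := hQ; exists x.
have : (k <= ideal_norm J)%N.
  by apply: kmin; apply/asboolP; exists J; split=> //; exact: subset_trans QJ.
by rewrite leqNgt -nQ norm_lt// => e; apply: nJQ.
Qed.

(** The quotient of [J] by [P J] is a line over the residue field of [P]: for [g] in [J] outside
    [P J], the ideal generated by [g] and [P J] has the form [J C] with [C] strictly above [P], so
    it is [J]. Representatives are then [r + g s]. *)
Lemma norm_prime_mul P J : nonzero_prime P -> nzideal J ->
  ideal_norm (ideal_mul P J) = (ideal_norm P * ideal_norm J)%N.
Proof.
move=> hP hJ; have hPn := prime_nz hP; have [hP1 _] := hPn; have [hJ1 _] := hJ.
have hPJ : is_ideal (ideal_mul P J) by exact: idm_ideal.
have hsP := ideal_subgroup hP1; have hsJ := ideal_subgroup hJ1; have hs := ideal_subgroup hPJ.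
have [g gJ gPJ] : exists2 g, J g & ~ ideal_mul P J g.
  apply: contrapT => hno; apply: (prime_neqO hP); apply: (idm_inj hJ) => //.
    exact: O_ideal.
  rewrite idm1// idmC//; apply/seteqP; split; first exact: idm_subr.
  by move=> x hx; apply: contrapT => nx; apply: hno; exists x.
have gO := ideal_O hJ1 gJ.
pose H := [set x | exists2 y, O y & ideal_mul P J (x - g * y)].
have hH : is_ideal H by exact: ideal_sum_ideal.
have HJ : H `<=` J.
  move=> x [y hy h]; rewrite -[x](subrK (g * y)); apply: subgD => //.
    exact: (idm_subr hP1 hJ1).
  exact: idealMr.
have [C hC eC] := idm_divides hJ hH HJ.
have PC : P `<=` C.
  apply: (idm_subP hJ) => //; rewrite -eC idmC// => x hx.
  by exists 0; [exact: O0|rewrite mulr0 subr0].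
have CP : C <> P.
  move=> e; apply: gPJ; rewrite idmC// -e -eC; exists 1; first exact: O1.
  by rewrite mulr1 subrr; exact: hs.1.
have HJE : H = J by rewrite eC (prime_max hP hC PC CP) idm1.
have ker x : O x -> ideal_mul P J (g * x) -> P x.
  move=> hx h; apply: contrapT => nx; have [y hy hxy] := prime_inv hP hx nx.
  apply: gPJ; have -> : g = (g * x) * y - (x * y - 1) * g by ring.
  by apply: hs.2; [apply: idealMr|apply: in_idm].
have [r [r1 r2 r3]] := ideal_norm_reps_ex hJ; have [s [s1 s2 s3]] := ideal_norm_reps_ex hPn.
have : reps (ideal_mul P J) (fun t : 'I_(ideal_norm P) * 'I_(ideal_norm J) => r t.2 + g * s t.1).
  split=> [t|x hx|[t1 t2] [t1' t2'] /= h].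
  - by apply: OD => //; apply: OM.
  - have [j hj] := r2 x hx; rewrite -HJE in hj; have [y hy h] := hj.
    have [i hi] := s2 y hy; exists (i, j) => /=.
    have -> : x - (r j + g * s i) = (x - r j - g * y) + (y - s i) * g by ring.
    by apply: subgD => //; apply: in_idm.
  - have e2 : t2 = t2'.
      apply: r3; have -> : r t2 - r t2' = (r t2 + g * s t1 - (r t2' + g * s t1')) - g * (s t1 - s t1') by ring.
      apply: hsJ.2; first exact: (idm_subr hP1 hJ1).
      by apply: idealMr => //; apply: OB.
    rewrite e2 in h *; congr (_, _); apply: s3; apply: ker; first exact: OB.
    by move: h; congr (ideal_mul _ _ _); ring.
by move/(ideal_norm_reps hPJ); rewrite card_prod !card_ord.
Qed.

Lemma factor_prime I : nzideal I -> I <> O -> exists P J,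
  [/\ nonzero_prime P, nzideal J, I = ideal_mul P J & (ideal_norm J < ideal_norm I)%N].
Proof.
move=> hI nO; have [P hP IP] := ex_prime_over hI nO; have hPn := prime_nz hP.
have [J hJ e] := idm_divides hPn hI.1 IP.
have hJn : nzideal J.
  split=> //; have [_ [x hx x0]] := hI; exists x => //.
  by move: hx; rewrite e; apply: idm_subr => //; exact: hPn.1.
exists P, J; split=> //; rewrite e norm_prime_mul//.
by rewrite ltn_Pmull ?prime_norm_gt1 ?ideal_norm_gt0.
Qed.

Lemma ideal_normM I J : nzideal I -> nzideal J ->
  ideal_norm (ideal_mul I J) = (ideal_norm I * ideal_norm J)%N.
Proof.
have [n hn] := ubnP (ideal_norm I); elim: n I hn => // n IH I hn hI hJ.
have [->|nO] := pselect (I = O); first by rewrite idm1l ?ideal_norm_O ?mul1n//; exact: hJ.1.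
have [P [I' [hP hI' e hlt]]] := factor_prime hI nO.
have hP1 := (prime_nz hP).1.
rewrite e -idmA//; [|exact: hI'.1|exact: hJ.1].
rewrite (norm_prime_mul hP (idm_nz hI' hJ)) (norm_prime_mul hP hI') IH ?mulnA//.
exact: leq_trans hlt hn.
Qed.

Lemma prime_idm P I J : nonzero_prime P -> is_ideal I -> is_ideal J ->
  ideal_mul I J `<=` P -> I `<=` P \/ J `<=` P.
Proof.
move=> hP hI hJ h; apply: contrapT => /not_orP[nI nJ].
have [x hx nx] : exists2 x, I x & ~ P x.
  by apply: contrapT => hno; apply: nI => x hx; apply: contrapT => nx; apply: hno; exists x.
have [y hy ny] : exists2 x, J x & ~ P x.
  by apply: contrapT => hno; apply: nJ => z hz; apply: contrapT => nz; apply: hno; exists z.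
have [_ _ _ pP] := hP.
by have [] := pP x y (ideal_O hI hx) (ideal_O hJ hy) (h _ (in_idm hx hy)).
Qed.

Lemma prime_sub_eq P Q : nonzero_prime P -> nonzero_prime Q -> P `<=` Q -> P = Q.
Proof.
move=> hP hQ PQ; apply: contrapT => nPQ; apply: (prime_neqO hQ).
by apply: (prime_max hP) => //; [exact: (prime_nz hQ).1|move=> e; apply: nPQ].
Qed.

(** Two of the integers from 0 to the norm are congruent, and their difference divides the
    factorial. *)
Lemma norm_nat_in I : nzideal I -> I ((ideal_norm I)`!%:R).
Proof.
move=> hI; have [r [r1 r2 r3]] := ideal_norm_reps_ex hI; have hs := ideal_subgroup hI.1.
have /choice[f hf] : forall k : 'I_(ideal_norm I).+1, exists t, I ((k : nat)%:R - r t).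
  by move=> k; apply: r2; exact: O_nat.
have [i [j [ij e]]] : exists i j : 'I_(ideal_norm I).+1, (i < j)%N /\ f i = f j.
  apply: contrapT => hno.
  have inj : injective f.
    move=> i j e; apply/val_inj; have [ij|ij|//] := ltngtP i j; exfalso; apply: hno.
      by exists i, j.
    by exists j, i.
  by have := leq_card f inj; rewrite !card_ord ltnn.
have h : I ((j - i)%:R).
  by rewrite natrB ?(ltnW ij)// -(subr_cong (r (f j))) -{2}e; apply: hs.2.
have /dvdnP[q ->] : (j - i %| (ideal_norm I)`!)%N.
  by rewrite dvdn_fact// subn_gt0 ij (leq_trans (leq_subr _ _))// -ltnS.
by rewrite natrM; apply: idealM => //; [exact: hI.1|exact: O_nat].
Qed.

Lemma finite_norm_le N : finite_set [set I : set F | nzideal I /\ (ideal_norm I <= N)%N].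
Proof.
apply: (sub_finite_set _ (@finite_ideals_containing F _ (fact_gt0 N))).
move=> I [hI hN]; split; first exact: hI.1.
have /dvdnP[q ->] : ((ideal_norm I)`! %| N`!)%N.
  by rewrite -(ffact_fact (leq_subr (ideal_norm I) N)) subKn// dvdn_mull.
by rewrite natrM; apply: idealM => //; [exact: hI.1|exact: O_nat|exact: norm_nat_in].
Qed.

End Norms.

(** * The Euler product of ideals *)

Section EulerProduct.
Variable F : fieldExtType rat.
Local Notation O := (@ring_of_integers F).
Implicit Types (I J A C P Q : set F) (S : seq (set F)).

Definition smooth S I := nzideal I /\ forall P, nonzero_prime P -> I `<=` P -> P \in S.

Definition smooth_list S N : seq (set F) :=
  fset_set [set I | smooth S I /\ (ideal_norm I <= N)%N].

Lemma finite_smooth S N : finite_set [set I | smooth S I /\ (ideal_norm I <= N)%N].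
Proof. by apply: sub_finite_set (@finite_norm_le F N) => I [[hI _] h]. Qed.

Lemma mem_smooth S N I : reflect (smooth S I /\ (ideal_norm I <= N)%N) (I \in smooth_list S N).
Proof.
rewrite /smooth_list in_fset_set; last exact: finite_smooth.
by apply: (iffP idP); rewrite inE.
Qed.

Lemma smooth_list_uniq S N : uniq (smooth_list S N).
Proof. exact: fset_uniq. Qed.

Lemma exp_sub_prime P Q k : nonzero_prime P -> nonzero_prime Q -> ideal_exp P k `<=` Q -> P = Q.
Proof.
move=> hP hQ; have hPn := prime_nz hP; elim: k => [|k IH].
  move=> h; exfalso; apply: (prime_neqO hQ); apply: ideal_eqO; first exact: (prime_nz hQ).1.
  by apply: h; exact: O1.
move=> h; have [|/IH//] := prime_idm hQ hPn.1 (idX_nz k hPn).1 h.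
exact: prime_sub_eq.
Qed.

Lemma norm_exp P k : nonzero_prime P -> ideal_norm (ideal_exp P k) = (ideal_norm P ^ k)%N.
Proof.
move=> hP; have hPn := prime_nz hP; elim: k => [|k IH]; first exact: ideal_norm_O.
by rewrite norm_prime_mul ?IH ?expnS//; exact: idX_nz.
Qed.

Lemma smooth_split P S I : nonzero_prime P -> smooth (P :: S) I -> P \notin S ->
  exists k J, smooth S J /\ I = ideal_mul (ideal_exp P k) J.
Proof.
move=> hP [hI hS] PS; have hPn := prime_nz hP.
have [n] := ubnP (ideal_norm I); elim: n I hI hS => // n IH I hI hS hn.
have [IP|nIP] := pselect (I `<=` P); last first.
  exists 0%N, I; split; last by rewrite /= idm1l//; exact: hI.1.
  split=> // Q hQ IQ; have := hS Q hQ IQ; rewrite inE => /orP[/eqP e|//].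
  by case: nIP; rewrite -e.
have [J hJ e] := idm_divides hPn hI.1 IP.
have hJn : nzideal J.
  split=> //; have [_ [x hx x0]] := hI; exists x => //.
  by move: hx; rewrite e; apply: idm_subr => //; exact: hPn.1.
have nJ : (ideal_norm J < n)%N.
  apply: leq_trans (_ : ideal_norm I <= _)%N => //; rewrite e norm_prime_mul//.
  by rewrite ltn_Pmull ?prime_norm_gt1 ?ideal_norm_gt0.
have [|k [J' [hJ' e']]] := IH J hJn _ nJ.
  move=> Q hQ JQ; apply: hS => //; rewrite e; apply: subset_trans JQ.
  by apply: idm_subr => //; exact: hPn.1.
exists k.+1, J'; split=> //.
by rewrite e e' /= idmA//; [exact: hPn.1|exact: (idX_nz k hPn).1|exact: hJ'.1.1].
Qed.

Lemma smooth_mul P S k J : nonzero_prime P -> smooth S J ->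
  smooth (P :: S) (ideal_mul (ideal_exp P k) J).
Proof.
move=> hP [hJ hS]; have hPn := prime_nz hP; split; first by apply: idm_nz => //; exact: idX_nz.
move=> Q hQ h; rewrite inE; have [/exp_sub_prime e|JQ] := prime_idm hQ (idX_nz k hPn).1 hJ.1 h.
  by rewrite (e hP hQ) eqxx.
by rewrite hS ?orbT.
Qed.

Lemma smooth_mul_inj P S k k' J J' : nonzero_prime P -> P \notin S -> smooth S J -> smooth S J' ->
  ideal_mul (ideal_exp P k) J = ideal_mul (ideal_exp P k') J' -> k = k' /\ J = J'.
Proof.
move=> hP PS; have hPn := prime_nz hP.
wlog kk : k k' J J' / (k <= k')%N.
  move=> H hJ hJ' e; have [kk|kk] := leqP k k'; first exact: H.
  by have [] := H _ _ _ _ (ltnW kk) hJ' hJ (esym e).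
move=> hJ hJ'; rewrite -(subnKC kk) idX_add// -idmA; first last.
- exact: hJ'.1.1.
- exact: (idX_nz _ hPn).1.
- exact: (idX_nz _ hPn).1.
have hX := idX_nz (k' - k) hPn.
move/(idm_inj (idX_nz k hPn) hJ.1.1 (idm_ideal hX.1 hJ'.1.1)) => e.
case: (k' - k)%N hX e => [|m] hX e.
  by rewrite addn0; split=> //; rewrite e /= idm1l//; exact: hJ'.1.1.
exfalso; move/negP: PS; apply; apply: hJ.2 => //; rewrite e /=.
rewrite -idmA; [|exact: hPn.1|exact: (idX_nz m hPn).1|exact: hJ'.1.1].
by apply: idm_subl; [exact: hPn.1|apply: idm_ideal; [exact: (idX_nz m hPn).1|exact: hJ'.1.1]].
Qed.

Lemma euler_smooth (R : realType) S K N (w : nat -> R) : uniq S ->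
  (forall P, P \in S -> nonzero_prime P) -> (N < 2 ^ K)%N -> supp N w ->
  opA K (map (@ideal_norm F) S) w 1 = \sum_(I <- smooth_list S N) w (ideal_norm I).
Proof.
move=> + + NK; elim: S w => [|P S IH] w /=.
  move=> _ _ hw; case: N NK hw => [|N] NK hw.
    rewrite hw// big_seq big1// => I /mem_smooth[[hI _]].
    by rewrite leqn0 => /eqP e; have := ideal_norm_gt0 hI; rewrite e.
  have -> : smooth_list [::] N.+1 = [:: O].
    apply: perm_small_eq => //; apply: uniq_perm => //; first exact: smooth_list_uniq.
    move=> I; rewrite inE; apply/mem_smooth/eqP => [[[hI h] _]|->].
      apply: contrapT => nO; have [P hP IP] := ex_prime_over hI nO.
      by have := h P hP IP.
    split; last by rewrite ideal_norm_O.
    split; first exact: O_nz.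
    move=> P hP OP; exfalso; apply: (prime_neqO hP); apply/seteqP; split=> //.
    by move=> x; apply: ideal_O; exact: (prime_nz hP).1.
  by rewrite big_seq1 ideal_norm_O.
move=> /andP[PS uS] hS hw.
have hP : nonzero_prime P by apply: hS; rewrite mem_head.
have hS' Q : Q \in S -> nonzero_prime Q by move=> h; apply: hS; rewrite inE h orbT.
have hPn := prime_nz hP; have q1 := prime_norm_gt1 hP.
under eq_bigr => k _ do rewrite (IH _ uS hS' (@supp_dil R N w _ hw)).
pose f (p : nat * set F) := ideal_mul (ideal_exp P p.1) p.2.
pose L := [seq p <- [seq (k, J) | k <- iota 0 K, J <- smooth_list S N] | (ideal_norm (f p) <= N)%N].
have nf k J : smooth S J -> ideal_norm (f (k, J)) = (ideal_norm P ^ k * ideal_norm J)%N.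
  by move=> hJ; rewrite /f ideal_normM ?norm_exp//; [exact: idX_nz|exact: hJ.1].
have memL k J : (k, J) \in L <-> [/\ (k < K)%N, smooth S J & (ideal_norm (f (k, J)) <= N)%N].
  rewrite mem_filter; split.
    move=> /andP[h /allpairsP[[k' J'] /= [hk /mem_smooth[hJ _] [e1 e2]]]].
    by split=> //; [move: hk; rewrite mem_iota e1 add0n|rewrite e2].
  move=> [hk hJ h]; rewrite h /=; apply/allpairsP; exists (k, J); split=> //=.
    by rewrite mem_iota.
  apply/mem_smooth; split=> //; apply: leq_trans h; rewrite nf//.
  by rewrite leq_pmull// expn_gt0 ltnW.
have E : perm_eq (smooth_list (P :: S) N) (map f L).
  apply: uniq_perm; first exact: smooth_list_uniq.
    rewrite map_inj_in_uniq.
      rewrite filter_uniq// allpairs_uniq ?iota_uniq ?smooth_list_uniq// => -[k J] [k' J'] _ _ [-> ->] //.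
    move=> [k J] [k' J'] /memL[_ hJ _] /memL[_ hJ' _] e.
    by have [e1 e2] := smooth_mul_inj hP PS hJ hJ' e; move: e1 e2 => /= -> ->.
  move=> I; apply/mem_smooth/mapP.
    move=> [hI hN]; have [k [J [hJ e]]] := smooth_split hP hI PS.
    exists (k, J) => //; apply/memL; rewrite -[f _]/(ideal_mul (ideal_exp P k) J) -e; split=> //.
    (* The chain [2 ^ k <= ideal_norm P ^ k <= N < 2 ^ K] shows that truncating the exponents at [K]
       loses nothing. *)
    rewrite -(@ltn_exp2l 2)//; apply: leq_ltn_trans NK; apply: leq_trans hN.
    rewrite e -[ideal_mul _ _]/(f (k, J)) nf//; apply: leq_trans (_ : ideal_norm P ^ k <= _)%N.
      by case: (k) => // k'; rewrite leq_exp2r.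
    by rewrite leq_pmulr// ideal_norm_gt0//; exact: hJ.1.
  by move=> [[k J] /memL[_ hJ hN] ->]; split=> //; exact: smooth_mul.
rewrite (perm_big _ E) big_map /L big_filter.
rewrite -(big_mkord xpredT (fun k => \sum_(I <- smooth_list S N) w (ideal_norm P ^ k * ideal_norm I)%N)).
rewrite [RHS]big_mkcond big_allpairs_dep /index_iota subn0 /=; apply: eq_bigr => k _.
rewrite big_seq [RHS]big_seq; apply: eq_bigr => J /mem_smooth[hJ _].
rewrite nf//; case: ifP => // /negbT; rewrite -ltnNge => h; apply: hw.
by rewrite h orbT.
Qed.


Definition count_ideals (n : nat) : nat :=
  #|` fset_set [set I : set F | nzideal I /\ ideal_norm I = n]|.

Definition count_primes (q : nat) : nat :=
  #|` fset_set [set P : set F | nonzero_prime P /\ ideal_norm P = q]|.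

Lemma finite_norm_eq n : finite_set [set I : set F | nzideal I /\ ideal_norm I = n].
Proof. by apply: sub_finite_set (@finite_norm_le F n) => I [hI e]; split=> //; rewrite e. Qed.

Lemma finite_prime_eq n : finite_set [set I : set F | nonzero_prime I /\ ideal_norm I = n].
Proof. by apply: sub_finite_set (finite_norm_eq n) => I [/prime_nz hI e]. Qed.

Lemma count_primes_le q : (count_primes q <= count_ideals q)%N.
Proof.
apply: fsubset_leq_card; apply/fsubsetP => I.
rewrite !in_fset_set; [|exact: finite_norm_eq|exact: finite_prime_eq].
by rewrite !inE => -[/prime_nz h e].
Qed.

Definition prime_seq N : seq (set F) :=
  flatten [seq (fset_set [set P : set F | nonzero_prime P /\ ideal_norm P = q] : seq _) | q <- iota 2 N.-1].

Lemma mem_prime_seq N P : reflect (nonzero_prime P /\ (ideal_norm P <= N)%N) (P \in prime_seq N).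
Proof.
apply: (iffP flattenP) => [[s /mapP[q + ->]]|[hP hN]].
  rewrite mem_iota in_fset_set; last exact: finite_prime_eq.
  by rewrite inE => hq [hP e]; split=> //; lia.
exists (fset_set [set Q : set F | nonzero_prime Q /\ ideal_norm Q = ideal_norm P] : seq _).
  by apply/mapP; exists (ideal_norm P) => //; rewrite mem_iota; have := prime_norm_gt1 hP; lia.
by rewrite in_fset_set ?inE//; exact: finite_prime_eq.
Qed.

Lemma prime_seq_uniq N : uniq (prime_seq N).
Proof.
rewrite /prime_seq; elim: (iota 2 N.-1) (iota_uniq 2 N.-1) => //= q s IH /andP[qs us].
rewrite cat_uniq fset_uniq IH// andbT /=; apply/hasPn => P /flatten_mapP[q' q's].
rewrite !in_fset_set ?inE; try exact: finite_prime_eq.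
move=> [_ e']; apply/negP; rewrite inE => -[_ e]; by move/negP: qs; apply; rewrite -e e'.
Qed.

Lemma map_norm_prime_seq N : map (@ideal_norm F) (prime_seq N) = norm_list count_primes N.
Proof.
rewrite /prime_seq /norm_list map_flatten -map_comp; congr flatten; apply: eq_map => q /=.
set X := fset_set _; have hX : forall P, P \in (X : seq _) -> ideal_norm P = q.
  by move=> P; rewrite in_fset_set ?inE; [move=> -[]|exact: finite_prime_eq].
have -> : count_primes q = size (X : seq _) by [].
by elim: (X : seq _) hX => //= P s IH h; rewrite h ?mem_head// IH// => Q hQ; rewrite h// inE hQ orbT.
Qed.

Lemma ideal_euler (R : realType) N (w : nat -> R) : supp N w ->
  psum (fun n => (count_ideals n)%:R * w n) N = opA N.+1 (norm_list count_primes N) w 1.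
Proof.
move=> hw; rewrite -map_norm_prime_seq (euler_smooth (N := N) (prime_seq_uniq N))//; first last.
- exact: ltn_expS2.
- by move=> P /mem_prime_seq[].
have E : perm_eq (smooth_list (prime_seq N) N)
  (flatten [seq (fset_set [set I : set F | nzideal I /\ ideal_norm I = n] : seq _) | n <- iota 1 N]).
  apply: uniq_perm; first exact: smooth_list_uniq.
    elim: (iota 1 N) (iota_uniq 1 N) => //= q s IH /andP[qs us].
    rewrite cat_uniq fset_uniq IH// andbT /=; apply/hasPn => P /flatten_mapP[q' q's].
    rewrite !in_fset_set ?inE; try exact: finite_norm_eq.
    move=> [_ e']; apply/negP; rewrite inE => -[_ e]; by move/negP: qs; apply; rewrite -e e'.
  move=> I; apply/mem_smooth/flatten_mapP.
    move=> [[hI h] hN]; exists (ideal_norm I).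
      by rewrite mem_iota; have := ideal_norm_gt0 hI; lia.
    by rewrite in_fset_set ?inE//; exact: finite_norm_eq.
  move=> [n]; rewrite mem_iota in_fset_set; last exact: finite_norm_eq.
  rewrite inE => hn [hI e]; split; last by lia.
  split=> // P hP IP; apply/mem_prime_seq; split=> //.
  have [e1|nIP] := pselect (I = P); first by rewrite -e1; lia.
  by have := norm_lt hI (prime_nz hP) IP nIP; lia.
rewrite (perm_big _ E) /= big_flatten big_map /psum /index_iota subSS subn0.
apply: eq_bigr => n _; rewrite big_seq.
under eq_bigr => I hI.
  have -> : ideal_norm I = n.
    by move: hI; rewrite in_fset_set ?inE; [move=> -[]|exact: finite_norm_eq].
  over.
rewrite [RHS](_ : _ = \sum_(I <- fset_set [set I : set F | nzideal I /\ ideal_norm I = n]) w n).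
  by rewrite big_const_seq count_predT iter_addr_0 mulr_natl.
by rewrite [RHS]big_seq.
Qed.

End EulerProduct.

(** * Counting ideals *)

Section PrincipalIdeals.
Variable F : fieldExtType rat.
Local Notation d := (dim F).
Local Notation O := (@ring_of_integers F).
Local Notation B := (O_basis F).
Implicit Types (x y a b : F) (I J A C P : set F).

Definition vz (z : 'rV[int]_d) : F := vc (map_mx intr z *m B).

Lemma vz_O z : O (vz z).
Proof. by apply: vc_O; apply/mxOverP => i j; rewrite mxE intr_int. Qed.

Lemma vzB z z' : vz (z - z') = vz z - vz z'.
Proof. by rewrite /vz map_mxB mulmxBl linearB. Qed.

Lemma vz_inj : injective vz.
Proof.
move=> z z' /(congr1 (crd B)); rewrite !crd_vc ?O_basis_unit// => /matrixP h.
by apply/matrixP => i j; have := h i j; rewrite !mxE => /intr_inj.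
Qed.

Lemma int_mxP m n (A : 'M[rat]_(m, n)) : A \is a mxOver Num.int ->
  exists Z : 'M[int]_(m, n), A = map_mx intr Z.
Proof.
move=> /mxOverP h; exists (map_mx Num.floor A); apply/matrixP => i j.
by rewrite !mxE; have /intrP[z ->] := h i j; rewrite intrKfloor.
Qed.

Lemma ex_vz x : O x -> exists z, x = vz z.
Proof.
rewrite [X in X x]O_basisE => /int_mxP[z hz]; exists z.
by rewrite /vz -hz crdK// O_basis_unit.
Qed.

Lemma vz_mul a : O a -> exists M : 'M[int]_d,
  (forall z, vz (z *m M) = a * vz z) /\ (`|\det M|)%:~R = `|Nm a|.
Proof.
move=> ha; have Bu := O_basis_unit F.
have [|M hM] := @int_mxP _ _ (B *m mulM a *m invmx B).
  by apply: (stable_int_mx Bu (O_basisE F)) => y hy; exact: OM.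
exists M; split=> [z|].
  rewrite /vz map_mxM -hM -!mulmxA mulVmx// mulmx1.
  by apply: (can_inj (@cvK F)); rewrite mulrC mulME !vcK mulmxA.
have : \det (map_mx intr M : 'M[rat]_d) = Nm a.
  rewrite -hM !det_mulmx mulrAC -det_mulmx mulmxV// det1 mul1r//.
by rewrite det_map_mx => <-; rewrite intr_norm.
Qed.

Lemma absz_det_unit (L : 'M[int]_d) : L \in unitmx -> `|\det L|%N = 1%N.
Proof. by rewrite unitmxE => /unitrP[y [h _]]; have := congr1 absz h; rewrite abszM => /eqP; rewrite muln_eq1 => /andP[_ /eqP]. Qed.

(** The Smith normal form of multiplication by [a] turns the residue ring into a product of cyclic
    groups, whose orders multiply to the determinant. *)
Lemma norm_scl a : O a -> a != 0 -> (ideal_norm (scl a O))%:R = `|Nm a|.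
Proof.
move=> ha a0; have [M [hM hd]] := vz_mul ha.
have hI : is_ideal (scl a O).
  by apply: scl_ideal (O_ideal F) => x [y hy <-]; exact: OM.
have [L Lu [U Uu [ds _ e]]] := int_Smith_normal_form M.
set D := \matrix_(i, j) _ in e.
have DE : D = diag_mx (\row_(i < d) ds`_i).
  by apply/matrixP => i j; rewrite !mxE val_eqE.
have detM : `|\det M|%N = (\prod_(i < d) `|(ds`_i)%R|)%N.
  rewrite e !det_mulmx !abszM (absz_det_unit Lu) (absz_det_unit Uu) mul1n muln1 DE det_diag.
  by rewrite (big_morph absz abszM (erefl _)); apply: eq_bigr => i _; rewrite mxE.
have nz i : (0 < `|(ds`_(nat_of_ord (i : 'I_d)))%R|)%N.
  have : (0 < `|\det M|)%N.
    rewrite absz_gt0; apply: contraNneq a0 => h.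
    by move: hd; rewrite h normr0 => /esym/eqP; rewrite normr_eq0 Nm_eq0.
  by rewrite detM (bigD1 i)//= muln_gt0 => /andP[].
pose n (i : 'I_d) := `|(ds`_i)%R|%N.
pose T := {dffun forall i : 'I_d, 'I_(n i)}.
pose r (f : T) := vz ((\row_i (f i : nat)%:Z) *m U).
have mulD (q : 'rV[int]_d) i : (q *m D) 0 i = q 0 i * ds`_i.
  by rewrite DE mul_mx_diag !mxE.
have hr : reps (scl a O) r.
  split.
  - by move=> f; exact: vz_O.
  - move=> x /ex_vz[z ->].
    pose y := z *m invmx U.
    have hlt i : (`|(y 0%R i %% (ds`_(nat_of_ord (i : 'I_d)))%R)%Z| < n i)%N.
      have h0 : ds`_i != 0 by rewrite -absz_gt0 nz.
      by rewrite -ltz_nat gez0_abs ?modz_ge0// /n; exact: ltz_mod.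
    pose f : T := [ffun i => Ordinal (hlt i)].
    pose q : 'rV[int]_d := \row_i (y 0%R i %/ (ds`_i)%R)%Z.
    exists f; rewrite /r -vzB; exists (vz (q *m invmx L)); first exact: vz_O.
    rewrite -hM; congr vz.
    have yE : y = q *m D + \row_i (f i : nat)%:Z.
      apply/rowP => i; have qE : q 0 i = (y 0%R i %/ (ds`_i)%R)%Z by rewrite mxE.
      have fE : (\row_j (f j : nat)%:Z) 0 i = (f i : nat)%:Z by rewrite mxE.
      rewrite [RHS]mxE mulD qE fE ffunE /= gez0_abs; last first.
        by rewrite modz_ge0// -absz_gt0 nz.
      exact: divz_eq.
    by rewrite e !mulmxA mulmxKV// -[z](mulmxKV Uu) -/y yE mulmxDl addrK.
  move=> f f' [w /ex_vz[z ->]]; rewrite -hM /r -vzB => /vz_inj.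
  rewrite e !mulmxA -mulmxBl => /(congr1 (mulmx^~ (invmx U))); rewrite !mulmxK// => h.
  apply/ffunP => i; apply/val_inj => /=.
  have := congr1 (fun v : 'rV[int]_d => v 0 i) h; rewrite /= mulD !mxE.
  set k := (X in X * _ = _) => hk.
  have hm : ((f i : nat)%:Z = (f' i : nat)%:Z %[mod ds`_i])%Z.
    by apply/eqP; rewrite eqz_mod_dvd -hk dvdz_mull.
  have ms (g : T) : ((g i : nat)%:Z %% ds`_i)%Z = (g i : nat)%:Z.
    rewrite -modz_abs modz_small//= -/(n i); have := ltn_ord (g i); lia.
  by move: hm; rewrite !ms => -[].
rewrite (ideal_norm_reps hI hr) card_dep_ffun -hd.
have -> : `|\det M| = `|\det M|%N%:Z by rewrite abszE.
rewrite detM; congr (_%:R); rewrite foldrE big_map big_enum /=.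
by apply: eq_bigr => i _; rewrite card_ord.
Qed.

Definition ounit u := [/\ O u, O u^-1 & u != 0 :> F].

Lemma Nm_unit u : ounit u -> `|Nm u| = 1.
Proof.
move=> [h1 h2 u0]; have [n e1] := Nm_nat h1; have [m e2] := Nm_nat h2.
have : (n * m)%:R = 1 :> rat by rewrite natrM -e1 -e2 -normrM -NmM divff// Nm1 normr1.
move=> /eqP; rewrite -[1]/(1%:R) eqr_nat muln_eq1 => /andP[/eqP e _].
by rewrite e1 e.
Qed.

Lemma oM u v : ounit u -> ounit v -> ounit (u * v).
Proof. by move=> [? ? ?] [? ? ?]; split; rewrite ?invfM ?mulf_neq0//; exact: OM. Qed.

Lemma oV u : ounit u -> ounit u^-1.
Proof. by move=> [? ? ?]; split; rewrite ?invrK ?invr_neq0. Qed.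

Lemma scl_unit u a : ounit u -> scl (u * a) O = scl a O.
Proof.
move=> [h1 h2 u0]; apply/seteqP; split=> x [y hy <-].
  by exists (u * y); [exact: OM|ring].
by exists (u^-1 * y); [exact: OM|field].
Qed.

Lemma scl_eq_unit a b : a != 0 -> b != 0 -> scl a O = scl b O -> exists2 u, ounit u & b = u * a.
Proof.
move=> a0 b0 e.
have [u hu hub] : scl a O b by rewrite e; exists 1; [exact: O1|rewrite mulr1].
have [v hv hva] : scl b O a by rewrite -e; exists 1; [exact: O1|rewrite mulr1].
have vu : v * u = 1 by apply: (mulfI a0); rewrite mulr1 -{2}hva -hub; ring.
exists u; last by rewrite mulrC.
have u0 : u != 0 by apply/eqP => u0; move: vu; rewrite u0 mulr0 => /esym/eqP; rewrite oner_eq0.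
by split=> //; rewrite -[u^-1]mul1r -vu mulfK.
Qed.

Definition nrm x : rat := \sum_i `|crd B x 0 i|.

Lemma nrm_ge0 x : 0 <= nrm x. Proof. exact: sumr_ge0. Qed.

Lemma crd_le_nrm x i : `|crd B x 0 i| <= nrm x.
Proof. by rewrite /nrm (bigD1 i)//= lerDl sumr_ge0. Qed.

Lemma nrmD x y : nrm (x + y) <= nrm x + nrm y.
Proof. by rewrite /nrm -big_split; apply: ler_sum => i _; rewrite crdD mxE ler_normD. Qed.

Lemma nrmN x : nrm (- x) = nrm x.
Proof. by rewrite /nrm; apply: eq_bigr => i _; rewrite crdN mxE normrN. Qed.

Lemma nrmZ (c : rat) x : nrm (c *: x) = `|c| * nrm x.
Proof. by rewrite /nrm mulr_sumr; apply: eq_bigr => i _; rewrite crdZ mxE normrM. Qed.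

Lemma nrm_sum (T : Type) (s : seq T) (f : T -> F) : nrm (\sum_(i <- s) f i) <= \sum_(i <- s) nrm (f i).
Proof.
elim: s => [|a s IH]; first by rewrite !big_nil -(scale0r 0) nrmZ normr0 mul0r.
by rewrite !big_cons (le_trans (nrmD _ _))// lerD2l.
Qed.

Lemma crd_sum x : x = \sum_i crd B x 0 i *: vc (row i B).
Proof. by rewrite -vc_sum crdK// O_basis_unit. Qed.

Lemma nrm_mul : exists2 E : rat, 0 < E & forall x y, nrm (x * y) <= E * (nrm x * nrm y).
Proof.
pose E := \sum_i \sum_j nrm (vc (row i B) * vc (row j B)).
have hE i j : nrm (vc (row i B) * vc (row j B)) <= E.
  rewrite /E (bigD1 i)//= (bigD1 j)//= -addrA lerDl addr_ge0//; last apply: sumr_ge0 => k _; apply: sumr_ge0 => l _; exact: nrm_ge0.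
have E0 : 0 <= E by apply: sumr_ge0 => k _; apply: sumr_ge0 => l _; exact: nrm_ge0.
exists (E + 1) => [|x y]; first lra.
apply: (@le_trans _ _ (E * (nrm x * nrm y))); last first.
  by rewrite ler_wpM2r ?mulr_ge0 ?nrm_ge0//; lra.
rewrite {1}(crd_sum x) {1}(crd_sum y) mulr_suml; apply: le_trans (nrm_sum _ _) _.
rewrite /nrm mulrC mulr_suml mulr_suml; apply: ler_sum => i _.
rewrite mulr_sumr; apply: le_trans (nrm_sum _ _) _.
rewrite -mulrA mulr_suml mulr_sumr; apply: ler_sum => j _.
by rewrite -scalerAl -scalerAr !nrmZ; do 2 apply: ler_wpM2l => //; exact: hE.
Qed.

Lemma Nm_nrm : exists2 C : rat, 0 < C & forall x, `|Nm x| <= C * nrm x ^+ d.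
Proof.
have [C C0 h] := Nm_bound (O_basis_unit F); exists C => // x; apply: h => i; exact: crd_le_nrm.
Qed.

(** The inverse is read off the adjugate matrix, whose entries are minors of order [d - 1]. *)
Lemma nrm_inv : exists2 E : rat, 0 < E & forall x, x != 0 -> nrm x^-1 <= E * nrm x ^+ d.-1 / `|Nm x|.
Proof.
have [E1 E10 h1] := mulM_bound (O_basis_unit F).
pose S := \sum_i \sum_k \sum_l (`|cv (1 : F) 0 k| * `|invmx B l i|).
have S0 : 0 <= S by do 3 (apply: sumr_ge0 => ? _); rewrite mulr_ge0.
pose K := (d.-1)`!%:R * E1 ^+ d.-1.
have K0 : 0 <= K by rewrite mulr_ge0// exprn_ge0// ltW.
exists (S * K + 1) => [|x x0]; first by rewrite ltr_wpDl// mulr_ge0.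
have N0 : 0 < `|Nm x| by rewrite normr_gt0 Nm_eq0.
have hadj i j : `|(\adj (mulM x)) i j| <= K * nrm x ^+ d.-1.
  rewrite mxE /cofactor normrM normrX normrN1 expr1n mul1r /K -mulrA -exprMn.
  apply: det_le => k l; rewrite [row' _ _ _ _]mxE [col' _ _ _ _]mxE; apply: h1 => m; exact: crd_le_nrm.
have -> : x^-1 = vc (cv 1 *m ((Nm x)^-1 *: \adj (mulM x))).
  apply: (can_inj (@cvK F)); rewrite vcK -[x^-1]mul1r mulME; congr (_ *m _).
  have : mulM x *m mulM x^-1 = 1%:M by rewrite -mulM_mul divff// mulM1.
  move=> /(congr1 (mulmx (invmx (mulM x)))); rewrite mulKmx ?mulM_unit// mulmx1 => ->.
  by rewrite /invmx mulM_unit.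
rewrite /nrm /crd vcK -scalemxAr -scalemxAl.
rewrite (@le_trans _ _ (S * (K * nrm x ^+ d.-1) / `|Nm x|))//; last first.
  rewrite ler_pM2r ?invr_gt0// mulrA ler_wpM2r ?exprn_ge0 ?nrm_ge0//; lra.
rewrite /S mulr_suml mulr_suml; apply: ler_sum => i _.
rewrite mxE normrM normfV mulrC ler_pM2r ?invr_gt0// mxE.
apply: le_trans (ler_norm_sum _ _ _) _; rewrite exchange_big mulr_suml; apply: ler_sum => l _.
rewrite normrM mxE; apply: le_trans (ler_wpM2r (normr_ge0 _) (ler_norm_sum _ _ _)) _.
rewrite !mulr_suml; apply: ler_sum => k _; rewrite normrM [leLHS]mulrAC ler_wpM2l ?mulr_ge0//.
Qed.

Lemma finite_nrm_le (r : rat) : finite_set [set x | O x /\ nrm x <= r].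
Proof.
pose m := (Num.truncn r).+1.
pose g (f : {ffun 'I_d -> 'I_(m + m)}) := vz (\row_i ((f i : nat)%:Z - m%:Z)).
apply: (@sub_finite_set _ _ (g @` [set: {ffun 'I_d -> 'I_(m + m)}]%classic)); last first.
  by apply: finite_image; exact: finite_finset.
move=> x [/ex_vz[z ->] h].
have hz i : `|z 0 i| < m%:Z.
  have := crd_le_nrm (vz z) i; rewrite crd_vc ?O_basis_unit// mxE => h1.
  rewrite -(@ltr_int rat) intr_norm; apply: le_lt_trans (le_trans h1 h) _.
  exact: truncnS_gt.
have hf i : (`|(z 0%R i + m%:Z)%R|%N < m + m)%N by have := hz i; lia.
exists [ffun i => Ordinal (hf i)] => //; rewrite /g; congr vz.
by apply/rowP => i; rewrite mxE ffunE /=; have := hz i; lia.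
Qed.

(** Units balance the coordinates: this takes the place of Dirichlet's unit theorem. More than
    [|Nm a|] lattice points in a small cube give a small multiple [a w]; then [Nm w] is bounded, so
    [w] is a unit times one of finitely many generators [g]. Dividing [a w] by [g] leaves a unit
    multiple of [a]. *)
Lemma unit_compact : exists2 C : rat, 0 < C & forall y, y != 0 ->
  exists2 u, ounit u & nrm (u * y) ^+ d <= C * `|Nm y|.
Proof.
have [E E0 hE] := nrm_mul; have [C0 C00 hC0] := Nm_nrm.
have d0 := d_gt0 F.
(* A bound for the norm of the cofactor [w] that the pigeonhole will give. *)
pose Cn := Num.truncn (C0 * d%:R ^+ d).
have /finite_fsetP[X hX] := @finite_norm_le F Cn.
pose gen (I : set F) : F := xget 0 [set a | I = scl a O].
pose S := 1 + \sum_(I <- X) nrm (gen I)^-1.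
have S1 : 1 <= S by rewrite lerDl sumr_ge0// => I _; exact: nrm_ge0.
pose E' := E * (d%:R * S).
have E'0 : 0 < E' by rewrite !mulr_gt0 ?ltr0n//; lra.
exists (E' ^+ d); first by rewrite exprn_gt0.
suff main a : O a -> a != 0 -> exists2 u, ounit u & nrm (u * a) ^+ d <= E' ^+ d * `|Nm a|.
  move=> y y0; have [n n0 hn] := ex_integer_multiple y.
  have n0' : (n%:R : rat) != 0 by rewrite pnatr_eq0 -lt0n.
  have [|u hu h] := main _ hn; first by rewrite scaler_eq0 negb_or n0' y0.
  exists u => //; move: h; rewrite -scalerAr nrmZ NmZ exprMn normrM normrX mulrCA ler_pM2l//.
  by rewrite exprn_gt0// normr_gt0.
move=> ha a0; set n := ideal_norm (scl a O).
have hI : nzideal (scl a O).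
  by apply: scl_nz (O_nz F) => // x [y hy <-]; exact: OM.
have nE : n%:R = `|Nm a| by exact: norm_scl.
have [k /andP[k1 k2]] := @ex_root d n d0.
have [r [_ r2 _]] := ideal_norm_reps_ex hI.
have /choice[t ht] : forall f : {ffun 'I_d -> 'I_k.+1}, exists t, scl a O (pt f - r t).
  by move=> f; apply: r2; exact: pt_O.
have /injectivePn[f [f' ff' e]] : ~~ injectiveb t.
  by apply/negP => /injectiveP/leq_card; rewrite card_ffun !card_ord leqNgt k2.
have [w hw ew] : scl a O (pt f - pt f').
  have := ideal_subgroup hI.1; move=> [_ hs]; have := hs _ _ (ht f) (ht f').
  by rewrite e; have -> : pt f - r (t f') - (pt f' - r (t f')) = pt f - pt f' by ring.
have hb : nrm (a * w) <= d%:R * k%:R.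
  rewrite ew /nrm /pt -linearB -mulmxBl.
  apply: le_trans (_ : \sum_(i < d) k%:R <= _); last by rewrite sumr_const card_ord mulr_natl.
  apply: ler_sum => i _; rewrite crd_vc ?O_basis_unit// !mxE.
  have := ltn_ord (f i); have := ltn_ord (f' i); rewrite !ltnS -!(ler_nat rat) => h1 h2.
  have := ler0n rat (f i); have := ler0n rat (f' i).
  by rewrite ler_norml => h3 h4; apply/andP; split; lra.
have w0 : w != 0.
  apply: contra_neq ff' => w0; move: ew; rewrite w0 mulr0 => /esym/eqP; rewrite subr_eq0 => /eqP.
  move=> /(congr1 (crd B)); rewrite !crd_vc ?O_basis_unit// => /rowP h.
  by apply/ffunP => i; apply/val_inj; have := h i; rewrite !mxE => /eqP; rewrite eqr_nat => /eqP.
have Na0 : 0 < `|Nm a| by rewrite normr_gt0 Nm_eq0.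
have kn : k%:R ^+ d <= `|Nm a| by rewrite -nE -natrX ler_nat.
have Nw : `|Nm w| <= C0 * d%:R ^+ d.
  rewrite -(ler_pM2l Na0) -normrM -NmM; apply: le_trans (hC0 _) _.
  rewrite mulrCA ler_pM2l//; apply: (@le_trans _ _ ((d%:R * k%:R) ^+ d)).
    by rewrite lerXn2r ?nnegrE ?nrm_ge0 ?mulr_ge0.
  by rewrite exprMn mulrC ler_wpM2r// exprn_ge0.
have wX : scl w O \in X.
  have : [set` X] (scl w O); last by [].
  rewrite -hX; split; first by apply: scl_nz (O_nz F) => // x [y hy <-]; exact: OM.
  rewrite -(ler_nat rat) norm_scl//; have [m hm] := Nm_nat hw; rewrite hm ler_nat /Cn truncn_ge_nat -?hm//.
  by rewrite mulr_ge0 ?exprn_ge0// ltW.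
have gE : scl w O = scl (gen (scl w O)) O.
  by apply: (@xgetPex _ 0 [set a | scl w O = scl a O]); exists w.
set g := gen (scl w O) in gE.
have g0 : g != 0.
  apply: contraNneq w0 => g0; have : scl g O w by rewrite -gE; exists 1; [exact: O1|rewrite mulr1].
  by move=> [y _]; rewrite g0 mul0r => <-.
have [u hu ue] := scl_eq_unit g0 w0 (esym gE).
exists u => //.
have -> : u * a = (a * w) * g^-1 by rewrite ue; field.
have hg : nrm g^-1 <= S.
  by rewrite /S (big_rem _ wX) /= -/g addrCA lerDl addr_ge0// sumr_ge0// => I _; exact: nrm_ge0.
apply: (@le_trans _ _ ((E' * k%:R) ^+ d)); last by rewrite exprMn ler_wpM2l// exprn_ge0// ltW.
apply: lerXn2r; rewrite ?nnegrE ?nrm_ge0//; first by rewrite mulr_ge0// ltW.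
apply: le_trans (hE _ _) _; rewrite /E' -mulrA ler_pM2l//.
rewrite mulrAC; apply: ler_pM; rewrite ?nrm_ge0//.
Qed.

(** If [y] and [u y] both lie in the cone, then [u = (u y) / y] is bounded by [nrm_inv], and bounded
    integers are finite in number. *)
Lemma finite_units (C : rat) : exists U : seq F, [/\ uniq U, forall u, u \in U -> ounit u &
  forall y u, y != 0 -> ounit u -> nrm y ^+ d <= C * `|Nm y| -> nrm (u * y) ^+ d <= C * `|Nm y| ->
    u \in U].
Proof.
have [E E0 hE] := nrm_mul; have [E2 E20 hE2] := nrm_inv.
have fin : finite_set [set u | ounit u /\ nrm u <= E * (E2 * C)].
  by apply: sub_finite_set (finite_nrm_le (E * (E2 * C))) => u [[]].
have /finite_fsetP[X hX] := fin.
have hX' u : u \in X <-> ounit u /\ nrm u <= E * (E2 * C).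
  split=> h; first by have : [set` X] u by []; rewrite -hX.
  by have : [set u | ounit u /\ nrm u <= E * (E2 * C)] u by []; rewrite hX.
exists X; split; [exact: fset_uniq|by move=> u /hX'[]|].
move=> y u y0 hu h1 h2; apply/hX'; split=> //.
have N0 : 0 < `|Nm y| by rewrite normr_gt0 Nm_eq0.
have -> : u = (u * y) * y^-1 by rewrite mulfK.
apply: le_trans (hE _ _) _; rewrite ler_pM2l//.
apply: le_trans (ler_wpM2l (nrm_ge0 _) (hE2 _ y0)) _.
rewrite -!mulrA mulrCA ler_pM2l// mulrA ler_pdivrMr//.
set p := nrm (u * y) in h2 *; set q := nrm y in h1 *.
have p0 : 0 <= p by exact: nrm_ge0.
have q0 : 0 <= q by exact: nrm_ge0.
have d0 := d_gt0 F.
have [pq|qp] := leP p q.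
  by apply: le_trans h1; rewrite -{2}(prednK d0) exprS ler_wpM2r// exprn_ge0.
apply: le_trans h2; rewrite -{2}(prednK d0) exprS ler_wpM2l//.
by rewrite lerXn2r ?nnegrE// ltW.
Qed.

End PrincipalIdeals.

(** * Lipschitz functions and a weight in place of a fundamental domain *)

Section LocallyLipschitz.
Variable F : fieldExtType rat.
Local Notation d := (dim F).
Local Notation O := (@ring_of_integers F).
Local Notation B := (O_basis F).
Implicit Types (x y : F) (f g : F -> rat).

Definition lip f := forall r : rat, exists2 K : rat, 0 <= K &
  forall x y, nrm x <= r -> nrm y <= r -> `|f x - f y| <= K * nrm (x - y).

Lemma lip_bd f r : lip f -> exists2 M : rat, 0 <= M & forall x, nrm x <= r -> `|f x| <= M.
Proof.
move=> /(_ r)[K K0 h]; exists (`|f 0| + K * `|r|) => [|x hx]; first by rewrite addr_ge0// mulr_ge0.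
have n0 : nrm (0 : F) = 0 by rewrite -(scale0r 0) nrmZ normr0 mul0r.
have r0 := le_trans (nrm_ge0 x) hx.
have := h x 0 hx; rewrite n0 subr0 => /(_ r0) h1.
have h2 : K * nrm x <= K * `|r| by rewrite ler_wpM2l// ger0_norm.
by have := ler_normD (f x - f 0) (f 0); rewrite subrK; lra.
Qed.

Lemma eq_lip f g : f =1 g -> lip f -> lip g.
Proof. by move=> e hf r; have [K K0 h] := hf r; exists K => // x y; rewrite -!e; exact: h. Qed.

Lemma lip_cst (c : rat) : lip (fun=> c).
Proof. by move=> r; exists 0 => // x y _ _; rewrite subrr normr0 mul0r. Qed.

Lemma lipD f g : lip f -> lip g -> lip (fun x => f x + g x).
Proof.
move=> hf hg r; have [K K0 h1] := hf r; have [K' K'0 h2] := hg r.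
exists (K + K') => [|x y hx hy]; first exact: addr_ge0.
have := ler_normD (f x - f y) (g x - g y); have := h1 x y hx hy; have := h2 x y hx hy.
by rewrite mulrDl (_ : f x + g x - (f y + g y) = f x - f y + (g x - g y)); [lra|ring].
Qed.

Lemma lipM f g : lip f -> lip g -> lip (fun x => f x * g x).
Proof.
move=> hf hg r; have [K K0 h1] := hf r; have [K' K'0 h2] := hg r.
have [M M0 h3] := lip_bd r hf; have [M' M'0 h4] := lip_bd r hg.
exists (K * M' + M * K') => [|x y hx hy]; first by rewrite addr_ge0// mulr_ge0.
have -> : f x * g x - f y * g y = (f x - f y) * g x + f y * (g x - g y) by ring.
apply: le_trans (ler_normD _ _) _; rewrite !normrM mulrDl; apply: lerD.
  by rewrite mulrAC; apply: ler_pM => //; [exact: h1|exact: h4].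
by rewrite -mulrA; apply: ler_pM => //; [exact: h3|exact: h2].
Qed.

Lemma lip_abs f : lip f -> lip (fun x => `|f x|).
Proof.
move=> hf r; have [K K0 h] := hf r; exists K => // x y hx hy.
exact: le_trans (ler_dist_dist _ _) (h x y hx hy).
Qed.

Lemma max0E (c : rat) : Num.max 0 c = 2^-1 * (c + `|c|).
Proof. by case: leP => h; [rewrite ger0_norm|rewrite ltr0_norm]; lra. Qed.

Lemma lip_max0 f : lip f -> lip (fun x => Num.max 0 (f x)).
Proof.
move=> hf; apply: (@eq_lip (fun x => 2^-1 * (f x + `|f x|))) => [x|]; first by rewrite max0E.
by apply: lipM; [exact: lip_cst|apply: lipD => //; exact: lip_abs].
Qed.

Lemma lip_sum (T : Type) (s : seq T) (f : T -> F -> rat) :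
  (forall i, lip (f i)) -> lip (fun x => \sum_(i <- s) f i x).
Proof.
move=> h; elim: s => [|a s IH].
  by apply: eq_lip (lip_cst 0) => x; rewrite big_nil.
by apply: eq_lip (lipD (h a) IH) => x; rewrite big_cons.
Qed.

Lemma lip_prod (T : Type) (s : seq T) (f : T -> F -> rat) :
  (forall i, lip (f i)) -> lip (fun x => \prod_(i <- s) f i x).
Proof.
move=> h; elim: s => [|a s IH].
  by apply: eq_lip (lip_cst 1) => x; rewrite big_nil.
by apply: eq_lip (lipM (h a) IH) => x; rewrite big_cons.
Qed.

Lemma lip_exp f n : lip f -> lip (fun x => f x ^+ n).
Proof.
move=> hf; elim: n => [|n IH]; first by apply: eq_lip (lip_cst 1) => x; rewrite expr0.
by apply: eq_lip (lipM hf IH) => x; rewrite exprS.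
Qed.

Lemma lip_lin f (K : rat) : 0 <= K -> (forall x y, f (x - y) = f x - f y) ->
  (forall x, `|f x| <= K * nrm x) -> lip f.
Proof. by move=> K0 h1 h2 r; exists K => // x y _ _; rewrite -h1. Qed.

Lemma lip_nrm : lip (@nrm F).
Proof.
apply: lip_sum => i; apply: lip_abs; apply: (@lip_lin _ 1) => // [x y|x].
  by rewrite crdB mxBE.
by rewrite mul1r crd_le_nrm.
Qed.

Lemma lip_Nm : lip (@Nm F).
Proof.
have [E E0 hE] := mulM_bound (O_basis_unit F).
apply: lip_sum => s; apply: lipM; first exact: lip_cst.
apply: lip_prod => i; apply: (@lip_lin _ E) => [|x y|x]; first exact: ltW.
  by rewrite -scaleN1r mulM_add mulMZ scaleN1r mxBE.
by apply: hE => j; exact: crd_le_nrm.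
Qed.

Lemma lip_mul f u : lip f -> lip (fun x => f (u * x)).
Proof.
move=> hf r; have [E E0 hE] := nrm_mul F; have [K K0 h] := hf (E * (nrm u * r)).
have hb x : nrm x <= r -> nrm (u * x) <= E * (nrm u * r).
  by move=> hx; apply: le_trans (hE _ _) _; rewrite ler_pM2l// ler_wpM2l// nrm_ge0.
exists (K * (E * nrm u)) => [|x y hx hy]; first by rewrite !mulr_ge0 ?nrm_ge0// ltW.
apply: le_trans (h _ _ (hb _ hx) (hb _ hy)) _; rewrite -mulrBr -[leRHS]mulrA ler_wpM2l//.
by rewrite -mulrA; exact: hE.
Qed.

End LocallyLipschitz.

(* [wtN y] is the norm of [y] times a weight that is invariant under rational
   dilations, supported on the cone [nrm y ^ d < Cw * |Nm y|], and sums to [1]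
   over the generators of a principal ideal. *)
Section UnitWeight.
Variable F : fieldExtType rat.
Local Notation d := (dim F).
Local Notation O := (@ring_of_integers F).
Implicit Types (x y u : F).

Variables (Cu : rat) (Uw : seq F).
(** The factor 2 leaves a margin: a multiple of [y] in the smaller cone given by [Cu] has [Gw] at
    least [Cu * |Nm y|], which keeps the denominator [Dw] away from zero. *)
Definition Cw : rat := 2 * Cu.
Hypothesis Cu_gt0 : 0 < Cu.
Hypothesis Cu_unit : forall y, y != 0 -> exists2 u, ounit u & nrm (u * y) ^+ d <= Cu * `|Nm y|.
Hypothesis Uw_uniq : uniq Uw.
Hypothesis Uw_unit : forall u, u \in Uw -> ounit u.
Hypothesis Uw_all : forall y u, y != 0 -> ounit u -> nrm y ^+ d <= Cw * `|Nm y| ->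
  nrm (u * y) ^+ d <= Cw * `|Nm y| -> u \in Uw.

Definition Gw y : rat := Num.max 0 (Cw * `|Nm y| - nrm y ^+ d).
Definition Dw y : rat := \sum_(u <- Uw) Gw (u * y).
Definition wtN y : rat := Gw y * `|Nm y| / Dw y.

Lemma Gw_ge0 y : 0 <= Gw y. Proof. by rewrite /Gw le_max lexx. Qed.

Lemma Dw_ge0 y : 0 <= Dw y. Proof. by apply: sumr_ge0 => u _; exact: Gw_ge0. Qed.

Lemma Gw_gt0 y : (0 < Gw y) = (nrm y ^+ d < Cw * `|Nm y|).
Proof. by rewrite /Gw lt_max ltxx /= subr_gt0. Qed.

Lemma Gw_neq0 y : 0 < Gw y -> y != 0.
Proof.
rewrite Gw_gt0; apply: contraTneq => ->; rewrite -leNgt.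
have -> : Nm (0 : F) = 0 by apply/eqP; rewrite Nm_eq0.
by rewrite normr0 mulr0 exprn_ge0// nrm_ge0.
Qed.

Lemma Uw_in u y : ounit u -> 0 < Gw y -> 0 < Gw (u * y) -> u \in Uw.
Proof.
move=> hu h1 h2; have y0 := Gw_neq0 h1.
apply: (Uw_all y0 hu); first by rewrite ltW// -Gw_gt0.
by have := h2; rewrite Gw_gt0 NmM normrM (Nm_unit hu) mul1r => /ltW.
Qed.

Lemma Gw_unit y : y != 0 -> exists2 u, ounit u & Cu * `|Nm y| <= Gw (u * y).
Proof.
move=> y0; have [u hu h] := Cu_unit y0; exists u => //.
rewrite /Gw NmM normrM (Nm_unit hu) mul1r le_max /Cw; apply/orP; right.
by move: h; move: (nrm (u * y) ^+ d) (`|Nm y|) => p q h; lra.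
Qed.

Lemma Dw_ge y : 0 < Gw y -> Cu * `|Nm y| <= Dw y.
Proof.
move=> h; have y0 := Gw_neq0 h; have [u hu hG] := Gw_unit y0.
have N0 : 0 < `|Nm y| by rewrite normr_gt0 Nm_eq0.
have uU : u \in Uw by apply: Uw_in hu h _; apply: lt_le_trans hG; rewrite mulr_gt0// Cu_gt0.
apply: le_trans hG _; rewrite /Dw (big_rem _ uU) /= lerDl sumr_ge0// => v _; exact: Gw_ge0.
Qed.

Lemma GwZ (c : rat) y : 0 < c -> Gw (c *: y) = c ^+ d * Gw y.
Proof.
move=> c0; have cd : 0 <= c ^+ d by rewrite exprn_ge0// ltW.
rewrite /Gw NmZ nrmZ (gtr0_norm c0) exprMn normrM (ger0_norm cd).
move: (c ^+ d) cd (`|Nm y|) (nrm y ^+ d) => p p0 a b.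
by rewrite [RHS]maxr_pMr// mulr0; congr Num.max; ring.
Qed.

Lemma wtNZ (c : rat) y : 0 < c -> wtN (c *: y) = c ^+ d * wtN y.
Proof.
move=> c0; have cd : 0 < c ^+ d by rewrite exprn_gt0.
have DZ : Dw (c *: y) = c ^+ d * Dw y.
  by rewrite /Dw mulr_sumr; apply: eq_bigr => u _; rewrite -scalerAr GwZ.
rewrite /wtN GwZ// DZ NmZ normrM (gtr0_norm cd) invfM.
have : c ^+ d != 0 by rewrite gt_eqF.
move: (c ^+ d) (Dw y)^-1 => p q p0; field; exact: p0.
Qed.

Lemma wtN_ge0 y : 0 <= wtN y.
Proof. by rewrite /wtN divr_ge0 ?mulr_ge0 ?Gw_ge0 ?Dw_ge0. Qed.

Lemma lip_Gw : lip Gw.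
Proof.
apply: lip_max0; apply: lipD; first by apply: lipM (lip_cst _ _) (lip_abs (lip_Nm F)).
apply: (@eq_lip _ (fun x => -1 * nrm x ^+ d)) => [x|]; first by rewrite mulN1r.
by apply: lipM (lip_cst _ _) (lip_exp _ (lip_nrm F)).
Qed.

Lemma lip_Dw : lip Dw.
Proof. by apply: lip_sum => u; apply: lip_mul; exact: lip_Gw. Qed.

Lemma Gw0_or y : Gw y = 0 \/ 0 < Gw y.
Proof. by have := Gw_ge0 y; rewrite le_eqVlt => /orP[/eqP ->|]; [left|right]. Qed.

(** The lower bound for [Dw] is available only on the cone, hence the distinction whether [Gw]
    vanishes. When both points lie in the cone, the one of larger [nrm] supplies the denominator, so
    that [Gw y' / Dw y] is bounded by [A]. *)
Lemma lip_wtN : lip wtN.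
Proof.
move=> r; have [KG KG0 hG] := lip_Gw r; have [KD KD0 hD] := lip_Dw r.
have [KN KN0 hN] := lip_abs (lip_Nm F) r.
have [C0 C00 hC0] := Nm_nrm F.
pose c := Cu^-1; have c'0 : 0 < c by rewrite invr_gt0.
pose A := Cw * C0 * Cw * c.
have Cw0 : 0 < Cw by rewrite /Cw mulr_gt0.
have A0 : 0 <= A by rewrite !mulr_ge0// ltW.
pose K := c * KG + A * KN + A * (c * KD).
have K0 : 0 <= K by rewrite /K !addr_ge0 ?mulr_ge0// ltW.
have one y y' : nrm y <= r -> nrm y' <= r -> 0 < Gw y -> Gw y' = 0 ->
    `|wtN y - wtN y'| <= K * nrm (y - y').
  move=> hy hy' g0 g'0; rewrite /wtN g'0 !mul0r subr0 ger0_norm; last exact: wtN_ge0.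
  have D0 := Dw_ge g0; have N0 : 0 < `|Nm y| by rewrite normr_gt0 Nm_eq0 Gw_neq0.
  have Dp : 0 < Dw y by apply: lt_le_trans D0; rewrite mulr_gt0.
  apply: (@le_trans _ _ (c * Gw y)).
    rewrite ler_pdivrMr// [c * _]mulrC -[leRHS]mulrA ler_wpM2l ?Gw_ge0//.
    by rewrite /c ler_pdivlMl.
  have := hG y y' hy hy'; rewrite g'0 subr0 (gtr0_norm g0) => h.
  apply: le_trans (ler_wpM2l (ltW c'0) h) _; rewrite mulrA ler_wpM2r ?nrm_ge0//.
  by rewrite /K -addrA lerDl addr_ge0// mulr_ge0// mulr_ge0// ltW.
have two y y' : nrm y <= r -> nrm y' <= nrm y -> 0 < Gw y -> 0 < Gw y' ->
    `|wtN y - wtN y'| <= K * nrm (y - y').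
  move=> hy yy g0 g'0; have hy' := le_trans yy hy.
  have D0 := Dw_ge g0; have N0 : 0 < `|Nm y| by rewrite normr_gt0 Nm_eq0 Gw_neq0.
  have D'0 := Dw_ge g'0; have N'0 : 0 < `|Nm y'| by rewrite normr_gt0 Nm_eq0 Gw_neq0.
  have Dp : 0 < Dw y by apply: lt_le_trans D0; rewrite mulr_gt0.
  have D'p : 0 < Dw y' by apply: lt_le_trans D'0; rewrite mulr_gt0.
  have b1 : `|Nm y| / Dw y <= c by rewrite ler_pdivrMr// /c ler_pdivlMl.
  have b2 : `|Nm y'| / Dw y' <= c by rewrite ler_pdivrMr// /c ler_pdivlMl.
  have b3 : Gw y' / Dw y <= A.
    rewrite ler_pdivrMr//; apply: (@le_trans _ _ (Cw * `|Nm y'|)).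
      rewrite /Gw ge_max; apply/andP; split; first by rewrite mulr_ge0// ltW.
      by rewrite lerBlDr lerDl exprn_ge0// nrm_ge0.
    have -> : A * Dw y = Cw * (C0 * (Cw * (c * Dw y))) by rewrite /A !mulrA.
    rewrite ler_pM2l//; apply: le_trans (hC0 _) _; rewrite ler_pM2l//.
    apply: (@le_trans _ _ (nrm y ^+ d)); first by rewrite lerXn2r ?nnegrE ?nrm_ge0.
    move: (g0); rewrite Gw_gt0 => /ltW h; apply: le_trans h _; rewrite ler_pM2l//.
    by rewrite /c ler_pdivlMl.
  have -> : wtN y - wtN y' = (Gw y - Gw y') * (`|Nm y| / Dw y) + Gw y' / Dw y * (`|Nm y| - `|Nm y'|)
     + Gw y' / Dw y * ((`|Nm y'| / Dw y') * (Dw y' - Dw y)).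
    by rewrite /wtN; field; rewrite !gt_eqF.
  apply: le_trans (ler_normD _ _) _; apply: le_trans (lerD (ler_normD _ _) (lexx _)) _.
  rewrite !normrM /K !mulrDl; apply: lerD; first apply: lerD.
  - rewrite mulrC -[leRHS]mulrA; apply: ler_pM; [exact: mulr_ge0|exact: normr_ge0| |exact: hG].
    by rewrite normr_id ger0_norm// invr_ge0 Dw_ge0.
  - rewrite -[leRHS]mulrA; apply: ler_pM; [exact: mulr_ge0|exact: normr_ge0| |exact: hN].
    by rewrite (ger0_norm (Gw_ge0 _)) ger0_norm// invr_ge0 Dw_ge0.
  rewrite -[leRHS]mulrA -[c * KD * _]mulrA; apply: ler_pM; rewrite ?mulr_ge0//.
    by rewrite (ger0_norm (Gw_ge0 _)) ger0_norm// invr_ge0 Dw_ge0.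
  rewrite distrC; apply: ler_pM; rewrite ?mulr_ge0//; last exact: hD.
  by rewrite normr_id ger0_norm// invr_ge0 Dw_ge0.
exists K => // y y' hy hy'; have [g|g] := Gw0_or y; have [g'|g'] := Gw0_or y'.
- by rewrite /wtN g g' !mul0r subrr normr0 mulr_ge0// nrm_ge0.
- by rewrite distrC -nrmN opprB; exact: one.
- exact: one.
have [yy|/ltW yy] := leP (nrm y') (nrm y); first exact: two.
by rewrite distrC -nrmN opprB; exact: two.
Qed.

(** Only generators in the cone contribute. [Uw] contains every unit that carries one such point to
    another, so [Dw] has the same value [T] at all of them, namely the sum of [Gw] over them. *)
Lemma wtN_orbit (s : seq F) a : uniq s -> O a -> a != 0 ->
  (forall u, ounit u -> 0 < Gw (u * a) -> u * a \in s) ->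
  \sum_(y <- s | `[< y != 0 /\ scl y O = scl a O >]) wtN y = `|Nm a|.
Proof.
move=> us ha a0 hs.
pose t := [seq y <- s | `[< y != 0 /\ scl y O = scl a O >] && (0 < Gw y)].
have mt y : y \in t <-> exists2 u, ounit u & y = u * a /\ 0 < Gw y.
  rewrite mem_filter; split.
    move=> /andP[/andP[/asboolP[y0 e] g] ys].
    by have [u hu ue] := scl_eq_unit a0 y0 (esym e); exists u.
  move=> [u hu [-> g]]; rewrite g hs// andbT /= andbT; apply/asboolP.
  by split; [case: hu => _ _ u0; rewrite mulf_neq0|exact: scl_unit].
have -> : \sum_(y <- s | `[< y != 0 /\ scl y O = scl a O >]) wtN y = \sum_(y <- t) wtN y.
  rewrite /t big_filter big_mkcond [RHS]big_mkcond; apply: eq_bigr => y _ /=.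
  case: ifP => //= _; case: ltP => // g; rewrite /wtN.
  by have -> : Gw y = 0; [apply/eqP; rewrite eq_le g Gw_ge0|rewrite !mul0r].
pose T := \sum_(y <- t) Gw y.
have DT y : y \in t -> Dw y = T.
  move=> /[dup] yt /mt[u hu [e g]].
  have y0 := Gw_neq0 g.
  rewrite /T /Dw (bigID (fun v => 0 < Gw (v * y))) /= [X in _ + X]big1 ?addr0; last first.
    move=> v; rewrite -leNgt => h; apply/eqP; by rewrite eq_le h Gw_ge0.
  rewrite -big_filter -(big_map (fun v => v * y) xpredT Gw); apply: perm_big.
  apply: uniq_perm; last move=> z.
  - rewrite map_inj_uniq ?filter_uniq ?Uw_uniq//; exact: mulIf.
  - by rewrite /t filter_uniq.
  apply/mapP/idP.
    move=> [v + ->]; rewrite mem_filter => /andP[gv vU]; apply/mt.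
    by exists (v * u); [apply: oM => //; exact: Uw_unit|rewrite {1}e mulrA].
  move=> /mt[w hw [ze gz]].
  have ez : z = (w / u) * y by rewrite ze e; case: hu => _ _ u0; field.
  have hwu : ounit (w / u) by apply: oM => //; exact: oV.
  exists (w / u) => //; rewrite mem_filter -ez gz /=; apply: Uw_in hwu g _.
  by rewrite -ez.
have NT y : y \in t -> `|Nm y| = `|Nm a|.
  by move=> /mt[u hu [-> _]]; rewrite NmM normrM (Nm_unit hu) mul1r.
have [u hu hG] := Gw_unit a0.
have N0 : 0 < `|Nm a| by rewrite normr_gt0 Nm_eq0.
have g0 : 0 < Gw (u * a) by apply: lt_le_trans hG; rewrite mulr_gt0// Cu_gt0.
have ut : u * a \in t by apply/mt; exists u.
have T0 : 0 < T.
  by rewrite /T (big_rem _ ut) /= ltr_pwDl// sumr_ge0// => v _; exact: Gw_ge0.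
rewrite big_seq (eq_bigr (fun y => Gw y * (`|Nm a| / T))) => [|y yt]; last first.
  by rewrite /wtN DT// NT// mulrA.
by rewrite -big_seq -mulr_suml -/T mulrC divfK// gt_eqF.
Qed.

End UnitWeight.

(** * Counting principal ideals as lattice points *)

Section CountByNorm.
Variable F : fieldExtType rat.
Implicit Types (S : set (set F)).

Definition norm_seq S N : seq (set F) :=
  fset_set [set A | [/\ nzideal A, S A & (ideal_norm A <= N)%N]].

Definition count_norm S n : nat :=
  #|` fset_set [set A | [/\ nzideal A, S A & ideal_norm A = n]]|.

Lemma mem_norm_seq S N A : reflect [/\ nzideal A, S A & (ideal_norm A <= N)%N] (A \in norm_seq S N).
Proof.
rewrite /norm_seq in_fset_set; last by apply: sub_finite_set (@finite_norm_le F N) => I [].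
by apply: (iffP idP); rewrite inE.
Qed.

Lemma sum_count_norm (R : realType) S (w : nat -> R) N :
  psum (fun n => (count_norm S n)%:R * w n) N = \sum_(A <- norm_seq S N) w (ideal_norm A).
Proof.
elim: N => [|N IH].
  rewrite psum0 big_seq big1// => A /mem_norm_seq[hA _].
  by rewrite leqn0 => /eqP e; have := ideal_norm_gt0 hA; rewrite e.
rewrite psumS IH /count_norm; set X := fset_set _.
have mX A : A \in X <-> [/\ nzideal A, S A & ideal_norm A = N.+1].
  rewrite /X in_fset_set; first by split; rewrite inE.
  by apply: sub_finite_set (@finite_norm_le F N.+1) => I [h _ e]; split; rewrite ?e.
have -> : #|` X|%:R * w N.+1 = \sum_(A <- X) w (ideal_norm A).
  rewrite big_seq (eq_bigr (fun=> w N.+1)); last by move=> A /mX[_ _ ->].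
  by rewrite -big_seq big_const_seq count_predT iter_addr_0 mulr_natl.
rewrite -big_cat; apply: perm_big; apply: uniq_perm.
- rewrite cat_uniq !fset_uniq /= andbT; apply/hasPn => A /mX[_ _ e].
  by apply/negP => /mem_norm_seq[_ _]; rewrite e ltnn.
- exact: fset_uniq.
move=> A; rewrite mem_cat; apply/orP/mem_norm_seq.
  by move=> [/mem_norm_seq[h1 h2 h3]|/mX[h1 h2 h3]]; split=> //; [exact: leqW|rewrite h3].
move=> [h1 h2]; rewrite leq_eqVlt => /orP[/eqP h3|h3]; first by right; apply/mX.
by left; apply/mem_norm_seq.
Qed.

Lemma psum_count_norm (R : realType) S N :
  psum (fun n => (count_norm S n)%:R) N = (size (norm_seq S N))%:R :> R.
Proof.
transitivity (psum (fun n => (count_norm S n)%:R * (1 : R)) N); first by apply: eq_psum => n _; rewrite mulr1.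
by rewrite (sum_count_norm S (fun=> 1)) big_const_seq count_predT iter_addr_0.
Qed.

End CountByNorm.

Section LatticeCount.
Variables (F : fieldExtType rat) (R : realType).
Local Notation d := (dim F).
Local Notation O := (@ring_of_integers F).
Implicit Types (x y a : F) (A : set F).
Variables (J : set F) (B : 'M[rat]_d) (Cu : rat) (Uw : seq F).
Hypothesis J_nz : nzideal J.
Hypothesis Bu : B \in unitmx.
Hypothesis JE : J = Lat B.
Hypothesis Cu_gt0 : 0 < Cu.
Hypothesis Cu_unit : forall y, y != 0 -> exists2 u, ounit u & nrm (u * y) ^+ d <= Cu * `|Nm y|.
Hypothesis Uw_uniq : uniq Uw.
Hypothesis Uw_unit : forall u, u \in Uw -> ounit u.
Hypothesis Uw_all : forall y u, y != 0 -> ounit u -> nrm y ^+ d <= Cw Cu * `|Nm y| ->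
  nrm (u * y) ^+ d <= Cw Cu * `|Nm y| -> u \in Uw.
Local Notation wt := (wtN Cu Uw).
Local Notation G := (Gw Cu).

Lemma crd_nrm : exists2 E : rat, 0 < E & forall y i, `|crd B y 0 i| <= E * nrm y.
Proof.
pose X := O_basis F *m invmx B.
pose E := \sum_i \sum_j `|X i j|.
have E0 : 0 <= E by apply: sumr_ge0 => i _; apply: sumr_ge0.
exists (E + 1) => [|y i]; first by rewrite ltr_wpDl.
have -> : crd B y = crd (O_basis F) y *m X by rewrite /X /crd mulmxA mulmxKV ?O_basis_unit.
rewrite mxE; apply: le_trans (ler_norm_sum _ _ _) _.
apply: (@le_trans _ _ (E * nrm y)); last by rewrite ler_wpM2r ?nrm_ge0// lerDl.
rewrite mulr_sumr; apply: ler_sum => j _; rewrite normrM mulrC ler_wpM2r//.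
rewrite /E (bigD1 j)//= (bigD1 i)//= -addrA lerDl addr_ge0//; first by apply: sumr_ge0.
by apply: sumr_ge0 => k _; apply: sumr_ge0.
Qed.

Lemma nrm_vc : exists2 E : rat, 0 <= E & forall (v : 'rV_d) (e : rat),
  (forall i, `|v 0 i| <= e) -> nrm (vc (v *m B)) <= E * e.
Proof.
exists (\sum_i nrm (vc (row i B))) => [|v e h]; first by apply: sumr_ge0 => i _; exact: nrm_ge0.
rewrite vc_sum; apply: le_trans (nrm_sum _ _) _; rewrite mulr_suml; apply: ler_sum => i _.
by rewrite nrmZ mulrC ler_wpM2l// nrm_ge0.
Qed.

(** The cutoff vanishes continuously at norm 1, so [fn] is locally Lipschitz. Rescaled by [1 / t]
    and summed over the generators of an ideal of norm [n], it gives [n * (t ^ d - n)] up to a power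
    of [t], the weight that [unsmooth] removes. *)
Definition fn y : rat := wt y * Num.max 0 (1 - `|Nm y|).

Lemma fn_ge0 y : 0 <= fn y.
Proof. by rewrite /fn mulr_ge0 ?wtN_ge0// le_max lexx. Qed.

Lemma lip_fn : lip fn.
Proof.
apply: lipM; first exact: lip_wtN.
apply: lip_max0; apply: lipD; first exact: lip_cst.
apply: (@eq_lip _ (fun x => -1 * `|Nm x|)) => [x|]; first by rewrite mulN1r.
by apply: lipM; [exact: lip_cst|apply: lip_abs; exact: lip_Nm].
Qed.

Lemma fnZ (t : nat) y : (0 < t)%N -> fn (t%:R^-1 *: y) =
  t%:R ^- (2 * d) * (wt y * Num.max 0 (t%:R ^+ d - `|Nm y|)).
Proof.
move=> t0; have T0 : 0 < t%:R :> rat by rewrite ltr0n.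
have Ti : 0 < t%:R^-1 :> rat by rewrite invr_gt0.
have Td : 0 < t%:R^-1 ^+ d :> rat by rewrite exprn_gt0.
rewrite /fn wtNZ// NmZ normrM (gtr0_norm Td).
have -> : 1 - t%:R^-1 ^+ d * `|Nm y| = t%:R^-1 ^+ d * (t%:R ^+ d - `|Nm y|).
  by rewrite mulrBr -exprMn mulVf ?gt_eqF// expr1n.
have -> : t%:R ^- (2 * d) = t%:R^-1 ^+ d * t%:R^-1 ^+ d :> rat.
  by rewrite -exprVn mul2n -addnn exprD.
move: (t%:R^-1 ^+ d) Td (wt y) (t%:R ^+ d - _) => p p0 q s.
by rewrite -{1}(mulr0 p) -maxr_pMr ?ltW//; ring.
Qed.

Definition pr A := exists a, [/\ J a, a != 0 & A = scl a O].

Variables (rho : nat).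
(** Lattice points of a box centred at 0, shifted so that they are indexed by the grid of
    [riemann]. *)
Definition al t (f : {ffun 'I_d -> 'I_(2 * rho * t)}) : F :=
  vc ((\row_i ((f i)%:R - (rho * t)%:R)) *m B).
Hypothesis box : forall t y, (0 < t)%N -> J y -> 0 < G y -> `|Nm y| <= t%:R ^+ d ->
  exists f, y = @al t f.

Lemma al_J t f : J (@al t f).
Proof.
rewrite JE /Lat /mkset /al crd_vc//; apply/mxOverP => i j; rewrite mxE.
by apply: rpredB; apply: rpred_nat.
Qed.

Lemma al_inj t : injective (@al t).
Proof.
move=> f f' /(congr1 (crd B)); rewrite /al !crd_vc// => /rowP h.
by apply/ffunP => i; apply/val_inj; have := h i; rewrite !mxE => /addIr/eqP; rewrite eqr_nat => /eqP.
Qed.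

(** The lattice points are grouped by the ideal that they generate. The hypothesis [box] ensures
    that every generator with positive weight is among them, so [wtN_orbit] evaluates each group. *)
Lemma smooth_sum t : (0 < t)%N ->
  \sum_f wt (@al t f) * Num.max 0 (t%:R ^+ d - `|Nm (@al t f)|) =
  \sum_(A <- norm_seq pr (t ^ d)) (ideal_norm A)%:R * (t%:R ^+ d - (ideal_norm A)%:R).
Proof.
move=> t0; pose s := [seq al f | f : {ffun 'I_d -> 'I_(2 * rho * t)}].
have us : uniq s by rewrite map_inj_uniq ?enum_uniq//; exact: al_inj.
set L := norm_seq pr (t ^ d).
have E y : y \in s -> wt y * Num.max 0 (t%:R ^+ d - `|Nm y|) =
    \sum_(A <- L) (if `[< y != 0 /\ scl y O = A >] then wt y * (t%:R ^+ d - (ideal_norm A)%:R) else 0).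
  move=> /mapP[f _ ye].
  have yJ : J y by rewrite ye; exact: al_J.
  have yO : O y by apply: ideal_O yJ; exact: J_nz.1.
  have [y0|y0] := eqVneq y 0.
    rewrite big1 => [|A _]; last by case: asboolP => // -[].
    have -> : Nm y = 0 by apply/eqP; rewrite Nm_eq0 y0.
    by rewrite /wtN; have -> : Nm y = 0 by [apply/eqP; rewrite Nm_eq0 y0]; rewrite normr0 mulr0 !mul0r.
  have hI : nzideal (scl y O) by apply: scl_nz (O_nz F) => // x [z hz <-]; exact: OM.
  have [hN|hN] := leP `|Nm y| (t%:R ^+ d).
    have yL : scl y O \in L.
      apply/mem_norm_seq; split=> //; first by exists y.
      by rewrite -(ler_nat rat) norm_scl// natrX.
    rewrite (bigD1_seq (scl y O)) ?fset_uniq//= big1 ?addr0 => [|A /negP AL].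
      by rewrite asboolT ?y0// norm_scl// max_r// subr_ge0.
    by case: asboolP => // -[_ e]; case: AL; rewrite e.
  rewrite max_l ?mulr0; last by rewrite subr_le0 ltW.
  rewrite big_seq big1// => A /mem_norm_seq[_ _ hA]; case: asboolP => // -[_ e].
  by move: hN; rewrite ltNge -norm_scl// e -natrX ler_nat hA.
transitivity (\sum_(y <- s) wt y * Num.max 0 (t%:R ^+ d - `|Nm y|)).
  by rewrite /s /image_mem big_map big_enum.
rewrite big_seq (eq_bigr _ E) -big_seq exchange_big /= big_seq [RHS]big_seq.
apply: eq_bigr => A /mem_norm_seq[hA [a [aJ a0 Ae]] An].
have aO : O a by apply: ideal_O aJ; exact: J_nz.1.
have NA : (ideal_norm A)%:R = `|Nm a| by rewrite Ae norm_scl.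
rewrite -big_mkcond -mulr_suml; congr (_ * _); rewrite NA.
rewrite -(wtN_orbit Cu_gt0 Cu_unit Uw_uniq Uw_unit Uw_all us aO a0) => [|u hu gu].
  by apply: eq_bigl => y; rewrite Ae.
have uaJ : J (u * a) by apply: idealM aJ; [exact: J_nz.1|case: hu].
have [|f ->] := box t0 uaJ gu; last by apply/mapP; exists f; rewrite ?mem_enum.
by rewrite NmM normrM (Nm_unit hu) mul1r -NA -natrX ler_nat.
Qed.

Definition point (v : 'I_d -> rat) : F := vc ((\row_i (v i - rho%:R)) *m B).

Lemma point_grid t (f : {ffun 'I_d -> 'I_(2 * rho * t)}) : (0 < t)%N ->
  point (grid f) = t%:R^-1 *: al f.
Proof.
move=> t0; rewrite /point /al -linearZ /= scalemxAl; congr (vc (_ *m _)).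
apply/rowP => i; rewrite !mxE /grid natrM mulrBr mulrC; congr (_ - _).
by rewrite mulrCA mulVf ?mulr1// pnatr_eq0 -lt0n.
Qed.

Definition Phi (v : 'I_d -> rat) : R := ratr (fn (point v)).

Lemma riemannE t : (0 < t)%N -> @riemann R d (2 * rho) Phi t =
  t%:R ^- (2 * d) * \sum_(A <- norm_seq pr (t ^ d)) (ideal_norm A)%:R * (t%:R ^+ d - (ideal_norm A)%:R).
Proof.
move=> t0; rewrite /riemann /Phi -rmorph_sum /=.
under eq_bigr => f _ do rewrite point_grid// fnZ//.
rewrite -mulr_sumr smooth_sum// rmorphM fmorphV rmorphXn /= ratr_nat rmorph_sum /=.
congr (_ * _); apply: eq_bigr => A _.
by rewrite rmorphM rmorphB rmorphXn /= !ratr_nat.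
Qed.

Lemma Phi_lip : exists2 K : rat, 0 <= K & forall (v v' : 'I_d -> rat) (e : rat),
  (forall i, 0 <= v i <= (2 * rho)%:R) -> (forall i, 0 <= v' i <= (2 * rho)%:R) ->
  (forall i, `|v i - v' i| <= e) -> `|Phi v - Phi v'| <= ratr K * ratr e :> R.
Proof.
have [E E0 hE] := nrm_vc; have [K K0 hK] := lip_fn (E * rho%:R).
have hb v : (forall i, 0 <= v i <= (2 * rho)%:R) -> nrm (point v) <= E * rho%:R.
  move=> h; apply: hE => i; rewrite mxE; have := h i; rewrite natrM.
  by move: (v i) (rho%:R) => p q /andP[h1 h2]; rewrite ler_norml; apply/andP; split; lra.
exists (K * E) => [|v v' e hv hv' h]; first exact: mulr_ge0.
rewrite /Phi -rmorphB -ratr_norm -rmorphM ler_rat /=.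
apply: le_trans (hK _ _ (hb _ hv) (hb _ hv')) _; rewrite -mulrA ler_wpM2l//.
have -> : point v - point v' = vc ((\row_i (v i - v' i)) *m B).
  rewrite /point -linearB -mulmxBl; congr (vc (_ *m _)); apply/rowP => i; rewrite !mxE.
  by move: (v i) (v' i) (rho%:R) => p q x; ring.
by apply: hE => i; rewrite mxE.
Qed.

Lemma ex_positive_point : exists y (t1 : nat), [/\ J y, 0 < G y, (0 < t1)%N, `|Nm y| < t1%:R ^+ d & 0 < wt y].
Proof.
have [_ [a aJ a0]] := J_nz; have [u hu hG] := Gw_unit Cu_unit a0.
have N0 : 0 < `|Nm a| by rewrite normr_gt0 Nm_eq0.
have g0 : 0 < G (u * a) by apply: lt_le_trans hG; rewrite mulr_gt0.
have Nu : 0 < `|Nm (u * a)| by rewrite normr_gt0 Nm_eq0; exact: Gw_neq0 g0.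
exists (u * a), (Num.truncn `|Nm (u * a)|).+1; split=> //.
- by apply: idealM aJ; [exact: J_nz.1|case: hu].
- apply: lt_le_trans (truncnS_gt _) _; rewrite -natrX ler_nat.
  by rewrite -{1}(expn1 _.+1) leq_pexp2l// d_gt0.
rewrite /wtN divr_gt0 ?mulr_gt0//.
by apply: lt_le_trans (Dw_ge Cu_gt0 Cu_unit Uw_all g0); rewrite mulr_gt0.
Qed.

Lemma lattice_Q : exists c C : R, [/\ 0 < c, 0 <= C & forall t, (0 < t)%N ->
  `|psum (fun n => n%:R * (count_norm pr n)%:R * ((t ^ d)%:R - n%:R)) (t ^ d) - c * t%:R ^+ (3 * d)|
    <= C * t%:R ^+ (3 * d).-1].
Proof.
have [K K0 hK] := Phi_lip; have K0' : 0 <= ratr K :> R by rewrite ler0q.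
have [c hc1 hc2] := riemann_limit K0' hK.
have d0 := d_gt0 F.
exists c, ((2 * rho)%:R ^+ d * ratr K); split; last 1 first.
- move=> t t0; have T0 : 0 < t%:R :> R by rewrite ltr0n.
  have -> : psum (fun n => n%:R * (count_norm pr n)%:R * ((t ^ d)%:R - n%:R)) (t ^ d) =
      t%:R ^+ (2 * d) * @riemann R d (2 * rho) Phi t.
    rewrite riemannE// mulrA divff ?mul1r ?expf_neq0 ?gt_eqF// -natrX.
    rewrite -(sum_count_norm pr (fun n => n%:R * ((t ^ d)%:R - n%:R))).
    by apply: eq_psum => n _; rewrite mulrA [n%:R * _]mulrC.
  have -> : t%:R ^+ (3 * d) = t%:R ^+ (2 * d) * t%:R ^+ d :> R by rewrite -exprD -mulSnr.
  have -> : t%:R ^+ (3 * d).-1 = t%:R ^+ (2 * d) * (t%:R ^+ d / t%:R) :> R.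
    rewrite exp_split// exprD; congr (_ * _).
    by rewrite -[in RHS](prednK d0) exprS mulrAC divff ?mul1r// gt_eqF.
  have P0 : 0 < t%:R ^+ (2 * d) :> R by rewrite exprn_gt0.
  rewrite [c * _]mulrCA -mulrBr normrM (gtr0_norm P0) [leRHS]mulrCA ler_pM2l//.
  by apply: le_trans (hc1 t t0) _; rewrite -[leLHS]mulrA.
- have [y [t1 [yJ gy t10 Ny wy]]] := ex_positive_point.
  pose eta : rat := fn (t1%:R^-1 *: y).
  have T10 : 0 < t1%:R :> rat by rewrite ltr0n.
  have eta0 : 0 < eta.
    rewrite /eta fnZ// mulr_gt0 ?invr_gt0 ?exprn_gt0// mulr_gt0// lt_max subr_gt0 Ny orbT//.
  (* A mesh so fine that the Lipschitz error [K / (j * t1)] is below the value [eta] of [fn] at a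
     grid point; this makes [c] positive. *)
  pose j := (Num.truncn (K / eta)).+1.
  have J0 : 0 < j%:R :> rat by rewrite ltr0n.
  have jK : K / (j * t1)%:R < eta.
    rewrite ltr_pdivrMr ?ltr0n ?muln_gt0// -ltr_pdivrMl// [eta^-1 * _]mulrC.
    by apply: lt_le_trans (truncnS_gt _) _; rewrite ler_nat leq_pmulr.
  have jy : J (j%:R *: y).
    by apply: (subg_int (ideal_subgroup J_nz.1)) => //; exact: rpred_nat.
  have [||f fe] := box (ltac:(by rewrite muln_gt0 t10) : (0 < j * t1)%N) jy.
  - by rewrite GwZ// mulr_gt0// exprn_gt0.
  - have jd : 0 < j%:R ^+ d :> rat by rewrite exprn_gt0.
    by rewrite NmZ normrM (gtr0_norm jd) natrM exprMn ler_pM2l// ltW.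
  have jt : (0 < j * t1)%N by rewrite muln_gt0 t10.
  apply: lt_le_trans (hc2 (j * t1)%N f _ jt); last by move=> v; rewrite /Phi ler0q fn_ge0.
  rewrite divr_gt0 ?exprn_gt0 ?ltr0n// subr_gt0 /Phi point_grid// -fe scalerA.
  have -> : (j * t1)%:R^-1 * j%:R = t1%:R^-1 :> rat.
    by rewrite natrM invfM mulrAC mulVf ?mul1r// gt_eqF.
  by rewrite -[(j * t1)%:R](ratr_nat R) -fmorphV -rmorphM ltr_rat.
by rewrite mulr_ge0// exprn_ge0.
Qed.

End LatticeCount.

(** * Summing over the ideal classes *)

Section ClassCount.
Variables (F : fieldExtType rat) (R : realType).
Local Notation d := (dim F).
Local Notation O := (@ring_of_integers F).
Implicit Types (x y a : F) (A I J : set F).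

Lemma count_principal J : nzideal J -> exists c C : R, [/\ 0 < c, 0 <= C & forall Y : nat,
  `|psum (fun n => (count_norm (pr J) n)%:R) Y - c * Y%:R| <= C * Y%:R `^ (unsmooth_exp R d)].
Proof.
move=> hJ; have [B Bu JE] := nzideal_lattice hJ.
have [Cu Cu0 hCu] := unit_compact F; have [Uw [U1 U2 U3]] := finite_units F (Cw Cu).
have [E E0 hE] := crd_nrm B.
pose c2 := (Num.truncn (Cw Cu)).+1.
pose rho := (Num.truncn (E * c2%:R)).+1.
have d0 := d_gt0 F.
have box t y : (0 < t)%N -> J y -> 0 < Gw Cu y -> `|Nm y| <= t%:R ^+ d -> exists f, y = @al F B rho t f.
  move=> t0 yJ gy Ny; have T0 : 0 < t%:R :> rat by rewrite ltr0n.
  have Cw0 : 0 < Cw Cu by rewrite /Cw mulr_gt0.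
  have ny : nrm y <= c2%:R * t%:R.
    rewrite -(@ler_pXn2r _ d) ?nnegrE ?nrm_ge0 ?mulr_ge0//.
    move: gy; rewrite Gw_gt0 => /ltW h; apply: le_trans h _; rewrite exprMn.
    apply: ler_pM => //; first exact: ltW.
    apply: le_trans (ltW (truncnS_gt _)) _; rewrite -natrX ler_nat.
    by apply: leq_trans (_ : c2 ^ 1 <= _)%N; [rewrite expn1|rewrite leq_pexp2l].
  have hz i : `|crd B y 0 i| < (rho * t)%:R.
    apply: le_lt_trans (hE _ _) _; apply: (@le_lt_trans _ _ (E * c2%:R * t%:R)).
      by rewrite -mulrA ler_pM2l.
    by rewrite natrM ltr_pM2r//; exact: truncnS_gt.
  have [Z eZ] : exists Z : 'rV[int]_d, crd B y = map_mx intr Z.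
    by apply: int_mxP; move: yJ; rewrite JE.
  have hZ i : `|Z 0 i| < (rho * t)%:Z by have := hz i; rewrite eZ mxE -intr_norm -[_%:R]/((_%:Z)%:~R) ltr_int.
  have hf i : (`|(Z 0%R i + (rho * t)%:Z)%R|%N < 2 * rho * t)%N.
    by have := hZ i; rewrite -mulnA mul2n -addnn; move: (rho * t)%N (Z 0 i) => p q; lia.
  exists [ffun i => Ordinal (hf i)]; rewrite -[LHS](crdK _ Bu) eZ /al; congr (vc (_ *m _)).
  apply/rowP => i; rewrite !mxE ffunE /=.
  have -> : `|(Z 0%R i + (rho * t)%:Z)%R|%N%:R = (Z 0 i + (rho * t)%:Z)%:~R :> rat.
    rewrite -[_%:R]/((_%:Z)%:~R) gez0_abs//; have := hZ i; move: (rho * t)%N (Z 0 i) => p q; lia.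
  by rewrite rmorphD /= addrK.
have [c [C [c0 C0 h]]] := lattice_Q R hJ Bu JE Cu0 hCu U1 U2 U3 box.
have [C' C'0 h'] := unsmooth d0 (fun n => ler0n R (count_norm (pr J) n)) (ltW c0) C0 h.
by exists (6 * c), C'; split=> //; rewrite mulr_gt0.
Qed.

Definition principal A := exists2 a, a != 0 & A = scl a O.

(** Ideal classes without a quotient group: two ideals with one common inverse class have the same
    inverse classes. *)
Lemma principal_trans I I' J J' : nzideal I -> nzideal I' -> nzideal J -> nzideal J' ->
  principal (ideal_mul I J) -> principal (ideal_mul I' J) ->
  principal (ideal_mul I J') -> principal (ideal_mul I' J').
Proof.
move=> hI hI' hJ hJ' [a a0 e1] [b b0 e2] [c c0 e3].
exists (b * c / a); first by rewrite !mulf_neq0 ?invr_neq0.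
have i1 := (hI.1, hI'.1, hJ.1, hJ'.1).
have hIJ := idm_ideal hI.1 hJ.1; have hIJ' := idm_ideal hI.1 hJ'.1.
have hI'J := idm_ideal hI'.1 hJ.1; have hI'J' := idm_ideal hI'.1 hJ'.1.
have E : ideal_mul (ideal_mul I J) (ideal_mul I' J') = ideal_mul (ideal_mul I' J) (ideal_mul I J').
  rewrite (idmC hI.1 hJ.1) -idmA; [|exact: hJ.1|exact: hI.1|exact: hI'J'].
  rewrite (idmA hI.1 hI'.1 hJ'.1) (idmC hI.1 hI'.1) -(idmA hI'.1 hI.1 hJ'.1).
  by rewrite (idmA hJ.1 hI'.1 hIJ') (idmC hJ.1 hI'.1).
move: E; rewrite e1 e2 e3 scl_O_idm// scl_idm idm1l; last by rewrite -e3.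
rewrite scl_scl => E; apply: (scl_inj a0); rewrite E scl_scl; congr scl; by field.
Qed.

Lemma ex_class_reps : exists s : seq (set F), [/\ uniq s, forall J, J \in s -> nzideal J &
  forall I, nzideal I -> exists2 J, J \in s & principal (ideal_mul I J)].
Proof.
have [N N0 hN] := class_finite F.
have NF : (N%:R : F) != 0 by rewrite natF_eq0 -lt0n.
have /finite_fsetP[X hX] := finite_ideals_containing F N0.
have mX J : J \in X <-> is_ideal J /\ J N%:R.
  split=> h; first by have : [set` X] J by []; rewrite -hX.
  by have : [set I | is_ideal I /\ I (N%:R : F)] J by []; rewrite hX.
exists X; split; [exact: fset_uniq|by move=> J /mX[h1 h2]; split=> //; exists N%:R|].
move=> I hI; have [I' [a [hI' a0 aO e]]] := ex_inverse_ideal hI.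
have [b [bI b0 hb]] := hN _ hI'.
pose J := scl b^-1 (scl N%:R I').
have NJ : scl N%:R I' = scl b J by rewrite /J scl_scl divff// scl1.
have JO : J `<=` O.
  move=> x hx; have : scl b O (b * x) by apply: hb; rewrite NJ; exists x.
  by move=> [z hz /(mulfI b0) <-].
have hJ : is_ideal J by move: JO; rewrite /J scl_scl => JO; apply: scl_ideal JO hI'.1.
have NJ' : J N%:R by rewrite /J; exists (N%:R * b); [exists b|rewrite mulrC mulfK].
exists J; first by apply/mX.
exists (b^-1 * N%:R * a); first by rewrite !mulf_neq0 ?invr_neq0.
by rewrite (idmC hI.1 hJ) /J scl_idm scl_idm (idmC hI'.1 hI.1) e !scl_scl.
Qed.

(** Multiplication by [J] carries the class inverse to [J] onto the principal ideals inside [J],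
    where lattice points count; it multiplies norms by that of [J]. *)
Lemma class_bij I0 J X : nzideal I0 -> nzideal J -> principal (ideal_mul I0 J) ->
  size (norm_seq (fun I => principal (ideal_mul I J)) X) = size (norm_seq (pr J) (X * ideal_norm J)).
Proof.
move=> hI0 hJ _; have nJ := ideal_norm_gt0 hJ.
rewrite -(size_map (fun I => ideal_mul I J)); apply: perm_size; apply: uniq_perm.
- rewrite map_inj_in_uniq ?fset_uniq// => I I' /mem_norm_seq[h1 _ _] /mem_norm_seq[h2 _ _].
  rewrite (idmC h1.1 hJ.1) (idmC h2.1 hJ.1); exact: idm_inj hJ h1.1 h2.1.
- exact: fset_uniq.
move=> A; apply/mapP/mem_norm_seq.
  move=> [I /mem_norm_seq[hI [a a0 e] hX] ->]; split; first exact: idm_nz.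
    exists a; split=> //; apply: (idm_subr hI.1 hJ.1); rewrite e.
    by exists 1; [exact: O1|rewrite mulr1].
  by rewrite ideal_normM// leq_mul2r hX orbT.
move=> [hA [a [aJ a0 e]] hX].
have AJ : A `<=` J by move=> x; rewrite e => -[y hy <-]; apply: idealMr aJ => //; exact: hJ.1.
have [I hI Ie] := idm_divides hJ hA.1 AJ.
have hIn : nzideal I.
  split=> //; have [_ [x hx x0]] := hA; exists x => //.
  by move: hx; rewrite Ie; apply: idm_subr => //; exact: hJ.1.
have Ie' : A = ideal_mul I J by rewrite Ie idmC//; exact: hJ.1.
exists I => //; apply/mem_norm_seq; split=> //; first by exists a => //; rewrite -Ie'.
by move: hX; rewrite Ie' ideal_normM// leq_pmul2r.
Qed.

Lemma ideal_count : exists rho C : R, [/\ 0 < rho, 0 <= C & forall Y : nat,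
  `|psum (fun n => (count_ideals F n)%:R) Y - rho * Y%:R| <= C * Y%:R `^ (unsmooth_exp R d)].
Proof.
have [s [us sn hs]] := ex_class_reps; set e := unsmooth_exp R d.
have /andP[e0 e1] : 0 < e < 1 := unsmooth_exp_bounds R (d_gt0 F).
(* The selected representative depends only on the set of candidates, which is the same for
   equivalent ideals; so [cls] is constant on classes. *)
pose cls I : set F := xget set0 [set J | J \in s /\ principal (ideal_mul I J)].
have clsP I : nzideal I -> cls I \in s /\ principal (ideal_mul I (cls I)).
  move=> hI; have [J Js pJ] := hs I hI.
  by apply: (@xgetPex _ set0 [set J | J \in s /\ principal (ideal_mul I J)]); exists J.
have cls_eq I I' J : nzideal I -> nzideal I' -> nzideal J ->
    principal (ideal_mul I J) -> principal (ideal_mul I' J) -> cls I = cls I'.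
  move=> hI hI' hJ p p'; congr xget; apply/seteqP; split=> J' [Js pJ]; split=> //.
    exact: (principal_trans hI hI' hJ (sn _ Js) p p').
  exact: (principal_trans hI' hI hJ (sn _ Js) p' p).
pose cnt J Y : R := (size (norm_seq (fun I => cls I = J) Y))%:R.
have est J : J \in s -> exists rC : R * R, [/\ 0 <= rC.1, 0 <= rC.2,
    forall Y : nat, `|cnt J Y - rC.1 * Y%:R| <= rC.2 * Y%:R `^ e & (J = cls O -> 0 < rC.1)].
  move=> Js; have hJ := sn _ Js.
  have [[I0 hI0 e1J]|no] := pselect (exists2 I, nzideal I & cls I = J); last first.
    exists (0, 0); split=> //= [Y|eJ]; last by case: no; exists O => //; exact: O_nz.
    rewrite mul0r mul0r subr0 /cnt.
    have -> : norm_seq (fun I => cls I = J) Y = [::].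
      apply/eqP; rewrite -size_eq0; case E: (norm_seq _ _) => [//|I t].
      have : I \in norm_seq (fun I => cls I = J) Y by rewrite E mem_head.
      by move=> /mem_norm_seq[hI h _]; case: no; exists I.
    by rewrite normr0.
  have p0 : principal (ideal_mul I0 J) by rewrite -e1J; exact: (clsP _ hI0).2.
  have [c [C [c0 C0 h]]] := count_principal hJ.
  have nJ := ideal_norm_gt0 hJ.
  exists (c * (ideal_norm J)%:R, C * (ideal_norm J)%:R `^ e).
  split=> [||Y|_] /=; [by rewrite mulr_ge0// ltW|by rewrite mulr_ge0// powR_ge0| |by rewrite mulr_gt0// ltr0n].
  have -> : cnt J Y = psum (fun n => (count_norm (pr J) n)%:R) (Y * ideal_norm J).
    rewrite psum_count_norm -(class_bij Y hI0 hJ p0) /cnt; congr (size (fset_set _))%:R.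
    apply/seteqP; split=> I [hI hc hX]; split=> //.
      by rewrite -hc; exact: (clsP _ hI).2.
    by rewrite -e1J; apply: (cls_eq _ _ J).
  have := h (Y * ideal_norm J)%N; rewrite natrM powRM//.
  by rewrite -!mulrA [(ideal_norm J)%:R * _]mulrC [_ `^ _ * _]mulrC.
pose rc J : R * R := if pselect (J \in s) is left h then sval (cid (est J h)) else (0, 0).
have rcP J : J \in s -> [/\ 0 <= (rc J).1, 0 <= (rc J).2,
    forall Y : nat, `|cnt J Y - (rc J).1 * Y%:R| <= (rc J).2 * Y%:R `^ e & (J = cls O -> 0 < (rc J).1)].
  by rewrite /rc; case: pselect => // h _; case: cid.
exists (\sum_(J <- s) (rc J).1), (\sum_(J <- s) (rc J).2).
have cO := (clsP O (O_nz F)).1.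
split.
- rewrite (big_rem _ cO) /= ltr_pwDl//; first by have [_ _ _] := rcP _ cO; apply.
  by rewrite big_seq sumr_ge0// => J /mem_rem/rcP[].
- by rewrite big_seq sumr_ge0// => J /rcP[].
move=> Y.
have -> : psum (fun n => (count_ideals F n)%:R) Y = \sum_(J <- s) cnt J Y.
  transitivity (psum (fun n => (count_norm [set: set F] n)%:R) Y : R).
    apply: eq_psum => n _; congr (#|` fset_set _|)%:R.
    by apply/seteqP; split=> A [h1 h2].
  rewrite psum_count_norm; set L := norm_seq [set: set F] Y.
  have cE J : cnt J Y = \sum_(I <- L) (cls I == J)%:R.
    have -> : cnt J Y = (count (fun I => cls I == J) L)%:R.
      rewrite /cnt -size_filter; congr (_%:R); apply: perm_size; apply: uniq_perm.
      - exact: fset_uniq.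
      - by rewrite filter_uniq// fset_uniq.
      move=> I; rewrite mem_filter; apply/mem_norm_seq/andP.
        by move=> [h1 /eqP h2 h3]; split=> //; apply/mem_norm_seq.
      by move=> [/eqP h2 /mem_norm_seq[h1 _ h3]].
    by rewrite -sum1_count natr_sum big_mkcond; apply: eq_bigr => I _; case: eqP.
  under eq_bigr => J _ do rewrite cE.
  rewrite exchange_big /= -[(size L)%:R]mulr1 mulr_natl -iter_addr_0 -(count_predT L) -big_const_seq.
  rewrite big_seq [RHS]big_seq; apply: eq_bigr => I /mem_norm_seq[hI _ _].
  rewrite (bigD1_seq (cls I)) ?eqxx//=; last exact: (clsP _ hI).1.
  by rewrite big1 ?addr0// => J; rewrite eq_sym => /negPf ->.
rewrite !mulr_suml -sumrB; apply: le_trans (ler_norm_sum _ _ _) _.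
by rewrite big_seq [leRHS]big_seq; apply: ler_sum => J /rcP[_ _ h _].
Qed.

End ClassCount.

(** * The prime ideal theorem *)

Section PrimeIdealTheorem.
Variables (R : realType) (F : fieldExtType rat).
Implicit Types (S : set (set F)).

Lemma prime_countE S n : prime_count S n = size (norm_seq (fun p => nonzero_prime p /\ S p) n).
Proof.
rewrite /prime_count /norm_seq; congr (size (fset_set _)); apply/seteqP; split=> p.
  by move=> [h1 h2 h3]; split=> //; exact: prime_nz.
by move=> [_ [h1 h2] h3].
Qed.

Lemma prime_count_psum n :
  psum (fun q => (count_primes F q)%:R) n = (prime_count [set: set F] n)%:R :> R.
Proof.
rewrite prime_countE -psum_count_norm; apply: eq_psum => q _; congr (#|` fset_set _|)%:R.
apply/seteqP; split=> p; first by move=> [h1 h2]; split=> //; exact: prime_nz.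
by move=> [_ [h1 _] h3].
Qed.

Lemma count_primes1 : count_primes F 1 = 0%N.
Proof.
apply/eqP; rewrite cardfs_eq0; apply/eqP/fsetP => p.
rewrite in_fset_set ?inE; last exact: finite_prime_eq.
by apply/negP; rewrite inE => -[/prime_norm_gt1 h e]; rewrite e in h.
Qed.

Theorem prime_ideal_theorem (e : R) : 0 < e -> exists n0, forall n, (n0 <= n)%N ->
  `|(prime_count [set: set F] n)%:R - Li R n| <= e * Li R n.
Proof.
have [rho [C0 [rho0 C00 hA]]] := ideal_count F R.
have s01 := unsmooth_exp_bounds R (d_gt0 F).
have ca := @count_primes_le F; have eu := @ideal_euler F R.
move=> e0; under eq_exists => n0 do under eq_forall => n do rewrite -prime_count_psum.
apply: count_Li e0 => [n||{}e e0]; first by [].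
  by rewrite count_primes1.
have [n1 h1] := Lam_pnt eu rho0 s01 hA (divr_gt0 e0 (ltr0n R 2)).
have [n2 h2] := @sqrt_ln_small R (rho + C0) (e / 2) (divr_gt0 e0 (ltr0n R 2)).
exists (maxn n1 n2) => n; rewrite geq_max => /andP[/h1 hn1 /h2 hn2].
have [t1 t2] := Lam_theta (count_primes F) rho0 s01 n.
have t3 := prime_sum_le ca s01 hA (Num.truncn (Num.sqrt n%:R : R)).
rewrite -/(theta R (count_primes F) n).
have l0 : 0 <= ln (n%:R : R) := ln_nat_ge0 R n.
have t4 : ln n%:R * psum (fun q => (count_primes F q)%:R) (Num.truncn (Num.sqrt n%:R : R))
    <= (rho + C0) * (Num.sqrt n%:R * ln n%:R).
  rewrite mulrA [leRHS]mulrC ler_wpM2l//; apply: le_trans t3 _.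
  apply: ler_wpM2l; first by rewrite addr_ge0// ltW.
  by rewrite truncn_le// sqrtr_ge0.
move: hn1; rewrite !ler_norml => /andP[a b]; apply/andP; split; lra.
Qed.

Lemma prime_count_le_linear : exists2 C : R, 0 <= C & forall n,
  (prime_count [set: set F] n)%:R <= C * n%:R.
Proof.
have [rho [C0 [rho0 C00 hA]]] := ideal_count F R.
have s01 := unsmooth_exp_bounds R (d_gt0 F).
exists (rho + C0) => [|n]; first by rewrite addr_ge0// ltW.
by rewrite -prime_count_psum; exact: (prime_sum_le (@count_primes_le F) s01 hA).
Qed.

End PrimeIdealTheorem.

(** * Residue fields and Frobenius elements *)

Section ResidueFields.
Variable F : fieldExtType rat.
Local Notation d := (dim F).
Local Notation O := (@ring_of_integers F).
Implicit Types (x y a b : F) (I P : set F).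

Lemma I0 I : is_ideal I -> I 0. Proof. by case. Qed.
Lemma ID I x y : is_ideal I -> I x -> I y -> I (x + y). Proof. by move=> [_ _ h _]; exact: h. Qed.
Lemma IN I x : is_ideal I -> I x -> I (- x).
Proof. by move=> /ideal_subgroup h; exact: subgN. Qed.
Lemma IB I x y : is_ideal I -> I x -> I y -> I (x - y).
Proof. by move=> /ideal_subgroup[_]; apply. Qed.
Lemma I_sym I x y : is_ideal I -> I (x - y) -> I (y - x).
Proof. by move=> hI /(IN hI); rewrite opprB. Qed.
Lemma I_trans I y x z : is_ideal I -> I (x - y) -> I (y - z) -> I (x - z).
Proof. by move=> hI h1 h2; rewrite -(subrK y x) -addrA; exact: ID. Qed.

Lemma prime_idl P : nonzero_prime P -> is_ideal P. Proof. by case. Qed.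

Lemma primeM P x y : nonzero_prime P -> O x -> O y -> P (x * y) -> P x \/ P y.
Proof. by move=> [_ _ _ h]; exact: h. Qed.

Lemma prime_prod P (T : Type) (s : seq T) (p : pred T) (f : T -> F) : nonzero_prime P ->
  (forall i, O (f i)) -> P (\prod_(i <- s | p i) f i) -> exists2 i, p i & P (f i).
Proof.
move=> hP hO; elim: s => [|i s IH]; first by rewrite big_nil; case: hP => _ _ h _ /h.
rewrite big_cons; case: ifP => // pi /(primeM hP (hO i))[|h|/IH//]; last by exists i.
by elim/big_rec: _ => [|j x _ hx]; [exact: O1|exact: OM].
Qed.

Lemma O_prod (T : Type) (s : seq T) (p : pred T) (f : T -> F) :
  (forall i, p i -> O (f i)) -> O (\prod_(i <- s | p i) f i).
Proof. by move=> h; elim/big_rec: _ => [|j x pj hx]; [exact: O1|apply: OM => //; exact: h]. Qed.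

Lemma O_sum (T : Type) (s : seq T) (p : pred T) (f : T -> F) :
  (forall i, p i -> O (f i)) -> O (\sum_(i <- s | p i) f i).
Proof. by move=> h; apply: subg_sum (O_subgroup F) _. Qed.

Lemma prime_exp P x n : nonzero_prime P -> O x -> P (x ^+ n) -> P x.
Proof.
move=> hP hx; elim: n => [|n IH]; first by rewrite expr0; case: hP => _ _ h _ /h.
by rewrite exprS => /(primeM hP hx (OX n hx))[|/IH].
Qed.

Lemma cong_mul I x y x' y' : is_ideal I -> O x -> O y' ->
  I (x - x') -> I (y - y') -> I (x * y - x' * y').
Proof.
move=> hI hx hy h1 h2.
have -> : x * y - x' * y' = x * (y - y') + y' * (x - x') by ring.
by apply: ID => //; exact: idealM.
Qed.

Lemma cong_prod I (T : Type) (s : seq T) (p : pred T) (f g : T -> F) : is_ideal I ->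
  (forall i, O (f i)) -> (forall i, O (g i)) -> (forall i, p i -> I (f i - g i)) ->
  I (\prod_(i <- s | p i) f i - \prod_(i <- s | p i) g i).
Proof.
move=> hI hf hg h; elim: s => [|i s IH]; first by rewrite !big_nil subrr; exact: I0.
rewrite !big_cons; case: ifP => // pi; apply: cong_mul => //; last exact: h.
exact: O_prod.
Qed.

Lemma cong_exp I x y n : is_ideal I -> O x -> O y -> I (x - y) -> I (x ^+ n - y ^+ n).
Proof.
move=> hI hx hy h; elim: n => [|n IH]; first by rewrite !expr0 subrr; exact: I0.
by rewrite !exprS; apply: cong_mul => //; exact: OX.
Qed.

Lemma fermat P x : nonzero_prime P -> O x -> P (x ^+ ideal_norm P - x).
Proof.
move=> hP hx; have hI := prime_idl hP; have n0 := ideal_norm_gt0 (prime_nz hP).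
have [Px|nPx] := pselect (P x).
  by apply: IB => //; rewrite -(prednK n0) exprS; apply: idealMr => //; exact: OX.
have [r [r1 r2 r3]] := ideal_norm_reps_ex (prime_nz hP).
have /choice[pi hpi] : forall t, exists t', P (x * r t - r t') by move=> t; apply: r2; exact: OM.
have pi_inj : injective pi.
  move=> t t' e; apply: r3.
  have h : P (x * (r t - r t')).
    by rewrite mulrBr; apply: (I_trans (y := r (pi t))) => //; rewrite e; exact: I_sym.
  by case: (primeM hP hx (OB (r1 t) (r1 t')) h).
have [t0 ht0] := r2 0 (O0 F); rewrite sub0r in ht0; have {}ht0 : P (r t0) by have := IN hI ht0; rewrite opprK.
have uniq0 t : P (r t) -> t = t0 by move=> h; apply: r3; exact: IB.
have pi0 t : (pi t != t0) = (t != t0).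
  congr negb; apply/eqP/eqP => [e|->]; apply: uniq0.
    have : P (x * r t) by have := ID hI (hpi t) (_ : P (r (pi t))); rewrite subrK e; apply.
    by case/(primeM hP hx (r1 t)).
  by have := IB hI (idealM hI hx ht0) (hpi t0); rewrite opprB addrC subrK.
have h : P (\prod_(t | t != t0) (x * r t) - \prod_(t | t != t0) r t).
  rewrite [X in _ - X](reindex_inj pi_inj) /=; rewrite (eq_bigl _ _ pi0).
  by apply: cong_prod => // t; apply: OM.
rewrite big_split /= prodr_const cardC1 card_ord in h.
set A := \prod_(t | t != t0) r t in h.
have nA : ~ P A by move=> /(prime_prod hP r1)[t /eqP tt /uniq0].
have hA : O A by apply: O_prod.
have {}h : P (x ^+ (ideal_norm P).-1 - 1).
  have {}h : P (A * (x ^+ (ideal_norm P).-1 - 1)) by rewrite mulrBr mulr1 mulrC.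
  by case: (primeM hP hA _ h) => //; apply: OB; [exact: OX|exact: O1].
have -> : x ^+ ideal_norm P - x = x * (x ^+ (ideal_norm P).-1 - 1).
  by rewrite mulrBr mulr1 -exprS (prednK n0).
exact: idealM.
Qed.

(** Counts the roots of [x ^ Q - x] modulo [P] without building the residue field. In a Vandermonde
    determinant with [Q + 1] nodes the last row may be replaced by its difference from the row of
    first powers, which vanishes modulo [P]; so two nodes are congruent. *)
Lemma few_roots P Q M (y : 'I_M -> F) : nonzero_prime P -> (1 < Q)%N ->
  (forall i, O (y i)) -> (forall i, P (y i ^+ Q - y i)) ->
  (forall i j, P (y i - y j) -> i = j) -> (M <= Q)%N.
Proof.
move=> hP Q1 yO yQ yi; rewrite leqNgt; apply/negP => QM; have hI := prime_idl hP.
pose z (j : 'I_Q.+1) := y (widen_ord QM j).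
pose A : 'M[F]_Q.+1 := \matrix_(i, j) z j ^+ i.
pose X (w : 'I_Q.+1 -> F) : 'M[F]_Q.+1 := \matrix_(i, j) if i == ord_max then w j else z j ^+ i.
have dA : \det A = \det (X z) + \det (X (fun j => z j ^+ Q - z j)).
  rewrite -[\det (X z)]mul1r -[X in _ + X]mul1r.
  apply: (@determinant_multilinear _ _ _ _ _ ord_max).
  - by apply/rowP => j; rewrite !mxE eqxx !mul1r /= addrCA subrr addr0.
  - by apply/matrixP => i j; rewrite !mxE eq_sym (negPf (neq_lift _ _)).
  - by apply/matrixP => i j; rewrite !mxE eq_sym (negPf (neq_lift _ _)).
have dz : \det (X z) = 0.
  have h1 : (1 < Q.+1)%N by rewrite ltnS ltnW.
  apply: (@determinant_alternate _ _ _ (Ordinal h1) ord_max).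
    by rewrite -val_eqE /= ltn_eqF.
  by move=> j; rewrite !mxE eqxx -val_eqE /= ltn_eqF// expr1.
have zO j : O (z j) by exact: yO.
have dP : P (\det A).
  rewrite dA dz add0r; apply: subg_sum (ideal_subgroup hI) _ => s _; apply: idealM => //.
    by apply: OX; apply: ON; exact: O1.
  rewrite (bigD1 ord_max)//= mxE eqxx; apply: idealMr => //; last exact: yQ.
  apply: O_prod => i _; rewrite mxE; case: ifP => _; last exact: OX.
  by apply: OB => //; exact: OX.
have : P (\prod_(i < Q.+1) \prod_(j < Q.+1 | (i < j)%N) (z j - z i)).
  have := @det_Vandermonde F Q.+1 (\row_j z j).
  have -> : Vandermonde Q.+1 (\row_j z j) = A by apply/matrixP => i j; rewrite !mxE.
  move=> e; move: dP; rewrite e; under eq_bigr => i _ do under eq_bigr => j _ do rewrite !mxE.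
  by [].
move=> /(prime_prod hP)[i|i _ /(prime_prod hP)[j|j ij h]].
- by apply: O_prod => j _; exact: OB.
- exact: OB.
have := yi _ _ h => /(congr1 val) /= e.
by move: ij; rewrite e ltnn.
Qed.

(** A prime [l] in [P] exists because some positive integer lies in [P]; then [P] divides the ideal
    of [l], whose norm is [l ^ d]. *)
Lemma prime_char P : nonzero_prime P ->
  exists l b : nat, [/\ prime l, P l%:R & ideal_norm P = (l ^ b)%N].
Proof.
move=> hP; have hI := prime_idl hP; have hPn := prime_nz hP.
have [n n0 Pn] := ex_nat_in hPn.
have [l [hl Pl]] : exists l, prime l /\ P l%:R.
  have : P (\prod_(p <- primes n) (p%:R ^+ logn p n)).
    rewrite (_ : \prod_(p <- primes n) _ = n%:R)//.
    transitivity ((\prod_(f <- prime_decomp n) f.1 ^ f.2)%N%:R : F); last by rewrite -prod_prime_decomp.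
    by rewrite prime_decompE big_map /= natr_prod; apply: eq_bigr => p _; rewrite natrX.
  rewrite big_seq => /(prime_prod hP)[p|p pn /(prime_exp hP (O_nat _ _)) h]; first by apply: OX; exact: O_nat.
  by exists p; split=> //; move: pn; rewrite mem_primes => /andP[].
exists l; have l0 : (l%:R : F) != 0 by rewrite natF_eq0 -lt0n prime_gt0.
have lO : O (l%:R : F) by exact: O_nat.
have hs : nzideal (scl l%:R O) by apply: scl_nz (O_nz F) => // x [y hy <-]; exact: OM.
have [|J hJ e] := idm_divides hPn hs.1.
  by move=> x [y hy <-]; apply: idealMr.
have hJn : nzideal J.
  split=> //; have [_ [x hx x0]] := hs; exists x => //.
  by move: hx; rewrite e; apply: idm_subr.
have : (ideal_norm P %| l ^ d)%N.
  suff -> : (l ^ d)%N = ideal_norm (scl (l%:R : F) O) by rewrite e ideal_normM// dvdn_mulr.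
  apply/eqP; rewrite -(eqr_nat rat) norm_scl// natrX.
  have -> : (l%:R : F) = (l%:R : rat) *: 1 by rewrite scaler_nat.
  by rewrite NmZ Nm1 mulr1 ger0_norm// exprn_ge0.
by move=> /(dvdn_pfactor _ _ hl)[b _ eb]; exists b.
Qed.

Lemma frob_add1 I l x y : is_ideal I -> prime l -> I l%:R -> O x -> O y ->
  I ((x + y) ^+ l - (x ^+ l + y ^+ l)).
Proof.
move=> hI hl Il hx hy; have l0 := prime_gt0 hl.
rewrite exprDn (bigD1 ord0)//= (bigD1 ord_max)/=; last by rewrite -val_eqE /= -lt0n.
rewrite subn0 expr0 mulr1 bin0 mulr1n subnn expr0 mul1r binn mulr1n.
set S := \sum_(_ < _ | _) _; have -> : x ^+ l + (y ^+ l + S) - (x ^+ l + y ^+ l) = S by ring.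
apply: subg_sum (ideal_subgroup hI) _ => i /andP[i0 il].
have /dvdnP[q ->] : (l %| 'C(l, i))%N.
  apply: prime_dvd_bin => //; move: i0 il; rewrite -!val_eqE /= lt0n => -> /=.
  by rewrite ltn_neqAle => ->; rewrite -ltnS ltn_ord.
rewrite mulrnA -mulr_natr; apply: idealM => //; rewrite -mulr_natr.
by apply: OM; [apply: OM; exact: OX|exact: O_nat].
Qed.

Lemma frob_add I (l b : nat) x y : is_ideal I -> prime l -> I l%:R -> O x -> O y ->
  I ((x + y) ^+ (l ^ b) - (x ^+ (l ^ b) + y ^+ (l ^ b))).
Proof.
move=> hI hl Il hx hy; elim: b => [|b IH]; first by rewrite !expr1 subrr; exact: I0.
rewrite expnSr !exprM.
have h1 : O (x ^+ (l ^ b)) by exact: OX.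
have h2 : O (y ^+ (l ^ b)) by exact: OX.
apply: (I_trans hI _ (frob_add1 hI hl Il h1 h2)); apply: cong_exp => //; last exact: OD.
by apply: OX; exact: OD.
Qed.

Lemma frob_sum I (l b : nat) (T : Type) (s : seq T) (f : T -> F) : is_ideal I -> prime l -> I l%:R ->
  (forall i, O (f i)) ->
  I ((\sum_(i <- s) f i) ^+ (l ^ b) - \sum_(i <- s) f i ^+ (l ^ b)).
Proof.
move=> hI hl Il hf; elim: s => [|i s IH].
  by rewrite !big_nil expr0n expn_eq0 eqn0Ngt prime_gt0//= subrr; exact: I0.
rewrite !big_cons; have hs : O (\sum_(j <- s) f j) by exact: O_sum.
apply: (I_trans hI (frob_add b hI hl Il (hf i) hs)).
by rewrite opprD addrACA subrr add0r.
Qed.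

Lemma incong_le P M (y : 'I_M -> F) : nzideal P -> (forall i, O (y i)) ->
  (forall i j, P (y i - y j) -> i = j) -> (M <= ideal_norm P)%N.
Proof.
move=> hP yO yi; have [r [r1 r2 r3]] := ideal_norm_reps_ex hP.
have /choice[t ht] : forall i, exists t, P (y i - r t) by move=> i; exact: r2.
have ti : injective t.
  move=> i j e; apply: yi; apply: (I_trans hP.1 (ht i)); rewrite e; exact: I_sym hP.1 (ht j).
by have := leq_card _ ti; rewrite !card_ord.
Qed.

(** If the element found for the tail still lies in the new prime [Q], it is corrected by an element
    of [P'] and of all primes in the tail that lies outside [Q]. *)
Lemma prime_avoidance (P' : set F) (S : seq (set F)) : nonzero_prime P' -> uniq S ->
  (forall Q, Q \in S -> nonzero_prime Q /\ Q <> P') ->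
  exists2 x, P' x & forall Q, Q \in S -> ~ Q x.
Proof.
move=> hP'; have hI' := prime_idl hP'.
elim: S => [|Q S IH] /=.
  by move=> _ _; exists 0 => //; exact: I0.
move=> /andP[QS uS] Sp; have [|x xP hx] := IH uS.
  by move=> Q' h; apply: Sp; rewrite inE h orbT.
have [hQ nQ] := Sp Q (mem_head _ _); have hQI := prime_idl hQ.
have [Qx|nQx] := pselect (Q x); last first.
  by exists x => // Q'; rewrite inE => /orP[/eqP ->|/hx].
have [y [yP yQ yS]] : exists y, [/\ P' y, ~ Q y & forall Q', Q' \in S -> Q' y].
  elim: S QS Sp {IH uS hx} => [|Q' S IH] /=.
    move=> _ _; have [y yP nQy] : exists2 y, P' y & ~ Q y.
      apply: contrapT => h; apply: nQ; apply/esym/(prime_sub_eq hP' hQ) => y yP.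
      by apply: contrapT => nQy; apply: h; exists y.
    by exists y.
  rewrite inE negb_or => /andP[QQ' QS] Sp; have [||y [yP nQy yS]] := IH => //.
    by move=> R; rewrite inE => /orP[/eqP ->|h]; apply: Sp; rewrite !inE ?eqxx// h !orbT.
  have [hQ' _] : nonzero_prime Q' /\ Q' <> P' by apply: Sp; rewrite !inE eqxx orbT.
  have [z zQ' nQz] : exists2 z, Q' z & ~ Q z.
    apply: contrapT => h; move/negP: QQ'; apply; apply/eqP/esym/(prime_sub_eq hQ' hQ) => z zQ.
    by apply: contrapT => nQz; apply: h; exists z.
  have zO : O z by exact: ideal_O (prime_idl hQ') zQ'.
  have yO : O y by exact: ideal_O hI' yP.
  exists (z * y); split; first exact: idealM.
    by move=> /(primeM hQ zO yO)[].
  move=> R; rewrite inE => /orP[/eqP ->|h]; first by apply: idealMr => //; exact: prime_idl.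
  apply: idealM => //; last exact: yS.
  by apply: prime_idl; apply: (Sp R _).1; rewrite !inE h !orbT.
exists (x + y); first exact: ID.
move=> Q'; rewrite inE => /orP[/eqP -> h|h h'].
  by apply: yQ; have := IB hQI h Qx; rewrite addrC addKr.
apply: (hx _ h); have hQ' : is_ideal Q' by apply: prime_idl; apply: (Sp Q' _).1; rewrite inE h orbT.
by have := IB hQ' h' (yS _ h); rewrite addrK.
Qed.

End ResidueFields.

(** * Extensions of number fields *)

Section Extension.
Variables (E W : fieldExtType rat) (iota : {rmorphism E -> W}).
Local Notation OE := (@ring_of_integers E).
Local Notation OW := (@ring_of_integers W).

Lemma iota_int x : OW (iota x) <-> OE x.
Proof.
have e (p : {poly int}) : map_poly iota (map_poly intr p) = map_poly intr p.
  by rewrite -map_poly_comp; apply: eq_map_poly => z /=; rewrite rmorph_int.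
split=> -[p pm pr]; exists p => //; move: pr.
  by rewrite -e fmorph_root.
by rewrite -e fmorph_root.
Qed.

Definition contr (P : set W) : set E := [set x | P (iota x)].

Lemma contr_ideal P : is_ideal P -> is_ideal (contr P).
Proof.
move=> hP; split.
- by move=> x /(ideal_O hP)/iota_int.
- by rewrite /contr /mkset rmorph0; exact: I0.
- by move=> x y hx hy; rewrite /contr /mkset rmorphD; exact: ID.
by move=> a x /iota_int ha hx; rewrite /contr /mkset rmorphM; exact: idealM.
Qed.

Lemma contr_nat P n : contr P n%:R = P n%:R.
Proof. by rewrite /contr /mkset rmorph_nat. Qed.

Lemma contr_prime P : nonzero_prime P -> nonzero_prime (contr P).
Proof.
move=> hP; split; first exact: contr_ideal (prime_idl hP).
- have [n n0 Pn] := ex_nat_in (prime_nz hP); exists n%:R; first by rewrite contr_nat.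
  by rewrite natF_eq0 -lt0n.
- by rewrite /contr /mkset rmorph1; case: hP.
move=> x y /iota_int hx /iota_int hy; rewrite /contr /mkset rmorphM; exact: primeM.
Qed.

(** Some power of [q] is generated by one element [w]. In the larger ring [w] is still not
    invertible, so a prime [P] contains it, and the [k]-th power of each element of [q] is a
    multiple of [w]. *)
Lemma lying_over q : nonzero_prime q -> exists2 P, nonzero_prime P & contr P = q.
Proof.
move=> hq; have hqn := prime_nz hq.
have [k [w [k0 w0 e]]] := idX_principal hqn.
have wX : ideal_exp q k w by rewrite e; exists 1; [exact: O1|rewrite mulr1].
have wq : q w.
  move: wX; rewrite -(prednK k0) /=; apply: idm_subl; first exact: hqn.1.
  exact: (idX_nz _ hqn).1.
have wO : OE w by exact: ideal_O hqn.1 wq.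
have iw0 : iota w != 0 by rewrite fmorph_eq0.
have iwO : OW (iota w) by apply/iota_int.
have hs : nzideal (scl (iota w) OW) by apply: scl_nz (O_nz W) => // x [y hy <-]; exact: OM.
have ns : scl (iota w) OW <> OW.
  move=> eO; have [z hz e1] : scl (iota w) OW 1 by rewrite eO; exact: O1.
  have ze : z = iota w^-1 by rewrite fmorphV; apply: (mulfI iw0); rewrite e1 divff.
  have wV : OE w^-1 by apply/iota_int; rewrite -ze.
  by case: hq => hI _ n1 _; apply: n1; rewrite -(divff w0) mulrC; exact: idealM hI wV wq.
have [P hP sP] := ex_prime_over hs ns; exists P => //.
have hc := contr_prime hP.
apply/esym/(prime_sub_eq hq hc) => x xq.
have xO : OE x by exact: ideal_O hqn.1 xq.
apply: (prime_exp (n := k) hc xO).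
have : ideal_exp q k (x ^+ k).
  elim: (k) => [|j IH]; first by rewrite expr0; exact: O1.
  by rewrite exprS /=; exact: in_idm.
rewrite e => -[y hy <-]; apply: idealMr => //; first exact: prime_idl.
by apply: sP; exists 1; [exact: O1|rewrite mulr1].
Qed.

End Extension.

Section Tower.
Variables (k E W : fieldExtType rat) (ik : {rmorphism k -> W}) (iE : {rmorphism E -> W}).
Hypothesis kE : forall a, exists y, iE y = ik a.
Local Notation OE := (@ring_of_integers E).
Local Notation OW := (@ring_of_integers W).
Local Notation Ok := (@ring_of_integers k).
Variable P : set W.
Hypothesis hP : nonzero_prime P.
Local Notation p := (contr ik P).
Local Notation q := (contr iE P).

Lemma norm_contr_le : (ideal_norm p <= ideal_norm q)%N.
Proof.
have [r [r1 _ r3]] := ideal_norm_reps_ex (prime_nz (contr_prime ik hP)).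
have /choice[y hy] : forall t, exists y, iE y = ik (r t) by move=> t; exact: kE.
apply: (incong_le (y := y)); first exact: prime_nz (contr_prime iE hP).
  by move=> t; apply/(iota_int iE); rewrite hy; apply/iota_int.
by move=> t t'; rewrite /contr /mkset rmorphB !hy => h; apply: r3; rewrite /contr /mkset rmorphB.
Qed.

(** The residue extension has degree 1 or at least 2: if some [y] is congruent to no element of the
    base, the combinations [r a + r b * y] are pairwise incongruent. *)
Lemma norm_contr_square : ideal_norm q = ideal_norm p \/ (ideal_norm p ^ 2 <= ideal_norm q)%N.
Proof.
have hp := contr_prime ik hP; have hq := contr_prime iE hP; have hI := prime_idl hP.
have [r [r1 r2 r3]] := ideal_norm_reps_ex (prime_nz hp).
have [all_k|] := pselect (forall y, OE y -> exists2 a, Ok a & P (iE y - ik a)).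
  left; apply/eqP; rewrite eqn_leq norm_contr_le andbT.
  have [s [s1 s2 s3]] := ideal_norm_reps_ex (prime_nz hq).
  have /choice[a ha] : forall t, exists a, Ok a /\ P (iE (s t) - ik a).
    by move=> t; have [a h1 h2] := all_k _ (s1 t); exists a.
  apply: (incong_le (y := a)); [exact: prime_nz hp|by move=> t; case: (ha t)|].
  move=> t t'; rewrite /contr /mkset rmorphB => h; apply: s3; rewrite /contr /mkset rmorphB.
  apply: (I_trans hI (ha t).2); apply: (I_trans hI h); exact: I_sym hI (ha t').2.
move=> /existsNP[y /not_implyP[yO ny]]; right.
have /choice[u hu] : forall t, exists u, iE u = ik (r t) by move=> t; exact: kE.
have uO t : OE (u t) by apply/(iota_int iE); rewrite hu; apply/iota_int.
pose f (i : 'I_(#|{: 'I_(ideal_norm p) * 'I_(ideal_norm p)}|)) : E :=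
  u (enum_val i).1 + u (enum_val i).2 * y.
have card2 : #|{: 'I_(ideal_norm p) * 'I_(ideal_norm p)}| = (ideal_norm p ^ 2)%N.
  by rewrite card_prod card_ord.
rewrite -card2; apply: (incong_le (y := f)); first exact: prime_nz hq.
  by move=> i; apply: OD => //; exact: OM.
move=> i j; rewrite /f; case: (enum_val i) (@enum_val_inj _ _ i j) => a b /=.
case: (enum_val j) => a' b' /= inj h; apply: inj.
have h' : P (ik (r a - r a') + ik (r b - r b') * iE y).
  move: h; rewrite /contr /mkset !rmorphB !rmorphD !rmorphM !hu.
  by rewrite (_ : _ - _ = ik (r a) - ik (r a') + (ik (r b) - ik (r b')) * iE y); [|ring].
have [eb|nb] := eqVneq b b'.
  rewrite eb subrr rmorph0 mul0r addr0 in h'.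
  by rewrite eb (r3 _ _ h').
exfalso; have npb : ~ p (r b - r b') by move=> /r3 e; rewrite e eqxx in nb.
have [z zO hz] := prime_inv hp (OB (r1 b) (r1 b')) npb.
apply: ny; exists (- z * (r a - r a')).
  by apply: OM; [exact: ON|exact: OB].
have yW : OW (iE y) by apply/iota_int.
have h1 : P (ik z * (ik (r a - r a') + ik (r b - r b') * iE y)).
  by apply: idealM => //; apply/iota_int.
have h2 : P (iE y * ik ((r b - r b') * z - 1)) by apply: idealM.
rewrite (_ : _ - _ = ik z * (ik (r a - r a') + ik (r b - r b') * iE y) - iE y * ik ((r b - r b') * z - 1)).
  exact: IB.
by rewrite !rmorphB !rmorphM rmorphN !rmorphB rmorph1; ring.
Qed.

End Tower.

Section PrimitiveElement.
Variable W : fieldExtType rat.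
Local Notation d := (dim W).
Local Notation O := (@ring_of_integers W).

(** The ring of integers need not be generated by one element, but a multiple [D] of it lies in the
    polynomials in [th]. Congruences checked at [th] then extend to all integers away from [D]. *)
Lemma ex_primitive : exists (th : W) (D : nat), [/\ O th, (0 < D)%N &
  forall x, O x -> exists p : {poly int}, D%:R * x = (map_poly intr p).[th]].
Proof.
have sep : separable 1%AS {:W}%AS.
  apply/separableP => y _; apply: pcharf0_separable.
  by apply/pcharf0P => n; exact: natF_eq0.
pose z := separable_generator 1%AS {:W}%AS.
have gen : {:W}%VS = <<1; z>>%VS by apply: eq_adjoin_separable_generator => //; exact: subvf.
have [n n0 hn] := ex_integer_multiple z.
have n0' : (n%:R : rat) != 0 by rewrite pnatr_eq0 -lt0n.
pose th := n%:R *: z.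
have zth : z = n%:R^-1 *: th by rewrite /th scalerA mulVf// scale1r.
pose Z : set W := [set x | exists p : {poly int}, x = (map_poly intr p).[th]].
have Zs : is_subgroup Z.
  split; first by exists 0; rewrite rmorph0 horner0.
  by move=> x y [p ->] [p' ->]; exists (p - p'); rewrite rmorphB hornerD hornerN.
have one x : exists2 D : nat, (0 < D)%N & Z (D%:R * x).
  have : x \in <<1; z>>%VS by rewrite -gen memvf.
  move=> /Fadjoin_polyP[p /polyOver1P[p' ->] ->].
  pose r := p' \Po (n%:R^-1 *: 'X).
  have e : (map_poly (in_alg W) p').[z] = (map_poly (in_alg W) r).[th].
    rewrite map_comp_poly horner_comp map_polyZ map_polyX hornerZ hornerX zth.
    by congr (_.[_]); rewrite /= -scalerAl mul1r.
  have [q [a a0 eq]] := rat_poly_scale r.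
  exists `|a|%N; first by rewrite absz_gt0.
  have Za : Z (a%:~R * (map_poly (in_alg W) p').[z]).
    have aW : a%:~R != 0 :> W by rewrite -(rmorph_int (in_alg W)) fmorph_eq0 intr_eq0.
    exists q; rewrite e eq map_polyZ hornerZ fmorphV rmorph_int mulrA mulfV// mul1r -map_poly_comp.
    by congr (_.[_]); apply: eq_map_poly => i; exact: (rmorph_int (in_alg W)).
  have [ea|ea] := leP 0 a.
    by move: Za; rewrite -[a in a%:~R](gez0_abs ea).
  have := subgN Zs Za; rewrite -mulNr -rmorphN /= -[- a](ltz0_abs ea).
  by [].
have /choice[Dj hDj] : forall j : 'I_d, exists D : nat, (0 < D)%N /\ Z (D%:R * vc (row j (O_basis W))).
  by move=> j; have [D h1 h2] := one (vc (row j (O_basis W))); exists D.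
exists th, (\prod_j Dj j)%N; split; first exact: hn.
  by rewrite prodn_gt0// => j; case: (hDj j).
move=> x hx; suff : Z ((\prod_j Dj j)%N%:R * x) by [].
rewrite {1}(crd_sum x) mulr_sumr; apply: subg_sum => // j _.
rewrite -scalerAr; apply: subg_int => //; first by move: hx; rewrite [X in X x]O_basisE => /mxOverP; apply.
rewrite (bigD1 j)//= mulnC natrM -mulrA -[X in Z (X * _)]mulr1 -scaler_nat -!scalerAl mul1r.
by rewrite mul1r; apply: subg_int => //; case: (hDj j).
Qed.

End PrimitiveElement.

(** * The Galois action and Frobenius elements *)

Section Frobenius.
Variables (W : fieldExtType rat) (gT : finGroupType) (act : gT -> {rmorphism W -> W}).
Hypothesis act1 : forall x, act 1%g x = x.
Hypothesis actM : forall s t x, act (s * t)%g x = act t (act s x).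
Hypothesis act_faithful : forall s, (forall x, act s x = x) -> s = 1%g.
Local Notation O := (@ring_of_integers W).
Implicit Types (x y : W) (P : set W) (s t g h : gT) (H : {group gT}).

Lemma actK s x : act s^-1%g (act s x) = x. Proof. by rewrite -actM mulgV act1. Qed.
Lemma actVK s x : act s (act s^-1%g x) = x. Proof. by rewrite -actM mulVg act1. Qed.

Lemma act_O s x : O x -> O (act s x). Proof. by move/(iota_int (act s)). Qed.

(** The image of [P] under [s], written as a preimage so that the lemmas on contractions apply. *)
Definition aim s P : set W := contr (act s^-1%g) P.

Lemma aim_prime s P : nonzero_prime P -> nonzero_prime (aim s P).
Proof. exact: contr_prime. Qed.

Lemma aim1 P : aim 1%g P = P.
Proof. by apply/funext => x; rewrite /aim /contr /mkset invg1 act1. Qed.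

Lemma aimM s t P : aim (s * t)%g P = aim t (aim s P).
Proof. by apply/funext => x; rewrite /aim /contr /mkset invMg actM. Qed.

Definition fixed H x := forall h, h \in H -> act h x = x.

(** [n0] is a positive integer in the ideal generated by [D] and the product of the differences of
    the conjugates of [th]; primes without [n0] keep these conjugates apart. *)
Lemma frobenius_setup : exists (th : W) (D n0 : nat), [/\ O th, (0 < n0)%N,
  (forall x, O x -> exists p : {poly int}, D%:R * x = (map_poly intr p).[th]) &
  forall P, nonzero_prime P -> ~ P n0%:R ->
    ~ P D%:R /\ forall s t, P (act s th - act t th) -> s = t].
Proof.
have [th [D [thO D0 hD]]] := ex_primitive W.
have inj s t : act s th = act t th -> s = t.
  move=> e; suff h x : act s x = act t x.
    by apply/eqP; rewrite eq_mulgV1; apply/eqP/act_faithful => x; rewrite actM h actK.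
  have [n n0 hn] := ex_integer_multiple x.
  have [p hp] := hD _ hn.
  have c u : act u (D%:R * (n%:R *: x)) = (map_poly intr p).[act u th].
    rewrite hp -horner_map -map_poly_comp; congr (_.[_]).
    by apply: eq_map_poly => i /=; rewrite rmorph_int.
  have : act s (D%:R * (n%:R *: x)) = act t (D%:R * (n%:R *: x)) by rewrite !c e.
  have -> : D%:R * (n%:R *: x) = (D%:R * n%:R) * x by rewrite scaler_nat -mulrA; congr (_ * _); rewrite mulr_natl.
  rewrite !rmorphM !rmorph_nat; apply: mulfI.
  by rewrite mulf_neq0// natF_eq0 -lt0n.
pose disc := \prod_(st : gT * gT | st.1 != st.2) (act st.1 th - act st.2 th).
have discO : O disc by apply: O_prod => st _; apply: OB; exact: act_O.
have disc0 : disc != 0.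
  by apply/prodf_neq0 => -[s t] /= st; rewrite subr_eq0; apply: contraNneq st => /inj ->.
have DO : O (D%:R : W) by exact: O_nat.
have d0 : D%:R * disc != 0 by rewrite mulf_neq0// natF_eq0 -lt0n.
have hs : nzideal (scl (D%:R * disc) O).
  by apply: scl_nz (O_nz W) => // x [y hy <-]; apply: OM => //; exact: OM.
have [n0 n00 [y hy e]] := ex_nat_in hs.
exists th, D, n0; split=> // P hP nP; have hI := prime_idl hP; split.
  by move=> h; apply: nP; rewrite -e; apply: idealMr => //; apply: idealMr.
move=> s t h; apply/eqP/negPn/negP => st; apply: nP; rewrite -e.
apply: idealMr => //; apply: idealM => //; rewrite /disc (bigD1 (s, t))//=; apply: idealMr => //.
by apply: O_prod => u _; apply: OB; exact: act_O.
Qed.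

(** If [P'] were not conjugate to [P] under [H], some [x] in [P'] would avoid all conjugates of [P].
    Its norm for [H] lies in [E] and in [P'], hence in [P], so some conjugate of [x] lies in [P]. *)
Lemma aim_transitive (E : fieldExtType rat) (iE : {rmorphism E -> W}) H P P' :
  (forall x, fixed H x -> exists y : E, x = iE y) -> nonzero_prime P -> nonzero_prime P' ->
  contr iE P = contr iE P' -> exists2 h, h \in H & P' = aim h P.
Proof.
move=> hE hP hP' e; apply: contrapT => no.
have hI' := prime_idl hP'.
pose S := undup [seq aim h P | h <- enum H].
have Sp Q : Q \in S -> nonzero_prime Q /\ Q <> P'.
  rewrite mem_undup => /mapP[h]; rewrite mem_enum => hH ->; split; first exact: aim_prime.
  by move=> eQ; apply: no; exists h.
have [x xP' hx] := prime_avoidance hP' (undup_uniq _) Sp.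
have xO : O x by exact: ideal_O hI' xP'.
pose N := \prod_(h in H) act h x.
have Nf : fixed H N.
  move=> g gH; rewrite /N rmorph_prod /= [RHS](reindex_inj (mulIg g)) /=.
  by apply: eq_big => [h|h _]; rewrite ?actM// groupMr.
have [y ye] := hE _ Nf.
have P'N : P' N.
  rewrite /N (bigD1 1%g)//= act1; apply: idealMr => //; apply: O_prod => h _; exact: act_O.
have : contr iE P y by rewrite e /contr /mkset -ye.
rewrite /contr /mkset -ye => /(prime_prod hP)[h|h hH h1]; first exact: act_O.
apply: (hx (aim h^-1%g P)).
  by rewrite mem_undup; apply/mapP; exists h^-1%g; rewrite ?mem_enum ?groupV.
by rewrite /aim /contr /mkset invgK.
Qed.

Variables (th : W) (D n0 : nat).
Hypothesis th_O : O th.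
Hypothesis D_th : forall x, O x -> exists p : {poly int}, D%:R * x = (map_poly intr p).[th].
Hypothesis good_th : forall P, nonzero_prime P -> ~ P n0%:R ->
    ~ P D%:R /\ forall s t, P (act s th - act t th) -> s = t.

Definition orb_poly H : {poly W} := \prod_(h in H) ('X - (act h th)%:P).

Lemma orb_poly_O H i : O (orb_poly H)`_i.
Proof.
have : forall j, O (orb_poly H)`_j; last by apply.
rewrite /orb_poly; elim/big_rec: _ => [j|h p hH hp j].
  by rewrite coef1; exact: O_nat.
rewrite coefM; apply: O_sum => u _; apply: OM => //; rewrite coefB coefX coefC.
by apply: OB; [exact: O_nat|case: ifP => _; [exact: act_O|exact: O0]].
Qed.

Lemma orb_poly_fixed H i : fixed H (orb_poly H)`_i.
Proof.
move=> g gH; rewrite -coef_map /=.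
suff -> : map_poly (act g) (orb_poly H) = orb_poly H by [].
rewrite /orb_poly rmorph_prod /= [RHS](reindex_inj (mulIg g)) /=; apply: eq_big => [h|h _]; first by rewrite groupMr.
by rewrite map_polyXsubC actM.
Qed.

Lemma orb_poly_root H : (orb_poly H).[th] = 0.
Proof. by rewrite /orb_poly horner_prod (bigD1 1%g)//= hornerXsubC act1 subrr mul0r. Qed.

Lemma orb_poly_in H P x : nonzero_prime P -> O x -> P (orb_poly H).[x] ->
  exists2 h, h \in H & P (x - act h th).
Proof.
move=> hP hx; rewrite /orb_poly horner_prod => /(prime_prod hP)[h|h hH]; rewrite hornerXsubC.
  by apply: OB => //; exact: act_O.
by exists h.
Qed.

Section AtPrime.
Variables (P : set W) (l b : nat).
Hypothesis hP : nonzero_prime P.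
Hypothesis l_prime : prime l.
Hypothesis P_l : P l%:R.
Local Notation Q := (l ^ b)%N.
Let hI := prime_idl hP.

Lemma cong_poly (c c' : nat -> W) n x y : (forall i, O (c i)) -> (forall i, O (c' i)) ->
  (forall i, P (c i ^+ Q - c' i)) -> O x -> O y -> P (x ^+ Q - y) ->
  P ((\sum_(i < n) c i * x ^+ i) ^+ Q - \sum_(i < n) c' i * y ^+ i).
Proof.
move=> hc hc' h hx hy hxy.
have hO i : O (c i * x ^+ i) by apply: OM => //; exact: OX.
apply: (I_trans hI (frob_sum b (index_enum 'I_n) hI l_prime P_l (fun i : 'I_n => hO i))).
rewrite -sumrB; apply: subg_sum (ideal_subgroup hI) _ => i _; rewrite exprMn -exprM mulnC exprM.
by apply: cong_mul => //; [exact: OX|exact: OX|exact: h|apply: cong_exp => //; exact: OX].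
Qed.

(** The coefficients of [orb_poly H] are unchanged by the [Q]-th power modulo [P]. The value at
    [th ^ Q] is then congruent to the [Q]-th power of the value at [th], which is zero, so [th ^ Q]
    is congruent to some [act h th]. *)
Lemma frob_in H : (forall x, O x -> fixed H x -> P (x ^+ Q - x)) ->
  exists2 h, h \in H & P (act h th - th ^+ Q).
Proof.
move=> hfix; have thQ : O (th ^+ Q) by exact: OX.
have [|h hH hh] := @orb_poly_in H P (th ^+ Q) hP thQ; last by exists h => //; exact: I_sym.
have := @cong_poly (fun i => (orb_poly H)`_i) (fun i => (orb_poly H)`_i) (size (orb_poly H)) th (th ^+ Q)
  (orb_poly_O H) (orb_poly_O H) (fun i => hfix _ (orb_poly_O H i) (@orb_poly_fixed H i)) th_O thQ _.
rewrite subrr -!horner_coef orb_poly_root expr0n expn_eq0 eqn0Ngt prime_gt0//= sub0r.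
by move=> /(_ (I0 hI)) /(IN hI); rewrite opprK.
Qed.

Lemma frob_all g : (forall z : int, P (z%:~R ^+ Q - z%:~R)) -> ~ P D%:R ->
  P (act g th - th ^+ Q) -> forall x, O x -> P (act g x - x ^+ Q).
Proof.
move=> hZ nD hg x hx; have [p hp] := D_th hx.
have zO (z : int) : O (z%:~R : W).
  by case: z => n; rewrite ?NegzE ?rmorphN /=; [|apply: ON]; exact: O_nat.
have DO : O (D%:R : W) by exact: O_nat.
have e1 u : (map_poly intr p).[u] = \sum_(i < size p) (p`_i)%:~R * u ^+ i :> W.
  rewrite (@horner_coef_wide _ (size p)); last exact: size_poly.
  by apply: eq_bigr => i _; rewrite coef_map.
have e2 : D%:R * act g x = (map_poly intr p).[act g th].
  transitivity (act g (D%:R * x)); first by rewrite rmorphM rmorph_nat.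
  rewrite hp -horner_map -map_poly_comp; congr (_.[_]).
  by apply: eq_map_poly => i /=; rewrite rmorph_int.
have h1 : P ((D%:R * x) ^+ Q - D%:R * act g x).
  rewrite hp e2 !e1; apply: (@cong_poly (fun i => (p`_i)%:~R) (fun i => (p`_i)%:~R)) => //.
    exact: act_O.
  exact: I_sym.
have h2 : P ((D%:R * x) ^+ Q - D%:R * x ^+ Q).
  rewrite exprMn; apply: cong_mul => //; [exact: OX|exact: OX|exact: (hZ D)|].
  by rewrite subrr; exact: I0.
have h3 : P (D%:R * (act g x - x ^+ Q)).
  by rewrite mulrBr; apply: (I_trans hI (I_sym hI h1)).
have gO : O (act g x - x ^+ Q) by apply: OB; [exact: act_O|exact: OX].
by have [] := primeM hP DO gO h3.
Qed.

End AtPrime.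

Section OverBase.
Variables (k : fieldExtType rat) (ik : {rmorphism k -> W}).
Hypothesis ikP : forall x, (forall s, act s x = x) <-> exists a, x = ik a.
Local Notation Ok := (@ring_of_integers k).

Lemma act_ik s a : act s (ik a) = ik a.
Proof. by have /ikP := ex_intro (fun b => ik a = ik b) a erefl; apply. Qed.

Definition good_prime P := nonzero_prime P /\ ~ P n0%:R.
Definition nrk P := ideal_norm (contr ik P).
Definition Frob P g := forall x, O x -> P (act g x - x ^+ nrk P).

Lemma contr_aim s P : contr ik (aim s P) = contr ik P.
Proof. by apply/funext => a; rewrite /aim /contr /mkset act_ik. Qed.

Lemma nrk_aim s P : nrk (aim s P) = nrk P. Proof. by rewrite /nrk contr_aim. Qed.

Lemma good_aim s P : good_prime P -> good_prime (aim s P).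
Proof. by move=> [h1 h2]; split; [exact: aim_prime|rewrite /aim contr_nat]. Qed.

Lemma nrk_char P : nonzero_prime P -> exists l b : nat, [/\ prime l, P l%:R & nrk P = (l ^ b)%N].
Proof.
move=> hP; have [l [b [h1 h2 h3]]] := prime_char (contr_prime ik hP).
by exists l, b; split=> //; move: h2; rewrite contr_nat.
Qed.

Lemma nrk_fermat P a : nonzero_prime P -> Ok a -> P (ik a ^+ nrk P - ik a).
Proof. by move=> hP ha; have := fermat (contr_prime ik hP) ha; rewrite /contr /mkset rmorphB rmorphXn. Qed.

Lemma frob_th P g : nonzero_prime P -> ~ P D%:R -> P (act g th - th ^+ nrk P) -> Frob P g.
Proof.
move=> hP nD; have [l [b [hl Pl e]]] := nrk_char hP; rewrite /Frob e => h.
apply: frob_all => // z; rewrite -e.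
have -> : z%:~R = ik z%:~R by rewrite rmorph_int.
by apply: nrk_fermat => //; case: z => n; rewrite ?NegzE ?rmorphN /=; [|apply: ON]; exact: O_nat.
Qed.

Lemma ex_Frob P : good_prime P -> exists g, Frob P g.
Proof.
move=> [hP nP]; have [nD _] := good_th hP nP; have [l [b [hl Pl e]]] := nrk_char hP.
have [|g _ hg] := @frob_in P l b hP hl Pl [set: gT]%G; last by exists g; apply: frob_th; rewrite ?e.
move=> x hx fx; have /ikP[a xa] : forall s, act s x = x by move=> s; apply: fx; rewrite inE.
by rewrite -e xa; apply: nrk_fermat => //; apply/(iota_int ik); rewrite -xa.
Qed.

Lemma Frob_uniq P g h : good_prime P -> Frob P g -> P (act h th - th ^+ nrk P) -> h = g.
Proof.
move=> [hP nP] hg hh; have [_ inj] := good_th hP nP; apply: inj.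
exact: (I_trans (prime_idl hP) hh (I_sym (prime_idl hP) (hg _ th_O))).
Qed.

Lemma Frob_conj P g s : Frob P g -> Frob (aim s P) (g ^ s)%g.
Proof.
move=> hg x hx; rewrite /aim /contr /mkset rmorphB rmorphXn nrk_aim conjgE !actM actK.
by apply: hg; exact: act_O.
Qed.

(** At a good prime the decomposition group is generated by Frobenius. If [s] fixes [P], reduce
    [orb_poly <[g]>] modulo [P]: its coefficients come from [k], so [s] preserves its roots, and
    [act s th] is congruent to [act h th] with [h] in [<[g]>]. *)
Lemma Frob_stab P g s : good_prime P -> Frob P g -> aim s P = P <-> s \in <[g]>%g.
Proof.
move=> gP hg; have [hP nP] := gP; have hI := prime_idl hP; have [_ inj] := good_th hP nP.
have q0 : (0 < nrk P)%N by rewrite ideal_norm_gt0//; exact: prime_nz (contr_prime ik hP).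
have q1 : (1 < nrk P)%N by exact: prime_norm_gt1 (contr_prime ik hP).
split; last first.
  move=> /cycleP[i ->]; elim: i => [|i IH]; first by rewrite expg0 aim1.
  have gP' : aim g P = P.
    apply: prime_sub_eq; [exact: aim_prime|exact: hP|] => x hx.
    have xO : O x by exact: ideal_O (prime_idl (aim_prime g hP)) hx.
    have : P (act g (act g^-1%g x)).
      have yO := act_O g^-1%g xO; rewrite -[act g _](subrK ((act g^-1%g x) ^+ nrk P)).
      apply: ID => //; first exact: hg.
      by rewrite -(prednK q0) exprS; apply: idealMr => //; exact: OX.
    by rewrite actVK.
  by rewrite expgS aimM gP'.
move=> sP; have actP x : P x -> P (act s x).
  by move=> hx; rewrite -sP /aim /contr /mkset actK.
pose c i := (orb_poly <[g]>)`_i.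
have [r [r1 _ r3]] := ideal_norm_reps_ex (prime_nz (contr_prime ik hP)).
(* The coefficients are fixed by [g], so they solve [x ^ q = x] modulo [P]. The residues of [k]
   already give [q] solutions and [few_roots] allows no more. *)
have ex_a i : exists a, Ok a /\ P (c i - ik a).
  have cO : O (c i) by exact: orb_poly_O.
  have cQ : P (c i ^+ nrk P - c i).
    have := hg _ cO; rewrite (@orb_poly_fixed <[g]>%G i g (cycle_id g)) => h; exact: I_sym.
  apply: contrapT => no.
  pose y (j : 'I_(nrk P).+1) : W := if unlift ord_max j is Some t then ik (r t) else c i.
  have ikO j : O (ik (r j)) by apply/(iota_int ik).
  have : ((nrk P).+1 <= nrk P)%N; last by rewrite ltnn.
  apply: (few_roots (P := P) (y := y)) => // [j|j|j j'].
  - by rewrite /y; case: unlift.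
  - by rewrite /y; case: unlift => [t|//]; exact: nrk_fermat.
  rewrite /y; case: unliftP => [t ->|->]; case: unliftP => [t' ->|->] h //.
  - by congr lift; apply: r3; rewrite /contr /mkset rmorphB.
  - by case: no; exists (r t); split=> //; exact: I_sym.
  - by case: no; exists (r t').
have /choice[a ha] := ex_a.
have thO' := act_O s th_O.
have cong u : O u -> P ((orb_poly <[g]>).[u] - \sum_(i < size (orb_poly <[g]>)) ik (a i) * u ^+ i).
  move=> uO; rewrite horner_coef -sumrB; apply: subg_sum (ideal_subgroup hI) _ => i _.
  by rewrite -mulrBl; apply: idealMr => //; [exact: OX|case: (ha i)].
have h1 : P (\sum_(i < size (orb_poly <[g]>)) ik (a i) * th ^+ i).
  by have := cong _ th_O; rewrite orb_poly_root sub0r => /(IN hI); rewrite opprK.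
have h2 : P (\sum_(i < size (orb_poly <[g]>)) ik (a i) * act s th ^+ i).
  have := actP _ h1; rewrite rmorph_sum; congr P; apply: eq_bigr => i _.
  by rewrite rmorphM rmorphXn /= act_ik.
have h3 : P (orb_poly <[g]>).[act s th] by have := ID hI (cong _ thO') h2; rewrite subrK.
by have [h hH /inj ->] := orb_poly_in hP thO' h3.
Qed.

(** Equal norms make every integer of [E] satisfy [x ^ q = x] modulo [P]; then [frob_in] finds a
    Frobenius element in [H], and it is unique. Conversely, if [g] fixes [E], the residues of [E]
    are roots of [x ^ q - x], and [few_roots] bounds their number. *)
Lemma Frob_norm (E : fieldExtType rat) (iE : {rmorphism E -> W}) H P g :
  (forall x, fixed H x <-> exists y : E, x = iE y) -> good_prime P -> Frob P g ->
  ideal_norm (contr iE P) = nrk P <-> g \in H.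
Proof.
move=> hE gP hg; have [hP nP] := gP; have hI := prime_idl hP.
have q1 : (1 < nrk P)%N by exact: prime_norm_gt1 (contr_prime ik hP).
have hq := contr_prime iE hP.
split=> [e|gH].
  have [l [b [hl Pl eq]]] := nrk_char hP.
  have [|h hH hh] := @frob_in P l b hP hl Pl H.
    move=> x hx /hE[y ye]; rewrite -eq -e ye.
    have yO : ring_of_integers y by apply/(iota_int iE); rewrite -ye.
    by have := fermat hq yO; rewrite /contr /mkset rmorphB rmorphXn.
  by rewrite -eq in hh; rewrite -(Frob_uniq gP hg hh).
apply/eqP; rewrite eqn_leq; apply/andP; split.
  have [r [r1 _ r3]] := ideal_norm_reps_ex (prime_nz hq).
  apply: (few_roots (P := contr iE P) (y := r)) => // t.
  rewrite /contr /mkset rmorphB rmorphXn.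
  have fx : act g (iE (r t)) = iE (r t) by have /hE := ex_intro (fun y : E => iE (r t) = iE y) (r t) erefl; apply.
  by have := hg (iE (r t)); rewrite fx => h; apply: I_sym => //; apply: h; apply/iota_int.
apply: norm_contr_le => // a.
have [|y ye] := (hE (ik a)).1; last by exists y.
by move=> h _; exact: act_ik.
Qed.

End OverBase.
End Frobenius.

(** * Density of Frobenius elements *)

Section Small.
Variable R : realType.
Implicit Types (u v : nat -> R).

Definition small u := forall e : R, 0 < e -> exists N : nat, forall n, (N <= n)%N -> `|u n| <= e * Li R n.

Lemma eq_small u v : u =1 v -> small u -> small v.
Proof. by move=> e h x x0; have [N hN] := h x x0; exists N => n; rewrite -e; exact: hN. Qed.

Lemma small0 : small (fun=> 0).
Proof. by move=> e e0; exists 0%N => n _; rewrite normr0 mulr_ge0 ?Li_ge0// ltW. Qed.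

Lemma smallD u v : small u -> small v -> small (fun n => u n + v n).
Proof.
move=> hu hv e e0; have e20 : 0 < e / 2 by rewrite divr_gt0.
have [N1 h1] := hu _ e20; have [N2 h2] := hv _ e20.
exists (maxn N1 N2) => n; rewrite geq_max => /andP[/h1 a /h2 b].
apply: le_trans (ler_normD _ _) _; apply: le_trans (lerD a b) _.
by rewrite -mulrDl -splitr.
Qed.

Lemma smallN u : small u -> small (fun n => - u n).
Proof. by move=> h e /h[N hN]; exists N => n /hN; rewrite normrN. Qed.

Lemma small_sum (T : finType) (A : pred T) (u : T -> nat -> R) :
  (forall i, A i -> small (u i)) -> small (fun n => \sum_(i | A i) u i n).
Proof.
move=> h; have : forall s : seq T, small (fun n => \sum_(i <- s | A i) u i n); last by apply.
elim=> [|i s IH].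
  by apply: eq_small small0 => n; rewrite big_nil.
case Ai : (A i); last by apply: eq_small IH => n; rewrite big_cons Ai.
by apply: eq_small (smallD (h _ Ai) IH) => n; rewrite big_cons Ai.
Qed.

Lemma small_mul u (c : R) : small u -> small (fun n => c * u n).
Proof.
move=> h e e0; have c0 : 0 < `|c| + 1 by rewrite ltr_wpDl.
have [N hN] := h _ (divr_gt0 e0 c0); exists N => n /hN a.
rewrite normrM; apply: (@le_trans _ _ ((`|c| + 1) * (e / (`|c| + 1) * Li R n))).
  by apply: ler_pM => //; rewrite lerDl.
by rewrite mulrA mulrCA mulfV ?gt_eqF// mulr1.
Qed.

Lemma small_le u v : (forall n, `|u n| <= v n) -> small v -> small u.
Proof.
by move=> h hv e /hv[N hN]; exists N => n /hN b; apply: le_trans (h n) (le_trans (ler_norm _) b).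
Qed.

Lemma small_sqrt (C c : R) (s : nat -> nat) : (forall n, (s n ^ 2 <= n)%N) ->
  small (fun n => C * (s n)%:R + c).
Proof.
move=> hs; apply: smallD.
  apply: small_mul => e e0; have [N hN] := @sqrt_Li_small R 1 e e0.
  exists N => n /hN; rewrite mul1r ger0_norm//; apply: le_trans.
  by rewrite -[leLHS]ger0_norm// -sqrtr_sqr ler_sqrt// -natrX ler_nat.
move=> e e0; have [N hN] := @cst_Li_small R `|c| e e0.
by exists N => n /hN.
Qed.

End Small.

Section Density.
Variables (R : realType) (W : fieldExtType rat) (gT : finGroupType) (act : gT -> {rmorphism W -> W}).
Hypothesis act1 : forall x, act 1%g x = x.
Hypothesis actM : forall s t x, act (s * t)%g x = act t (act s x).
Local Notation O := (@ring_of_integers W).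
Variables (th : W) (D n0 : nat).
Hypothesis th_O : O th.
Hypothesis n0_gt0 : (0 < n0)%N.
Hypothesis D_th : forall x, O x -> exists p : {poly int}, D%:R * x = (map_poly intr p).[th].
Hypothesis good_th : forall P, nonzero_prime P -> ~ P n0%:R ->
    ~ P D%:R /\ forall s t, P (act s th - act t th) -> s = t.
Variables (k : fieldExtType rat) (ik : {rmorphism k -> W}).
Hypothesis ikP : forall x, (forall s, act s x = x) <-> exists a, x = ik a.
Local Notation good_prime := (good_prime n0).
Local Notation nrk := (nrk ik).
Local Notation Frob := (Frob act ik).
Local Notation aim := (aim act).
Implicit Types (P : set W) (H : {group gT}) (A S : {set gT}).

(** The Frobenius element at a good prime; 1 if there is none. *)
Definition phi P : gT := xget 1%g [set g | Frob P g].

Lemma phiP P : good_prime P -> Frob P (phi P).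
Proof.
move=> gP; have [g hg] := ex_Frob act1 actM th_O D_th good_th ikP gP.
by apply: (@xgetPex _ 1%g [set g | Frob P g]); exists g.
Qed.

Lemma phi_uniq P g : good_prime P -> Frob P g -> g = phi P.
Proof. by move=> gP hg; apply: (Frob_uniq th_O good_th gP (phiP gP)); exact: hg. Qed.

Lemma phi_aim s P : good_prime P -> phi (aim s P) = (phi P ^ s)%g.
Proof.
move=> gP; apply/esym/phi_uniq; first exact: good_aim.
exact: (@Frob_conj _ _ _ act1 actM _ _ ikP P _ s (phiP gP)).
Qed.

Definition frob_seq n : seq (set W) := fset_set [set P | good_prime P /\ (nrk P <= n)%N].

Lemma prime_nrk_fact P n : nonzero_prime P -> (nrk P <= n)%N -> P (n`!)%:R.
Proof.
move=> hP hn; have hp := contr_prime ik hP.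
have : contr ik P (n`!)%:R; last by rewrite contr_nat.
have /dvdnP[q ->] : ((nrk P)`! %| n`!)%N.
  by rewrite -(ffact_fact (leq_subr (nrk P) n)) subKn// dvdn_mull.
by rewrite natrM; apply: idealM; [exact: prime_idl|exact: O_nat|exact: norm_nat_in (prime_nz hp)].
Qed.

Lemma mem_frob_seq n P : reflect (good_prime P /\ (nrk P <= n)%N) (P \in frob_seq n).
Proof.
rewrite /frob_seq in_fset_set; first by apply: (iffP idP); rewrite inE.
apply: (sub_finite_set _ (finite_ideals_containing W (fact_gt0 n))) => Q [[hQ _] hn].
by split; [exact: prime_idl|exact: prime_nrk_fact].
Qed.

(** The weight is the order of the decomposition group; it makes the fibres above primes of an
    intermediate field equal in weight. *)
Definition wsum A n : nat := \sum_(P <- frob_seq n | phi P \in A) #[phi P]%g.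

Section Fibers.
Variables (E : fieldExtType rat) (iE : {rmorphism E -> W}) (H : {group gT}).
Hypothesis iEP : forall x, fixed act H x <-> exists y : E, x = iE y.

Lemma contr_aimE h P : h \in H -> contr iE (aim h P) = contr iE P.
Proof.
move=> hH; apply/funext => y; rewrite /aim /contr /mkset.
suff -> : act h^-1%g (iE y) = iE y by [].
have /iEP := ex_intro (fun z : E => iE y = iE z) y erefl; apply; by rewrite groupV.
Qed.

(** Orbit and stabiliser: the fibre is an orbit of [H], and the stabiliser of each member is the
    cyclic group of its Frobenius element, which is contained in [H]. *)
Lemma fiber_sum n P : P \in frob_seq n -> phi P \in H ->
  (\sum_(P' <- frob_seq n | contr iE P' == contr iE P) #[phi P']%g = #|H|)%N.
Proof.
move=> /mem_frob_seq[gP hn] pH; have [hP _] := gP.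
have fibE P' : P' \in frob_seq n -> contr iE P' == contr iE P ->
    #[phi P']%g = (\sum_(h in H) (aim h P == P'))%N.
  move=> /mem_frob_seq[[hP' _] _] /eqP/esym e.
  have [h0 h0H e0] := aim_transitive act1 actM (fun x => (iEP x).1) hP hP' e.
  rewrite e0 phi_aim// orderJ.
  have -> : #[phi P]%g = #|[set h in H | aim h P == aim h0 P]%SET|.
    rewrite orderE -(card_rcoset <[phi P]>%g h0); apply: eq_card => h; rewrite !inE mem_rcoset.
    have st := Frob_stab act1 actM th_O good_th ikP (h * h0^-1)%g gP (phiP gP).
    apply/idP/andP => [hin|[hH /eqP eh]].
      split.
        have : (h * h0^-1)%g \in H by apply: (fintype.subsetP _ _ hin); rewrite cycle_subG.
        by rewrite groupMr// groupV.
      by move/st: hin => {2}<-; rewrite -aimM// mulgKV.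
    by apply/st; rewrite aimM// eh -aimM// mulgV aim1.
  by rewrite -sum1dep_card big_mkcondr.
rewrite big_seq_cond (eq_bigr (fun P' => \sum_(h in H) (aim h P == P'))%N); last first.
  by move=> P' /andP[h1 h2]; exact: fibE.
rewrite -big_seq_cond exchange_big /= -sum1_card; apply: eq_bigr => h hH.
have hin : aim h P \in frob_seq n by apply/mem_frob_seq; split; [exact: good_aim|rewrite nrk_aim].
rewrite big_mkcond (bigD1_seq (aim h P)) ?fset_uniq//= contr_aimE// !eqxx big1 ?addn0// => P' /negPf.
by rewrite eq_sym => ->; case: ifP.
Qed.

Definition low_seq A n : seq (set E) := undup [seq contr iE P | P <- frob_seq n & phi P \in A].

Lemma wsum_low A n : A \subset H -> (forall g h, g \in A -> h \in H -> (g ^ h)%g \in A) ->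
  wsum A n = (#|H| * size (low_seq A n))%N.
Proof.
move=> sAH cA.
have mL P : P \in frob_seq n -> phi P \in A -> contr iE P \in low_seq A n.
  by move=> h1 h2; rewrite mem_undup; apply/mapP; exists P => //; rewrite mem_filter h2.
transitivity (\sum_(P <- frob_seq n | phi P \in A) \sum_(q <- low_seq A n) (contr iE P == q) * #[phi P]%g)%N.
  rewrite /wsum big_seq_cond [RHS]big_seq_cond; apply: eq_bigr => P /andP[hP pA].
  rewrite (bigD1_seq (contr iE P)) ?undup_uniq ?mL//= eqxx mul1n big1 ?addn0// => q /negPf.
  by rewrite eq_sym => ->.
rewrite exchange_big /=; transitivity (\sum_(q <- low_seq A n) #|H|)%N; last first.
  by rewrite big_const_seq count_predT iter_addn_0.
rewrite big_seq [RHS]big_seq; apply: eq_bigr => q.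
rewrite mem_undup => /mapP[P]; rewrite mem_filter => /andP[pA hP] ->.
rewrite -(fiber_sum hP (fintype.subsetP sAH _ pA)) big_mkcond [RHS]big_mkcond /=.
rewrite big_seq [RHS]big_seq; apply: eq_bigr => P' hP'.
case: eqP => [e|]; last by rewrite mul0n if_same.
have /mem_frob_seq[gP _] := hP; have /mem_frob_seq[gP' _] := hP'.
have [h hH e'] := aim_transitive act1 actM (fun x => (iEP x).1) gP.1 gP'.1 (esym e).
by rewrite e' phi_aim// cA// mul1n.
Qed.

Lemma low_sub n q : q \in low_seq H n -> nonzero_prime q /\ (ideal_norm q <= n)%N.
Proof.
rewrite mem_undup => /mapP[P]; rewrite mem_filter => /andP[pH /mem_frob_seq[gP hn]] ->.
split; first by apply: contr_prime; exact: gP.1.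
by rewrite (Frob_norm act1 actM th_O good_th ikP iEP gP (phiP gP)).2.
Qed.

(** The good primes of [E] missing from [low_seq H] have norm at least the square of the norm below.
    They lie over primes of [k] of norm at most the square root of [n], with at most [|G|] over
    each, so a linear bound for the primes of [k] already makes them negligible. *)
Lemma low_count : small (fun n => (#|H| * size (low_seq H n))%:R - #|H|%:R * Li R n).
Proof.
have /finite_fsetP[Y hY] := finite_ideals_containing E n0_gt0.
have [Ck Ck0 hCk] := prime_count_le_linear R k.
have /choice[s hs] : forall n, exists t, (t ^ 2 <= n < t.+1 ^ 2)%N by move=> n; exact: ex_root.
have /choice[P0 hP0] : forall p : set k, exists P, nonzero_prime p -> nonzero_prime P /\ contr ik P = p.
  move=> p; have [hp|] := pselect (nonzero_prime p); last by exists set0.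
  by have [P h1 h2] := lying_over ik hp; exists P.
have /choice[PE hPE] : forall q : set E, exists P, nonzero_prime q -> nonzero_prime P /\ contr iE P = q.
  move=> q; have [hq|] := pselect (nonzero_prime q); last by exists set0.
  by have [P h1 h2] := lying_over iE hq; exists P.
have kE a : exists y, iE y = ik a.
  have [|y ye] := (iEP (ik a)).1; last by exists y.
  by move=> h _; exact: act_ik ikP _ _.
pose pr n := norm_seq (fun q : set E => nonzero_prime q /\ [set: set E] q) n.
pose prk n := norm_seq (fun p : set k => nonzero_prime p /\ [set: set k] p) n.
have bound n : (prime_count [set: set E] n <= size (low_seq H n) + (#|gT| * prime_count [set: set k] (s n) + size Y))%N.
  rewrite !prime_countE -/(pr n) -/(prk (s n)).
  pose Z := [seq contr iE (aim g (P0 p)) | p <- prk (s n), g <- enum gT].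
  have sZ : size Z = (#|gT| * size (prk (s n)))%N by rewrite size_allpairs mulnC -cardE.
  rewrite -sZ -size_cat -size_cat; apply: uniq_leq_size; first exact: fset_uniq.
  move=> q /mem_norm_seq[hq [hqp _] hn]; rewrite !mem_cat.
  have [qn0|qn0] := pselect (q n0%:R).
    apply/orP; right; apply/orP; right; have : [set` Y] q; last by [].
    by rewrite -hY; split=> //; exact: prime_idl.
  have [hP cP] := hPE q hqp; set P := PE q in hP cP.
  have gP : good_prime P by split=> //; rewrite -(contr_nat iE) cP.
  have le1 := norm_contr_le kE hP; rewrite cP in le1.
  have [pH|pH] := boolP (phi P \in H).
    apply/orP; left; rewrite mem_undup; apply/mapP; exists P; last by rewrite cP.
    by rewrite mem_filter pH; apply/mem_frob_seq; split=> //; exact: leq_trans le1 hn.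
  apply/orP; right; apply/orP; left.
  have := norm_contr_square kE hP; rewrite cP => -[e|le2].
    case/negP: pH; apply/(Frob_norm act1 actM th_O good_th ikP iEP gP (phiP gP)).
    by rewrite cP.
  have hp := contr_prime ik hP; have [hP0' e0] := hP0 _ hp.
  have [|g _ eg] := aim_transitive act1 actM (H := [set: gT]%G) _ hP0' hP e0.
    by move=> x fx; apply/ikP => t; apply: fx; rewrite inE.
  apply/allpairsP; exists (contr ik P, g) => /=; split; rewrite ?mem_enum//; last by rewrite -eg cP.
  apply/mem_norm_seq; split=> //; first exact: prime_nz.
  have /andP[_ hs2] := hs n; rewrite -ltnS -(@ltn_exp2r _ _ 2)//.
  exact: leq_ltn_trans (leq_trans le2 hn) hs2.
have bound2 n : (size (low_seq H n) <= prime_count [set: set E] n)%N.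
  rewrite prime_countE; apply: uniq_leq_size; first exact: undup_uniq.
  move=> q /low_sub[h1 h2]; apply/mem_norm_seq; split=> //; exact: prime_nz.
have pit : small (fun n => (prime_count [set: set E] n)%:R - Li R n).
  by move=> e e0; exact: prime_ideal_theorem.
have d1 : small (fun n => (size (low_seq H n))%:R - (prime_count [set: set E] n)%:R : R).
  apply: small_le (small_sqrt (#|gT|%:R * Ck) (size Y)%:R (fun n => (andP (hs n)).1)) => n.
  have := bound n; have := bound2 n; rewrite -!(ler_nat R) !natrD natrM => b2 b1.
  have b3 : #|gT|%:R * (prime_count [set: set k] (s n))%:R <= #|gT|%:R * Ck * (s n)%:R :> R.
    by rewrite -mulrA ler_wpM2l.
  by rewrite ler_norml; apply/andP; split; lra.
apply: eq_small (small_mul #|H|%:R (smallD d1 pit)) => n.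
by rewrite natrM; ring.
Qed.

End Fibers.

Variables (E : {group gT} -> fieldExtType rat) (iE : forall H, {rmorphism E H -> W}).
Hypothesis iEP : forall H x, fixed act H x <-> exists y : E H, x = iE H y.

(** Deviation of the weight of one element from its expected share. Individually it is not
    controlled; only sums over divisions, that is over generators of one cyclic group, are shown to
    be small. *)
Definition dev g n : R := (wsum [set g]%SET n)%:R - Li R n.

Lemma wsum_dev A n : \sum_(g in A) dev g n = (wsum A n)%:R - #|A|%:R * Li R n.
Proof.
rewrite /dev sumrB [X in _ - X]sumr_const -[X in _ - X]mulr_natl; congr (_ - _); rewrite -natr_sum; congr (_%:R).
rewrite /wsum (exchange_big_dep (fun P => phi P \in A)) /=; last first.
  by move=> g P gA; rewrite inE => /eqP ->.
apply: eq_bigr => P pA; rewrite (big_pred1 (phi P))// => g; rewrite !inE.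
by case: eqP => [<-|e]; rewrite ?andbF ?andbT ?pA ?eqxx// eq_sym; apply/esym/negP => /eqP.
Qed.

Lemma group_small H : small (fun n => \sum_(g in H) dev g n).
Proof.
apply: eq_small (low_count (iEP H)) => n; rewrite wsum_dev -(wsum_low (iEP H))//.
by move=> g h gH hH; rewrite groupJ.
Qed.

(* A cyclic group is the disjoint union of the generators of its subgroups. *)
Lemma gen_small g : small (fun n => \sum_(h | <[h]>%g == <[g]>%g) dev h n).
Proof.
have [m] := ubnP #[g]%g; elim: m g => // m IH g hm.
apply: eq_small (smallD (group_small <[g]>%G)
  (smallN (small_sum (A := fun B : {set gT} => (B != <[g]>%g) && (B \in [set <[h]>%g | h in <[g]>%g]%SET))
    (u := fun B n => \sum_(h | <[h]>%g == B) dev h n) _))); last first.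
  move=> B /andP[Bg /imsetP[h hg Be]]; rewrite Be; apply: IH.
  rewrite -ltnS; apply: leq_trans hm; rewrite ltnS; apply: proper_card.
  by rewrite finset.properEneq -Be Bg Be cycle_subG.
move=> n; rewrite (partition_big (fun h => <[h]>%g) (fun B => B \in [set <[h]>%g | h in <[g]>%g]%SET)) /=; last first.
  by move=> h hg; apply/imsetP; exists h.
have gin : <[g]>%g \in [set <[h]>%g | h in <[g]>%g]%SET by apply/imsetP; exists g => //; exact: cycle_id.
have inn B h : B \in [set <[h]>%g | h in <[g]>%g]%SET -> <[h]>%g == B -> h \in <[g]>%g.
  by move=> /imsetP[x xg ->] /eqP e; rewrite -cycle_subG e cycle_subG.
rewrite (bigD1 <[g]>%g)//= [X in X + _ - _](eq_bigl (fun h => <[h]>%g == <[g]>%g)); last first.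
  by move=> h; apply/andP/idP => [[]//|e]; split=> //; exact: inn gin e.
rewrite -addrA -[RHS]addr0; congr (_ + _); apply/eqP; rewrite subr_eq0; apply/eqP.
apply: eq_big => [B|B /andP[hB _]]; first by rewrite andbC.
by apply: eq_bigl => h; apply/andP/idP => [[]//|e]; split=> //; exact: inn hB e.
Qed.

Lemma class_small A : (forall g h, g \in A -> <[h]>%g = <[g]>%g -> h \in A) ->
  small (fun n => \sum_(g in A) dev g n).
Proof.
move=> cA.
have : small (fun n => \sum_(B in [set <[h]>%g | h in A]%SET) \sum_(h | <[h]>%g == B) dev h n).
  by apply: small_sum => B /imsetP[g gA ->]; exact: gen_small.
apply: eq_small => n; rewrite [RHS](partition_big (fun h => <[h]>%g) (mem [set <[h]>%g | h in A]%SET)) /=.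
  apply: eq_bigr => B /imsetP[g gA ->]; apply: eq_bigl => h; apply/idP/andP => [/eqP e|[]//].
  by split; [exact: cA gA e|rewrite e].
by move=> h hA; apply/imsetP; exists h.
Qed.

(** [wsum_low] with the whole group counts each prime of [k] whose Frobenius elements lie in [A]
    with multiplicity [|G|]. The primes of [S] are among these, apart from the finitely many that
    contain [n0 * bad]. *)
Theorem frobenius_upper_density (S : set (set k)) A (bad : nat) : (0 < bad)%N ->
  (forall g h, g \in A -> <[h]>%g = <[g]>%g -> h \in A) ->
  (forall g h, g \in A -> (g ^ h)%g \in A) ->
  (forall P, good_prime P -> S (contr ik P) -> ~ P bad%:R -> phi P \in A) ->
  (upper_density R S <= (#|A|%:R / #|gT|%:R)%:E)%E.
Proof.
move=> bad0 cA jA hS.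
have G0 : 0 < #|gT|%:R :> R by rewrite ltr0n; apply/card_gt0P; exists 1%g.
have iTP x : fixed act [set: gT]%G x <-> exists a : k, x = ik a.
  by rewrite -ikP; split=> [h s|h s _]; [apply: h; rewrite inE|exact: h].
have dA : small (fun n => #|gT|%:R * (size (low_seq ik A n))%:R - #|A|%:R * Li R n).
  apply: eq_small (class_small cA) => n; rewrite wsum_dev (wsum_low iTP) ?finset.subsetT//.
    by rewrite cardsT natrM.
  by move=> g h gA _; exact: jA.
have /finite_fsetP[Y hY] := finite_ideals_containing k (ltac:(by rewrite muln_gt0 n0_gt0) : (0 < n0 * bad)%N).
have bound n : (prime_count S n <= size (low_seq ik A n) + size Y)%N.
  rewrite prime_countE -size_cat; apply: uniq_leq_size; first exact: fset_uniq.
  move=> p /mem_norm_seq[hp [hpp Sp] hn]; rewrite mem_cat.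
  have [pn|pn] := pselect (p (n0 * bad)%:R).
    by apply/orP; right; have : [set` Y] p; last by []; rewrite -hY; split=> //; exact: prime_idl.
  apply/orP; left; have [P hP cP] := lying_over ik hpp.
  have pO (j : nat) : ring_of_integers (j%:R : k) by exact: O_nat.
  have gP : good_prime P.
    split=> // h; apply: pn; rewrite natrM; apply: idealMr => //; first exact: prime_idl.
    by rewrite -cP contr_nat.
  have nb : ~ P bad%:R.
    move=> h; apply: pn; rewrite natrM; apply: idealM => //; first exact: prime_idl.
    by rewrite -cP contr_nat.
  rewrite mem_undup; apply/mapP; exists P; last by rewrite cP.
  rewrite mem_filter; apply/andP; split; first by apply: hS => //; rewrite cP.
  by apply/mem_frob_seq; split=> //; rewrite /nrk cP.
set c := #|A|%:R / #|gT|%:R.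
have c0 : 0 <= c by rewrite divr_ge0.
apply/lee_addgt0Pr => e e0.
have pit : small (fun n => (prime_count [set: set k] n)%:R - Li R n).
  by move=> e' e'0; exact: prime_ideal_theorem.
have dY : small (fun n => (size Y)%:R : R).
  by move=> e' e'0; have [N hN] := @cst_Li_small R (size Y)%:R e' e'0; exists N => n /hN; rewrite ger0_norm.
(* Chosen so that smallness at level [e] cancels the margin [e] in [c + e], once [Li] is expressed
   through the prime count. *)
have dS : small (fun n => #|gT|%:R^-1 * (#|gT|%:R * (size (low_seq ik A n))%:R - #|A|%:R * Li R n)
    + (size Y)%:R - (c + e) * ((prime_count [set: set k] n)%:R - Li R n)).
  apply: smallD; last by apply: smallN; exact: small_mul.
  by apply: smallD => //; exact: small_mul.
have [N1 h1] := dS _ e0.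
have [N2 h2] := pit 2^-1 (ltac:(by rewrite invr_gt0) : 0 < 2^-1 :> R).
have [N3 h3] := @cst_Li_small R 1 1 ltr01.
pose N := maxn N1 (maxn N2 N3).
have evt n : (N <= n)%N ->
    (((prime_count S n)%:R / (prime_count [set: set k] n)%:R : R)%:E <= (c + e)%:E)%E.
  rewrite !geq_max => /andP[/h1 a /andP[/h2 b /h3 d]].
  have l1 : 1 <= Li R n by lra.
  have p0 : 0 < (prime_count [set: set k] n)%:R :> R by move: b; rewrite ler_norml => /andP[? ?]; lra.
  rewrite lee_fin ler_pdivrMr//; have := bound n; rewrite -(ler_nat R) natrD => b1.
  move: a; rewrite mulrBr mulKf ?gt_eqF// mulrA [_^-1 * _]mulrC -/c ler_norml => /andP[_ a].
  have := mulr_ge0 c0 (Li_ge0 R n).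
  by move: a b1; rewrite !mulrBr; lra.
pose u := fun n : nat => ((prime_count S n)%:R / (prime_count [set: set k] n)%:R : R)%:E.
apply: (@le_trans _ _ (ereal_sup (u @` [set n | (N <= n)%N]))).
  by apply: ereal_inf_lbound; exists [set n | (N <= n)%N] => //; exists N.
by apply: ge_ereal_sup => _ [n /= hn <-]; exact: evt.
Qed.

End Density.

(** * Localisation and absolute values *)

Section Localisation.
Variables (F : fieldExtType rat) (P : set F).
Hypothesis hP : nonzero_prime P.
Local Notation O := (@ring_of_integers F).
Implicit Types (x y v w : F).
Let hI := prime_idl hP.

(** The localisation at [P]; [mloc] is its maximal ideal. Coefficients and critical points need only
    be integral here, not integral elements of the field. *)
Definition loc x := exists v, [/\ O v, ~ P v & O (v * x)].
Definition mloc x := exists v, [/\ O v, ~ P v & P (v * x)].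

Lemma nPM v w : O v -> O w -> ~ P v -> ~ P w -> ~ P (v * w).
Proof. by move=> hv hw nv nw /(primeM hP hv hw)[]. Qed.

Lemma loc_O x : O x -> loc x.
Proof. by move=> hx; exists 1; split; [exact: O1|case: hP|rewrite mul1r]. Qed.

Lemma locD x y : loc x -> loc y -> loc (x + y).
Proof.
move=> [v [hv nv hx]] [w [hw nw hy]]; exists (v * w); split; [exact: OM|exact: nPM|].
have -> : v * w * (x + y) = w * (v * x) + v * (w * y) by ring.
by apply: OD; exact: OM.
Qed.

Lemma locM x y : loc x -> loc y -> loc (x * y).
Proof.
move=> [v [hv nv hx]] [w [hw nw hy]]; exists (v * w); split; [exact: OM|exact: nPM|].
by rewrite mulrACA; exact: OM.
Qed.

Lemma locN x : loc x -> loc (- x).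
Proof. by rewrite -mulN1r; apply: locM; apply: loc_O; apply: ON; exact: O1. Qed.

Lemma locB x y : loc x -> loc y -> loc (x - y).
Proof. by move=> hx hy; apply: locD => //; exact: locN. Qed.

Lemma loc_horner (g : {poly F}) x : (forall i, loc g`_i) -> loc x -> loc g.[x].
Proof.
move=> hg hx; rewrite horner_coef; elim/big_rec: _ => [|i y _ hy]; first exact: loc_O (O0 F).
apply: locD => //; apply: locM => //; elim: (nat_of_ord i) => [|n IH].
  by rewrite expr0; exact: loc_O (O1 F).
by rewrite exprS; exact: locM.
Qed.

Lemma loc_multiple (B : nat) x : ~ P B%:R -> O (B%:R * x) -> loc x.
Proof. by move=> nB h; exists B%:R; split=> //; exact: O_nat. Qed.

Lemma mlocD x y : mloc x -> mloc y -> mloc (x + y).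
Proof.
move=> [v [hv nv hx]] [w [hw nw hy]]; exists (v * w); split; [exact: OM|exact: nPM|].
have -> : v * w * (x + y) = w * (v * x) + v * (w * y) by ring.
by apply: ID => //; apply: idealM.
Qed.

Lemma mlocM x y : mloc x -> loc y -> mloc (x * y).
Proof.
move=> [v [hv nv hx]] [w [hw nw hy]]; exists (v * w); split; [exact: OM|exact: nPM|].
by rewrite mulrACA; exact: idealMr.
Qed.

Lemma mlocN x : mloc x -> mloc (- x).
Proof. by rewrite -mulrN1 => h; apply: mlocM => //; apply: loc_O; apply: ON; exact: O1. Qed.

Lemma mloc1 : ~ mloc 1.
Proof. by move=> [v [_ nv]]; rewrite mulr1. Qed.

Lemma mloc_prime x y : loc x -> loc y -> mloc (x * y) -> mloc x \/ mloc y.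
Proof.
move=> [v [hv nv hx]] [w [hw nw hy]] [u [hu nu h]].
have h1 : P ((v * x) * (u * (w * y))).
  have -> : (v * x) * (u * (w * y)) = v * w * (u * (x * y)) by ring.
  by apply: idealM => //; exact: OM.
have [h2|/(primeM hP hu hy)[//|h2]] := primeM hP hx (OM hu hy) h1.
- by left; exists v.
- by right; exists w.
Qed.

Lemma mloc_prod (s : seq F) (h : F -> F) : (forall z, z \in s -> loc (h z)) ->
  mloc (\prod_(z <- s) h z) -> exists2 z, z \in s & mloc (h z).
Proof.
elim: s => [|z s IH] hs; first by rewrite big_nil => /mloc1.
have hs' y : y \in s -> loc (h y) by move=> ys; apply: hs; rewrite inE ys orbT.
rewrite big_cons => /mloc_prime[||hz|/(IH hs')[y ys hy]].
- by apply: hs; exact: mem_head.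
- elim: (s) hs' => [|y t IHt] ht; first by rewrite big_nil; exact: loc_O (O1 F).
  rewrite big_cons; apply: locM; first by apply: ht; exact: mem_head.
  by apply: IHt => w wt; apply: ht; rewrite inE wt orbT.
- by exists z => //; exact: mem_head.
by exists y => //; rewrite inE ys orbT.
Qed.

End Localisation.

Lemma common_multiple (F : fieldExtType rat) (s : seq F) :
  exists2 B : nat, (0 < B)%N & forall e, e \in s -> ring_of_integers (B%:R * e).
Proof.
elim: s => [|x s [B B0 hB]]; first by exists 1%N.
have [n n0 hn] := ex_integer_multiple x.
exists (B * n)%N; first by rewrite muln_gt0 B0.
move=> e; rewrite inE natrM => /orP[/eqP ->|/hB h].
  by rewrite -mulrA [n%:R * x]mulr_natl -[x *+ n]scaler_nat; apply: OM => //; exact: O_nat.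
by rewrite mulrAC; apply: OM => //; exact: O_nat.
Qed.

Section LocalExtension.
Variables (E W : fieldExtType rat) (iota : {rmorphism E -> W}) (P : set W).

Lemma loc_iota x : loc (contr iota P) x -> loc P (iota x).
Proof.
move=> [v [hv nv hx]]; exists (iota v); split=> //; first by apply/iota_int.
by rewrite -rmorphM; apply/iota_int.
Qed.

Lemma mloc_iota x : mloc (contr iota P) x -> mloc P (iota x).
Proof.
move=> [v [hv nv hx]]; exists (iota v); split=> //; first by apply/iota_int.
by move: hx; rewrite /contr /mkset rmorphM.
Qed.

End LocalExtension.

Section PadicOrder.
Variables (F : fieldExtType rat) (p : set F) (R : realType).
Hypothesis hp : nonzero_prime p.
Local Notation O := (@ring_of_integers F).

Lemma idX_le i j : (i <= j)%N -> ideal_exp p j `<=` ideal_exp p i.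
Proof.
move=> /subnKC <-; rewrite idX_add; last exact: prime_nz.
by apply: idm_subl; exact: (idX_nz _ (prime_nz hp)).1.
Qed.

(** As [u] is invertible modulo [p], numerator and denominator of any fraction equal to [u] lie in
    the same powers of [p]; without a presentation the default value 0 is the right one. *)
Lemma padic_ord_unit u : O u -> ~ p u -> padic_ord p u = 0.
Proof.
move=> hu nu; have hpn := prime_nz hp; have hI := prime_idl hp.
have iX i := (idX_nz i hpn).1.
have [y hy hz] := prime_inv hp hu nu.
have ordE a b (i j : nat) : u = a / b -> b != 0 -> has_ord p a i -> has_ord p b j -> i = j.
  move=> e b0 [ai nai] [bj nbj]; have ea : a = u * b by rewrite e divfK.
  have ij : (j <= i)%N.
    rewrite leqNgt; apply/negP => h; apply: nai; apply: (idX_le h).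
    by rewrite ea; exact: idealM.
  apply/eqP; rewrite eqn_leq ij andbT leqNgt; apply/negP => h; apply: nbj.
  have -> : b = a * y - b * (u * y - 1) by rewrite ea; ring.
  apply: IB => //; first by apply: (idX_le h); exact: idealMr.
  by rewrite /= mulrC; exact: in_idm.
rewrite /padic_ord; case: xgetP => [k _ [a [b [i [j [e b0 h1 h2 ->]]]]]|//].
by rewrite (ordE a b i j)// subrr.
Qed.

Lemma padic_abs_lt1 u : O u -> padic_abs R p u < 1 -> p u.
Proof.
move=> hu; rewrite /padic_abs; case: eqP => [-> _|_ h]; first exact: I0 (prime_idl hp).
by apply: contrapT => nu; move: h; rewrite padic_ord_unit// oppr0 expr0z ltxx.
Qed.

End PadicOrder.

(** * Nonarchimedean absolute values *)

Section Nonarchimedean.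
Variables (R : realType) (C : fieldType) (a : C -> R).
Hypothesis ha : nonarchimedean_absval a.
Implicit Types (x y z : C) (g : {poly C}).

Lemma av_ge0 x : 0 <= a x. Proof. by case: ha. Qed.
Lemma avM x y : a (x * y) = a x * a y. Proof. by case: ha. Qed.
Lemma av0 : a 0 = 0. Proof. by apply/eqP; case: ha => _ -> _ _. Qed.

Lemma av1 : a 1 = 1.
Proof.
have h : a 1 * a 1 = a 1 by rewrite -avM mulr1.
have n0 : a 1 != 0 by case: ha => _ -> _ _; exact: oner_neq0.
by apply: (mulfI n0); rewrite h mulr1.
Qed.

Lemma avN x : a (- x) = a x.
Proof.
have h : a (-1) = 1.
  by apply/eqP; rewrite -(@pexpr_eq1 _ _ 2) ?av_ge0// expr2 -avM mulrNN mulr1 av1.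
by rewrite -mulN1r avM h mul1r.
Qed.

Lemma avD_le (r : R) x y : a x <= r -> a y <= r -> a (x + y) <= r.
Proof. by case: ha => _ _ _ h hx hy; apply: le_trans (h x y) _; rewrite ge_max hx. Qed.

Lemma avD_lt (r : R) x y : a x < r -> a y < r -> a (x + y) < r.
Proof. by case: ha => _ _ _ h hx hy; apply: le_lt_trans (h x y) _; rewrite gt_max hx. Qed.

Lemma avX x n : a (x ^+ n) = a x ^+ n.
Proof. by elim: n => [|n IH]; rewrite ?expr0 ?av1// !exprS avM IH. Qed.

Lemma av_prod (T : Type) (s : seq T) (h : T -> C) : a (\prod_(i <- s) h i) = \prod_(i <- s) a (h i).
Proof. by elim: s => [|i s IH]; rewrite ?big_nil ?av1// !big_cons avM IH. Qed.

Lemma av_nat n : a n%:R <= 1.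
Proof.
elim: n => [|n IH]; first by rewrite av0.
by rewrite -natr1; apply: avD_le => //; rewrite av1.
Qed.

Lemma av_int (n : int) : a n%:~R <= 1.
Proof. by case: n => n; [exact: av_nat|rewrite NegzE rmorphN avN; exact: av_nat]. Qed.

Lemma av_integral x : integralOver (intr : int -> C) x -> a x <= 1.
Proof.
move=> [p pm pr]; rewrite leNgt; apply/negP => x1.
pose q : {poly C} := map_poly intr p.
have qm : q \is monic by exact: monic_map.
have qc i : a q`_i <= 1 by rewrite coef_map; exact: av_int.
have : q.[x] = 0 by exact/eqP.
rewrite horner_coef; have s0 : (0 < size q)%N by rewrite size_poly_gt0 monic_neq0.
rewrite -(prednK s0) big_ord_recr /= -lead_coefE (eqP qm) mul1r => /eqP; rewrite addrC addr_eq0 => /eqP e.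
have : a (x ^+ (size q).-1) < a x ^+ (size q).-1; last by rewrite avX ltxx.
rewrite {1}e avN; set n := (size q).-1.
case: n e => [|n] _; first by rewrite big_ord0 av0 expr0 ltr01.
apply: (@le_lt_trans _ _ (a x ^+ n)); last first.
  by rewrite exprS ltr_pMl// exprn_gt0//; lra.
elim/big_rec: _ => [|i y _ hy]; first by rewrite av0 exprn_ge0// av_ge0.
apply: avD_le => //; rewrite avM avX; apply: (@le_trans _ _ (1 * a x ^+ i)).
  by rewrite ler_wpM2r// exprn_ge0// av_ge0.
rewrite mul1r; apply: ler_weXn2l; first exact: ltW.
by rewrite -ltnS ltn_ord.
Qed.

Lemma av_horner g u v : (forall i, a g`_i <= 1) -> a u <= 1 -> a v <= 1 ->
  a g.[u] <= 1 /\ (a (u - v) < 1 -> a (g.[u] - g.[v]) < 1).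
Proof.
move=> hg hu hv; split.
  rewrite horner_coef; elim/big_rec: _ => [|i y _ hy]; first by rewrite av0.
  apply: avD_le => //; rewrite avM avX mulr_ile1 ?av_ge0 ?exprn_ge0 ?av_ge0//.
  by rewrite exprn_ile1 ?av_ge0.
move=> huv; rewrite !horner_coef -sumrB; elim/big_rec: _ => [|i y _ hy]; first by rewrite av0 ltr01.
apply: avD_lt => //; rewrite -mulrBr avM; apply: (@le_lt_trans _ _ (1 * a (u ^+ i - v ^+ i))).
  by rewrite ler_wpM2r ?av_ge0.
rewrite mul1r subrXX avM; apply: (@le_lt_trans _ _ (a (u - v) * 1)); last by rewrite mulr1.
rewrite ler_wpM2l ?av_ge0//; elim/big_rec: _ => [|j z _ hz]; first by rewrite av0.
apply: avD_le => //; rewrite avM !avX mulr_ile1 ?exprn_ge0 ?av_ge0//; exact: exprn_ile1 (av_ge0 _) _.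
Qed.

End Nonarchimedean.

(** * Attracting cycles *)

Lemma split_of_roots (k : fieldType) (p : {poly k}) : p != 0 ->
  (forall g, g %| p -> (1 < size g)%N -> exists x, root g x) ->
  exists cs, p = lead_coef p *: \prod_(c <- cs) ('X - c%:P).
Proof.
have [n] := ubnP (size p); elim: n p => // n IH p hn p0 hr.
have [s1|s1] := leqP (size p) 1.
  exists [::]; rewrite big_nil; have /size_poly1P[c c0 ->] : size p == 1%N.
    by rewrite eqn_leq s1 size_poly_gt0.
  by rewrite lead_coefC alg_polyC.
have [x /factor_theorem[q e]] := hr p (dvdpp p) s1.
have q0 : q != 0 by apply: contraNneq p0 => q0; rewrite e q0 mul0r.
have [||g gq|cs ecs] := IH q => //.
- by move: hn; rewrite e size_Mmonic ?monicXsubC// size_XsubC addn2.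
- by apply: hr; rewrite e dvdp_mulr.
exists (x :: cs); rewrite big_cons {1}e ecs.
have -> : lead_coef p = lead_coef q by rewrite e lead_coef_Mmonic ?monicXsubC.
by rewrite -scalerAl mulrC.
Qed.

Section Iteration.
Variables (k C : fieldType) (j : {rmorphism k -> C}) (f : {poly k}).
Local Notation fC := (map_poly j f).
Local Notation it n z := (iter n (fun t : C => fC.[t]) z).

Lemma iter_polyE n z : (map_poly j (iter_poly f n)).[z] = it n z.
Proof.
elim: n => [|n IH] /=; first by rewrite map_polyX hornerX.
by rewrite map_comp_poly horner_comp IH.
Qed.

Lemma deriv_iter_poly n z : (map_poly j (deriv (iter_poly f n))).[z] =
  \prod_(i < n) (map_poly j (deriv f)).[it i z].
Proof.
elim: n => [|n IH]; first by rewrite /= derivX rmorph1 hornerC big_ord0.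
rewrite big_ord_recr /= -IH deriv_comp rmorphM /= hornerM mulrC; congr (_ * _).
by rewrite map_comp_poly horner_comp iter_polyE.
Qed.

Lemma iter_poly_comp (n m : nat) : iter_poly f (n + m) = iter_poly f n \Po iter_poly f m.
Proof. by elim: n => [|n IH]; rewrite ?comp_polyX// addSn /= IH comp_polyA. Qed.

End Iteration.

Section AttractingCycle.
Variables (R : realType) (k C : fieldType) (a : C -> R) (j : {rmorphism k -> C}).
Hypothesis ha : nonarchimedean_absval a.
Variables (f : {poly k}) (cs : seq k).
Hypothesis f'E : deriv f = lead_coef (deriv f) *: \prod_(c <- cs) ('X - c%:P).
Hypothesis f_int : forall i, a (j f`_i) <= 1.
Hypothesis lc_unit : a (j (lead_coef (deriv f))^-1) <= 1.
Hypothesis cs_int : forall c, c \in cs -> a (j c) <= 1.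
Hypothesis f'0 : deriv f != 0.
Local Notation fC := (map_poly j f).
Local Notation it n z := (iter n (fun t : C => fC.[t]) z).

Lemma fC_int i : a fC`_i <= 1. Proof. by rewrite coef_map; exact: f_int. Qed.

Lemma f'C_int i : a (map_poly j (deriv f))`_i <= 1.
Proof.
rewrite coef_map coef_deriv /= rmorphMn -mulr_natr avM// mulr_ile1 ?av_ge0//; exact: av_nat.
Qed.

Lemma it_cong n u v : a u <= 1 -> a v <= 1 -> a (it n u) <= 1 /\ (a (u - v) < 1 -> a (it n u - it n v) < 1).
Proof.
elim: n u v => [|n IH] u v hu hv //; rewrite !iterSr.
have [h1 h2] := av_horner ha fC_int hu hv; have [h3 _] := av_horner ha fC_int hv hu.
by have [h4 h5] := IH _ _ h1 h3; split=> // huv; apply: h5; exact: h2.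
Qed.

Lemma attracting_critical n m z : (0 < n)%N -> (0 < m)%N -> it n z = z ->
  a (map_poly j (deriv (iter_poly f n))).[z] < 1 ->
  exists c, [/\ c \in cs, a (j c) <= 1 &
    a (j (deriv f \Po iter_poly f m).[(iter_poly f (n * m - m)).[c]]) < 1].
Proof.
move=> n0 m0 hz; rewrite deriv_iter_poly => h.
have [i hi] : exists i : 'I_n, a (map_poly j (deriv f)).[it i z] < 1.
  apply: contrapT => no; move: h; rewrite (av_prod ha) ltNge => /negP; apply.
  elim/big_rec: _ => [//|i x _ hx]; apply: mulr_ege1 => //.
  by rewrite leNgt; apply/negP => hi; apply: no; exists i.
set w := it i z in hi.
(* The number of iterations will be [n * m]: a multiple of the period, hence returning to [w], and
   at least [m], so that the last [m] can be split off. *)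
have wn q : it (n * q) w = w.
  have zq : it (n * q) z = z by elim: q => [|q IH]; rewrite ?muln0// mulnS iterD IH.
  by rewrite /w -iterD addnC iterD zq.
have [c ccs hc] : exists2 c, c \in cs & a (w - j c) < 1.
  apply: contrapT => no; move: hi; rewrite f'E map_polyZ hornerZ rmorph_prod /= horner_prod.
  rewrite avM// ltNge => /negP; apply; rewrite (av_prod ha).
  (* With a leading coefficient of absolute value at least 1, a small value of the derivative forces
     one of the linear factors to be small. *)
  have l1 : 1 <= a (j (lead_coef (deriv f))).
    have l0 : lead_coef (deriv f) != 0 by rewrite lead_coef_eq0.
    have e : a (j (lead_coef (deriv f))) * a (j (lead_coef (deriv f))^-1) = 1.
      by rewrite -avM// -rmorphM divff// rmorph1 av1.
    by rewrite -e ler_piMr ?av_ge0.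
  apply: mulr_ege1 => //; rewrite big_seq.
  elim/big_rec: _ => [//|c x ccs hx]; apply: mulr_ege1 => //.
  rewrite map_polyXsubC hornerXsubC leNgt; apply/negP => hcw; apply: no; by exists c.
have jc := cs_int ccs.
have w1 : a w <= 1 by rewrite -(subrK (j c) w); apply: avD_le => //; exact: ltW.
have c1 : a (it (n * m) (j c) - j c) < 1.
  have [_ h1] := it_cong (n * m) w1 jc; have := h1 hc; rewrite wn => h2.
  by rewrite -(subrK w (it _ _)) -addrA; apply: avD_lt => //; rewrite -avN// opprB.
exists c; split=> //.
have mn : (m <= n * m)%N by rewrite leq_pmull.
have -> : j (deriv f \Po iter_poly f m).[(iter_poly f (n * m - m)).[c]] =
    (map_poly j (deriv f)).[it (n * m) (j c)].
  rewrite [X in j X]horner_comp -[(iter_poly f m).[_]]horner_comp -iter_poly_comp subnKC//.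
  by rewrite -horner_map -iter_polyE; congr (_.[_]); rewrite horner_map.
have f'c : (map_poly j (deriv f)).[j c] = 0.
  rewrite horner_map; apply/eqP; rewrite fmorph_eq0 f'E hornerZ horner_prod (big_rem _ ccs) /=.
  by rewrite hornerXsubC subrr mul0r mulr0.
have [h2 _] := it_cong (n * m) jc jc; have [_ h1] := av_horner ha f'C_int h2 jc.
by have := h1 c1; rewrite f'c subr0.
Qed.

End AttractingCycle.

(** * The splitting field and its Galois action *)

Section SplittingField.
Variables (K : fieldExtType rat) (f : {poly K}) (hf : critical_points_rational f) (m : nat).
Variable (L : splittingFieldType K).
Local Notation Ff := (deriv f \Po iter_poly f m).
Hypothesis hL : splittingFieldFor 1%VS (map_poly (in_alg L) Ff) fullv.

Lemma Ff_split : exists rs : seq L, map_poly (in_alg L) Ff = (lead_coef Ff)%:A *: \prod_(z <- rs) ('X - z%:P).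
Proof.
have [rs e _] := hL; exists rs.
have /eqpP[[c1 c2] /= /andP[c10 c20] e'] := e.
have mon : \prod_(z <- rs) ('X - z%:P) \is monic by apply: monic_prod_XsubC.
have e2 : map_poly (in_alg L) Ff = (c2 / c1) *: \prod_(z <- rs) ('X - z%:P).
  by rewrite mulrC -scalerA -e' scalerA mulVf// scale1r.
rewrite {1}e2; congr (_ *: _).
have : lead_coef (map_poly (in_alg L) Ff) = c2 / c1 by rewrite e2 lead_coefZ (monicP mon) mulr1.
by rewrite lead_coef_map => <-.
Qed.

(** Zero is not associated to a product of monic linear factors; the splitting hypothesis thus
    excludes constant [f]. *)
Lemma Ff_neq0 : Ff != 0.
Proof.
apply/eqP => F0; have [rs + _] := hL; rewrite F0 rmorph0 eqp_sym eqp0 => /eqP e.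
by have := monic_neq0 (monic_prod_XsubC rs xpredT id); rewrite e eqxx.
Qed.

Lemma f'_neq0 : deriv f != 0.
Proof. by apply/eqP => e; have := Ff_neq0; rewrite e comp_poly0 eqxx. Qed.

Lemma f_nonconst : (1 < size f)%N.
Proof.
rewrite ltnNge; apply/negP => /size1_polyC e; have := f'_neq0; by rewrite e derivC eqxx.
Qed.

Lemma iter_nonconst n : (1 < size (iter_poly f n))%N.
Proof.
elim: n => [|n IH]; first by rewrite size_polyX.
rewrite /= -subn_gt0 subn1 size_comp_poly; move: f_nonconst IH; case: (size f) => [|[|a]]//.
by case: (size _) => [|[|b]]// _ _; rewrite muln_gt0.
Qed.

(** The assumption on critical points concerns roots in extensions, so a field in which the
    derivative splits is required first; [L] is one. A factor [g] of the derivative composed with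
    the iterate divides the split polynomial, so it has a root [r], and the iterate sends [r] to a
    root of [g]. *)
Lemma f'_split : exists cs : seq K, deriv f = lead_coef (deriv f) *: \prod_(c <- cs) ('X - c%:P).
Proof.
have [rs e] := Ff_split.
have h : map_poly (in_alg L) Ff = map_poly (in_alg L) (deriv f) \Po map_poly (in_alg L) (iter_poly f m).
  exact: map_comp_poly.
have [||cs ecs] := @split_of_roots L (map_poly (in_alg L) (deriv f)).
- by rewrite map_poly_eq0 f'_neq0.
- move=> g /dvdpP[q gq] sg.
  pose h' := map_poly (in_alg L) (iter_poly f m).
  have sh : (1 < size h')%N by rewrite size_map_poly iter_nonconst.
  have gd : g \Po h' %| \prod_(z <- rs) ('X - z%:P).
    have l0 : (lead_coef Ff)%:A != 0 :> L by rewrite scaler_eq0 oner_eq0 orbF lead_coef_eq0 Ff_neq0.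
    by rewrite -(dvdpZr _ _ l0) -e h gq comp_polyM dvdp_mulIr.
  have [ms ee] := dvdp_prod_XsubC gd.
  have sgh : (1 < size (g \Po h'))%N.
    rewrite -subn_gt0 subn1 size_comp_poly; move: sg sh; case: (size g) => [|[|a]]//.
    by case: (size h') => [|[|b]]// _ _; rewrite muln_gt0.
  case E : (mask ms rs) ee sgh => [|r t] ee.
    by rewrite (eqp_size ee) big_nil size_poly1.
  move=> _; exists h'.[r]; have : root (g \Po h') r by rewrite (eqp_root ee) root_prod_XsubC mem_head.
  by rewrite /root horner_comp.
have /choice[b hb] : forall c : L, exists b : K, c \in cs -> c = b%:A.
  move=> c; have [ccs|] := boolP (c \in cs); last by exists 0.
  have [|b ->] := hf (c := c); last by exists b.
  by rewrite ecs rootZ ?root_prod_XsubC// lead_coef_eq0 map_poly_eq0 f'_neq0.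
exists (map b cs); apply: (map_poly_inj (in_alg L)).
rewrite {1}ecs map_polyZ lead_coef_map; congr (_ *: _).
rewrite big_map rmorph_prod /= big_seq [RHS]big_seq; apply: eq_bigr => c ccs.
by rewrite map_polyXsubC /= -hb.
Qed.

Local Notation W := (baseFieldType L).
Local Notation gT := (gal_of {:L}).

(** The results on number fields are stated for extensions of [rat], so [L] is regarded as such an
    extension and its automorphisms as ring morphisms. *)
Definition galW (s : gT) : {rmorphism W -> W} := (s : {rmorphism L -> L}).
Definition inW : {rmorphism K -> W} := (in_alg L : {rmorphism K -> L}).

Lemma galW1 x : galW 1%g x = x. Proof. exact: gal_id. Qed.
Lemma galWM s t x : galW (s * t)%g x = galW t (galW s x).
Proof. by apply: galM; exact: memvf. Qed.
Lemma galW_faithful s : (forall x, galW s x = x) -> s = 1%g.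
Proof. by move=> h; apply/eqP/gal_eqP => x _; rewrite gal_id; exact: h. Qed.

Lemma in_gal (s : gT) : s \in 'Gal({:L} / 1)%g.
Proof. by rewrite gal_kHom ?sub1v// k1AHom. Qed.

Lemma inWP x : (forall s, galW s x = x) <-> exists a, x = inW a.
Proof.
split=> [h|[a ->] s]; last first.
  by apply: (fixed_gal (sub1v _) (in_gal s)); apply: memvZ; exact: mem1v.
have gal1 : galois 1 {:L}.
  apply/and3P; split; [exact: sub1v| |exact: normalFieldf].
  apply/separableP => y _; apply: pcharf0_separable; apply/pcharf0P => n.
  exact: (@natF_eq0 W).
have : (x : L) \in fixedField 'Gal({:L} / 1)%g.
  by apply/fixedFieldP; [exact: memvf|move=> s _; exact: h].
by move/galois_fixedField: gal1 => -> /vlineP[a ->]; exists a.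
Qed.

Definition fixW (H : {group gT}) : fieldExtType rat := baseFieldType (subvs_of (fixedField H)).
Definition inFix (H : {group gT}) : {rmorphism fixW H -> W} :=
  (vsval : {rmorphism subvs_of (fixedField H) -> L}).

Lemma inFixP H x : fixed galW H x <-> exists y : fixW H, x = inFix H y.
Proof.
split=> [h|[y ->] s sH].
  have xf : (x : L) \in fixedField H by apply/fixedFieldP; [exact: memvf|exact: h].
  by exists (Subvs xf).
by have [_ h] := mem_fixedFieldP (subvsP y); exact: h.
Qed.

End SplittingField.

Section LocalAbsoluteValue.
Variables (R : realType) (K : fieldExtType rat) (p : set K) (hp : nonzero_prime p).
Variable C : padic_closure R p.
Local Notation O := (@ring_of_integers K).
Local Notation a := (@pc_closure_abs R K p C).
Let j : {rmorphism K -> C} := (pc_closure_inj C \o pc_inj C)%FUN.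
Let ha := pc_closure_absP C.

Lemma pc_absE x : a (j x) = padic_abs R p x.
Proof. by rewrite pc_closure_abs_inj pc_abs_inj. Qed.

Lemma pc_abs_int v : O v -> a (j v) <= 1.
Proof.
move=> [g gm gr]; apply: (av_integral ha); exists g => //.
have -> : map_poly (intr : int -> C) g = map_poly j (map_poly (intr : int -> K) g).
  by rewrite -map_poly_comp; apply: eq_map_poly => i /=; rewrite !rmorph_int.
by rewrite /root horner_map fmorph_eq0.
Qed.

Lemma pc_abs_unit v : O v -> ~ p v -> a (j v) = 1.
Proof.
move=> hv nv; apply/eqP; rewrite eq_le pc_abs_int//= leNgt; apply/negP; rewrite pc_absE.
by move=> /(padic_abs_lt1 hp hv).
Qed.

Lemma pc_abs_loc x : loc p x -> a (j x) <= 1.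
Proof.
move=> [v [hv nv hx]]; have := pc_abs_int hx.
by rewrite rmorphM (avM ha) pc_abs_unit// mul1r.
Qed.

Lemma pc_abs_mloc x : loc p x -> a (j x) < 1 -> mloc p x.
Proof.
move=> [v [hv nv hx]] h; exists v; split=> //; apply: (padic_abs_lt1 (R := R) hp hx).
by rewrite -pc_absE rmorphM (avM ha) pc_abs_unit// mul1r.
Qed.

Lemma loc_iter_poly (f : {poly K}) n x : (forall i, loc p f`_i) -> loc p x -> loc p (iter_poly f n).[x].
Proof.
move=> hf hx; elim: n => [|n IH] /=; first by rewrite hornerX.
by rewrite horner_comp; exact: loc_horner.
Qed.

Lemma attracting_mloc (f : {poly K}) (cs : seq K) (m : nat) (z : C) : (0 < m)%N ->
  deriv f != 0 -> deriv f = lead_coef (deriv f) *: \prod_(c <- cs) ('X - c%:P) ->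
  (forall i, loc p f`_i) -> loc p (lead_coef (deriv f))^-1 -> (forall c, c \in cs -> loc p c) ->
  attracting_periodic f z -> exists2 x, loc p x & mloc p (deriv f \Po iter_poly f m).[x].
Proof.
move=> m0 f'0 f'E hf hl hcs [n [n0 hz _ hd]].
have hzi : iter n (fun t : C => (map_poly j f).[t]) z = z by rewrite -iter_polyE; exact: hz.
have hf' i := pc_abs_loc (hf i); have hcs' c h := pc_abs_loc (hcs c h).
have [c [ccs _ hc]] := attracting_critical ha f'E hf' (pc_abs_loc hl) hcs' f'0 n0 m0 hzi hd.
have hx : loc p (iter_poly f (n * m - m)).[c] by apply: loc_iter_poly => //; exact: hcs.
exists (iter_poly f (n * m - m)).[c] => //; apply: pc_abs_mloc => //.
rewrite horner_comp; apply: loc_horner => //; last exact: loc_iter_poly.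
move=> i; rewrite coef_deriv -mulr_natr; apply: locM => //; apply: loc_O => //; exact: O_nat.
Qed.

End LocalAbsoluteValue.

Section FixedRoot.
Variables (W : fieldExtType rat) (P : set W) (hP : nonzero_prime P).
Variables (s : {rmorphism W -> W}) (F : {poly W}) (rs : seq W).
Hypothesis sP : forall v, P v <-> P (s v).
Hypothesis FE : F = lead_coef F *: \prod_(r <- rs) ('X - r%:P).
Hypothesis sF : map_poly s F = F.
Hypothesis F0 : F != 0.
Hypothesis lc_loc : loc P (lead_coef F)^-1.
Hypothesis rs_loc : forall r, r \in rs -> loc P r.
Hypothesis rs_sep : forall r r', r \in rs -> r' \in rs -> loc P (r - r')^-1.

Lemma mloc_fixed_root x : loc P x -> s x = x -> mloc P F.[x] ->
  exists2 r, r \in rs & s r = r.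
Proof.
move=> hx sx hF; have l0 : lead_coef F != 0 by rewrite lead_coef_eq0.
have rsE r : (r \in rs) = root F r by rewrite FE rootZ// root_prod_XsubC.
have [r rr hr] : exists2 r, r \in rs & mloc P (x - r).
  apply: (@mloc_prod _ _ hP rs (fun r => x - r)) => [r /rs_loc hr|]; first exact: locB.
  have -> : \prod_(r <- rs) (x - r) = F.[x] * (lead_coef F)^-1.
    rewrite {1}FE hornerZ horner_prod mulrAC divff// mul1r.
    by apply: eq_bigr => r _; rewrite hornerXsubC.
  exact: mlocM.
have srr : s r \in rs by rewrite rsE -sF /root horner_map fmorph_eq0 -/(root F r) -rsE.
exists r => //; apply/eqP; rewrite -subr_eq0 -(opprB r) oppr_eq0.
(* A nonzero difference of roots is a unit at [P], whereas [r] and [s r] are both congruent to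
   [x]. *)
apply: contraT => d0; exfalso; apply: (mloc1 (P := P)).
have hs : mloc P (x - s r).
  case: hr => v [hv nv hr]; exists (s v); split; first by apply/iota_int.
    by move=> h; apply: nv; apply/sP.
  by rewrite -{1}sx -rmorphB -rmorphM; have [h _] := sP (v * (x - r)); exact: h.
rewrite -(divff d0); apply: mlocM => //; last exact: rs_sep.
have -> : r - s r = - (x - r) + (x - s r) by ring.
by apply: mlocD => //; exact: mlocN.
Qed.

End FixedRoot.

Theorem theorem5p1 (R : realType) (K : fieldExtType rat)
  (Kbar : forall p : set K, nonzero_prime p -> padic_closure R p)
  (f : {poly K}) (hf : critical_points_rational f)
  (m : nat) (hm : (0 < m)%N)
  (L : splittingFieldType K)
  (hL : splittingFieldFor 1%VS
          (map_poly (in_alg L) (deriv f \Po iter_poly f m)) fullv) :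
  (upper_density R
     [set p | exists (hp : nonzero_prime p) (P : Kbar p hp),
                attracting_periodic f P]
   <= (FPP R 'Gal({:L} / 1)%g (fun (s : gal_of {:L}) (x : L) => s x)
         [set x | root (map_poly (in_alg L) (deriv f \Po iter_poly f m)) x])%:E)%E.
Proof.
pose W : fieldExtType rat := baseFieldType L.
set F := deriv f \Po iter_poly f m in hL *.
have [cs csE] := f'_split hf hL.
have [rs rsE] := Ff_split hL.
have f'0 := f'_neq0 hL; have F0 : F != 0 := Ff_neq0 hL.
pose FW : {poly W} := map_poly (inW L) F.
have lcW : lead_coef FW = inW L (lead_coef F) by rewrite lead_coef_map.
have FW0 : FW != 0 by rewrite map_poly_eq0.
have FWE : FW = lead_coef FW *: \prod_(r <- (rs : seq W)) ('X - r%:P) by rewrite lcW; exact: rsE.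
have sFW (s : gal_of {:L}) : map_poly (galW s) FW = FW.
  rewrite -map_poly_comp; apply: eq_map_poly => x /=.
  by have [_ h] := inWP (inW L x); apply: h; exists x.
have rsP r : (r \in (rs : seq W)) = root FW r.
  by rewrite [FW]FWE rootZ ?root_prod_XsubC// lead_coef_eq0.
have galr (s : gal_of {:L}) r : root FW r -> root FW (galW s r).
  by move=> hr; rewrite -(sFW s) /root horner_map fmorph_eq0.
(* Two integers clear the denominators of all data that must be integral: over [K] the coefficients
   of [f], the inverse of the leading coefficient of its derivative and the critical points, over
   [L] those needed for the roots of [F]. Primes containing their product are the ones discarded.
   For [r = r'] the listed inverse is 0. *)
have [BK BK0 hBK] := common_multiple ((f : seq K) ++ (lead_coef (deriv f))^-1 :: cs).
have [BW BW0 hBW] := @common_multiple W ((lead_coef FW)^-1 :: rs ++ [seq (r - r')^-1 | r <- rs, r' <- rs]).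
have [th [D [n0 [th_O n0_gt0 D_th good_th]]]] :=
  frobenius_setup (@galW1 K L) (@galWM K L) (@galW_faithful K L).
pose A : {set gal_of {:L}} := finset (fun g => `[< exists2 x : W, root FW x & galW g x = x >]).
have inA g : (g \in A) <-> exists2 x : W, root FW x & galW g x = x.
  by rewrite inE; split=> /asboolP.
set fpp := FPP _ _ _ _.
have -> : fpp = #|A|%:R / #|{: gal_of {:L}}|%:R.
  by rewrite /fpp /FPP; congr (_%:R / _%:R); apply: eq_card => g; rewrite !inE in_gal.
apply: (frobenius_upper_density R (@galW1 K L) (@galWM K L) th_O n0_gt0 D_th good_th
  (@inWP K L) (@inFixP K L) (bad := (BK * BW)%N)).
- by rewrite muln_gt0 BK0.
(* [h] is a power of [g], so it fixes every root that [g] fixes. *)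
- move=> g h /inA[x rx gx] e; apply/inA; exists x => //.
  have /cycleP[i ->] : h \in <[g]>%g by rewrite -e cycle_id.
  by elim: i => [|i IH]; rewrite ?expg0 ?galW1// expgS galWM gx.
- move=> g h /inA[x rx gx]; apply/inA; exists (galW h x); first exact: galr.
  by rewrite conjgE -galWM !mulgA mulgV mul1g galWM gx.
move=> P gP [hp [z hz]] nbad; apply/inA.
have [hP _] := gP; pose p := contr (inW L) P.
have nBW : ~ P BW%:R.
  by move=> h; apply: nbad; rewrite natrM; apply: idealM => //; [exact: prime_idl|exact: O_nat].
have nBK : ~ p BK%:R.
  move=> h0; have h : P BK%:R by rewrite -(rmorph_nat (inW L)); exact: h0.
  apply: nbad; rewrite natrM mulrC.
  by apply: idealM => //; [exact: prime_idl|exact: O_nat].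
have locK e : e \in (f : seq K) ++ (lead_coef (deriv f))^-1 :: cs -> loc p e.
  by move=> /hBK; exact: loc_multiple.
have locW e : e \in (lead_coef FW)^-1 :: rs ++ [seq (r - r')^-1 | r <- rs, r' <- rs] -> loc P e.
  by move=> /hBW; exact: loc_multiple.
have [|||x hx hFx] := attracting_mloc (m := m) hp hm f'0 csE _ _ _ hz.
- move=> i; have [si|si] := ltnP i (size f).
    by apply: locK; rewrite mem_cat mem_nth.
  by rewrite nth_default//; apply: loc_O => //; exact: O0.
- by apply: locK; rewrite mem_cat mem_head orbT.
- by move=> c hc; apply: locK; rewrite mem_cat inE hc !orbT.
pose s := phi (@galW K L) (inW L) P.
have hs : Frob (@galW K L) (inW L) P s := phiP (@galW1 K L) (@galWM K L) th_O D_th good_th (@inWP K L) gP.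
have aimP : aim (@galW K L) s P = P.
  (* Frobenius belongs to the decomposition group, so it acts on congruences modulo [P]. *)
  by apply/(Frob_stab (@galW1 K L) (@galWM K L) th_O good_th (@inWP K L) s gP hs); exact: cycle_id.
have [|||||||r rr sr] := @mloc_fixed_root W P hP (galW s) FW rs _ FWE (sFW s) FW0 _ _ _ (inW L x).
- move=> v; rewrite -{2}aimP /aim /contr /= -galWM mulgV galW1; by [].
- by apply: locW; exact: mem_head.
- by move=> r hr; apply: locW; rewrite inE mem_cat hr orbT.
- move=> r r' hr hr'; apply: locW; rewrite inE mem_cat; apply/orP; right; apply/orP; right.
  by apply/allpairsP; exists (r, r').
- exact: loc_iota.
- by have [_ h] := inWP (inW L x); apply: h; exists x.
- by rewrite horner_map; exact: mloc_iota.
by exists r; rewrite -?rsP.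
Qed.
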